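(* Let $\mathcal{M}$ be a uniquely geodesic Riemannian manifold whose sectional curvature is bounded below by $\kappa_{\min}$, let $x^*\in\mathcal{M}$ be a minimizer of $f$, let $x_0$ be an initial point, $R=\mathrm{dist}(x_0,x^* )$ and $\epsilon>0$. Let $\mathcal{X}=\bar B(x^*, R\sqrt{3/2})\subset\mathcal{M}$ and $f\in\mathcal{F}_L(\mathcal{X})$. Then the iterates $x_{t+1}=\mathrm{Exp}_{x_t}(-\eta\nabla f(x_t))$ of Riemannian gradient descent with step size $\eta = 1/(\zeta_{\sqrt{3/2}R}\,L)$ satisfy $x_t\in\mathcal{X}$ for all $t\ge0$, and an $\epsilon$-minimizer of $f$ is obtained after $O(\zeta_R LR^2/\epsilon)$ iterations. If $f$ is also $\mu$-strongly g-convex in $\mathcal{X}$, then it takes $O\big((\zeta_R L/\mu)\log(LR^2/\epsilon)\big)$ iterations.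
   Context: A space is uniquely geodesic if every two points are connected by one and only one geodesic. $\mathrm{Exp}_x$ is the Riemannian exponential map and $\mathrm{Exp}_x^{-1}$ its inverse; $\bar B(x,r)$ is the closed Riemannian ball. A set is g-convex if every two of its points are joined by a geodesic contained in it. For a g-convex set $\mathcal{X}\subset\mathcal{M}$, $\mathcal{F}_L(\mathcal{X})$ is the class of functions $f:\mathcal{M}\to\mathbb{R}\cup\{+\infty\}$ that are proper, lower semicontinuous, differentiable in an open set containing $\mathcal{X}$ and satisfy, for all $x,y\in\mathcal{X}$, $0\le f(y)-f(x)-\langle\nabla f(x),\mathrm{Exp}_x^{-1}(y)\rangle\le\frac{L}{2}\mathrm{dist}(x,y)^2$ (g-convexity and $L$-smoothness). Such an $f$ is $\mu$-strongly g-convex in $\mathcal{X}$ ($\mu>0$) if $\frac{\mu}{2}\mathrm{dist}(x,y)^2\le f(y)-f(x)-\langle\nabla f(x),\mathrm{Exp}_x^{-1}(y)\rangle$ for all $x,y\in\mathcal{X}$. For $r>0$, $\zeta_r = r\sqrt{|\kappa_{\min}|}\coth(r\sqrt{|\kappa_{\min}|})$ if $\kappa_{\min}<0$ and $\zeta_r=1$ otherwise. Functions being optimized are assumed to have at least one minimizer, denoted $x^*$. A point $x$ is an $\epsilon$-minimizer of $f$ if $f(x)-f(x^* )\le\epsilon$. $O(\cdot)$ hides universal constants only. *)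

(* Defs.v *)
From HB Require Import structures.
From mathcomp Require Import all_boot all_order all_algebra.
From mathcomp Require Import all_classical all_reals all_analysis.
Set Implicit Arguments.
Unset Strict Implicit.
Unset Printing Implicit Defensive.
Import Order.TTheory GRing.Theory Num.Theory numFieldNormedType.Exports.
Local Open Scope classical_set_scope.
Local Open Scope ring_scope.

Section smooth.
Context {R : realType} {n : nat}.

Definition partial (i : 'I_n) (f : 'rV[R]_n -> R) (u : 'rV[R]_n) : R :=
  'D_(delta_mx 0 i) f u.

Fixpoint Ck (k : nat) (U : set 'rV[R]_n) (f : 'rV[R]_n -> R) : Prop :=
  if k is k'.+1 then
    (forall u, U u -> differentiable f u) /\
    (forall i, Ck k' U (partial i f))
  else forall u, U u -> {for u, continuous f}.

Definition smooth_on (U : set 'rV[R]_n) (f : 'rV[R]_n -> R) : Prop :=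
  forall k, Ck k U f.

End smooth.

(* The smooth structure is given by an atlas indexed by the points of the
   manifold, [chart x] being defined around [x] with domain [dom x]; every
   smooth manifold has such an atlas, since an atlas may be re-indexed by
   choosing a chart around each point.  Tangent vectors at [x] are represented
   by their coordinates in [chart x]: the tangent space at [x] is ['rV[R]_n]. *)
Record riemannian_manifold (R : realType) (n : nat) := RiemannianManifold {
  rm_point :> topologicalType ;
  rm_hausdorff : hausdorff_space rm_point ;
  rm_second_countable : @second_countable rm_point ;
  dom : rm_point -> set rm_point ;
  chart : rm_point -> rm_point -> 'rV[R]_n ;
  chart_inv : rm_point -> 'rV[R]_n -> rm_point ;
  dom_open : forall p, open (dom p) ;
  dom_self : forall p, dom p p ;
  chart_image_open : forall p, open (chart p @` dom p) ;
  chartK : forall p x, dom p x -> chart_inv p (chart p x) = x ;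
  chart_continuous : forall p x, dom p x -> {for x, continuous (chart p)} ;
  chart_inv_continuous : forall p x, dom p x ->
    {for chart p x, continuous (chart_inv p)} ;
  transition_smooth : forall p q (i : 'I_n),
    smooth_on (chart p @` (dom p `&` dom q))
      (fun u => chart q (chart_inv p u) 0 i) ;
  (* [metric p u] is the Gram matrix of the coordinate frame of [chart p] at
     the point of coordinates [u] *)
  metric : rm_point -> 'rV[R]_n -> 'M[R]_n ;
  metric_sym : forall p x, dom p x ->
    (metric p (chart p x))^T = metric p (chart p x) ;
  metric_pos : forall p x (v : 'rV[R]_n), dom p x -> v != 0 ->
    0 < (v *m metric p (chart p x) *m v^T) 0 0 ;
  metric_smooth : forall p (i j : 'I_n),
    smooth_on (chart p @` dom p) (fun u => metric p u i j) ;
  metric_transition : forall p q x, dom p x -> dom q x ->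
    let J := jacobian (chart q \o chart_inv p) (chart p x) in
    metric p (chart p x) = J *m metric q (chart q x) *m J^T
}.

Section riemannian.
Context {R : realType} {n : nat} (M : riemannian_manifold R n).
Implicit Types (x y p : M) (u v w a b : 'rV[R]_n) (c : R -> M).

Definition inner x v w : R := (v *m metric x (chart x x) *m w^T) 0 0.
Definition tnorm x v : R := Num.sqrt (inner x v v).

Definition velocity c (t : R) : 'rV[R]_n := derive1 (chart (c t) \o c) t.

(* Curves may stop, so they can turn corners in a C^1 way: the infimum of the
   lengths is the same as over piecewise C^1 curves. *)
Definition C1_curve c : Prop :=
  continuous c /\
  forall p t, dom p (c t) ->
    derivable (chart p \o c) t 1 /\ {for t, continuous (derive1 (chart p \o c))}.

Definition curve_length c : R :=
  Rintegral lebesgue_measure `[0%R, 1%R] (fun t => tnorm (c t) (velocity c t)).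

Definition dist x y : R :=
  inf [set l | exists c, [/\ C1_curve c, c 0 = x, c 1 = y & l = curve_length c]].

Definition closed_rball x (r : R) : set M := [set y | dist x y <= r].

(* Gamma^k_{ij} *)
Definition christoffel p u (k i j : 'I_n) : R :=
  2^-1 * \sum_l invmx (metric p u) k l *
    (partial i (fun z => metric p z j l) u
     + partial j (fun z => metric p z i l) u
     - partial l (fun z => metric p z i j) u).

(* R^l_{kij}, i.e. the coefficient on d_l of R(d_i, d_j) d_k, where
   R(X, Y) Z = D_X D_Y Z - D_Y D_X Z - D_[X,Y] Z *)
Definition curvature p u (l k i j : 'I_n) : R :=
  partial i (fun z => christoffel p z l j k) u
  - partial j (fun z => christoffel p z l i k) u
  + \sum_m (christoffel p u l i m * christoffel p u m j k
            - christoffel p u l j m * christoffel p u m i k).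

Definition curvature_op x a b w : 'rV[R]_n :=
  \row_l \sum_k \sum_i \sum_j
    curvature x (chart x x) l k i j * w 0 k * a 0 i * b 0 j.

Definition sectional x a b : R :=
  inner x (curvature_op x a b b) a
  / (inner x a a * inner x b b - inner x a b ^+ 2).

Definition sectional_ge (kappa : R) : Prop :=
  forall x a b, row_free (col_mx a b) -> kappa <= sectional x a b.

(* the geodesic equation u''^k + Gamma^k_{ij}(u) u'^i u'^j = 0 *)
Definition geodesic_at c (t : R) : Prop :=
  {for t, continuous c} /\
  forall p, dom p (c t) ->
    let u := chart p \o c in
    let u' := derive1 u in
    [/\ derivable u t 1, derivable u' t 1 &
      forall k, derive1 u' t 0 k
        + \sum_i \sum_j christoffel p (u t) k i j * u' t 0 i * u' t 0 j = 0].

(* Geodesics are parametrized by [0, 1]; the equation is required on an open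
   neighborhood of [0, 1], which is no restriction because a geodesic defined
   on a compact interval extends beyond its endpoints.  The values of c away
   from [0, 1] are irrelevant. *)
Definition geodesic c : Prop :=
  forall t : R, 0 <= t <= 1 -> \forall s \near t, geodesic_at c s.

Definition geodesic_from_to c x y : Prop := [/\ geodesic c, c 0 = x & c 1 = y].

Definition uniquely_geodesic : Prop :=
  forall x y,
    (exists c, geodesic_from_to c x y) /\
    (forall c1 c2, geodesic_from_to c1 x y -> geodesic_from_to c2 x y ->
       forall t : R, 0 <= t <= 1 -> c1 t = c2 t).

(* v is in the domain of Exp_x and Exp_x(v) = y: as no completeness is
   assumed, the exponential map may be partial. *)
Definition is_Exp x v y : Prop :=
  exists2 c, geodesic_from_to c x y & velocity c 0 = v.

(* Exp_x^-1 (y), unambiguous when the manifold is uniquely geodesic *)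
Definition Log x y : 'rV[R]_n := xget 0 [set v | is_Exp x v y].

Definition g_convex (X : set M) : Prop :=
  forall x y, X x -> X y ->
    exists2 c, geodesic_from_to c x y & forall t : R, 0 <= t <= 1 -> X (c t).

Implicit Types (f : M -> \bar R) (X : set M).

Definition proper_fun f : Prop :=
  (forall x, f x != -oo%E) /\ (exists x, f x != +oo%E).

Definition in_chart f x (u : 'rV[R]_n) : R := fine (f (chart_inv x u)).

Definition differentiable_in (U : set M) f : Prop :=
  forall x, U x ->
    f x \is a fin_num /\ differentiable (in_chart f x) (chart x x).

(* (grad f)^j = g^{ij} d_i f *)
Definition grad f x : 'rV[R]_n :=
  (\row_i partial i (in_chart f x) (chart x x)) *m invmx (metric x (chart x x)).

Definition bregman f x y : R :=
  fine (f y) - fine (f x) - inner x (grad f x) (Log x y).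

Definition class_F (L : R) X f : Prop :=
  [/\ g_convex X,
      proper_fun f,
      lower_semicontinuous f,
      exists U, [/\ open U, X `<=` U & differentiable_in U f] &
      forall x y, X x -> X y ->
        0 <= bregman f x y <= L / 2 * dist x y ^+ 2].

Definition strongly_g_convex (mu : R) X f : Prop :=
  forall x y, X x -> X y -> mu / 2 * dist x y ^+ 2 <= bregman f x y.

Definition minimizer f x : Prop := forall y, (f x <= f y)%E.

Definition eps_minimizer f xs (eps : R) x : Prop := (f x - f xs <= eps%:E)%E.

Definition gradient_descent f (eta : R) (x : nat -> M) : Prop :=
  forall t, is_Exp (x t) (- eta *: grad f (x t)) (x t.+1).

End riemannian.

Definition coth {R : realType} (s : R) : R :=
  (expR s + expR (- s)) / (expR s - expR (- s)).

(* zeta_r is meant for r > 0; the junk value at r = 0 is 0 when kappa < 0 *)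
Definition zeta {R : realType} (kappa r : R) : R :=
  if kappa < 0 then
    let s := r * Num.sqrt `|kappa| in s * coth s
  else 1.

(* Main.v *)
Require Import Defs.
From HB Require Import structures.
From mathcomp Require Import all_boot all_order all_algebra.
From mathcomp Require Import all_classical all_reals all_analysis.
From mathcomp Require Import ring lra.
Import Order.TTheory GRing.Theory Num.Theory numFieldNormedType.Exports.
Local Open Scope classical_set_scope.
Local Open Scope ring_scope.
Set Implicit Arguments.
Unset Strict Implicit.
Unset Printing Implicit Defensive.

(* Write D(x, y) for the length of the unique geodesic from x to y.

   Locally, geodesics solve a two-point boundary value problem by contraction,
   and an explicit calibration shows that they minimize energy.  Globally,
   neither completeness nor an initial value problem for geodesics is
   available; the triangle inequality D(p, z') <= D(p, z) + D(z, z') is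
   propagated along the geodesic issued from p.  If p, q, y are consecutive on
   it, then q is the only critical point of the two-piece energy
   z |-> D(p, z)^2 / a + D(z, y)^2 / b, because a critical z yields, by gluing,
   another geodesic from p to y.  A discrete gradient flow of this energy makes
   "q is a local minimum" persist as y moves.  Then D is the Riemannian
   distance.

   The Hessian bound for D(p, .)^2 / 2 comes from the second variation of
   energy along phi P, with P parallel and phi'' = k^2 phi: the sum of these
   variations over the pieces of a geodesic gives at every point an upper
   barrier with second derivative at most k coth k, hence the cosine law
   D(p, z)^2 <= D(p, y)^2 - 2 <Log_y p, v> + zeta |v|^2.

   With u = 1 / zeta and gaps delta_t = f(x_t) - f(x^* ), the cosine law,
   convexity and descent give
     D_t^2 <= R^2 + ((delta_0 - delta_t) / (1 - u/2) - 2 u sum_(i < t) delta_i) / L.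
   As delta_0 <= L R^2 / 2 and 1 / (1 - u/2) - 2 u < 1, the iterates never
   reach the boundary of the ball, and the same inequality bounds delta_t. *)

(* Unique geodesicity provides a geodesic between any two points, but tells neither that it
   minimizes length nor that it depends continuously on its endpoints. Both facts have to be won
   from short geodesics alone, where a chart gives estimates. Nor is D(p, .) known to be
   differentiable, so second derivatives enter only as upper barriers, and a minimum argument draws
   concavity along a curve from them.

   The shape of the last estimate: a step of size u / L lowers f by at least (u / L)(1 - u / 2)|grad
   f|^2, and this decrease pays for the quadratic term of the cosine law, whence the factor 1 / (1 -
   u / 2); convexity contributes the term with 2 u. The excess of D_t^2 over R^2 is then at most
   delta_0 / L, hence at most R^2 / 2, which is the origin of 3 / 2 in the radius.

   The cosine law can be applied only along a geodesic that is already inside the ball. The estimate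
   is therefore made at every fraction of a step, and its strictness keeps the moving point away
   from the boundary. The universal constant 2 only compares zeta at the radius of the ball with
   zeta_R. *)
Tactic Notation "lra_of" ne_constr_list(hs) :=
  generalize hs; repeat match goal with H : is_true _ |- _ => clear H end; lra.

(** * Differential calculus in R^n *)

Lemma diff_epsP {R : numFieldType} {V W : normedModType R} (f : V -> W)
    (L : {linear V -> W}) x :
  continuous L ->
  (forall e, 0 < e -> \forall h \near 0, `|f (h + x) - f x - L h| <= e * `|h|) ->
  is_diff x f L.
Proof.
move=> cL H.
have E : f \o shift x = cst (f x) + L +o_ 0 id.
  apply/eqaddoP => e e0; have := H e e0; apply: filterS => h.
  by rewrite /= opprD addrA.
have D := diff_unique cL E.
apply: DiffDef => //; apply/diff_locallyP; rewrite D; split => //.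
Qed.

Lemma diff_eps {R : numFieldType} {V W : normedModType R} (f : V -> W) x :
  differentiable f x -> forall e, 0 < e ->
  \forall h \near 0, `|f (h + x) - f x - 'd f x h| <= e * `|h|.
Proof.
move=> /diff_locallyP[_ /eqaddoP H] e e0; apply: filterS (H e e0) => h /=.
by rewrite opprD addrA.
Qed.

Lemma near_eq_is_diff {R : numFieldType} {V W : normedModType R} (f g : V -> W) x :
  {near x, f =1 g} -> differentiable f x -> is_diff x g ('d f x).
Proof.
move=> fg df.
apply: diff_epsP => [|e e0]; first exact: diff_continuous.
have fgx : f x = g x by exact: nbhs_singleton fg.
have fg' : \forall h \near 0, f (h + x) = g (h + x).
  by move: fg; rewrite (near_shift 0)/= subr0; apply: filterS.
near=> h; rewrite -fgx -(near fg' h)//.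
by near: h; exact: diff_eps.
Unshelve. all: by end_near. Qed.

Lemma near_eq_continuous {T U : topologicalType} (f g : T -> U) x :
  {near x, f =1 g} -> {for x, continuous f} -> {for x, continuous g}.
Proof.
move=> fg cf A; rewrite -(nbhs_singleton fg) => /cf; apply: filterS2 fg => y /=.
by rewrite /= => ->.
Qed.

(* Sealed copy of [partial]: comparing two distinct partial derivatives by
   conversion unfolds limits and does not terminate in practice. *)
Fact pd_sig (R : realType) n : {pd | pd = @partial R n}.
Proof. by exists (@partial R n). Qed.
Definition pd {R : realType} {n} : 'I_n -> ('rV[R]_n -> R) -> 'rV[R]_n -> R :=
  sval (pd_sig R n).
Lemma pdE {R : realType} {n} : @pd R n = @partial R n.
Proof. exact: svalP (pd_sig R n). Qed.

Section smooth_calculus.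
Context {R : realType} {n : nat}.
Implicit Types (U : set 'rV[R]_n) (f g : 'rV[R]_n -> R) (u e : 'rV[R]_n).

Lemma near_open_eq U f g u : open U -> U u -> {in U, f =1 g} -> {near u, f =1 g}.
Proof.
move=> oU Uu fg.
by apply: filterS (open_nbhs_nbhs (conj oU Uu)) => x Ux; apply/fg/mem_set.
Qed.

Lemma Ck_congr k U f g : open U -> {in U, f =1 g} -> Ck k U f -> Ck k U g.
Proof.
move=> oU; elim: k f g => [|k IH] f g fg /=.
  by move=> cf u Uu; apply: near_eq_continuous (near_open_eq oU Uu fg) (cf u Uu).
move=> [df pf]; split=> [u Uu|i].
  by have [] := near_eq_is_diff (near_open_eq oU Uu fg) (df u Uu).
apply: IH (pf i) => u /set_mem Uu.
by apply: near_eq_derive; exact: near_open_eq oU Uu fg.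
Qed.

Lemma CkW k U f : Ck k.+1 U f -> Ck k U f.
Proof.
elim: k f => [f [df _] u /df/differentiable_continuous //|k IH f [df pf]].
by split=> // i; exact/IH/pf.
Qed.

Lemma Ck_cst k U c : Ck k U (cst c).
Proof.
elim: k c => [c u _|k IH c]; first exact: cst_continuous.
split=> [u _|i]; first exact: differentiable_cst.
rewrite (_ : partial i _ = cst 0) //; apply/funext => u.
by rewrite /partial derive_cst.
Qed.

Lemma CkD k U f g : open U -> Ck k U f -> Ck k U g -> Ck k U (f + g).
Proof.
move=> oU; elim: k f g => [|k IH] f g /=.
  by move=> cf cg u Uu; apply: continuousD; [exact: cf|exact: cg].
move=> [df pf] [dg pg]; split=> [u Uu|i].
  by apply: differentiableD; [exact: df|exact: dg].
apply: Ck_congr (IH _ _ (pf i) (pg i)) => // u /set_mem Uu.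
by rewrite /partial deriveD //; apply: diff_derivable; [exact: df|exact: dg].
Qed.

Lemma CkM k U f g : open U -> Ck k U f -> Ck k U g -> Ck k U (f * g).
Proof.
move=> oU; elim: k f g => [|k IH] f g /=.
  by move=> cf cg u Uu; apply: continuousM; [exact: cf|exact: cg].
move=> [df pf] [dg pg]; split=> [u Uu|i].
  by apply: differentiableM; [exact: df|exact: dg].
have cf : Ck k U f by apply: CkW.
have cg : Ck k U g by apply: CkW.
apply: (@Ck_congr k U (f * partial i g + g * partial i f)) => //; last first.
  by apply: CkD => //; exact: IH.
move=> u /set_mem Uu.
by rewrite /partial deriveM //; apply: diff_derivable; [exact: df|exact: dg].
Qed.

Lemma CkV k U f : open U -> (forall u, U u -> f u != 0) -> Ck k U f ->
  Ck k U (fun u => (f u)^-1).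
Proof.
move=> oU f0; elim: k f f0 => [|k IH] f f0 /=.
  by move=> cf u Uu; apply: continuousV; [exact: f0|exact: cf].
move=> [df pf]; split=> [u Uu|i].
  by apply: differentiableV; [exact: df|exact: f0].
have cf : Ck k U f by apply: CkW.
apply: (@Ck_congr k U (cst (-1) * ((fun u => (f u)^-1) * (fun u => (f u)^-1) * partial i f))) => //; last first.
  by apply: CkM => //; [exact: Ck_cst|apply: CkM => //; apply: CkM => //; exact: IH].
move=> u /set_mem Uu.
rewrite /partial deriveV; [|exact: f0|exact/diff_derivable/df].
by rewrite /cst /= !fctE scaleNr mulN1r expr2 invfM.
Qed.

Lemma smooth_cst U c : smooth_on U (cst c).
Proof. by move=> k; exact: Ck_cst. Qed.

Lemma smoothD U f g : open U -> smooth_on U f -> smooth_on U g -> smooth_on U (f + g).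
Proof. by move=> oU sf sg k; exact: CkD. Qed.

Lemma smoothM U f g : open U -> smooth_on U f -> smooth_on U g -> smooth_on U (f * g).
Proof. by move=> oU sf sg k; exact: CkM. Qed.

Lemma smoothV U f : open U -> (forall u, U u -> f u != 0) -> smooth_on U f ->
  smooth_on U (fun u => (f u)^-1).
Proof. by move=> oU f0 sf k; exact: CkV. Qed.

Lemma smooth_congr U f g : open U -> {in U, f =1 g} -> smooth_on U f -> smooth_on U g.
Proof. by move=> oU fg sf k; exact: Ck_congr (sf k). Qed.

Lemma smooth_big_sum U (I : Type) (r : seq I) (P : pred I) (F : I -> 'rV[R]_n -> R) :
  open U -> (forall i, smooth_on U (F i)) ->
  smooth_on U (fun u => \sum_(i <- r | P i) F i u).
Proof.
move=> oU sF; elim: r => [|i r IH].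
  by rewrite (_ : (fun _ => _) = cst 0) ?funeqE => [|u]; [exact: smooth_cst|rewrite big_nil].
case Pi : (P i); last by under eq_fun do rewrite big_cons Pi.
by under eq_fun do rewrite big_cons Pi; apply: (smoothD (f := F i)).
Qed.

Lemma smooth_big_prod U (I : Type) (r : seq I) (P : pred I) (F : I -> 'rV[R]_n -> R) :
  open U -> (forall i, smooth_on U (F i)) ->
  smooth_on U (fun u => \prod_(i <- r | P i) F i u).
Proof.
move=> oU sF; elim: r => [|i r IH].
  by rewrite (_ : (fun _ => _) = cst 1) ?funeqE => [|u]; [exact: smooth_cst|rewrite big_nil].
case Pi : (P i); last by under eq_fun do rewrite big_cons Pi.
by under eq_fun do rewrite big_cons Pi; apply: (smoothM (f := F i)).
Qed.

Lemma smooth_det m U (A : 'rV[R]_n -> 'M[R]_m) : open U ->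
  (forall i j, smooth_on U (fun u => A u i j)) -> smooth_on U (fun u => \det (A u)).
Proof.
move=> oU sA; apply: smooth_big_sum => // s.
apply: (smoothM (f := cst _)) => //; first exact: smooth_cst.
exact: smooth_big_prod.
Qed.

Lemma smooth_invmx m U (A : 'rV[R]_n -> 'M[R]_m) : open U ->
  (forall u, U u -> A u \in unitmx) ->
  (forall i j, smooth_on U (fun u => A u i j)) ->
  forall i j, smooth_on U (fun u => invmx (A u) i j).
Proof.
move=> oU uA sA i j.
apply: (@smooth_congr _ (fun u => (\det (A u))^-1 * cofactor (A u) j i)) => //.
  by move=> u /set_mem Uu; rewrite /invmx uA // !mxE.
apply: (smoothM (f := fun u => (\det (A u))^-1)) => //.
  apply: smoothV => //; last exact: smooth_det.
  by move=> u /uA; rewrite unitmxE unitfE.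
apply: (smoothM (f := cst _)) => //; first exact: smooth_cst.
apply: smooth_det => // k l.
by under eq_fun do rewrite !mxE; exact: sA.
Qed.

Lemma smooth_partial U f i : smooth_on U f -> smooth_on U (partial i f).
Proof. by move=> sf k; case: (sf k.+1) => _; exact. Qed.

Lemma smooth_differentiable U f u : smooth_on U f -> U u -> differentiable f u.
Proof. by move=> sf Uu; case: (sf 1%N) => + _; exact. Qed.

Lemma smooth_continuous U f u : smooth_on U f -> U u -> {for u, continuous f}.
Proof. by move=> sf Uu; exact: (sf 0%N). Qed.

Lemma smooth_pd U f i : smooth_on U f -> smooth_on U (pd i f).
Proof. by rewrite pdE; exact: smooth_partial. Qed.

Definition dpart f u e : R := \sum_i e 0 i * pd i f u.

Lemma diff_dpart f u e : differentiable f u -> 'd f u e = dpart f u e.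
Proof.
move=> df; rewrite {1}(row_sum_delta e) linear_sum; apply: eq_bigr => i _.
by rewrite linearZ /= pdE /partial deriveE.
Qed.

End smooth_calculus.

Fact d1_sig (R : realType) (V : normedModType R) : {d | d = @derive1 R V}.
Proof. by exists (@derive1 R V). Qed.
(* Sealed copy of [derive1], for the same reason as [pd]. *)
Definition d1 {R : realType} {V : normedModType R} : (R -> V) -> R -> V :=
  sval (d1_sig V).
Lemma d1E {R : realType} {V : normedModType R} : @d1 R V = @derive1 R V.
Proof. exact: svalP (d1_sig V). Qed.

Section curves.
Context {R : realType}.

Definition der {V : normedModType R} (f : R -> V) (t : R) (df : V) : Prop :=
  is_derive t 1 f df.

Lemma der_eq {V : normedModType R} (f : R -> V) (t : R) (df df' : V) :
  der f t df -> df = df' -> der f t df'.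
Proof. by move=> H <-. Qed.

Lemma derP {V : normedModType R} (f : R -> V) (t : R) (df : V) :
  der f t df <-> derivable f t 1 /\ d1 f t = df.
Proof.
rewrite d1E.
split=> [[H <-]|[H <-]]; first by rewrite derive1E.
by rewrite derive1E; exact: DeriveDef.
Qed.

Lemma der_unique {V : normedModType R} (f : R -> V) (t : R) (df df' : V) :
  der f t df -> der f t df' -> df = df'.
Proof. by move=> /derP[_ <-] /derP[_ <-]. Qed.

Lemma near_eq_der {V : normedModType R} (f g : R -> V) (t : R) (df : V) :
  (\forall s \near t, f s = g s) -> der f t df -> der g t df.
Proof. exact: near_eq_is_derive. Qed.

Lemma eq_der {V : normedModType R} (f g : R -> V) (t : R) (df : V) :
  f =1 g -> der f t df -> der g t df.
Proof. by move=> /funext ->. Qed.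

Lemma der_comp_diff {V W : normedModType R} (f : V -> W) (u : R -> V) (t : R) (u' : V) :
  differentiable f (u t) -> der u t u' -> der (f \o u) t ('d f (u t) u').
Proof.
move=> df [du du'].
have du1 : differentiable u t by exact/derivable1_diffP.
apply: DeriveDef; first exact/derivable1_diffP/differentiable_comp.
rewrite -derive1E derive1E'; last exact: differentiable_comp.
by rewrite diff_comp //= -derive1E' // derive1E du'.
Qed.

Lemma der_mxP m n (u : R -> 'M[R]_(m, n)) (t : R) (u' : 'M[R]_(m, n)) :
  der u t u' <-> forall i j, der (fun s => u s i j) t (u' i j).
Proof.
split=> [[du <-] i j|H].
  by rewrite derive_mx // mxE; apply/derivableP; move/derivable_mxP : du; exact.
have du : derivable u t 1 by apply/derivable_mxP => i j; case: (H i j).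
apply: DeriveDef => //; rewrite derive_mx //; apply/matrixP => i j.
by rewrite mxE; case: (H i j).
Qed.

Lemma der_rVP n (u : R -> 'rV[R]_n) (t : R) (u' : 'rV[R]_n) :
  der u t u' <-> forall i, der (fun s => u s 0 i) t (u' 0 i).
Proof.
by split=> [/der_mxP H i|H]; [exact: H|apply/der_mxP => i j; rewrite ord1].
Qed.

Lemma der_cst {V : normedModType R} (c : V) (t : R) : der (fun _ : R => c) t 0.
Proof. exact: is_derive_cst. Qed.

Lemma der_id (t : R) : der (fun s : R => s) t 1.
Proof. exact: is_derive_id. Qed.

Lemma derD {V : normedModType R} (f g : R -> V) (df dg : V) (t : R) :
  der f t df -> der g t dg -> der (fun s => f s + g s) t (df + dg).
Proof. by move=> Hf Hg; exact: (is_deriveD Hf Hg). Qed.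

Lemma derB {V : normedModType R} (f g : R -> V) (df dg : V) (t : R) :
  der f t df -> der g t dg -> der (fun s => f s - g s) t (df - dg).
Proof. by move=> Hf Hg; exact: (is_deriveB Hf Hg). Qed.

Lemma derN {V : normedModType R} (f : R -> V) (df : V) (t : R) :
  der f t df -> der (fun s => - f s) t (- df).
Proof. by move=> Hf; exact: (is_deriveN Hf). Qed.

Lemma derM (f g : R -> R) (df dg : R) (t : R) : der f t df -> der g t dg ->
  der (fun s => f s * g s) t (df * g t + f t * dg).
Proof.
move=> Hf Hg; apply: (der_eq (is_deriveM Hf Hg)).
by rewrite /GRing.scale /= addrC mulrC.
Qed.

Lemma derZ {n : nat} (f : R -> R) (v : R -> 'rV[R]_n) (df : R) dv (t : R) :
  der f t df -> der v t dv ->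
  der (fun s => f s *: v s) t (df *: v t + f t *: dv).
Proof.
move=> Hf /der_rVP Hv; apply/der_rVP => i.
by rewrite !mxE; under eq_fun do rewrite mxE; exact: derM.
Qed.

Lemma der_sum (I : Type) (r : seq I) (P : pred I) (F : I -> R -> R) (dF : I -> R) (t : R) :
  (forall i, P i -> der (F i) t (dF i)) ->
  der (fun s => \sum_(i <- r | P i) F i s) t (\sum_(i <- r | P i) dF i).
Proof.
move=> H; elim: r => [|i r IH].
  by rewrite big_nil; apply: eq_der (der_cst 0 t) => s; rewrite big_nil.
rewrite big_cons; under eq_fun do rewrite big_cons.
by case: ifP => Pi //; apply: derD => //; exact: H.
Qed.

Lemma der_continuous {V : normedModType R} (u : R -> V) (t : R) u' :
  der u t u' -> {for t, continuous u}.
Proof. by move=> [du _]; apply: differentiable_continuous; exact/derivable1_diffP. Qed.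

Lemma der_comp {V : normedModType R} (f : R -> V) (g : R -> R) df (dg t : R) :
  der f (g t) df -> der g t dg -> der (fun s => f (g s)) t (dg *: df).
Proof.
move=> [Df <-] Dg; have D : differentiable f (g t) by exact/derivable1_diffP.
apply: (der_eq (der_comp_diff D Dg)).
by rewrite -{1}[dg]mulr1 [dg * 1]/(dg *: (1 : R^o)) linearZ /= deriveE.
Qed.

Lemma continuous_eps {V W : normedModType R} (f : V -> W) (x : V) :
  {for x, continuous f} -> forall e, 0 < e ->
  exists2 d, 0 < d & forall y, `|y - x| < d -> `|f y - f x| < e.
Proof.
move=> /cvgrPdist_lt cf e /cf /nbhs_ballP[d /= d0 Hd]; exists d => // y yx.
by rewrite distrC; apply: Hd; rewrite -ball_normE /ball_ /= distrC.
Qed.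

Lemma eps_continuous {V W : normedModType R} (f : V -> W) (x : V) :
  (forall e, 0 < e -> exists2 d, 0 < d & forall y, `|y - x| < d -> `|f y - f x| < e) ->
  {for x, continuous f}.
Proof.
move=> H; apply/cvgrPdist_lt => e /H[d d0 Hd]; apply/nbhs_ballP; exists d => // y.
by rewrite -ball_normE /ball_ /= distrC => /Hd; rewrite distrC.
Qed.

Lemma near_eps {V : normedModType R} (P : V -> Prop) (x : V) :
  (\forall y \near x, P y) <-> exists2 d, 0 < d & forall y, `|y - x| < d -> P y.
Proof.
split=> [/nbhs_ballP[d /= d0 Hd]|[d d0 Hd]].
  by exists d => // y yx; apply: Hd; rewrite -ball_normE /ball_ /= distrC.
by apply/nbhs_ballP; exists d => // y; rewrite -ball_normE /ball_ /= distrC => /Hd.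
Qed.

Lemma open_eps {V : normedModType R} (U : set V) (x : V) : open U -> U x ->
  exists2 d, 0 < d & forall y, `|y - x| < d -> U y.
Proof. by move=> oU Ux; apply/near_eps; exact: open_nbhs_nbhs. Qed.

Lemma MVT_everywhere (f df : R -> R) (a b : R) : a <= b ->
  (forall x, a <= x <= b -> der f x (df x)) ->
  exists2 c, a <= c <= b & f b - f a = df c * (b - a).
Proof.
move=> ab H; have [|x xab|c cab E] := @MVT_segment R f df a b ab.
- by move=> x; rewrite in_itv /= => /andP[/ltW ax /ltW xb]; apply: H; rewrite ax.
- apply: continuous_in_subspaceT => y; rewrite inE /= in_itv /= => /H.
  exact: der_continuous.
- by exists c.
Qed.

End curves.

Ltac ider := repeat first [ eassumption | exact: der_cst | exact: der_id
  | apply: derD | apply: derB | apply: derN | apply: derM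
  | apply: derZ ].

Section fields.
Context {R : realType} {n : nat}.
Implicit Types (U : set 'rV[R]_n) (f g : 'rV[R]_n -> R) (u e a b : 'rV[R]_n).

Lemma der_along f (u : R -> 'rV[R]_n) (t : R) u' :
  differentiable f (u t) -> der u t u' ->
  der (fun s => f (u s)) t (dpart f (u t) u').
Proof. by move=> df du; rewrite -diff_dpart //; exact: der_comp_diff. Qed.

Lemma der_line (x e : 'rV[R]_n) (t : R) : der (fun s : R => x + s *: e) t e.
Proof.
apply: der_eq; first by ider.
by rewrite add0r scale1r scaler0 addr0.
Qed.

Lemma smooth_MVT U f x w : smooth_on U f ->
  (forall s : R, 0 <= s <= 1 -> U (x + s *: w)) ->
  exists2 s : R, 0 <= s <= 1 & f (x + w) - f x = dpart f (x + s *: w) w.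
Proof.
move=> sf HU.
have [|s s01|s s01 E] := @MVT_everywhere R (fun s => f (x + s *: w))
  (fun s => dpart f (x + s *: w) w) 0 1.
- by [].
- by apply: der_along; [exact/(smooth_differentiable sf)/HU|exact: der_line].
- by exists s => //; move: E; rewrite scale0r scale1r addr0 subr0 mulr1.
Qed.

Lemma dpart_delta f u i : dpart f u (delta_mx 0 i) = pd i f u.
Proof.
rewrite /dpart (bigD1 i) //= mxE !eqxx mul1r big1 ?addr0 // => j ji.
by rewrite mxE eqxx (negbTE ji) mul0r.
Qed.

Lemma norm_delta (i : 'I_n) : `|delta_mx 0 i : 'rV[R]_n| <= 1.
Proof.
rewrite [leLHS]/Num.Def.normr/= mx_normrE; apply/bigmax_leP; split=> // -[k j] _ /=.
by rewrite mxE; case: (_ && _); rewrite ?normr1 ?normr0.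
Qed.

(** Schwarz's theorem. The second difference of [f] over a square of side [h] is [h^2] times a mixed
    derivative at a nearby point, in either order of differentiation; continuity of both mixed
    derivatives at [u] makes them equal up to any [eps]. *)
Lemma pdC U f u i j : open U -> smooth_on U f -> U u ->
  pd i (pd j f) u = pd j (pd i f) u.
Proof.
move=> oU sf Uu.
apply/eqP; rewrite -subr_eq0 -normr_le0; apply/ler_addgt0Pr => eps eps0; rewrite add0r.
pose p1 := pd i (pd j f); pose p2 := pd j (pd i f).
have c1 : {for u, continuous p1}.
  by apply: (@smooth_continuous _ _ U) => //; do 2 apply: smooth_pd.
have c2 : {for u, continuous p2}.
  by apply: (@smooth_continuous _ _ U) => //; do 2 apply: smooth_pd.
have e20 : 0 < eps / 2 by rewrite divr_gt0.
have [r r0 Hr] : exists2 r, 0 < r & forall x, `|x - u| < r ->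
    [/\ U x, `|p1 u - p1 x| < eps / 2 & `|p2 u - p2 x| < eps / 2].
  have [r1 r10 H1] := continuous_eps c1 e20.
  have [r2 r20 H2] := continuous_eps c2 e20.
  have [r3 r30 H3] := open_eps oU Uu.
  exists (Num.min r1 (Num.min r2 r3)) => [|x]; rewrite !lt_min ?r10 ?r20 ?r30//.
  move=> /and3P[x1 x2 x3].
  have K1 := H1 _ x1.
  have K2 := H2 _ x2.
  have K3 := H3 _ x3.
  split => //.
    by move: K1; rewrite -normrN opprB.
  by move: K2; rewrite -normrN opprB.
have [h h0 hr] : exists2 h, 0 < h & h + h < r by exists (r / 3); lra.
pose ei : 'rV[R]_n := delta_mx 0 i; pose ej : 'rV[R]_n := delta_mx 0 j.
have inball (s t : R) : 0 <= s <= 1 -> 0 <= t <= 1 ->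
    `|u + s *: (h *: ei) + t *: (h *: ej) - u| < r.
  move=> /andP[s0 s1] /andP[t0 t1]; rewrite addrAC (addrAC u) subrr add0r.
  rewrite !scalerA (le_lt_trans (ler_normD _ _))//.
  rewrite !normrZ (ger0_norm s0) (ger0_norm t0) (gtr0_norm h0).
  have l1 : s * h * `|ei| <= h.
    have a1 : s * h <= h by nra.
    apply: le_trans a1; apply: ler_piMr; [nra|exact: norm_delta].
  have l2 : t * h * `|ej| <= h.
    have a1 : t * h <= h by nra.
    apply: le_trans a1; apply: ler_piMr; [nra|exact: norm_delta].
  by apply: (le_lt_trans (lerD l1 l2)).
have dp (k : 'I_n) (g : 'rV[R]_n -> R) x : dpart g x (h *: delta_mx 0 k) = h * pd k g x.
  rewrite -dpart_delta /dpart mulr_sumr; apply: eq_bigr => l _.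
  by rewrite mxE mulrA.
have key (k l : 'I_n) : (forall s t : R, 0 <= s <= 1 -> 0 <= t <= 1 ->
    U (u + s *: (h *: delta_mx 0 k) + t *: (h *: delta_mx 0 l))) ->
  exists s t : R, [/\ 0 <= s <= 1, 0 <= t <= 1 &
    f (u + h *: delta_mx 0 k + h *: delta_mx 0 l) - f (u + h *: delta_mx 0 k)
    - (f (u + h *: delta_mx 0 l) - f u) =
    h * (h * pd l (pd k f) (u + s *: (h *: delta_mx 0 k) + t *: (h *: delta_mx 0 l)))].
  move=> HU.
  have [//| |s s01 E] := @MVT_everywhere R
    (fun s => f (u + h *: delta_mx 0 l + s *: (h *: delta_mx 0 k)) - f (u + s *: (h *: delta_mx 0 k)))
    (fun s => dpart f (u + h *: delta_mx 0 l + s *: (h *: delta_mx 0 k)) (h *: delta_mx 0 k)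
      - dpart f (u + s *: (h *: delta_mx 0 k)) (h *: delta_mx 0 k)) 0 1.
    move=> s s01; apply: derB; apply: der_along.
    - apply: (smooth_differentiable sf); rewrite -addrA [X in _ + X]addrC addrA.
      by rewrite -[X in _ + X]scale1r; apply: HU => //; rewrite lexx ler01.
    - exact: der_line.
    - apply: (smooth_differentiable sf); rewrite -[X in U X]addr0 -(scale0r (h *: delta_mx 0 l)).
      by apply: HU => //; rewrite lexx ler01.
    - exact: der_line.
  have [||t t01 Et] := @smooth_MVT U (pd k f) (u + s *: (h *: delta_mx 0 k)) (h *: delta_mx 0 l).
  - exact: smooth_pd.
  - by move=> t t01; exact: HU.
  - exists s, t; split => //; rewrite dp in Et.
    move: E; rewrite !scale1r !scale0r !addr0 subr0 mulr1 !dp -mulrBr.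
    by rewrite (addrAC u (h *: delta_mx 0 l) (s *: _)) Et (addrAC u (h *: delta_mx 0 l)) => ->.
have [|s1 [t1 [s101 t101 E1]]] := key i j.
  by move=> s t s01 t01; have [] := Hr _ (inball s t s01 t01).
have [|s2 [t2 [s201 t201 E2]]] := key j i.
  by move=> s t s01 t01; rewrite addrAC; have [] := Hr _ (inball t s t01 s01).
set y1 := u + s1 *: _ + _ in E1; set y2 := u + s2 *: _ + _ in E2.
have E : p2 y1 = p1 y2.
  have : h * (h * p2 y1) = h * (h * p1 y2).
    by rewrite -[LHS]E1 -[RHS]E2 (addrAC u (h *: delta_mx 0 j)); ring.
  by move=> /(mulfI (lt0r_neq0 h0))/(mulfI (lt0r_neq0 h0)).
have [_ _ B2] := Hr _ (inball s1 t1 s101 t101).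
have [_ B1 _] : [/\ U y2, `|p1 u - p1 y2| < eps / 2 & `|p2 u - p2 y2| < eps / 2].
  by rewrite /y2 addrAC; exact: (Hr _ (inball t2 s2 t201 s201)).
rewrite -/p1 -/p2 (_ : p1 u - p2 u = (p1 u - p1 y2) - (p2 u - p2 y1)); last by rewrite E; ring.
by rewrite (splitr eps) (le_trans (ler_normB _ _))// lerD// ltW.
Qed.

End fields.

(** * Charts, Christoffel symbols and changes of charts *)

Section bilinear.
Context {R : realType} {n : nat}.
Implicit Types (B : 'I_n -> 'I_n -> R) (a b e : 'rV[R]_n).

Definition bil B a b : R := \sum_i \sum_j B i j * a 0 i * b 0 j.

Definition tri (T : 'I_n -> 'I_n -> 'I_n -> R) e a b : R :=
  \sum_i \sum_j \sum_l T i j l * e 0 i * a 0 j * b 0 l.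

Lemma bilDl B a a' b : bil B (a + a') b = bil B a b + bil B a' b.
Proof.
rewrite /bil -big_split; apply: eq_bigr => i _ /=; rewrite -big_split; apply: eq_bigr => j _ /=.
by rewrite mxE; ring.
Qed.

Lemma bilDr B a b b' : bil B a (b + b') = bil B a b + bil B a b'.
Proof.
rewrite /bil -big_split; apply: eq_bigr => i _ /=; rewrite -big_split; apply: eq_bigr => j _ /=.
by rewrite mxE; ring.
Qed.

Lemma bilZl B k a b : bil B (k *: a) b = k * bil B a b.
Proof.
rewrite /bil mulr_sumr; apply: eq_bigr => i _ /=; rewrite mulr_sumr; apply: eq_bigr => j _ /=.
by rewrite mxE; ring.
Qed.

Lemma bilZr B k a b : bil B a (k *: b) = k * bil B a b.
Proof.
rewrite /bil mulr_sumr; apply: eq_bigr => i _ /=; rewrite mulr_sumr; apply: eq_bigr => j _ /=.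
by rewrite mxE; ring.
Qed.

Lemma bilNl B a b : bil B (- a) b = - bil B a b.
Proof. by rewrite -scaleN1r bilZl mulN1r. Qed.

Lemma bilNr B a b : bil B a (- b) = - bil B a b.
Proof. by rewrite -scaleN1r bilZr mulN1r. Qed.

Lemma bil0l B b : bil B 0 b = 0.
Proof. by rewrite -(scale0r 0) bilZl mul0r. Qed.

Lemma bil0r B a : bil B a 0 = 0.
Proof. by rewrite -(scale0r 0) bilZr mul0r. Qed.

Definition bilE := (bilDl, bilDr, bilNl, bilNr, bilZl, bilZr, bil0l, bil0r).

Lemma bilC B a b : (forall i j, B i j = B j i) -> bil B a b = bil B b a.
Proof.
move=> BC; rewrite /bil exchange_big; apply: eq_bigr => i _; apply: eq_bigr => j _.
by rewrite BC mulrAC.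
Qed.

Lemma row_norm_ge a i : `|a 0 i| <= `|a|.
Proof.
rewrite [leRHS]/Num.Def.normr/= mx_normrE.
exact: (le_bigmax 0 (fun ij : 'I_1 * 'I_n => `|a ij.1 ij.2|) (0, i)).
Qed.

Lemma row_norm_le a c : 0 <= c -> (forall i, `|a 0 i| <= c) -> `|a| <= c.
Proof.
move=> c0 H; rewrite [leLHS]/Num.Def.normr/= mx_normrE; apply/bigmax_leP; split=> // -[k j] _ /=.
by rewrite ord1.
Qed.

Lemma norm_sum_le (F : 'I_n -> R) C : (forall i, `|F i| <= C) -> `|\sum_i F i| <= n%:R * C.
Proof.
move=> H; apply: le_trans (ler_norm_sum _ _ _) _.
apply: (@le_trans _ _ (\sum_(i < n) C)); first by apply: ler_sum => i _.
by rewrite sumr_const card_ord mulr_natl.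
Qed.

Lemma bil_bound B C a b : (forall i j, `|B i j| <= C) ->
  `|bil B a b| <= n%:R ^+ 2 * C * `|a| * `|b|.
Proof.
move=> HB; rewrite (_ : _ * `|b| = n%:R * (n%:R * (C * `|a| * `|b|))); last by ring.
apply: norm_sum_le => i; apply: norm_sum_le => j.
rewrite !normrM; apply: ler_pM; rewrite ?mulr_ge0 // ?row_norm_ge //.
by apply: ler_pM; rewrite ?row_norm_ge.
Qed.

Lemma der_bil (B B' : R -> 'I_n -> 'I_n -> R) (a b : R -> 'rV[R]_n) (t : R) a' b' :
  (forall i j, der (fun s => B s i j) t (B' t i j)) -> der a t a' -> der b t b' ->
  der (fun s => bil (B s) (a s) (b s)) t
    (bil (B' t) (a t) (b t) + bil (B t) a' (b t) + bil (B t) (a t) b').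
Proof.
move=> dB /der_rVP da /der_rVP db; apply: der_eq.
  by apply: der_sum => i _; apply: der_sum => j _; apply: derM; [apply: derM; [exact: dB|exact: da]|exact: db].
rewrite /bil -!big_split; apply: eq_bigr => i _ /=; rewrite -!big_split; apply: eq_bigr => j _ /=.
by ring.
Qed.

Lemma dpartD f (u : 'rV[R]_n) a b : dpart f u (a + b) = dpart f u a + dpart f u b.
Proof. by rewrite /dpart -big_split; apply: eq_bigr => i _; rewrite mxE mulrDl. Qed.

Lemma dpartZ f (u : 'rV[R]_n) k a : dpart f u (k *: a) = k * dpart f u a.
Proof. by rewrite /dpart mulr_sumr; apply: eq_bigr => i _; rewrite mxE mulrA. Qed.

Lemma dpart_bound f (u : 'rV[R]_n) C a : (forall i, `|pd i f u| <= C) ->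
  `|dpart f u a| <= n%:R * C * `|a|.
Proof.
move=> H; rewrite -mulrA; apply: norm_sum_le => i; rewrite normrM mulrC.
by apply: ler_pM; rewrite ?row_norm_ge.
Qed.

End bilinear.

Section manifold.
Context {R : realType} {n : nat} (M : riemannian_manifold R n).
Implicit Types (p q x : M) (u e a b : 'rV[R]_n).

Definition img p : set 'rV[R]_n := chart p @` dom p.

Lemma img_open p : open (img p). Proof. exact: chart_image_open. Qed.

Lemma img_chart p x : dom p x -> img p (chart p x). Proof. by exists x. Qed.

Lemma img_dom p u : img p u -> dom p (chart_inv p u).
Proof. by move=> [x px <-]; rewrite chartK. Qed.

Lemma chart_invK p u : img p u -> chart p (chart_inv p u) = u.
Proof. by move=> [x px <-]; rewrite chartK. Qed.

Lemma chart_inv_cont p u : img p u -> {for u, continuous (chart_inv p)}.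
Proof. by move=> [x px <-]; exact: chart_inv_continuous. Qed.

Definition gf p u a b := bil (fun i j => metric p u i j) a b.

Lemma mx_bil (A : 'M[R]_n) a b : (a *m A *m b^T) 0 0 = bil (fun i j => A i j) a b.
Proof.
rewrite /bil mxE exchange_big; apply: eq_bigr => j _; rewrite !mxE mulr_suml; apply: eq_bigr => i _.
by ring.
Qed.

Lemma innerE x a b : inner x a b = gf x (chart x x) a b.
Proof. by rewrite /inner mx_bil. Qed.

Lemma metricC p u i j : img p u -> metric p u i j = metric p u j i.
Proof. by move=> [x px <-]; rewrite -[in LHS]Defs.metric_sym // mxE. Qed.

Lemma gfC p u a b : img p u -> gf p u a b = gf p u b a.
Proof. by move=> pu; apply: bilC => i j; exact: metricC. Qed.

Lemma gf_gt0 p u a : img p u -> a != 0 -> 0 < gf p u a a.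
Proof. by move=> [x px <-] a0; rewrite /gf -mx_bil; exact: Defs.metric_pos. Qed.

Lemma gf_ge0 p u a : img p u -> 0 <= gf p u a a.
Proof.
by move=> pu; have [->|a0] := eqVneq a 0; [rewrite /gf bil0l|rewrite ltW // gf_gt0].
Qed.

Lemma metric_unit p u : img p u -> metric p u \in unitmx.
Proof.
move=> pu; rewrite -row_free_unit -kermx_eq0; apply/eqP/row_matrixP => i; rewrite row0.
have : row i (kermx (metric p u)) *m metric p u = 0 by rewrite -row_mul mulmx_ker row0.
move: (row _ _) => a Ea; apply/eqP; apply: contraT => a0.
by have := gf_gt0 pu a0; rewrite /gf -mx_bil Ea mul0mx mxE ltxx.
Qed.

(** Christoffel symbols of the first kind: with the index lowered no inverse matrix is left, and
    metric compatibility becomes an identity between derivatives of the metric. *)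
Definition low p u (i j l : 'I_n) := 2^-1 * (pd i (fun z => metric p z j l) u
     + pd j (fun z => metric p z i l) u - pd l (fun z => metric p z i j) u).

Lemma christoffelE p u k i j : christoffel p u k i j =
  \sum_l invmx (metric p u) k l * low p u i j l.
Proof.
rewrite /christoffel mulr_sumr; apply: eq_bigr => l _; rewrite /low pdE.
by ring.
Qed.

Lemma low_sym p u i j l : img p u -> low p u i j l = low p u j i l.
Proof.
move=> pu; rewrite /low (addrC (pd i _ _)); congr (_ * (_ - _)).
rewrite pdE; apply: near_eq_derive; apply/near_eps.
have [d d0 Hd] := open_eps (@img_open p) pu.
by exists d => // y /Hd py; exact: metricC.
Qed.

Lemma christoffelC p u k i j : img p u -> christoffel p u k i j = christoffel p u k j i.
Proof.
by move=> pu; rewrite !christoffelE; apply: eq_bigr => l _; rewrite low_sym.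
Qed.

Lemma lowE p u i j l : img p u ->
  \sum_k metric p u k l * christoffel p u k i j = low p u i j l.
Proof.
move=> pu.
under eq_bigr => k _ do rewrite christoffelE mulr_sumr.
rewrite exchange_big /=.
transitivity (\sum_m (metric p u *m invmx (metric p u)) l m * low p u i j m).
  apply: eq_bigr => m _; rewrite mxE mulr_suml; apply: eq_bigr => k _.
  by rewrite metricC // mulrA.
rewrite mulmxV ?metric_unit // (bigD1 l) //= mxE eqxx mul1r big1 ?addr0 // => m ml.
by rewrite mxE eq_sym (negbTE ml) mul0r.
Qed.

Definition Gam p u a b : 'rV[R]_n := \row_k bil (christoffel p u k) a b.

Definition dgf p u e a b :=
  bil (fun i j => dpart (fun z => metric p z i j) u e) a b.

Definition dGam p u e a b : 'rV[R]_n :=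
  \row_k bil (fun i j => dpart (fun z => christoffel p z k i j) u e) a b.

Lemma GamC p u a b : img p u -> Gam p u a b = Gam p u b a.
Proof.
move=> pu; apply/rowP => k; rewrite !mxE; apply: bilC => i j; exact: christoffelC.
Qed.

Lemma gf_Gam p u e a b : img p u -> gf p u (Gam p u e a) b = tri (low p u) e a b.
Proof.
move=> pu; rewrite /gf /bil.
transitivity (\sum_l \sum_i \sum_j low p u i j l * e 0 i * a 0 j * b 0 l).
  rewrite exchange_big; apply: eq_bigr => l _.
  under eq_bigr => k _ do rewrite mxE /bil.
  transitivity (\sum_k \sum_i \sum_j metric p u k l * christoffel p u k i j * e 0 i * a 0 j * b 0 l).
    apply: eq_bigr => k _; rewrite mulr_sumr mulr_suml; apply: eq_bigr => i _.
    by rewrite mulr_sumr mulr_suml; apply: eq_bigr => j _; ring.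
  rewrite exchange_big; apply: eq_bigr => i _; rewrite exchange_big; apply: eq_bigr => j _.
  by rewrite -!mulr_suml lowE.
rewrite /tri exchange_big; apply: eq_bigr => i _; rewrite exchange_big; apply: eq_bigr => j _.
by [].
Qed.

(** Metric compatibility of the connection. For symbols of the first kind it reads
    [d_i g_jl = low i j l + low i l j], where the other derivatives cancel by symmetry of the
    metric. *)
Lemma compat p u e a b : img p u ->
  dgf p u e a b = gf p u (Gam p u e a) b + gf p u a (Gam p u e b).
Proof.
move=> pu; rewrite (gfC a) // !gf_Gam // /tri.
under [X in _ + X]eq_bigr => i _ do rewrite exchange_big.
rewrite -big_split /= /dgf /bil.
transitivity (\sum_i \sum_j \sum_l pd i (fun z => metric p z j l) u * e 0 i * a 0 j * b 0 l).
  rewrite [RHS]exchange_big; apply: eq_bigr => j _; rewrite exchange_big; apply: eq_bigr => l _.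
  by rewrite !mulr_suml; apply: eq_bigr => i _; ring.
apply: eq_bigr => i _; rewrite -big_split; apply: eq_bigr => j _; rewrite -big_split.
apply: eq_bigr => l _ /=.
have -> : pd i (fun z => metric p z j l) u = low p u i j l + low p u i l j.
  rewrite /low (_ : pd i (fun z => metric p z l j) u = pd i (fun z => metric p z j l) u); first by field.
  rewrite pdE; apply: near_eq_derive; apply/near_eps.
  have [d d0 Hd] := open_eps (@img_open p) pu.
  by exists d => // y /Hd py; exact: metricC.
by ring.
Qed.

Lemma smooth_metric p i j : smooth_on (img p) (fun u => metric p u i j).
Proof. exact: Defs.metric_smooth. Qed.

Lemma smooth_christoffel p k i j : smooth_on (img p) (fun u => christoffel p u k i j).
Proof.
have oU := @img_open p.
apply: (@smooth_congr _ _ _ (fun u => \sum_l invmx (metric p u) k l * low p u i j l)) => //.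
  by move=> u _; rewrite christoffelE.
apply: smooth_big_sum => // l.
apply: (smoothM (f := fun u => invmx (metric p u) k l)) => //.
  apply: smooth_invmx => //; first exact: metric_unit.
  exact: smooth_metric.
apply: (smoothM (f := cst _)) => //; first exact: smooth_cst.
have P i1 j1 k1 : smooth_on (img p) (pd i1 (fun z => metric p z j1 k1)).
  by apply: smooth_pd; exact: smooth_metric.
apply: (smoothD (f := fun u => pd i (fun z => metric p z j l) u + pd j (fun z => metric p z i l) u)
  (g := fun u => - pd l (fun z => metric p z i j) u)) => //.
  exact: (smoothD (f := pd i (fun z => metric p z j l))).
apply: (@smooth_congr _ _ _ (cst (-1) * pd l (fun z => metric p z i j))) => //.
  by move=> u _; rewrite /= fctE mulN1r.
by apply: smoothM => //; exact: smooth_cst.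
Qed.

Lemma der_gf p (c a b : R -> 'rV[R]_n) (t : R) c' a' b' : img p (c t) ->
  der c t c' -> der a t a' -> der b t b' ->
  der (fun s => gf p (c s) (a s) (b s)) t
    (dgf p (c t) c' (a t) (b t) + gf p (c t) a' (b t) + gf p (c t) (a t) b').
Proof.
move=> pc dc da db.
apply: (@der_bil _ _ (fun s i j => metric p (c s) i j)
  (fun s i j => dpart (fun z => metric p z i j) (c s) c')) => // i j.
apply: (@der_along _ _ (fun z => metric p z i j)) => //.
exact: smooth_differentiable (smooth_metric p i j) pc.
Qed.

Lemma der_Gam p (c a b : R -> 'rV[R]_n) (t : R) c' a' b' : img p (c t) ->
  der c t c' -> der a t a' -> der b t b' ->
  der (fun s => Gam p (c s) (a s) (b s)) t
    (dGam p (c t) c' (a t) (b t) + Gam p (c t) a' (b t) + Gam p (c t) (a t) b').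
Proof.
move=> pc dc da db; apply/der_rVP => k; rewrite !mxE; under eq_fun do rewrite mxE.
apply: (@der_bil _ _ (fun s i j => christoffel p (c s) k i j)
  (fun s i j => dpart (fun z => christoffel p z k i j) (c s) c')) => // i j.
apply: (@der_along _ _ (fun z => christoffel p z k i j)) => //.
exact: smooth_differentiable (smooth_christoffel p k i j) pc.
Qed.

End manifold.
Arguments img_open {R n M} p.

Lemma near_continuous {T U : topologicalType} (f : T -> U) (x : T) (A : set U) :
  {for x, continuous f} -> open A -> A (f x) -> \forall y \near x, A (f y).
Proof. by move=> cf oA Ax; apply: cf; exact: open_nbhs_nbhs. Qed.

Section chart_change.
Context {R : realType} {n : nat} (M : riemannian_manifold R n).
Implicit Types (p q x : M) (u v e a b : 'rV[R]_n).

Definition tr p q u : 'rV[R]_n := chart q (chart_inv p u).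
Definition imgI p q : set 'rV[R]_n := chart p @` (dom p `&` dom q).
Definition DT p q u a : 'rV[R]_n := \row_k dpart (fun z => tr p q z 0 k) u a.
(** Second differential of the change of charts: the inhomogeneous term in the transformation law
    [Gam_tr]. *)
Definition D2T p q u e a : 'rV[R]_n :=
  \row_k bil (fun i j => pd i (pd j (fun z => tr p q z 0 k)) u) e a.

Lemma imgI_P p q u : imgI p q u <-> img p u /\ dom q (chart_inv p u).
Proof.
split=> [[x [px qx] <-]|[pu qu]]; first by rewrite chartK //; split=> //; exact: img_chart.
by exists (chart_inv p u); [split=> //; exact: img_dom|exact: chart_invK].
Qed.

Lemma imgI_img p q u : imgI p q u -> img p u. Proof. by case/imgI_P. Qed.

Lemma imgI_tr p q u : imgI p q u -> img q (tr p q u).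
Proof. by move=> /imgI_P[_ qu]; exact: img_chart. Qed.

Lemma imgI_open p q : open (imgI p q).
Proof.
rewrite openE => u /imgI_P[pu qu].
have H1 : nbhs u (img p) by apply: open_nbhs_nbhs; split => //; exact: img_open.
have H2 : nbhs u (chart_inv p @^-1` dom q).
  by apply: (chart_inv_cont pu); apply: open_nbhs_nbhs; split => //; exact: dom_open.
by apply: filterS2 H1 H2 => z pz qz; apply/imgI_P.
Qed.

Lemma smooth_tr p q k : smooth_on (imgI p q) (fun z => tr p q z 0 k).
Proof. exact: transition_smooth. Qed.

Lemma DTD p q u a b : DT p q u (a + b) = DT p q u a + DT p q u b.
Proof. by apply/rowP => k; rewrite !mxE dpartD. Qed.

Lemma DTZ p q u k a : DT p q u (k *: a) = k *: DT p q u a.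
Proof. by apply/rowP => i; rewrite !mxE dpartZ. Qed.

Lemma DTN p q u a : DT p q u (- a) = - DT p q u a.
Proof. by rewrite -scaleN1r DTZ scaleN1r. Qed.

Lemma D2TC p q u e a : imgI p q u -> D2T p q u e a = D2T p q u a e.
Proof.
move=> pqu; apply/rowP => k; rewrite !mxE; apply: bilC => i j.
exact: (pdC _ _ (@imgI_open p q) (smooth_tr p q k)).
Qed.

Lemma der_tr p q (c : R -> 'rV[R]_n) (t : R) c' : imgI p q (c t) -> der c t c' ->
  der (fun s => tr p q (c s)) t (DT p q (c t) c').
Proof.
move=> pqc dc; apply/der_rVP => k; rewrite mxE.
apply: (@der_along _ _ (fun z => tr p q z 0 k)) => //.
exact: smooth_differentiable (smooth_tr p q k) pqc.
Qed.

Lemma der_DT p q (c a : R -> 'rV[R]_n) (t : R) c' a' : imgI p q (c t) ->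
  der c t c' -> der a t a' ->
  der (fun s => DT p q (c s) (a s)) t (D2T p q (c t) c' (a t) + DT p q (c t) a').
Proof.
move=> pqc dc /der_rVP da; apply/der_rVP => k; rewrite !mxE; under eq_fun do rewrite mxE.
apply: der_eq.
  apply: der_sum => j _; apply: derM; first exact: da.
  apply: (@der_along _ _ (pd j (fun z => tr p q z 0 k)) c) dc.
  exact: smooth_differentiable (smooth_pd j (smooth_tr p q k)) pqc.
rewrite /= big_split /= [RHS]addrC; congr (_ + _).
rewrite /bil exchange_big; apply: eq_bigr => j _; rewrite /dpart mulr_sumr; apply: eq_bigr => i _.
by ring.
Qed.

Lemma jacobianE p q u a : imgI p q u -> a *m jacobian (chart q \o chart_inv p) u = DT p q u a.
Proof.
move=> pqu; rewrite /jacobian mul_rV_lin1 /=.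
have dk k : differentiable (fun z => tr p q z 0 k) u.
  exact: smooth_differentiable (smooth_tr p q k) pqu.
have E : chart q \o chart_inv p = \sum_k (fun z => tr p q z 0 k *: (delta_mx 0 k : 'rV[R]_n)).
  by apply/funext => z; rewrite fct_sumE /= -/(tr p q z) {1}[tr p q z]row_sum_delta.
have dT : differentiable (chart q \o chart_inv p) u.
  by rewrite E; apply: differentiable_sum => k; exact: differentiableZl.
apply/rowP => k; rewrite mxE -diff_dpart //.
have dc : differentiable (fun v : 'rV[R]_n => v 0 k) (tr p q u) by exact: differentiable_coord.
have := @diff_comp _ _ _ _ (chart q \o chart_inv p) (fun v : 'rV[R]_n => v 0 k) u dT dc.
move=> /(congr1 (fun g : 'rV[R]_n -> R => g a)) /= ->.
have L : linear (fun v : 'rV[R]_n => v 0 k) by move=> l v w; rewrite !mxE.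
pose g := GRing.isLinear.Build _ _ _ _ (fun v : 'rV[R]_n => v 0 k) L.
pose G : {linear 'rV[R]_n -> R} := HB.pack (fun v : 'rV[R]_n => v 0 k) g.
by rewrite (@diff_lin _ _ _ G) //; exact: coord_continuous.
Qed.

Lemma gf_tr p q u a b : imgI p q u ->
  gf p u a b = gf q (tr p q u) (DT p q u a) (DT p q u b).
Proof.
move=> pqu; have [x [px qx] xu] := pqu.
have := metric_transition px qx; rewrite /= xu => E.
rewrite /gf -!mx_bil E -!jacobianE // trmx_mul !mulmxA.
by rewrite /tr -xu chartK.
Qed.

(** Koszul's uniqueness argument, which spares the expansion of the symbols in the second chart. The
    defect [S] is symmetric because both connections are torsion free, and its pairing with a third
    vector is antisymmetric in the last two arguments because both are metric; such a form
    vanishes. *)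
Lemma Gam_tr p q u e a : imgI p q u ->
  DT p q u (Gam p u e a) = Gam q (tr p q u) (DT p q u e) (DT p q u a) + D2T p q u e a.
Proof.
move=> pqu; have pu := imgI_img pqu; have qu := imgI_tr pqu.
(* The identity [gf_tr] differentiated along [e0], with the derivative computed in either chart. *)
have dg (e0 a0 b0 : 'rV[R]_n) : dgf p u e0 a0 b0 =
    dgf q (tr p q u) (DT p q u e0) (DT p q u a0) (DT p q u b0)
    + gf q (tr p q u) (D2T p q u e0 a0) (DT p q u b0)
    + gf q (tr p q u) (DT p q u a0) (D2T p q u e0 b0).
  have u0 : u = u + (0 : R) *: e0 by rewrite scale0r addr0.
  have dl := @der_line R n u e0 0.
  have H1 := @der_gf _ _ _ p (fun s => u + s *: e0) (fun _ => a0) (fun _ => b0) 0 e0 0 0.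
  rewrite -u0 /gf !bilE !addr0 in H1.
  have H2 := @der_gf _ _ _ q (fun s => tr p q (u + s *: e0))
    (fun s => DT p q (u + s *: e0) a0) (fun s => DT p q (u + s *: e0) b0) 0
    (DT p q u e0) (D2T p q u e0 a0) (D2T p q u e0 b0).
  rewrite -u0 in H2.
  have DTc a1 : der (fun s : R => DT p q (u + s *: e0) a1) 0 (D2T p q u e0 a1).
    apply: der_eq; first by apply: der_DT (der_cst _ _) => //; [rewrite -u0|exact: dl].
    by rewrite /= -u0 -[X in DT _ _ _ X](scale0r a1) DTZ scale0r addr0.
  apply: der_unique (H1 pu dl (der_cst _ _) (der_cst _ _)) _.
  apply: near_eq_der (H2 qu _ (DTc a0) (DTc b0)); last first.
    by apply: der_eq; [apply: der_tr dl; rewrite -u0|rewrite /= -u0].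
  have cl : {for 0, continuous (fun s : R => u + s *: e0)} by exact: der_continuous dl.
  have N : \forall s \near (0 : R), imgI p q (u + s *: e0).
    by apply: near_continuous cl (@imgI_open p q) _; rewrite -u0.
  by apply: filterS N => s Hs; rewrite -gf_tr.
pose S e0 a0 := DT p q u (Gam p u e0 a0) -
  (Gam q (tr p q u) (DT p q u e0) (DT p q u a0) + D2T p q u e0 a0).
have SC e0 a0 : S e0 a0 = S a0 e0 by rewrite /S GamC // [X in _ - (X + _)]GamC // D2TC.
pose A e0 a0 b0 := gf q (tr p q u) (S e0 a0) (DT p q u b0).
have AC e0 a0 b0 : A e0 a0 b0 = A a0 e0 b0 by rewrite /A SC.
have AN e0 a0 b0 : A e0 a0 b0 = - A e0 b0 a0.
  apply/eqP; rewrite -addr_eq0; apply/eqP; have := dg e0 a0 b0.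
  rewrite !compat // !(gf_tr _ _ pqu) => E.
  rewrite /A (gfC (S e0 b0)) // /S /gf !bilE -/(gf _ _ _ _); move: E; rewrite /gf; lra.
have A0 e0 a0 b0 : A e0 a0 b0 = 0.
  have : A e0 a0 b0 = - A e0 a0 b0 by rewrite {1}AN AC AN opprK AC AN AC.
  by move=> E; lra.
apply/eqP; rewrite -subr_eq0; apply/eqP; rewrite -/(S e a).
apply/eqP; apply: contraT => S0; have := gf_gt0 qu S0.
pose J := jacobian (chart q \o chart_inv p) u.
have uJ : J \in unitmx.
  rewrite -row_free_unit -kermx_eq0; apply/eqP/row_matrixP => i; rewrite row0.
  have : row i (kermx J) *m J = 0 by rewrite -row_mul mulmx_ker row0.
  move: (row _ _) => r Er; apply/eqP; apply: contraT => r0.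
  by have := gf_gt0 pu r0; rewrite (gf_tr _ _ pqu) -jacobianE // -/J Er /gf bil0l ltxx.
(* The differential of the change of charts is invertible, so a third vector with image [S e a]
   exists. *)
have := A0 e a (S e a *m invmx J).
by rewrite /A -jacobianE // -/J mulmxKV // => ->; rewrite ltxx.
Qed.

Lemma geodesic_atE (c : R -> M) (t : R) : geodesic_at c t <-> {for t, continuous c} /\
  forall p, dom p (c t) -> [/\ derivable (chart p \o c) t 1, derivable (d1 (chart p \o c)) t 1 &
    d1 (d1 (chart p \o c)) t =
      - Gam p (chart p (c t)) (d1 (chart p \o c) t) (d1 (chart p \o c) t)].
Proof.
rewrite /geodesic_at -d1E; split=> -[cc H]; split=> // p /H [h1 h2 E]; split=> //.
  apply/rowP => k; move: (E k) => /eqP; rewrite addr_eq0 => /eqP ->.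
  by rewrite !mxE.
by move=> k; rewrite E !mxE addrC /bil subrr.
Qed.

Lemma velocityE (c : R -> M) (t : R) : velocity c t = d1 (chart (c t) \o c) t.
Proof. by rewrite /velocity d1E. Qed.

(** [geodesic_at] quantifies over all charts; by [Gam_tr] the second differential of the change of
    charts cancels, so the equation in one chart is enough. *)
Lemma geodesic_at_chart p (u v : R -> 'rV[R]_n) (t : R) : img p (u t) ->
  (\forall s \near t, der u s (v s)) -> der v t (- Gam p (u t) (v t) (v t)) ->
  geodesic_at (chart_inv p \o u) t.
Proof.
move=> pu du dv; have cu := der_continuous (nbhs_singleton du).
apply/geodesic_atE; split; first by apply: continuous_comp => //; exact: chart_inv_cont.
move=> q qc; have pqu : imgI p q (u t) by apply/imgI_P.
have N : \forall s \near t, imgI p q (u s).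
  by apply: cu; apply: open_nbhs_nbhs; split=> //; exact: imgI_open.
have du1 : \forall s \near t, der (chart q \o (chart_inv p \o u)) s (DT p q (u s) (v s)).
  by apply: filterS2 N du => s Hs ds; exact: der_tr.
have /derP[h1 e1] := nbhs_singleton du1.
have dv1 : der (d1 (chart q \o (chart_inv p \o u))) t
    (D2T p q (u t) (v t) (v t) + DT p q (u t) (- Gam p (u t) (v t) (v t))).
  apply: near_eq_der (der_DT pqu (nbhs_singleton du) dv).
  by apply: filterS du1 => s /derP[_ ->].
have /derP[d2 e2] := dv1.
split=> //; rewrite e1 e2 DTN Gam_tr //= -/(tr p q (u t)).
by rewrite opprD addrCA subrr addr0.
Qed.

Lemma chart_comp_near p q (c : R -> M) (t : R) : {for t, continuous c} ->
  dom p (c t) -> dom q (c t) ->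
  \forall s \near t, imgI p q (chart p (c s)) /\ tr p q (chart p (c s)) = chart q (c s).
Proof.
move=> cc pc qc.
have Np : \forall s \near t, dom p (c s) by apply: cc; apply: open_nbhs_nbhs; split=> //; exact: dom_open.
have Nq : \forall s \near t, dom q (c s) by apply: cc; apply: open_nbhs_nbhs; split=> //; exact: dom_open.
apply: filterS2 Np Nq => s ps qs; rewrite /tr chartK //; split=> //.
by apply/imgI_P; rewrite chartK //; split=> //; exact: img_chart.
Qed.

Lemma der_chart_change p q (c : R -> M) (t : R) u' : {for t, continuous c} ->
  dom p (c t) -> dom q (c t) -> der (chart p \o c) t u' ->
  der (chart q \o c) t (DT p q (chart p (c t)) u').
Proof.
move=> cc pc qc dc; have N := chart_comp_near cc pc qc.
apply: near_eq_der (der_tr (nbhs_singleton N).1 dc).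
by apply: filterS N => s [].
Qed.

Lemma velocity_chart p (c : R -> M) (t : R) u' : {for t, continuous c} ->
  dom p (c t) -> der (chart p \o c) t u' ->
  velocity c t = DT p (c t) (chart p (c t)) u'.
Proof.
move=> cc pc dc; have [_] := (derP _ _ _).1 (der_chart_change cc pc (@dom_self _ _ _ (c t)) dc).
by rewrite velocityE.
Qed.

Lemma inner_chart p x a b : dom p x ->
  inner x (DT p x (chart p x) a) (DT p x (chart p x) b) = gf p (chart p x) a b.
Proof.
move=> px; have pxx : imgI p x (chart p x).
  by apply/imgI_P; rewrite chartK //; split; [exact: img_chart|exact: dom_self].
by rewrite innerE (gf_tr _ _ pxx) /tr chartK.
Qed.

Lemma geodesic_chart p (c : R -> M) (t : R) : (\forall s \near t, geodesic_at c s) ->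
  dom p (c t) ->
  (\forall s \near t, der (chart p \o c) s (d1 (chart p \o c) s)) /\
  der (d1 (chart p \o c)) t
    (- Gam p (chart p (c t)) (d1 (chart p \o c) t) (d1 (chart p \o c) t)).
Proof.
move=> gc pc; have /geodesic_atE[cc Hc] := nbhs_singleton gc.
have Np : \forall s \near t, dom p (c s) by apply: cc; apply: open_nbhs_nbhs; split=> //; exact: dom_open.
split; first by apply: filterS2 gc Np => s /geodesic_atE[_ H] /H[d _ _]; apply/derP.
by have [_ d2 E] := Hc p pc; apply/derP; split.
Qed.

End chart_change.

(** * Geodesics in a small coordinate ball *)

Section fixpoint.
Context {R : realType}.

(** Every lower bound [x j - 2 c / 2^j] lies below every upper bound [x k + 2 c / 2^k], so the
    supremum of the former is the limit, with an explicit rate. *)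
Lemma geometric_limit (x : nat -> R) c : (forall k, `|x k.+1 - x k| <= c / 2 ^+ k) ->
  exists l, forall k, `|l - x k| <= 2 * c / 2 ^+ k.
Proof.
move=> H; have p2 k : 0 < 2 ^+ k :> R by rewrite exprn_gt0.
have c0 : 0 <= c by have := H 0%N; rewrite expr0 divr1; apply: le_trans.
have step k j : `|x (k + j)%N - x k| <= 2 * c / 2 ^+ k - 2 * c / 2 ^+ (k + j).
  elim: j => [|j IH]; first by rewrite addn0 !subrr normr0.
  rewrite addnS -(subrKA (x (k + j)%N)) (le_trans (ler_normD _ _)) //.
  apply: le_trans (lerD (H _) IH) _; rewrite exprS.
  have := p2 (k + j)%N; move: (2 ^+ (k + j)) => z z0.
  rewrite (_ : 2 * c / (2 * z) = c / z); last by field; rewrite gt_eqF.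
  have : 0 <= c / z by rewrite divr_ge0 // ltW.
  lra.
have step0 k j : `|x (k + j)%N - x k| <= 2 * c / 2 ^+ k.
  apply: le_trans (step k j) _; rewrite gerBl; have := p2 (k + j)%N => z0.
  by rewrite !mulr_ge0 // invr_ge0 ltW.
have LU j k : x j - 2 * c / 2 ^+ j <= x k + 2 * c / 2 ^+ k.
  have P (i : nat) : 0 <= 2 * c / 2 ^+ i by rewrite !mulr_ge0 // invr_ge0 ltW.
  case: (leqP j k) => jk.
    have := step0 j (k - j)%N; rewrite subnKC // ler_norml => /andP[]; have := P k; lra.
  have := step0 k (j - k)%N; rewrite subnKC ?(ltnW jk) // ler_norml => /andP[]; have := P j; lra.
exists (sup [set y | exists j, y = x j - 2 * c / 2 ^+ j]) => k.
have hs : has_sup [set y | exists j, y = x j - 2 * c / 2 ^+ j].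
  split; first by exists (x 0%N - 2 * c / 2 ^+ 0), 0%N.
  by exists (x 0%N + 2 * c / 2 ^+ 0) => _ [j ->]; exact: LU.
rewrite ler_norml; apply/andP; split.
  have : x k - 2 * c / 2 ^+ k <= sup [set y | exists j, y = x j - 2 * c / 2 ^+ j].
    by apply: sup_upper_bound => //; exists k.
  lra.
have : sup [set y | exists j, y = x j - 2 * c / 2 ^+ j] <= x k + 2 * c / 2 ^+ k.
  by apply: ge_sup => [|_ [j ->]]; [exact: hs.1|exact: LU].
lra.
Qed.

Lemma pow2_small (c e : R) : 0 < e -> exists k : nat, c / 2 ^+ k < e.
Proof.
move=> e0; exists (Num.truncn `|c / e|).+1.
have p2 k : 0 < 2 ^+ k :> R by rewrite exprn_gt0.
rewrite ltr_pdivrMr // mulrC -ltr_pdivrMr //.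
apply: (le_lt_trans (ler_norm _)); apply: (lt_le_trans (truncnS_gt _)).
by rewrite -natrX ler_nat ltnW // ltn_expl.
Qed.

(** Banach's theorem in the uniform norm, on continuous functions of the whole line bounded by [D].
    The rate [2 D / 2^k] of the iterates is uniform in time, so the limit is continuous. *)
Lemma contraction_fixpoint {n : nat} (Phi : (R -> 'rV[R]_n) -> R -> 'rV[R]_n) (D : R) :
  0 <= D ->
  (forall v, continuous v -> (forall t, `|v t| <= D) ->
     continuous (Phi v) /\ forall t, `|Phi v t| <= D) ->
  (forall v w m, continuous v -> (forall t, `|v t| <= D) ->
     continuous w -> (forall t, `|w t| <= D) -> 0 <= m ->
     (forall t, `|v t - w t| <= m) -> forall t, `|Phi v t - Phi w t| <= m / 2) ->
  exists v, [/\ continuous v, forall t, `|v t| <= D & forall t, Phi v t = v t].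
Proof.
move=> D0 stab contr.
pose x k := iter k Phi (fun _ => 0).
have gx k : continuous (x k) /\ forall t, `|x k t| <= D.
  elim: k => [|k [IH1 IH2]]; last exact: stab.
  by split=> t; [exact: cst_continuous|rewrite normr0].
have dx k t : `|x k.+1 t - x k t| <= D / 2 ^+ k.
  elim: k t => [t|k IH t].
    by rewrite expr0 divr1 subr0; exact: (gx 1%N).2.
  have -> : D / 2 ^+ k.+1 = D / 2 ^+ k / 2 by rewrite exprS invfM; ring.
  have [c1 b1] := gx k; have [c2 b2] := gx k.+1.
  apply: (contr (x k.+1) (x k) (D / 2 ^+ k) c2 b2 c1 b1 _ IH).
  by rewrite mulr_ge0 // invr_ge0 exprn_ge0.
have [v Hv] : exists v : R -> 'rV[R]_n, forall t k, `|v t - x k t| <= 2 * D / 2 ^+ k.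
  have : forall t, exists w : 'rV[R]_n, forall k, `|w - x k t| <= 2 * D / 2 ^+ k.
    move=> t.
    have : forall i, exists l, forall k, `|l - x k t 0 i| <= 2 * D / 2 ^+ k.
      move=> i; apply: geometric_limit => k; apply: le_trans (dx k t).
      by have := row_norm_ge (x k.+1 t - x k t) i; rewrite !mxE.
    move=> /choice[l Hl]; exists (\row_i l i) => k; apply: row_norm_le.
      by rewrite !mulr_ge0 // invr_ge0 exprn_ge0.
    by move=> i; rewrite !mxE.
  by move=> /choice[v Hv]; exists v.
have small e : 0 < e -> exists k : nat, 2 * D / 2 ^+ k < e by exact: pow2_small.
have cv : continuous v.
  move=> t; apply: eps_continuous => e e0.
  have [k Hk] := small (e / 3) ltac:(lra).
  have [d d0 Hd] := continuous_eps ((gx k).1 t) (e := e / 3) ltac:(lra).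
  exists d => // s /Hd H.
  rewrite (_ : v s - v t = (v s - x k s) + (x k s - x k t) + (x k t - v t)); last first.
    by rewrite !addrA !subrK.
  have := ler_normD (v s - x k s + (x k s - x k t)) (x k t - v t).
  have := ler_normD (v s - x k s) (x k s - x k t).
  have := Hv s k; have := Hv t k; rewrite (distrC (v t)); lra.
have bv t : `|v t| <= D.
  apply/ler_addgt0Pr => e e0; have [k Hk] := small e e0.
  rewrite -[v t](subrK (x k t)) (le_trans (ler_normD _ _)) //.
  have := Hv t k; have := (gx k).2 t; lra.
exists v; split=> // t.
apply/eqP; rewrite -subr_eq0 -normr_le0; apply/ler_addgt0Pr => e e0; rewrite add0r.
have [k Hk] := small (e / 2) ltac:(lra).
rewrite (_ : Phi v t - v t = (Phi v t - x k.+1 t) + (x k.+1 t - v t)); last by rewrite !addrA !subrK.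
rewrite (le_trans (ler_normD _ _)) //.
have h1 : `|Phi v t - x k.+1 t| <= 2 * D / 2 ^+ k / 2.
  have [c1 b1] := gx k.
  apply: (contr v (x k) (2 * D / 2 ^+ k) cv bv c1 b1) => //.
  by rewrite !mulr_ge0 // invr_ge0 exprn_ge0.
have h2 := Hv t k.+1; rewrite distrC in h2.
have e3 : 2 * D / 2 ^+ k.+1 = 2 * D / 2 ^+ k / 2 by rewrite exprS invfM; ring.
rewrite e3 in h2.
lra.
Qed.

Lemma primitive_real (f : R -> R) : continuous f ->
  exists F : R -> R, F 0 = 0 /\ forall t, -3 < t -> der F t (f t).
Proof.
(* The integral starts at -3, to the left of every time used later. *)
move=> cf; pose F (x : R) := (\int[lebesgue_measure]_(t in `[-3, x]) f t)%R.
exists (fun x => F x - F 0); split; first by rewrite subrr.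
move=> t t3; apply: der_eq; first (apply: derB; last exact: der_cst); last by rewrite subr0.
apply/derP; rewrite d1E; apply: (@continuous_FTC1_closed _ f (-3) t (t + 1)) => //; last exact: cf.
  by rewrite ltrDl.
apply: continuous_compact_integrable; first exact: segment_compact.
exact: continuous_subspaceT.
Qed.

Lemma primitive_ex {n} (f : R -> 'rV[R]_n) : continuous f ->
  exists F : R -> 'rV[R]_n, F 0 = 0 /\ forall t, -3 < t -> der F t (f t).
Proof.
move=> cf.
have : forall i, exists F : R -> R, F 0 = 0 /\ forall t, -3 < t -> der F t (f t 0 i).
  move=> i; apply: primitive_real => t.
  by apply: (continuous_comp (f := f) (g := fun M : 'rV[R]_n => M 0 i)); [exact: cf|exact: coord_continuous].
move=> /choice[F HF]; exists (fun t => \row_i F i t); split.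
  by apply/rowP => i; rewrite !mxE; exact: (HF i).1.
move=> t t3; apply/der_rVP => i; under eq_fun do rewrite mxE; exact: (HF i).2.
Qed.

Definition prim {n} (f : R -> 'rV[R]_n) : R -> 'rV[R]_n :=
  xget (fun _ => 0) [set F | F 0 = 0 /\ forall t, -3 < t -> der F t (f t)].

Lemma prim0 {n} (f : R -> 'rV[R]_n) : continuous f -> prim f 0 = 0.
Proof. by move=> /primitive_ex[F HF]; rewrite /prim; case: xgetP => [G _ []//|/(_ F)]. Qed.

Lemma der_prim {n} (f : R -> 'rV[R]_n) (t : R) : continuous f -> -3 < t -> der (prim f) t (f t).
Proof.
by move=> /primitive_ex[F HF] t3; rewrite /prim; case: xgetP => [G _ [_]|/(_ F)]; [exact|].
Qed.

(** The norm is the maximum norm, so the scalar mean value theorem in each coordinate gives the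
    vector inequality with no loss of a factor. *)
Lemma der_bound {n} (F F' : R -> 'rV[R]_n) (s t K : R) : 0 <= K ->
  (forall r, (s <= r <= t) || (t <= r <= s) -> der F r (F' r)) ->
  (forall r, (s <= r <= t) || (t <= r <= s) -> `|F' r| <= K) ->
  `|F t - F s| <= K * `|t - s|.
Proof.
move=> K0; wlog st : s t / s <= t.
  move=> W H1 H2; case: (leP s t) => [st|/ltW ts]; first exact: W.
  rewrite distrC (distrC t); apply: W => // r; rewrite orbC; [exact: H1|exact: H2].
move=> H1 H2; apply: row_norm_le => [|i]; first by rewrite mulr_ge0.
have [r rst E] := @MVT_everywhere R (fun s => F s 0 i) (fun s => F' s 0 i) s t st
  (fun r rst => (der_rVP _ _ _).1 (H1 r (introT orP (or_introl rst))) i).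
rewrite !mxE E normrM; apply: ler_pM => //.
by apply: le_trans (row_norm_ge _ _) _; apply: H2; rewrite rst.
Qed.

End fixpoint.

(** * Compactness and uniform bounds in coordinates *)

Section compactness.
Context {R : realType} {n : nat}.

Lemma cball_compact (u0 : 'rV[R]_n) (r : R) : compact [set u : 'rV[R]_n | `|u - u0| <= r].
Proof.
apply: bounded_closed_compact.
  exists (r + `|u0|); split; first exact: num_real.
  move=> K rK u /= ur; apply: le_trans (ltW rK).
  by rewrite -[u](subrK u0) (le_trans (ler_normD _ _)) // lerD2r.
have -> : [set u : 'rV[R]_n | `|u - u0| <= r] = (fun u => `|u - u0|) @^-1` [set x | x <= r] by [].
apply: closed_comp; last exact: closed_le.
by move=> u _; apply: continuous_comp; [apply: continuousB; [exact: id_fun_cont || by []|exact: cst_continuous]|exact: norm_continuous].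
Qed.

Lemma cball_max (f : 'rV[R]_n -> R) (u0 : 'rV[R]_n) (r : R) : 0 <= r ->
  (forall u, `|u - u0| <= r -> {for u, continuous f}) ->
  exists2 c, `|c - u0| <= r & forall u, `|u - u0| <= r -> f u <= f c.
Proof.
move=> r0 cf; have [||c /set_mem cA Hc] := EVT_max_rV _ (@cball_compact u0 r) (f := f).
- by exists u0; rewrite /= subrr normr0.
- by apply: continuous_in_subspaceT => u /set_mem /cf.
- by exists c => // u ur; apply/Hc/mem_set.
Qed.

Lemma cball_min (f : 'rV[R]_n -> R) (u0 : 'rV[R]_n) (r : R) : 0 <= r ->
  (forall u, `|u - u0| <= r -> {for u, continuous f}) ->
  exists2 c, `|c - u0| <= r & forall u, `|u - u0| <= r -> f c <= f u.
Proof.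
move=> r0 cf; have [||c /set_mem cA Hc] := EVT_min_rV _ (@cball_compact u0 r) (f := f).
- by exists u0; rewrite /= subrr normr0.
- by apply: continuous_in_subspaceT => u /set_mem /cf.
- by exists c => // u ur; apply/Hc/mem_set.
Qed.

Lemma smooth_bounded (I : finType) (U : set 'rV[R]_n) (F : I -> 'rV[R]_n -> R) u0 (r : R) :
  0 <= r -> (forall u, `|u - u0| <= r -> U u) -> (forall i, smooth_on U (F i)) ->
  exists2 C, 0 <= C & forall i u, `|u - u0| <= r -> `|F i u| <= C.
Proof.
move=> r0 HU sF.
have : forall i, exists C, 0 <= C /\ forall u, `|u - u0| <= r -> `|F i u| <= C.
  move=> i; have [|c _ Hc] := @cball_max (fun u => `|F i u|) u0 r r0.
    move=> u /HU Uu; apply: continuous_comp; [exact: smooth_continuous (sF i) Uu|exact: norm_continuous].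
  by exists `|F i c|; split.
move=> /choice[C HC]; exists (\sum_i C i); first by apply: sumr_ge0 => i _; exact: (HC i).1.
move=> i u /(HC i).2 H; apply: (le_trans H).
by rewrite (bigD1 i) //= lerDl; apply: sumr_ge0 => j _; exact: (HC j).1.
Qed.

Lemma bil_sub B B' (a b : 'rV[R]_n) :
  bil B a b - bil B' a b = bil (fun i j => B i j - B' i j) a b.
Proof.
rewrite /bil -sumrB; apply: eq_bigr => i _; rewrite -sumrB; apply: eq_bigr => j _.
by ring.
Qed.

Lemma seg_ball (u0 u v : 'rV[R]_n) (r s : R) : `|u - u0| <= r -> `|v - u0| <= r -> 0 <= s <= 1 ->
  `|u + s *: (v - u) - u0| <= r.
Proof.
move=> ur vr /andP[s0 s1].
have -> : u + s *: (v - u) - u0 = (1 - s) *: (u - u0) + s *: (v - u0).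
  by apply/rowP => i; rewrite !mxE; ring.
rewrite (le_trans (ler_normD _ _)) // !normrZ (ger0_norm s0) ger0_norm ?subr_ge0 //.
nra.
Qed.

Lemma smooth_lip U (f : 'rV[R]_n -> R) u0 r C u v : smooth_on U f ->
  (forall u, `|u - u0| <= r -> U u) ->
  (forall i u, `|u - u0| <= r -> `|pd i f u| <= C) -> `|u - u0| <= r -> `|v - u0| <= r ->
  `|f v - f u| <= n%:R * C * `|v - u|.
Proof.
move=> sf HU HC ur vr.
have [||s s01 E] := @smooth_MVT R n U f u (v - u).
- by [].
- by move=> s s01; apply: HU; exact: seg_ball.
- rewrite (addrC u) subrK in E; rewrite E; apply: dpart_bound => i; apply: HC; exact: seg_ball.
Qed.

Lemma smooth_taylor U (f : 'rV[R]_n -> R) u0 r C u v : open U -> smooth_on U f ->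
  (forall u, `|u - u0| <= r -> U u) ->
  (forall i j u, `|u - u0| <= r -> `|pd i (pd j f) u| <= C) -> `|u - u0| <= r -> `|v - u0| <= r ->
  `|f v - f u - dpart f u (v - u)| <= n%:R * (n%:R * C) * `|v - u| ^+ 2.
Proof.
move=> oU sf HU HC ur vr.
have [||s s01 E] := @smooth_MVT R n U f u (v - u).
- by [].
- by move=> s s01; apply: HU; exact: seg_ball.
rewrite (addrC u) subrK in E; rewrite E /dpart -sumrB.
rewrite (_ : _ * `|v - u| ^+ 2 = n%:R * (n%:R * C * `|v - u| * `|v - u|)); last by ring.
apply: norm_sum_le => i; rewrite -mulrBr normrM mulrC; apply: ler_pM => //; last exact: row_norm_ge.
have C0 : 0 <= C by apply: le_trans (HC i i u ur).
have sr := seg_ball ur vr s01.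
apply: le_trans (smooth_lip (smooth_pd i sf) HU (fun j => HC j i) ur sr) _.
apply: ler_wpM2l; first by rewrite mulr_ge0.
rewrite addrAC subrr add0r normrZ; case/andP: s01 => s0 s1.
by rewrite ger0_norm // ler_piMl.
Qed.

End compactness.

Section bounds.
Context {R : realType} {n : nat} (M : riemannian_manifold R n).
Implicit Types (p q x : M) (u v e a b : 'rV[R]_n).

(** One ball and one set of constants for all later estimates: [C] bounds the metric, the
    Christoffel symbols, their variation and the second-order remainder of the metric, and [lam] is
    the ellipticity constant. *)
Record bounds p (u0 : 'rV[R]_n) (rho C lam : R) : Prop := Bounds {
  b_rho : 0 < rho ;
  b_C : 1 <= C ;
  b_lam0 : 0 < lam ;
  b_img : forall u, `|u - u0| <= rho -> img p u ;
  b_gf : forall u a b, `|u - u0| <= rho -> `|gf p u a b| <= C * `|a| * `|b| ;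
  b_lam : forall u a, `|u - u0| <= rho -> lam * `|a| ^+ 2 <= gf p u a a ;
  b_Gam : forall u a b, `|u - u0| <= rho -> `|Gam p u a b| <= C * `|a| * `|b| ;
  b_gfL : forall u v a b, `|u - u0| <= rho -> `|v - u0| <= rho ->
    `|gf p v a b - gf p u a b| <= C * `|v - u| * `|a| * `|b| ;
  b_GamL : forall u v a b, `|u - u0| <= rho -> `|v - u0| <= rho ->
    `|Gam p v a b - Gam p u a b| <= C * `|v - u| * `|a| * `|b| ;
  b_gfT : forall u v a b, `|u - u0| <= rho -> `|v - u0| <= rho ->
    `|gf p v a b - gf p u a b - dgf p u (v - u) a b| <= C * `|v - u| ^+ 2 * `|a| * `|b| }.

Lemma gf_lower p u0 : img p u0 ->
  exists2 lam, 0 < lam & forall a, lam * `|a| ^+ 2 <= gf p u0 a a.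
Proof.
move=> pu0.
pose S := [set a : 'rV[R]_n | `|a| = 1].
(* The unit sphere is empty in dimension 0. *)
have [[a0 Sa0]|nS] := pselect (S !=set0); last first.
  exists 1 => // a; have [->|a0] := eqVneq a 0; first by rewrite normr0 expr0n mulr0 /gf bil0l.
  by exfalso; apply: nS; exists (`|a|^-1 *: a); rewrite /S /= normrZ normfV normr_id mulVf // normr_eq0.
have cS : compact S.
  apply: (subclosed_compact _ (@cball_compact R n 0 1)) => [|a]; last by rewrite /S /= subr0 => ->.
  have -> : S = (fun u : 'rV[R]_n => `|u|) @^-1` [set x | x = 1] by [].
  apply: closed_comp; last exact: closed_eq.
  by move=> u _; exact: norm_continuous.
have [C0 HC] : exists C, forall i j, `|metric p u0 i j| <= C.
  exists (\sum_i \sum_j `|metric p u0 i j|) => i j.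
  rewrite (bigD1 i) //= (bigD1 j) //= -addrA lerDl addr_ge0 ?sumr_ge0 // => k _.
  by rewrite sumr_ge0.
have [||c /set_mem cS1 Hc] := EVT_min_rV _ cS (f := fun a => gf p u0 a a).
- by exists a0.
- apply: continuous_in_subspaceT => a _; apply: eps_continuous => e e0.
  pose K := n%:R ^+ 2 * `|C0| * (2 * `|a| + 1) + 1.
  have K0 : 0 < K.
    rewrite /K ltr_pwDr // !mulr_ge0 ?exprn_ge0 // addr_ge0 // mulr_ge0 //.
  exists (Num.min 1 (e / K)) => [|b]; first by rewrite lt_min ltr01 divr_gt0.
  rewrite lt_min => /andP[b1 be].
  have -> : gf p u0 b b - gf p u0 a a = gf p u0 (b - a) b + gf p u0 a (b - a).
    by rewrite /gf !bilE; ring.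
  apply: (le_lt_trans (ler_normD _ _)).
  have HC' i j : `|metric p u0 i j| <= `|C0| by apply: le_trans (HC i j) (ler_norm _).
  have h1 := bil_bound (b - a) b HC'; have h2 := bil_bound a (b - a) HC'.
  apply: (le_lt_trans (lerD h1 h2)).
  have bb : `|b| <= `|a| + 1.
    by rewrite -[b](subrK a) (le_trans (ler_normD _ _)) // addrC lerD2l ltW.
  rewrite ltr_pdivlMr // in be.
  have c0 : 0 <= n%:R ^+ 2 * `|C0| by rewrite mulr_ge0 ?exprn_ge0.
  apply: le_lt_trans be.
  move: c0 bb; rewrite /K; move: (n%:R ^+ 2 * `|C0|) => k k0 bb.
  have := normr_ge0 (b - a); move: `|b - a| => z z0.
  have : k * z * `|b| <= k * z * (`|a| + 1) by rewrite ler_wpM2l // mulr_ge0.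
  nra.
- exists (gf p u0 c c).
    apply: gf_gt0 => //; apply: contraTneq isT => c0.
    by move: cS1; rewrite /S /= c0 normr0 => /eqP; rewrite eq_sym oner_eq0.
  move=> a; have [->|a0'] := eqVneq a 0; first by rewrite normr0 expr0n mulr0 /gf bil0l.
  have na : 0 < `|a| by rewrite normr_gt0.
  have := Hc (`|a|^-1 *: a); rewrite mem_set; last first.
    by rewrite /S /= normrZ normfV normr_id mulVf // normr_eq0.
  move=> /(_ isT); rewrite {2}/gf !bilE -/(gf p u0 a a) => H.
  rewrite -ler_pdivlMr ?exprn_gt0 //; apply: le_trans H _.
  by rewrite expr2 invfM [leRHS]mulrC -mulrA.
Qed.

Lemma bounds_ex p u0 : img p u0 -> exists rho C lam, bounds p u0 rho C lam.
Proof.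
move=> pu0.
have [d d0 Hd] := open_eps (img_open p) pu0.
have r0 : 0 <= d / 2 by rewrite divr_ge0 // ltW.
have HU u : `|u - u0| <= d / 2 -> img p u.
  by move=> H; apply: Hd; apply: le_lt_trans H _; lra.
have [C1 C10 H1] := @smooth_bounded R n ('I_n * 'I_n)%type (img p)
  (fun ij u => metric p u ij.1 ij.2) u0 _ r0 HU (fun ij => @smooth_metric _ _ M p _ _).
have [C2 C20 H2] := @smooth_bounded R n ('I_n * ('I_n * 'I_n))%type (img p)
  (fun kij => pd kij.1 (fun u => metric p u kij.2.1 kij.2.2)) u0 _ r0 HU
  (fun kij => smooth_pd _ (@smooth_metric _ _ M p _ _)).
have [C3 C30 H3] := @smooth_bounded R n (('I_n * 'I_n) * ('I_n * 'I_n))%type (img p)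
  (fun kij => pd kij.1.1 (pd kij.1.2 (fun u => metric p u kij.2.1 kij.2.2))) u0 _ r0 HU
  (fun kij => smooth_pd _ (smooth_pd _ (@smooth_metric _ _ M p _ _))).
have [C4 C40 H4] := @smooth_bounded R n ('I_n * ('I_n * 'I_n))%type (img p)
  (fun kij u => christoffel p u kij.1 kij.2.1 kij.2.2) u0 _ r0 HU
  (fun kij => @smooth_christoffel _ _ M p _ _ _).
have [C5 C50 H5] := @smooth_bounded R n ('I_n * ('I_n * ('I_n * 'I_n)))%type (img p)
  (fun lk => pd lk.1 (fun u => christoffel p u lk.2.1 lk.2.2.1 lk.2.2.2)) u0 _ r0 HU
  (fun lk => smooth_pd _ (@smooth_christoffel _ _ M p _ _ _)).
have [l0 l00 Hl0] := gf_lower pu0.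
pose N : R := n%:R.
have N0 : 0 <= N by [].
have K1 : 0 <= N ^+ 2 * C1 by rewrite !mulr_ge0 ?exprn_ge0.
have K2 : 0 <= N ^+ 2 * (N * C2) by rewrite !mulr_ge0 ?exprn_ge0.
have K3 : 0 <= N ^+ 2 * (N * (N * C3)) by rewrite !mulr_ge0 ?exprn_ge0.
have K4 : 0 <= N ^+ 2 * C4 by rewrite !mulr_ge0 ?exprn_ge0.
have K5 : 0 <= N ^+ 2 * (N * C5) by rewrite !mulr_ge0 ?exprn_ge0.
have [C [C0 c1 c2 c3 [c4 c5]]] : exists C, [/\ 1 <= C, N ^+ 2 * C1 <= C, N ^+ 2 * (N * C2) <= C,
    N ^+ 2 * (N * (N * C3)) <= C & N ^+ 2 * C4 <= C /\ N ^+ 2 * (N * C5) <= C].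
  exists (1 + N ^+ 2 * C1 + N ^+ 2 * (N * C2) + N ^+ 2 * (N * (N * C3)) + N ^+ 2 * C4 + N ^+ 2 * (N * C5)).
  by repeat split; lra_of K1 K2 K3 K4 K5.
have mono (x y : R) : 0 <= y -> x <= C -> x * y <= C * y by move=> *; apply: ler_wpM2r.
have gfL u v a b : `|u - u0| <= d / 2 -> `|v - u0| <= d / 2 ->
    `|gf p v a b - gf p u a b| <= C * `|v - u| * `|a| * `|b|.
  move=> ur vr; rewrite bil_sub.
  apply: le_trans (@bil_bound _ _ _ (N * C2 * `|v - u|) _ _ _) _.
    move=> i j; apply: (smooth_lip (@smooth_metric _ _ M p i j) HU) => // k w wr.
    exact: (H2 (k, (i, j))).
  do 2 (apply: ler_wpM2r => //); rewrite !mulrA -!mulrA mulrCA !mulrA; apply: mono => //.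
  by move: c2; rewrite !mulrA.
(* On this ball the metric moves by at most [l0 / 2], so half of the ellipticity constant at [u0]
   survives. *)
pose rho := Num.min (d / 2) (l0 / 2 / C).
have rd u : `|u - u0| <= rho -> `|u - u0| <= d / 2 by rewrite /rho le_min => /andP[].
exists rho, C, (l0 / 2); split => //.
- by rewrite /rho lt_min !divr_gt0 //; lra_of C0.
- lra_of l00.
- by move=> u /rd; exact: HU.
- move=> u a b /rd ur; apply: le_trans (@bil_bound _ _ _ C1 _ _ _) _.
    by move=> i j; exact: (H1 (i, j)).
  by do 2 (apply: ler_wpM2r => //); rewrite -/N.
- move=> u a ur; have := gfL u0 u a a; rewrite subrr normr0 => /(_ r0 (rd _ ur)).
  have := Hl0 a; have : C * `|u - u0| <= l0 / 2.
    have Cp : 0 < C by lra_of C0.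
    by move: ur; rewrite /rho le_min => /andP[_]; rewrite ler_pdivlMr // mulrC.
  move=> h1 h2; rewrite ler_norml => /andP[h3 _].
  have : C * `|u - u0| * `|a| * `|a| <= l0 / 2 * `|a| * `|a| by do 2 (apply: ler_wpM2r => //).
  by rewrite expr2 in h2 *; lra_of h3 h2.
- move=> u a b /rd ur; apply: row_norm_le; first by rewrite !mulr_ge0 //; lra_of C0.
  move=> k; rewrite mxE; apply: le_trans (@bil_bound _ _ _ C4 _ _ _) _.
    by move=> i j; exact: (H4 (k, (i, j))).
  by do 2 (apply: ler_wpM2r => //); rewrite -/N.
- by move=> u v a b /rd ur /rd vr; exact: gfL.
- move=> u v a b /rd ur /rd vr; apply: row_norm_le; first by rewrite !mulr_ge0 //; lra_of C0.
  move=> k; rewrite !mxE bil_sub.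
  apply: le_trans (@bil_bound _ _ _ (N * C5 * `|v - u|) _ _ _) _.
    move=> i j; apply: (smooth_lip (@smooth_christoffel _ _ M p k i j) HU) => // l w wr.
    exact: (H5 (l, (k, (i, j)))).
  do 2 (apply: ler_wpM2r => //); rewrite !mulrA -!mulrA mulrCA !mulrA; apply: mono => //.
  by move: c5; rewrite !mulrA.
- move=> u v a b /rd ur /rd vr; rewrite /dgf /gf !bil_sub.
  apply: le_trans (@bil_bound _ _ _ (N * (N * C3) * `|v - u| ^+ 2) _ _ _) _.
    move=> i j; apply: (smooth_taylor (img_open p) (@smooth_metric _ _ M p i j) HU) => // k l w wr.
    exact: (H3 ((k, l), (i, j))).
  do 2 (apply: ler_wpM2r => //); rewrite !mulrA; do 2 (apply: ler_wpM2r => //).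
  by move: c3; rewrite !mulrA.
Qed.

End bounds.

Section continuity_rules.
Context {R : realType} {T : topologicalType} {V : normedModType R}.
Implicit Types (f g : T -> V) (t : T).

Lemma contD f g t : {for t, continuous f} -> {for t, continuous g} ->
  {for t, continuous (fun s => f s + g s)}.
Proof. exact: continuousD. Qed.

Lemma contB f g t : {for t, continuous f} -> {for t, continuous g} ->
  {for t, continuous (fun s => f s - g s)}.
Proof. exact: continuousB. Qed.

Lemma contN f t : {for t, continuous f} -> {for t, continuous (fun s => - f s)}.
Proof. exact: continuousN. Qed.

Lemma contC (c : V) t : {for t, continuous (fun _ : T => c)}.
Proof. exact: cst_continuous. Qed.

End continuity_rules.
Arguments contC {R T V} c t.
Arguments contD {R T V f g t} _ _.
Arguments contB {R T V f g t} _ _.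
Arguments contN {R T V f t} _.

(** * The two-point boundary value problem for short geodesics *)

Section boundary_value.
Context {R : realType} {n : nat} (M : riemannian_manifold R n).
Implicit Types (p q x : M) (e a b : 'rV[R]_n) (D : R).

Lemma GamDl p u a a' b : Gam p u (a + a') b = Gam p u a b + Gam p u a' b.
Proof. by apply/rowP => k; rewrite !mxE bilDl. Qed.
Lemma GamDr p u a b b' : Gam p u a (b + b') = Gam p u a b + Gam p u a b'.
Proof. by apply/rowP => k; rewrite !mxE bilDr. Qed.
Lemma GamNl p u a b : Gam p u (- a) b = - Gam p u a b.
Proof. by apply/rowP => k; rewrite !mxE bilNl. Qed.
Lemma GamNr p u a b : Gam p u a (- b) = - Gam p u a b.
Proof. by apply/rowP => k; rewrite !mxE bilNr. Qed.
Lemma GamZl p u k a b : Gam p u (k *: a) b = k *: Gam p u a b.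
Proof. by apply/rowP => i; rewrite !mxE bilZl. Qed.
Lemma GamZr p u k a b : Gam p u a (k *: b) = k *: Gam p u a b.
Proof. by apply/rowP => i; rewrite !mxE bilZr. Qed.

(** Time is truncated to [-1, 2]: the integral operators then act on functions of the whole line,
    and their fixed points are genuine solutions on (-1, 2). *)
Definition clamp (t : R) : R := if t < -1 then -1 else if t < 2 then t else 2.

Lemma clamp_itv t : -1 <= clamp t <= 2.
Proof. by rewrite /clamp; case: ltrP => h1; [|case: ltrP => h2]; lra. Qed.

Lemma clamp_id t : -1 <= t <= 2 -> clamp t = t.
Proof. by rewrite /clamp => /andP[h1 h2]; case: ltrP => h3; [|case: ltrP => h4]; lra. Qed.

Lemma clamp_continuous : continuous clamp.
Proof.
move=> t; apply: eps_continuous => e e0; exists e => // s; apply: le_lt_trans.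
suff : clamp s - clamp t <= `|s - t| /\ clamp t - clamp s <= `|s - t|.
  by move=> [h1 h2]; rewrite ler_norml; apply/andP; split; lra.
have h := ler_norm (s - t); have := ler_norm (t - s); rewrite distrC => h'.
rewrite /clamp; case: ltrP => h1; case: ltrP => h2; try case: ltrP => h3; try case: ltrP => h4;
  split; lra.
Qed.

Section fixed_ball.
Variables (p : M) (u0 : 'rV[R]_n) (rho C lam : R).
Hypothesis B : bounds p u0 rho C lam.

Let C0 : 0 <= C. Proof. by apply: le_trans (b_C B). Qed.

Lemma Gam_diff D u w a b : `|u - u0| <= rho -> `|w - u0| <= rho -> `|a| <= D -> `|b| <= D ->
  `|Gam p u a a - Gam p w b b| <= C * D ^+ 2 * `|u - w| + 2 * C * D * `|a - b|.
Proof.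
move=> ur wr aD bD.
have -> : Gam p u a a - Gam p w b b = (Gam p u a a - Gam p w a a)
    + (Gam p w (a - b) a + Gam p w b (a - b)).
  by rewrite !(GamDl, GamDr, GamNl, GamNr); apply/rowP => k; rewrite !mxE; ring.
rewrite (le_trans (ler_normD _ _)) // lerD //.
  apply: le_trans (b_GamL B a a wr ur) _.
  rewrite (_ : C * D ^+ 2 * `|u - w| = C * `|u - w| * D * D); last by ring.
  by apply: ler_pM => //; [rewrite !mulr_ge0|apply: ler_pM => //; rewrite mulr_ge0].
rewrite (le_trans (ler_normD _ _)) //.
have h1 := b_Gam B (a - b) a wr; have h2 := b_Gam B b (a - b) wr.
apply: le_trans (lerD h1 h2) _.
have h3 : C * `|a - b| * `|a| <= C * `|a - b| * D by rewrite ler_wpM2l // mulr_ge0.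
have h4 : C * `|b| * `|a - b| <= C * D * `|a - b| by rewrite ler_wpM2r // ler_wpM2l.
lra.
Qed.

Lemma Gam_bound D u a : `|u - u0| <= rho -> `|a| <= D -> `|Gam p u a a| <= C * D ^+ 2.
Proof.
move=> ur aD; apply: le_trans (b_Gam B a a ur) _.
by rewrite expr2 mulrA; apply: ler_pM => //; [rewrite mulr_ge0|rewrite ler_wpM2l].
Qed.

Lemma Gam_continuous D (f g : R -> 'rV[R]_n) : 0 <= D -> continuous f -> continuous g ->
  (forall t, `|f t - u0| <= rho) -> (forall t, `|g t| <= D) ->
  continuous (fun t => Gam p (f t) (g t) (g t)).
Proof.
move=> D0 cf cg fr gD t; apply: eps_continuous => e e0.
pose K := C * D ^+ 2 + 2 * C * D + 1.
have k1 : 0 <= C * D ^+ 2 by rewrite mulr_ge0 // exprn_ge0.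
have k2 : 0 <= 2 * C * D by rewrite !mulr_ge0.
have [d1 d10 H1] := continuous_eps (cf t) (divr_gt0 e0 (ltac:(by rewrite /K; lra) : 0 < K)).
have [d2 d20 H2] := continuous_eps (cg t) (divr_gt0 e0 (ltac:(by rewrite /K; lra) : 0 < K)).
exists (Num.min d1 d2) => [|s]; first by rewrite lt_min d10.
rewrite lt_min => /andP[/H1 h1 /H2 h2].
apply: le_lt_trans (Gam_diff (fr s) (fr t) (gD s) (gD t)) _.
have K0 : 0 < K by rewrite /K; lra.
have eK : e = (C * D ^+ 2) * (e / K) + 2 * C * D * (e / K) + e / K.
  by rewrite -[X in _ = _ + X]mul1r -!mulrDl -/K mulrC divfK // gt_eqF.
have h3 : C * D ^+ 2 * `|f s - f t| <= C * D ^+ 2 * (e / K) by apply: ler_wpM2l => //; exact: ltW.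
have h4 : 2 * C * D * `|g s - g t| <= 2 * C * D * (e / K) by apply: ler_wpM2l => //; exact: ltW.
have : 0 < e / K by rewrite divr_gt0.
move: h3 h4 eK; move: (e / K) (C * D ^+ 2 * `|f s - f t|) (2 * C * D * `|g s - g t|) => *; lra.
Qed.

(** A first-order system on (-1, 2) rather than on [0, 1], because [geodesic] asks for the equation
    around both endpoints. *)
Definition gsol D (u v : R -> 'rV[R]_n) : Prop := forall t, -1 < t < 2 ->
  [/\ der u t (v t), der v t (- Gam p (u t) (v t) (v t)), `|v t| <= D & `|u t - u0| <= rho].

(** The unknown of the contraction is the velocity, and the position is recovered by integration
    from [a]. The acceleration is at most [C D^2 <= D / 24], so the velocity stays within
    [D / 2 + 4 D / 24] and the bound [D] is preserved. *)
Lemma gsol_ex D a b : 0 <= D -> D <= 1 -> 48 * C * D <= 1 -> 4 * D <= rho ->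
  `|a - u0| <= rho / 2 -> `|b - a| <= D / 2 ->
  exists u v : R -> _, [/\ gsol D u v, u 0 = a & u 1 = b].
Proof.
move=> D0 D1 CD Dr ar ab.
have CDD2 : C * D ^+ 2 <= D / 48 by rewrite expr2; nra.
have CDD : C * D ^+ 2 <= D / 24 by lra.
pose U (v : R -> 'rV[R]_n) t := a + prim v (clamp t).
pose F v t := - Gam p (U v t) (v (clamp t)) (v (clamp t)).
pose P v t := prim (F v) (clamp t).
(* The mean over [0, 1] of the new velocity is [b - a], which forces [u 1 = b] at a fixed point. *)
pose Phi v t := (b - a) + P v t - prim (P v) 1.
have cl3 t : -3 < clamp t by have := clamp_itv t; lra.
have clc (f : R -> 'rV[R]_n) t : {for clamp t, continuous f} -> {for t, continuous (f \o clamp)}.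
  by move=> cf; apply: continuous_comp => //; exact: clamp_continuous.
have rng (s t : R) : -1 <= t <= 2 -> (0 <= s <= t) || (t <= s <= 0) -> -1 <= s <= 2 by lra.
have cprim (f : R -> 'rV[R]_n) : continuous f -> continuous (fun t => prim f (clamp t)).
  by move=> cf t; apply: (clc (prim f)); apply: der_continuous (der_prim cf (cl3 t)).
have prim_le (f : R -> 'rV[R]_n) K t : continuous f -> (forall s, `|f s| <= K) -> -1 <= t <= 2 ->
    `|prim f t| <= 2 * K.
  move=> cf fK t2; have K0 : 0 <= K by apply: le_trans (fK 0).
  have h : `|prim f t - prim f 0| <= K * `|t - 0|.
    by apply: (der_bound (F' := f)) => // s /(rng _ _ t2) s2; apply: der_prim => //; lra_of s2.
  rewrite prim0 // !subr0 in h; apply: le_trans h _; rewrite mulrC ler_wpM2r //.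
  by rewrite ler_norml; lra.
have prim_le1 (f : R -> 'rV[R]_n) K : continuous f -> (forall s, `|f s| <= K) -> `|prim f 1| <= K.
  move=> cf fK; have K0 : 0 <= K by apply: le_trans (fK 0).
  have h : `|prim f 1 - prim f 0| <= K * `|1 - 0|.
    by apply: (der_bound (F' := f)) => // s s2; apply: der_prim => //; lra.
  by rewrite prim0 // !subr0 normr1 mulr1 in h.
have primB (f g : R -> 'rV[R]_n) t : continuous f -> continuous g -> -1 <= t <= 2 ->
    prim (fun s => f s - g s) t = prim f t - prim g t.
  move=> cf cg t2; have cfg : continuous (fun s => f s - g s).
    by move=> s; exact: (contB (cf s) (cg s)).
  have h : `|(prim (fun s => f s - g s) t - (prim f t - prim g t))
       - (prim (fun s => f s - g s) 0 - (prim f 0 - prim g 0))| <= 0 * `|t - 0|.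
    apply: (@der_bound _ _ (fun t => prim (fun s => f s - g s) t - (prim f t - prim g t)) (fun _ => 0)) => // s; last by rewrite normr0.
    move=> /(rng _ _ t2) s2; apply: der_eq; last exact: (subrr (f s - g s)).
    by apply: derB; [|apply: derB]; apply: der_prim => //; lra_of s2.
  move: h; rewrite !prim0 // !subrr subr0 mul0r normr_le0 subr_eq0 => /eqP; exact.
have Ur v t : continuous v -> (forall s, `|v s| <= D) -> `|U v t - u0| <= rho.
  move=> cv vD; rewrite /U addrAC (le_trans (ler_normD _ _)) //.
  by have := prim_le v D _ cv vD (clamp_itv t); lra.
have UC v : continuous v -> continuous (U v).
  by move=> cv t; exact: (contD (contC a t) (cprim v cv t)).
have FC v : continuous v -> (forall s, `|v s| <= D) -> continuous (F v).
  move=> cv vD t; apply: (contN (f := fun t => Gam p (U v t) (v (clamp t)) (v (clamp t)))).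
  apply: (@Gam_continuous D (U v) (fun t => v (clamp t))) => //; [exact: UC|by move=> s; exact: clc (cv _)|by move=> s; exact: Ur].
have FD v t : (forall s, `|v s| <= D) -> continuous v -> `|F v t| <= D / 24.
  by move=> vD cv; rewrite normrN; apply: le_trans CDD; apply: Gam_bound => //; exact: Ur.
have PC v : continuous v -> (forall s, `|v s| <= D) -> continuous (P v).
  by move=> cv vD; rewrite /P; apply: cprim; exact: FC.
have [||v w m cv vD cw wD m0 vw t|v [cv vD Hv]] := @contraction_fixpoint R n Phi D.
- by [].
- move=> v cv vD; rewrite /Phi; split=> t.
    exact: (contB (contD (contC (b - a) t) (PC v cv vD t)) (contC (prim (P v) 1) t)).
  have h1 : `|P v t| <= 2 * (D / 24).
    by apply: prim_le; [exact: FC|move=> s; exact: FD|exact: clamp_itv].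
  have h2 : `|prim (P v) 1| <= 2 * (D / 24).
    apply: prim_le1; first exact: PC.
    by move=> s; apply: prim_le; [exact: FC|move=> r; exact: FD|exact: clamp_itv].
  rewrite /Phi (le_trans (ler_normB _ _)) //.
  by have := ler_normD (b - a) (P v t); lra_of D0 ab h1 h2.
(* After integration over times of modulus at most 2, [P] and its integral over [0, 1] each
   contribute [2 m / 8], which makes the factor 1/2 of the contraction. *)
- have Fvw s : `|F v s - F w s| <= m / 8.
    rewrite /F opprK addrC distrC.
    apply: le_trans (Gam_diff (Ur _ s cv vD) (Ur _ s cw wD) (vD _) (wD _)) _.
    have h : `|U v s - U w s| <= 2 * m.
      rewrite /U opprD addrACA subrr add0r -primB //; last exact: clamp_itv.
      apply: prim_le => //; last exact: clamp_itv.
      by move=> r; exact: (contB (cv r) (cw r)).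
    have h2 := vw (clamp s).
    have CDD0 : 0 <= C * D ^+ 2 by rewrite mulr_ge0 // exprn_ge0.
    have h3 : C * D ^+ 2 * `|U v s - U w s| <= D / 48 * (2 * m) by apply: ler_pM.
    have h5 : C * D * m <= m / 48 by rewrite [leRHS]mulrC; apply: ler_wpM2r => //; lra_of CD.
    have h6 : D * m <= m by rewrite ler_piMl.
    have h4 : 2 * C * D * `|v (clamp s) - w (clamp s)| <= 2 * C * D * m.
      by apply: ler_wpM2l => //; rewrite !mulr_ge0.
    apply: le_trans (lerD h3 h4) _; lra_of m0 h5 h6.
  have cFvw : continuous (fun s => F v s - F w s).
    by move=> s; exact: (contB (FC v cv vD s) (FC w cw wD s)).
  have Pvw s : `|P v s - P w s| <= 2 * (m / 8).
    rewrite -primB; [|exact: FC|exact: FC|exact: clamp_itv].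
    by apply: prim_le => //; exact: clamp_itv.
  have cPvw : continuous (fun s => P v s - P w s).
    by move=> s; exact: (contB (PC v cv vD s) (PC w cw wD s)).
  have Qvw : `|prim (P v) 1 - prim (P w) 1| <= 2 * (m / 8).
    rewrite -primB; [|exact: PC|exact: PC|lra_of isT].
    exact: prim_le1.
  have -> : Phi v t - Phi w t = (P v t - P w t) - (prim (P v) 1 - prim (P w) 1).
    by apply/rowP => i; rewrite !mxE; ring.
  by rewrite (le_trans (ler_normB _ _)) //; have := Pvw t; lra_of Qvw.
have cFv := FC v cv vD; have cPv := PC v cv vD.
exists (U v), v; have Ud t : -1 < t < 2 -> der (U v) t (v t).
  move=> t2; apply: (@near_eq_der _ _ (fun s => a + prim v s)).
    apply/near_eps; exists (Num.min (t + 1) (2 - t)); first by rewrite lt_min; lra.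
    move=> s; rewrite lt_min !ltr_norml /U => s2; rewrite clamp_id //; lra_of s2.
  by apply: der_eq; [apply: derD; [exact: der_cst|apply: der_prim => //; lra_of t2]|rewrite add0r].
have Vd t : -1 < t < 2 -> der v t (F v t).
  move=> t2; apply: (@near_eq_der _ _ (fun s => (b - a) + prim (F v) s - prim (P v) 1)).
    apply/near_eps; exists (Num.min (t + 1) (2 - t)); first by rewrite lt_min; lra.
    move=> s; rewrite lt_min !ltr_norml => s2; rewrite -Hv /Phi /P clamp_id //; lra_of s2.
  apply: der_eq; first (apply: derB; last exact: der_cst).
    by apply: derD; [exact: der_cst|apply: der_prim => //; lra_of t2].
  by rewrite add0r subr0.
split.
- move=> t t2; split; [exact: Ud| |exact: vD|exact: Ur].
  have := Vd t t2; rewrite /F clamp_id //; lra_of t2.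
- by rewrite /U clamp_id ?prim0 ?addr0 //; lra_of isT.
(* Position and the explicit primitive of its velocity differ by a constant, namely [a]; at time 1
   the two correction terms cancel and leave [b - a]. *)
- have h : `|(U v 1 - (1 *: (b - a) + prim (P v) 1 - 1 *: prim (P v) 1))
     - (U v 0 - (0 *: (b - a) + prim (P v) 0 - 0 *: prim (P v) 1))| <= 0 * `|1 - 0 : R|.
    apply: (der_bound (F := fun s => U v s - (s *: (b - a) + prim (P v) s - s *: prim (P v) 1))
      (F' := fun _ => 0)) => // s; last by rewrite normr0.
    move=> s2; apply: der_eq.
      apply: derB; first by apply: Ud; lra_of s2.
      apply: derB; last by ider.
      apply: derD; first by ider.
      by apply: der_prim => //; lra_of s2.
    rewrite !scale1r !scaler0 !addr0 -Hv /Phi subrr //.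
  move: h; rewrite !(scale1r, scale0r, subr0, add0r, prim0 cPv, addrK, mul0r) normr_le0.
  have -> : U v 0 = a by rewrite /U clamp_id ?prim0 ?addr0 //; lra_of isT.
  rewrite subr_eq0 => /eqP h; rewrite -[LHS](subrK (b - a)) h.
  by rewrite (addrC a) subrK.
Qed.

End fixed_ball.
End boundary_value.

Section monotone.
Context {R : realType}.

Lemma eq_cont {T U : topologicalType} (f g : T -> U) t : f =1 g ->
  {for t, continuous f} -> {for t, continuous g}.
Proof. by move=> /funext ->. Qed.

Lemma contM {T : topologicalType} (f g : T -> R) t : {for t, continuous f} ->
  {for t, continuous g} -> {for t, continuous (fun s => f s * g s)}.
Proof. exact: continuousM. Qed.

Lemma cont_sum {T : topologicalType} (I : Type) (r : seq I) (f : I -> T -> R) t :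
  (forall i, {for t, continuous (f i)}) ->
  {for t, continuous (fun s => \sum_(i <- r) f i s)}.
Proof.
move=> cf; elim: r => [|i r IH].
  by apply: eq_cont (contC 0 t) => s; rewrite big_nil.
by apply: eq_cont (contD (cf i) IH) => s; rewrite big_cons.
Qed.

Lemma cont_coord {T : topologicalType} {n} (f : T -> 'rV[R]_n) t i :
  {for t, continuous f} -> {for t, continuous (fun s => f s 0 i)}.
Proof.
move=> cf; apply: (continuous_comp (f := f) (g := fun A : 'rV[R]_n => A 0 i)) => //.
exact: coord_continuous.
Qed.

Lemma der_mono (F F' : R -> R) (a b : R) : a <= b ->
  (forall t, a <= t <= b -> {for t, continuous F}) ->
  (forall t, a < t < b -> der F t (F' t) /\ 0 <= F' t) -> F a <= F b.
Proof.
rewrite le_eqVlt => /predU1P[->//|ab] cF dF.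
have [t|t|t tab E] := @MVT R F F' a b ab.
- by rewrite in_itv /= => /dF[].
- by apply: continuous_in_subspaceT; move: t => _ t; rewrite inE /= in_itv /= => /cF.
rewrite -subr_ge0 E mulr_ge0 ?subr_ge0 ?(ltW ab) //; apply: (dF t _).2.
by move: tab; rewrite in_itv.
Qed.

(** The exceptional time [th] is meant for the corner of a curve made of two pieces. *)
Lemma der_mono_except (F F' : R -> R) (a b th : R) : a <= b ->
  (forall t, a <= t <= b -> {for t, continuous F}) ->
  (forall t, a < t < b -> t != th -> der F t (F' t) /\ 0 <= F' t) -> F a <= F b.
Proof.
move=> ab cF dF; case: (boolP (a < th < b)) => [/andP[ath thb]|nth].
  apply: (@le_trans _ _ (F th)); apply: (@der_mono _ F').
  - exact: ltW.
  - by move=> t tab; apply: cF; lra.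
  - by move=> t tab; apply: dF; [lra|rewrite lt_eqF //; lra].
  - exact: ltW.
  - by move=> t tab; apply: cF; lra.
  - by move=> t tab; apply: dF; [lra|rewrite gt_eqF //; lra].
apply: (@der_mono _ F') => // t tab; apply: dF => //.
by apply: contraNneq nth => <-.
Qed.

End monotone.

(** * Local minimality by calibration *)

Section minimality.
Context {R : realType} {n : nat} (M : riemannian_manifold R n).
Implicit Types (p q x : M) (e a b : 'rV[R]_n) (D : R).

(** The maximum norm is not differentiable, so the calibration uses the Euclidean product of
    coordinates. *)
Definition dot a b : R := \sum_i a 0 i * b 0 i.

Lemma der_dot (f g : R -> 'rV[R]_n) (t : R) f' g' : der f t f' -> der g t g' ->
  der (fun s => dot (f s) (g s)) t (dot f' (g t) + dot (f t) g').
Proof.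
move=> /der_rVP df /der_rVP dg; rewrite /dot -big_split /=; apply: der_sum => i _.
by apply: derM.
Qed.

Lemma dot_ge a : `|a| ^+ 2 <= dot a a.
Proof.
have d0 : 0 <= dot a a by apply: sumr_ge0 => i _; rewrite -expr2 sqr_ge0.
have [[i Hi]|H] := pselect (exists i, `|a| <= `|a 0 i|).
  apply: (@le_trans _ _ (`|a 0 i| ^+ 2)).
    by rewrite ler_sqr ?nnegrE.
  by rewrite real_normK ?num_real // /dot (bigD1 i) //= expr2 lerDl; apply: sumr_ge0 => j _; rewrite -expr2 sqr_ge0.
suff -> : a = 0 by rewrite normr0 expr0n /= sumr_ge0 // => i _; rewrite -expr2 sqr_ge0.
apply/eqP; rewrite -normr_le0 leNgt; apply/negP => a0.
have [e e0 He] : exists2 e, e < `|a| & forall i, `|a 0 i| <= e.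
  exists (\big[Num.max/0]_i `|a 0 i|); last by move=> i; exact: (le_bigmax 0 (fun i => `|a 0 i|)).
  apply/bigmax_ltP; split=> // i _; rewrite ltNge; apply/negP => Hi; apply: H; by exists i.
have e1 : 0 <= Num.max 0 e by rewrite le_max lexx.
have : `|a| <= Num.max 0 e by apply: row_norm_le => // i; rewrite le_max He orbT.
by rewrite leNgt gt_max a0 e0.
Qed.

Lemma dot_le a b : `|dot a b| <= n%:R * (`|a| * `|b|).
Proof.
by apply: norm_sum_le => i; rewrite normrM; apply: ler_pM; rewrite ?row_norm_ge.
Qed.

Section fixed_ball.
Variables (p : M) (u0 : 'rV[R]_n) (rho C lam D : R).
Hypothesis B : bounds p u0 rho C lam.
Hypothesis D0 : 0 <= D.
Hypothesis D1 : D <= 1.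
Hypothesis CD : 48 * C * D <= 1.
Hypothesis Dlam : (C + n%:R) ^+ 2 * D <= lam.

Local Notation gsol := (gsol p u0 rho D).
Let C0 : 0 <= C. Proof. by apply: le_trans (b_C B). Qed.

Let CDD : C * D ^+ 2 <= D / 48.
Proof.
rewrite expr2 mulrA [leRHS]mulrC; apply: (ler_wpM2r D0).
by move: CD; rewrite -mulrA; move: (C * D) => x; lra.
Qed.

(** Lipschitz dependence on the endpoints. The maximum [m] of the difference of velocities is
    bounded by the displacement of the ends plus [K], the variation of that difference; [K] is a
    small multiple of [m] and of the displacement, so it can be absorbed. *)
Lemma gsol_lip (u v w z : R -> 'rV[R]_n) : gsol u v -> gsol w z ->
  forall t, 0 <= t <= 1 ->
    `|v t - z t| <= 4 * (`|u 0 - w 0| + `|u 1 - w 1|) /\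
    `|u t - w t| <= 5 * (`|u 0 - w 0| + `|u 1 - w 1|).
Proof.
move=> uv wz.
have cvz t : 0 <= t <= 1 -> {for t, continuous (fun t => v t - z t)}.
  move=> t1; have [|_ dv _ _] := uv t; first lra.
  have [|_ dz _ _] := wz t; first lra.
  exact: (contB (der_continuous dv) (der_continuous dz)).
have [||ts ts1 Hts] := @EVT_max R (fun t => `|v t - z t|) 0 1.
- by [].
- apply: continuous_in_subspaceT => t; rewrite inE /= in_itv /= => t1.
  by apply: (continuous_comp (cvz t t1)); exact: norm_continuous.
rewrite in_itv /= in ts1.
have {}Hts t : 0 <= t <= 1 -> `|v t - z t| <= `|v ts - z ts|.
  by move=> t1; apply: Hts; rewrite in_itv.
move: Hts; set m := `|v ts - z ts| => Hm.
have m0 : 0 <= m by exact: normr_ge0.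
set E0 := `|u 0 - w 0|; set E1 := `|u 1 - w 1|.
have duw t : 0 <= t <= 1 -> der (fun t => u t - w t) t (v t - z t).
  move=> t1; have [|du _ _ _] := uv t; first lra.
  have [|dw _ _ _] := wz t; first lra.
  exact: derB.
have H1 t : 0 <= t <= 1 -> `|u t - w t| <= E0 + m.
  move=> t1; have h : `|(u t - w t) - (u 0 - w 0)| <= m * `|t - 0|.
    apply: (@der_bound _ _ (fun t => u t - w t) (fun t => v t - z t)) => // s st.
      by apply: duw; lra.
    by apply: Hm; lra.
  have t11 : `|t - 0| <= 1 by rewrite ler_norml; lra.
  rewrite -[u t - w t](subrK (u 0 - w 0)) (le_trans (ler_normD _ _)) // -/E0.
  by move: t11 (normr_ge0 (t - 0)) h; move: `|t - 0| => T; nra.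
have d0 := D0; have d1 := D1; have cd := CD.
have CDD' : C * D ^+ 2 <= 1 / 48 by have := CDD; lra.
pose K := (E0 + m) / 48 + m / 24.
have HK t : 0 <= t <= 1 ->
    `|- Gam p (u t) (v t) (v t) - - Gam p (w t) (z t) (z t)| <= K.
  move=> t1; have [|_ _ vD ur] := uv t; first lra.
  have [|_ _ zD wr] := wz t; first lra.
  rewrite opprK addrC distrC; apply: le_trans (Gam_diff B ur wr vD zD) _; rewrite /K.
  have h3 : C * D ^+ 2 * `|u t - w t| <= 1 / 48 * (E0 + m).
    by apply: ler_pM => //; [rewrite mulr_ge0 // exprn_ge0|exact: H1].
  have h4 : 2 * C * D * `|v t - z t| <= 1 / 24 * m.
    by apply: ler_pM => //; [rewrite !mulr_ge0|lra|exact: Hm].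
  by apply: le_trans (lerD h3 h4) _; lra.
have E00 : 0 <= E0 by exact: normr_ge0.
have K0 : 0 <= K by rewrite /K; lra.
have Hz s t : 0 <= s <= 1 -> 0 <= t <= 1 -> `|(v t - z t) - (v s - z s)| <= K.
  move=> s1 t1; apply: (@le_trans _ _ (K * `|t - s|)).
    apply: (@der_bound _ _ (fun t => v t - z t)
      (fun t => - Gam p (u t) (v t) (v t) - - Gam p (w t) (z t) (z t))) => // r rst.
      have [|_ dv _ _] := uv r; first lra_of s1 t1 rst.
      have [|_ dz _ _] := wz r; first lra_of s1 t1 rst.
      exact: derB.
    by apply: HK; lra_of s1 t1 rst.
  by rewrite ler_piMr // ler_norml; lra_of s1 t1.
(* [u - w] is compared with the uniform motion whose velocity is the extremal one; the two
   velocities differ by at most [K]. *)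
have H2 : `|(u 1 - w 1 - 1 *: (v ts - z ts)) - (u 0 - w 0 - 0 *: (v ts - z ts))| <= K * `|1 - 0 : R|.
  apply: (@der_bound _ _ (fun t => u t - w t - t *: (v ts - z ts))
    (fun t => (v t - z t) - (v ts - z ts))) => // s s1; last by apply: Hz => //; lra_of s1.
  apply: der_eq; first (apply: derB; first by apply: duw; lra).
    by apply: derZ; [exact: der_id|exact: der_cst].
  by rewrite scale1r scaler0 addr0.
have mE : m <= E1 + E0 + K.
  move: H2; rewrite scale1r scale0r !subr0 normr1 mulr1 => H2.
  have -> : m = `|(u 1 - w 1) - (u 0 - w 0) - (u 1 - w 1 - (v ts - z ts) - (u 0 - w 0))|.
    by rewrite /m; congr (`|_|); apply/rowP => i; rewrite !mxE; ring.
  rewrite (le_trans (ler_normB _ _)) // lerD //.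
  by rewrite (le_trans (ler_normB _ _)).
have mE' : m <= 4 * (E0 + E1).
  have : 0 <= E1 by exact: normr_ge0.
  by rewrite /K in mE; lra.
move=> t t1; split; first by apply: le_trans (Hm t t1) _.
have := H1 t t1; have : 0 <= E1 by exact: normr_ge0.
lra_of mE'.
Qed.

Lemma gsol_energy (u v : R -> 'rV[R]_n) : gsol u v -> forall t, 0 <= t <= 1 ->
  gf p (u t) (v t) (v t) = gf p (u 0) (v 0) (v 0).
Proof.
move=> uv t t1.
have d0 s : 0 <= s <= t -> der (fun s => gf p (u s) (v s) (v s)) s 0.
  move=> st; have [|du dv _ ur] := uv s; first lra.
  have pu := b_img B ur.
  apply: der_eq; first exact: (der_gf pu du dv dv).
  by rewrite compat // /gf !bilE; ring.
have t0 : 0 <= t by lra.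
have [s _ E] := @MVT_everywhere R _ (fun _ => 0) 0 t t0 d0.
by move: E; rewrite mul0r => /eqP; rewrite subr_eq0 => /eqP.
Qed.

(** Pointwise form of the calibration, with [w = c - u]: the terms of first order cancel by metric
    compatibility, the term [D dot w w] pays for the second-order error in position, and ellipticity
    pays for the mixed terms. *)
Lemma energy_pointwise u c a z : `|u - u0| <= rho -> `|c - u0| <= rho -> `|a| <= D ->
  forall m, `|m| <= D / 2 ->
  lam / 8 * `|z| ^+ 2 <= 2^-1 * gf p c (a + z) (a + z) - 2^-1 * gf p u a a
    - (gf p u a (Gam p u a (c - u)) + gf p u a z)
    - (- D * dot (c - u) (c - u) + m * (dot z (c - u) + dot (c - u) z)).
Proof.
have d0 := D0; have d1 := D1; have cd := CD; have cdd := CDD.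
move=> ur cr aD m mD; have pu := b_img B ur; have pc := b_img B cr.
set w := c - u.
have dC : dot z w = dot w z by apply: eq_bigr => i _; rewrite mulrC.
have T1 := b_gfT B a a ur cr; rewrite -/w compat // (gfC (Gam p u w a)) // GamC // in T1.
have T2 := b_gfL B a z ur cr; rewrite -/w in T2.
have T3 := b_lam B z cr.
have T4 := dot_le w z; have T5 := dot_ge w.
have E1 : gf p c (a + z) (a + z) = gf p c a a + 2 * gf p c a z + gf p c z z.
  have : gf p c z a = gf p c a z by rewrite gfC.
  by rewrite /gf !bilE => ->; ring.
rewrite E1 dC.
move: T1; rewrite ler_norml => /andP[T1 _]; move: T2; rewrite ler_norml => /andP[T2 _].
have w0 := normr_ge0 w; have z0 := normr_ge0 z; have a0 := normr_ge0 a.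
have S1 : C * `|w| ^+ 2 * `|a| * `|a| <= C * D ^+ 2 * `|w| ^+ 2.
  rewrite (_ : C * D ^+ 2 * `|w| ^+ 2 = C * `|w| ^+ 2 * D * D); last by ring.
  by apply: ler_pM => //; [rewrite !mulr_ge0|apply: ler_pM => //; rewrite mulr_ge0 // exprn_ge0].
have S2 : C * `|w| * `|a| * `|z| <= C * D * (`|w| * `|z|).
  rewrite (_ : C * D * (`|w| * `|z|) = C * `|w| * D * `|z|); last by ring.
  by apply: ler_wpM2r => //; apply: ler_wpM2l => //; rewrite mulr_ge0.
have S3 : m * (2 * dot w z) <= D * (n%:R * (`|w| * `|z|)).
  apply: le_trans (ler_norm _) _; rewrite !normrM (ger0_norm (ltac:(lra_of isT) : 0 <= 2 :> R)).
  apply: (@le_trans _ _ (D / 2 * (2 * (n%:R * (`|w| * `|z|))))); last by lra.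
  by apply: ler_pM => //; rewrite ?mulr_ge0 // ler_pM2l.
have S4 : D * `|w| ^+ 2 <= D * dot w w by exact: ler_wpM2l.
have S5 : C * D ^+ 2 * `|w| ^+ 2 <= D / 48 * `|w| ^+ 2 by rewrite ler_wpM2r // exprn_ge0.
(* A weighted form of [2 x y <= x^2 + y^2]. It leaves [lam / 8] out of the [lam / 2] given by the
   energy, and a quarter of [D |w|^2] for the remainder of the metric. *)
have key : (C + n%:R) * D * (`|w| * `|z|) <= 3 / 8 * (lam * `|z| ^+ 2) + 3 / 4 * (D * `|w| ^+ 2).
  move: Dlam; move: (C + n%:R) => k kD.
  have h1 : k ^+ 2 * D * `|z| ^+ 2 <= lam * `|z| ^+ 2 by rewrite ler_wpM2r // exprn_ge0.
  have h3 : 0 <= D * (3 * (k * `|z|) - 4 * `|w|) ^+ 2 by rewrite mulr_ge0 // sqr_ge0.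
  have e3 : D * (3 * (k * `|z|) - 4 * `|w|) ^+ 2 = 9 * (k ^+ 2 * D * `|z| ^+ 2)
    - 24 * (k * D * (`|w| * `|z|)) + 16 * (D * `|w| ^+ 2) by ring.
  have S0 : 0 <= D * `|w| ^+ 2 by rewrite mulr_ge0 // exprn_ge0.
  move: h1 h3 S0; rewrite e3; move: (k ^+ 2 * D * `|z| ^+ 2) (k * D * (`|w| * `|z|)) => X Y; lra_of isT.
have S0 : 0 <= D * `|w| ^+ 2 by rewrite mulr_ge0 // exprn_ge0.
rewrite -/w in E1 *.
move: S1 S2 S3 S4 S5 key T1 T2 T3 S0.
have kE : (C + n%:R) * D * (`|w| * `|z|) = C * D * (`|w| * `|z|) + D * (n%:R * (`|w| * `|z|)) by ring.
rewrite kE; clear; move=> S1 S2 S3 S4 S5 key T1 T2 T3 S0.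
lra.
Qed.

(** [P] stands for the energy of [c]: any function whose derivative dominates the energy density
    will do. Subtracting the energy of [u] and the calibration [<v, c - u> + m |c - u|^2], which
    vanishes at both ends, leaves an [F] that is nondecreasing by [energy_pointwise]. *)
Lemma minimality (u v c c' : R -> 'rV[R]_n) (P P' : R -> R) (th : R) : gsol u v ->
  c 0 = u 0 -> c 1 = u 1 ->
  (forall t, 0 <= t <= 1 -> `|c t - u0| <= rho) ->
  (forall t, 0 <= t <= 1 -> {for t, continuous c} /\ {for t, continuous P}) ->
  (forall t, 0 < t < 1 -> t != th -> [/\ der c t (c' t), der P t (P' t) &
     2^-1 * gf p (c t) (c' t) (c' t) <= P' t]) ->
  2^-1 * gf p (u 0) (v 0) (v 0) <= P 1 - P 0 /\
  (P 1 - P 0 <= 2^-1 * gf p (u 0) (v 0) (v 0) -> forall t, 0 <= t <= 1 -> c t = u t).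
Proof.
move=> uv cu0 cu1 cr cc Hd.
have d0 := D0; pose Ku := 2^-1 * gf p (u 0) (v 0) (v 0).
(* The slope [-D] creates the coercive term in position, while [|m| <= D / 2] keeps the mixed term
   small. *)
pose m t := D / 2 - D * t.
pose F t := P t - Ku * t - gf p (u t) (v t) (c t - u t) - m t * dot (c t - u t) (c t - u t).
pose F' t := P' t - Ku - (gf p (u t) (v t) (Gam p (u t) (v t) (c t - u t))
     + gf p (u t) (v t) (c' t - v t))
   - (- D * dot (c t - u t) (c t - u t)
      + m t * (dot (c' t - v t) (c t - u t) + dot (c t - u t) (c' t - v t))).
have dF t : 0 < t < 1 -> t != th -> der F t (F' t).
  move=> t1 tth; have [dc dP _] := Hd t t1 tth.
  have [|du dv _ ur] := uv t; first lra.
  have pu := b_img B ur.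
  have dw := derB dc du.
  apply: der_eq.
    apply: derB; first apply: derB; first apply: derB.
    - exact: dP.
    - by apply: derM; [exact: der_cst|exact: der_id].
    - exact: (der_gf pu du dv dw).
    - apply: derM; last exact: (der_dot dw dw).
      by rewrite /m; apply: derB; [exact: der_cst|apply: derM; [exact: der_cst|exact: der_id]].
  by rewrite compat // /F' /gf !bilE /=; ring.
have cF t : 0 <= t <= 1 -> {for t, continuous F}.
  move=> t1; have [cct cPt] := cc t t1; have [|du dv _ ur] := uv t; first lra.
  have cw := contB cct (der_continuous du).
  apply: (contB (f := fun t => P t - Ku * t - gf p (u t) (v t) (c t - u t))
    (g := fun t => m t * dot (c t - u t) (c t - u t))); last first.
    apply: contM; last by apply: cont_sum => i; apply: contM; exact: (cont_coord (f := fun s => c s - u s)).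
    apply: (contB (contC _ _)); apply: contM; [exact: contC|by []].
  apply: (contB (f := fun t => P t - Ku * t)
    (g := fun t => gf p (u t) (v t) (c t - u t))).
    by apply: (contB cPt); apply: contM; [exact: contC|by []].
  apply: cont_sum => i; apply: cont_sum => j; apply: contM; last exact: (cont_coord (f := fun s => c s - u s)).
  apply: contM; last exact: (cont_coord (der_continuous dv)).
  apply: (der_continuous (der_along (f := fun z => metric p z i j) _ du)).
  exact: smooth_differentiable (smooth_metric p i j) (b_img B ur).
have F'ge t : 0 < t < 1 -> t != th -> lam / 8 * `|c' t - v t| ^+ 2 <= F' t.
  move=> t1 tth; have [dc dP HP] := Hd t t1 tth.
  have [|du dv vD ur] := uv t; first lra.
  have mD : `|m t| <= D / 2 by rewrite ler_norml /m; nra.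
  have ct := cr t ltac:(lra).
  have := energy_pointwise (c' t - v t) ur ct vD mD.
  rewrite [v t + (c' t - v t)]addrC subrK (gsol_energy uv); last lra.
  by rewrite /F' /Ku; move: HP; lra.
have F'0 t : 0 < t < 1 -> t != th -> 0 <= F' t.
  by move=> t1 tth; apply: le_trans (F'ge t t1 tth); rewrite mulr_ge0 ?exprn_ge0 // divr_ge0 // ltW // (b_lam0 B).
have mono s t : 0 <= s -> s <= t -> t <= 1 -> F s <= F t.
  move=> s0 st t1; apply: (@der_mono_except _ F F' s t th) => // r rst; first by apply: cF; lra_of s0 t1 rst.
  by move=> rth; split; [apply: dF => //; lra|apply: F'0 => //; lra].
have F0E : F 0 = P 0.
  by rewrite /F cu0 subrr /gf bil0r mulr0 /dot big1 ?mulr0 ?subr0 // => i _; rewrite mxE mul0r.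
have F1E : F 1 = P 1 - Ku.
  by rewrite /F cu1 subrr /gf bil0r mulr1 /dot big1 ?mulr0 ?subr0 // => i _; rewrite mxE mul0r.
have F01 := mono 0 1 (lexx 0) ler01 (lexx 1).
split; first by move: F01; rewrite F0E F1E -/Ku; lra.
rewrite -/Ku => PK.
(* In the equality case the monotone [F] has equal end values, so it is constant, and the coercive
   bound [F'ge] forces [c' = v] off the corner. *)
have Fc t : 0 <= t <= 1 -> F t = F 0.
  move=> t1; apply/eqP; rewrite eq_le.
  have h1 := mono 0 t (lexx 0) ltac:(lra) ltac:(lra).
  have h2 := mono t 1 ltac:(lra_of t1) ltac:(lra_of t1) (lexx 1).
  by rewrite h1 andbT; move: h2 F0E F1E; lra.
have z0 t : 0 < t < 1 -> t != th -> c' t - v t = 0.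
  move=> t1 tth; have h := F'ge t t1 tth.
  have E : F' t = 0.
    apply: der_unique (dF t t1 tth) _; apply: near_eq_der (der_cst (F 0) t).
    apply/near_eps; exists (Num.min t (1 - t)); first by rewrite lt_min; lra.
    by move=> s; rewrite lt_min !ltr_norml => s1; rewrite Fc //; lra_of s1.
  rewrite E pmulr_rle0 ?divr_gt0 ?(b_lam0 B) // in h.
  by apply/eqP; rewrite -normr_eq0 -sqrf_eq0 eq_le h exprn_ge0.
move=> t t1; apply/rowP => i; apply/eqP; rewrite -subr_eq0; apply/eqP.
have ci s : 0 <= s <= 1 -> {for s, continuous (fun s => c s 0 i - u s 0 i)}.
  move=> s1; have [|du _ _ _] := uv s; first lra.
  have h := contB (cc s s1).1 (der_continuous du).
  by apply: eq_cont (cont_coord (i := i) h) => r; rewrite !mxE.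
have di s : 0 < s < 1 -> s != th -> der (fun s => c s 0 i - u s 0 i) s 0.
  move=> s1 sth; have [dc _ _] := Hd s s1 sth; have [|du _ _ _] := uv s; first lra.
  have := (der_rVP _ _ _).1 (derB dc du) i; rewrite z0 // mxE.
  by apply: eq_der => r; rewrite !mxE.
have ge : c 0 0 i - u 0 0 i <= c t 0 i - u t 0 i.
  apply: (@der_mono_except _ (fun s => c s 0 i - u s 0 i) (fun _ => 0) 0 t th); first lra.
    by move=> r rt; apply: ci; lra_of t1 rt.
  by move=> r rt rth; split=> //; apply: di => //; lra_of t1 rt.
have le : - (c 0 0 i - u 0 0 i) <= - (c t 0 i - u t 0 i).
  apply: (@der_mono_except _ (fun s => - (c s 0 i - u s 0 i)) (fun _ => 0) 0 t th); first lra.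
    by move=> r rt; apply: contN; apply: ci; lra.
  by move=> r rt rth; split=> //; apply: der_eq; [apply: derN; apply: di => //; lra_of t1 rt|rewrite oppr0].
by move: ge le; rewrite cu0 subrr; lra.
Qed.

End fixed_ball.
End minimality.

(** * The unique geodesics and their lengths *)

Section real_induction.
Context {R : realType}.

(** Induction along a segment: the property is known on an initial interval and has to be pushed to
    the end of it, or a little beyond. It carries local properties along geodesics. *)
Lemma real_induction (P : R -> Prop) (a b : R) : a <= b -> P a ->
  (forall t, a <= t < b -> (forall s, a <= s <= t -> P s) ->
     exists2 d, 0 < d & forall s, t < s < t + d -> s <= b -> P s) ->
  (forall t, a < t <= b -> (forall s, a <= s < t -> P s) -> P t) ->
  forall t, a <= t <= b -> P t.
Proof.
move=> ab Pa Popen Pclosed.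
pose S := [set t | a <= t <= b /\ forall s, a <= s <= t -> P s].
have Sa : S a.
  by split=> [|s sa]; [lra|rewrite (_ : s = a) //; lra].
have hS : has_sup S by split; [exists a|exists b => t [tb _]; lra].
have aS : a <= sup S by exact: sup_upper_bound.
have Sb : sup S <= b by apply: ge_sup => [|t [tb _]]; [exists a|lra].
have below s : a <= s < sup S -> P s.
  move=> sS; have [] := @sup_adherent _ S (sup S - s) _ hS; first lra.
  by move=> t [tb Pt] st; apply: Pt; lra.
have PS : P (sup S).
  have [aS'|] := ltP a (sup S); first by apply: Pclosed; [lra|exact: below].
  by move=> Sa'; rewrite (_ : sup S = a) //; lra.
have below' s : a <= s <= sup S -> P s.
  have [sS sS'|sS sS'] := ltP s (sup S); first by apply: below; lra.
  by rewrite (_ : s = sup S) //; lra.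
suff Sb' : sup S = b by move=> t tb; apply: below'; lra.
apply/eqP; rewrite eq_le Sb leNgt; apply/negP => Sltb.
have [|d d0 Hd] := Popen (sup S) _ below'; first lra.
pose s := Num.min b (sup S + d / 2).
have sS : sup S < s by rewrite /s lt_min; lra.
have sb : s <= b by rewrite /s ge_min lexx.
have sd : s <= sup S + d / 2 by rewrite /s ge_min lexx orbT.
have : S s.
  split=> [|r rs]; first lra.
  have [rS|rS] := leP r (sup S); first by apply: below'; lra.
  by apply: Hd; lra.
by move=> /(sup_upper_bound hS); lra.
Qed.

Lemma der_eps {V : normedModType R} (f : R -> V) (t : R) (v : V) : der f t v ->
  forall e, 0 < e -> exists2 d, 0 < d & forall s, `|s| < d ->
    `|f (s + t) - f t - s *: v| <= e * `|s|.
Proof.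
move=> [df <-] e e0; have D : differentiable f t by exact/derivable1_diffP.
have [d d0 Hd] := (near_eps _ _).1 (diff_eps D e0); exists d => // s sd.
have := Hd s; rewrite subr0 => /(_ sd); apply: le_trans.
by rewrite deriveE // -linearZ /= [s *: _]mulr1.
Qed.

(** Uniqueness of geodesics gives equality on [0, 1] only, so velocities at the ends have to be
    compared by one-sided derivatives. *)
Lemma der_right_unique {V : normedModType R} (f g : R -> V) (a b : V) :
  (forall t, 0 <= t <= 1 -> f t = g t) -> der f 0 a -> der g 0 b -> a = b.
Proof.
move=> fg df dg; apply/eqP; rewrite -subr_eq0 -normr_le0; apply/ler_addgt0Pr => e e0.
have [d d0 Hd] := der_eps (derB df dg) e0; rewrite add0r.
pose s := Num.min (1 / 2) (d / 2).
have s0 : 0 < s by rewrite /s lt_min; lra.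
have s1 : s <= 1 / 2 by rewrite /s ge_min lexx.
have sd : s <= d / 2 by rewrite /s ge_min lexx orbT.
have := Hd s; rewrite gtr0_norm // addr0 => /(_ ltac:(lra)).
rewrite !fg; [|lra|lra]; rewrite !subrr sub0r normrN normrZ gtr0_norm // mulrC.
by rewrite ler_pM2r.
Qed.

End real_induction.

Lemma near_comp {T U : topologicalType} (f : T -> U) (x : T) (P : U -> Prop) :
  {for x, continuous f} -> (\forall y \near f x, P y) -> \forall s \near x, P (f s).
Proof. by move=> cf; exact: cf. Qed.

Lemma itv0 {R : realType} : (0 : R) <= (0 : R) <= (1 : R). Proof. by rewrite lexx ler01. Qed.
Lemma itv1 {R : realType} : (0 : R) <= (1 : R) <= (1 : R). Proof. by rewrite lexx ler01. Qed.

Section geodesics.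
Context {R : realType} {n : nat} (M : riemannian_manifold R n).
Implicit Types (p q x y z : M) (c : R -> M).

Lemma geodesic_continuous c (t : R) : geodesic c -> 0 <= t <= 1 -> {for t, continuous c}.
Proof. by move=> gc /gc /nbhs_singleton[]. Qed.

Lemma geodesic_affine c (k l t : R) : (\forall s \near k * t + l, geodesic_at c s) ->
  geodesic_at (fun s => c (k * s + l)) t.
Proof.
move=> gc; have cc : {for k * t + l, continuous c} by case: (nbhs_singleton gc).
have caff (s : R) : der (fun s => k * s + l) s k.
  by apply: der_eq; [apply: derD; [apply: derM; [exact: der_cst|exact: der_id]|exact: der_cst]|rewrite mul0r add0r mulr1 addr0].
apply/geodesic_atE; split.
  by apply: (continuous_comp (f := fun s => k * s + l) (g := c)) => //; exact: der_continuous (caff t).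
move=> p pc; have [dc dv] := geodesic_chart gc pc.
set v := d1 (chart p \o c) in dc dv.
have N : \forall s \near t, der (chart p \o (fun s => c (k * s + l))) s (k *: v (k * s + l)).
  have H := near_comp (der_continuous (caff t)) dc.
  by apply: filterS H => s Hs; exact: (@der_comp _ _ (chart p \o c) (fun s => k * s + l) _ k s Hs (caff s)).
have /derP[h1 e1] := nbhs_singleton N.
have d2 : der (d1 (chart p \o (fun s => c (k * s + l)))) t
    (k *: (k *: - Gam p (chart p (c (k * t + l))) (v (k * t + l)) (v (k * t + l)))).
  apply: (@near_eq_der _ _ (fun s => k *: v (k * s + l))).
    by apply: filterS N => s /derP[_ ->].
  apply: der_eq; first by apply: derZ; [exact: der_cst|exact: (@der_comp _ _ v (fun s => k * s + l) _ k t dv (caff t))].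
  by rewrite scale0r add0r.
have /derP[d2' e2] := d2.
split; [exact: h1|exact: d2'|].
by rewrite e1 e2 GamZl GamZr !scalerN.
Qed.

Definition geod_on c (a b : R) := forall t : R, a <= t <= b -> \forall s \near t, geodesic_at c s.

Lemma geod_on_affine c (a b k l a' b' : R) : geod_on c a b ->
  (forall t, a' <= t <= b' -> a <= k * t + l <= b) ->
  geod_on (fun s => c (k * s + l)) a' b'.
Proof.
move=> gc H t /H /gc /nbhs_interior N.
have caff : {for t, continuous (fun t => k * t + l)}.
  by apply: contD; [apply: contM; [exact: contC|by []]|exact: contC].
by apply: filterS (near_comp caff N) => s; exact: geodesic_affine.
Qed.

Lemma geodesic_sub c x y (s t : R) : geodesic_from_to c x y -> 0 <= s <= 1 -> 0 <= t <= 1 ->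
  geodesic_from_to (fun r => c ((t - s) * r + s)) (c s) (c t).
Proof.
move=> [gc _ _] s1 t1; split; last 2 first.
- by rewrite mulr0 add0r.
- by rewrite mulr1 subrK.
by apply: (@geod_on_affine c 0 1) => // r r1; nra.
Qed.

Lemma near_eq_geodesic_at c c' (t : R) : (\forall s \near t, c s = c' s) ->
  (\forall s \near t, geodesic_at c s) -> geodesic_at c' t.
Proof.
move=> cc' gc; have E := nbhs_singleton cc'.
apply/geodesic_atE; split; first by apply: near_eq_continuous (nbhs_singleton gc).1.
move=> p; rewrite -E => pc; have [dc dv] := geodesic_chart gc pc.
have N : \forall s \near t, der (chart p \o c') s (d1 (chart p \o c) s).
  have := nbhs_interior cc'; apply: filterS2 dc => s Hs Hc.
  by apply: near_eq_der Hs; apply: filterS Hc => r /= ->.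
have /derP[h1 e1] := nbhs_singleton N.
rewrite -?E; have /derP[d2 e2] : der (d1 (chart p \o c')) t
    (- Gam p (chart p (c t)) (d1 (chart p \o c) t) (d1 (chart p \o c) t)).
  by apply: near_eq_der dv; apply: filterS N => s /derP[_ ->].
by split; [exact: h1|exact: d2|rewrite e2 e1].
Qed.

Lemma near_eq_geodesic c c' (t : R) : (\forall s \near t, c s = c' s) ->
  (\forall s \near t, geodesic_at c s) -> \forall s \near t, geodesic_at c' s.
Proof.
move=> /nbhs_interior N /nbhs_interior; apply: filterS2 N => s H1 H2.
exact: near_eq_geodesic_at H1 H2.
Qed.

(** The switch takes place in the middle of the overlap, so that near every time the glued curve
    coincides with one of the two geodesics. Agreement with [c1] also holds beyond the switch, up to
    the end of the overlap. *)
Lemma geodesic_glue c1 c2 (a b l r : R) : a <= l -> l < r -> r <= b ->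
  geod_on c1 a r -> geod_on c2 l b -> (forall t, l <= t <= r -> c1 t = c2 t) ->
  exists c, [/\ geod_on c a b, forall t, t <= r -> t < (l + r) / 2 \/ l <= t -> c t = c1 t &
    forall t, l <= t -> c t = c2 t].
Proof.
move=> al lr rb g1 g2 E; pose c t := if t < (l + r) / 2 then c1 t else c2 t.
have E1 t : t <= r -> t < (l + r) / 2 \/ l <= t -> c t = c1 t.
  by rewrite /c; case: ltrP => // h tr [|lt]; [move=> h2; exfalso; lra|rewrite E //; lra].
have E2 t : l <= t -> c t = c2 t.
  by rewrite /c; case: ltrP => // h lt; rewrite E //; lra.
exists c; split=> // t tab; have [tm|tm] := ltP t ((l + r) / 2).
  apply: (@near_eq_geodesic c1); last by apply: g1; lra.
  apply/near_eps; exists ((l + r) / 2 - t); first lra.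
  move=> s; rewrite ltr_norml => st; rewrite E1 //; [lra|left; lra].
apply: (@near_eq_geodesic c2); last by apply: g2; lra.
apply/near_eps; exists (t - l); first lra.
by move=> s; rewrite ltr_norml => st; rewrite E2 //; lra.
Qed.

Definition speed2 c (t : R) := inner (c t) (velocity c t) (velocity c t).

Lemma speed2_chart p c (t : R) v : {for t, continuous c} -> dom p (c t) ->
  der (chart p \o c) t v -> speed2 c t = gf p (chart p (c t)) v v.
Proof. by move=> cc pc dc; rewrite /speed2 (velocity_chart cc pc dc) inner_chart. Qed.

Lemma speed2_const c (a b : R) : geod_on c a b -> forall s t, a <= s <= b -> a <= t <= b ->
  speed2 c s = speed2 c t.
Proof.
move=> gc; suff W s t : a <= s -> s <= t -> t <= b -> speed2 c s = speed2 c t.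
  move=> s t /andP[sa sb] /andP[ta tb]; have [st|ts] := leP s t; first exact: W.
  by apply/esym/W => //; exact: ltW.
move=> as_ st tb.
have d0 r : s <= r <= t -> der (speed2 c) r 0.
  move=> rst; have N : \forall s \near r, geodesic_at c s by apply: gc; lra.
  have cc : {for r, continuous c} by case: (nbhs_singleton N).
  set p := c r; have pc : dom p (c r) by exact: dom_self.
  have [dc dv] := geodesic_chart N pc.
  set v := d1 (chart p \o c) in dc dv.
  have pu : img p (chart p (c r)) by exact: img_chart.
  have dg : der (fun s => gf p (chart p (c s)) (v s) (v s)) r 0.
    apply: der_eq; first exact: (der_gf pu (nbhs_singleton dc) dv dv).
    by rewrite /= compat // /gf !bilE; ring.
  apply: near_eq_der dg.
  have Nd : \forall s \near r, dom p (c s) by apply: (near_continuous cc) => //; exact: dom_open.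
  apply: filterS3 N Nd dc => s' [cs _] ps ds.
  by rewrite (speed2_chart cs ps ds).
have [r _ E] := @MVT_everywhere R _ (fun _ => 0) s t st d0.
by apply/esym/eqP; rewrite -subr_eq0 E mul0r.
Qed.

Hypothesis UG : uniquely_geodesic M.

Definition sg x y : R -> M := projT1 (cid (UG x y).1).

Lemma sgP x y : geodesic_from_to (sg x y) x y.
Proof. exact: (projT2 (cid (UG x y).1)). Qed.

Lemma sg_unique c x y (t : R) : geodesic_from_to c x y -> 0 <= t <= 1 -> sg x y t = c t.
Proof. by move=> gc t1; apply: (UG x y).2 => //; exact: sgP. Qed.

Lemma sg0 x y : sg x y 0 = x. Proof. by case: (sgP x y). Qed.
Lemma sg1 x y : sg x y 1 = y. Proof. by case: (sgP x y). Qed.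

Lemma geodesic_der p c (t : R) : (\forall s \near t, geodesic_at c s) -> dom p (c t) ->
  der (chart p \o c) t (d1 (chart p \o c) t).
Proof. by move=> gc pc; have [/nbhs_singleton] := geodesic_chart gc pc. Qed.

Lemma velocity_unique c c' x y : geodesic_from_to c x y -> geodesic_from_to c' x y ->
  velocity c 0 = velocity c' 0.
Proof.
move=> gc gc'; have E := (UG x y).2 _ _ gc gc'.
have [g c0 _] := gc; have [g' c0' _] := gc'; rewrite !velocityE c0 c0'.
have i0 := @itv0 R.
apply: (@der_right_unique _ _ (chart x \o c) (chart x \o c')).
- by move=> t t1; rewrite /= E.
- by apply: geodesic_der; [exact: (g 0 itv0)|rewrite c0; exact: dom_self].
- by apply: geodesic_der; [exact: (g' 0 itv0)|rewrite c0'; exact: dom_self].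
Qed.

Lemma LogE c x y : geodesic_from_to c x y -> Log x y = velocity c 0.
Proof.
move=> gc; rewrite /Log; case: xgetP => [v _ [c' gc' <-]|/(_ (velocity c 0))].
  exact: velocity_unique gc' gc.
by move=> []; exists c.
Qed.

(** The length D of the overview: geodesics have constant speed and run over a unit of time, so the
    length is the initial speed. *)
Definition gdist x y : R := tnorm x (Log x y).

Lemma gdist_ge0 x y : 0 <= gdist x y. Proof. exact: sqrtr_ge0. Qed.

Lemma inner_ge0 x a : 0 <= inner x a a.
Proof. by rewrite innerE; apply: gf_ge0; exact: img_chart (dom_self x). Qed.

Lemma gdist_speed2 c x y (t : R) : geodesic_from_to c x y -> 0 <= t <= 1 ->
  gdist x y ^+ 2 = speed2 c t.
Proof.
move=> gc t1; rewrite /gdist /tnorm sqr_sqrtr ?inner_ge0 // (LogE gc).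
have [g c0 _] := gc; rewrite -(@speed2_const _ 0 1 g 0 t) //; last exact: itv0.
by rewrite /speed2 c0.
Qed.

Lemma speed2_affine c (k l t : R) : (\forall s \near k * t + l, geodesic_at c s) ->
  speed2 (fun s => c (k * s + l)) t = k ^+ 2 * speed2 c (k * t + l).
Proof.
move=> gc; have [cc _] := nbhs_singleton gc; pose p := c (k * t + l).
have dc := geodesic_der gc (dom_self p).
have da : der (fun s => k * s + l) t k.
  by apply: der_eq; [apply: derD; [apply: derM; [exact: der_cst|exact: der_id]|exact: der_cst]|rewrite mul0r add0r mulr1 addr0].
have cc' : {for t, continuous (fun s => c (k * s + l))}.
  by apply: (continuous_comp (f := fun s => k * s + l) (g := c)) => //; exact: der_continuous da.
rewrite (speed2_chart cc (dom_self p) dc) (speed2_chart cc' (dom_self p) (@der_comp _ _ (chart p \o c) (fun s => k * s + l) _ k t dc da)).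
by rewrite /gf !bilE; ring.
Qed.

Lemma gdist_sub c x y (s t : R) : geodesic_from_to c x y -> 0 <= s <= 1 -> 0 <= t <= 1 ->
  gdist (c s) (c t) = `|t - s| * gdist x y.
Proof.
move=> gc s1 t1; have gs := geodesic_sub gc s1 t1.
apply/eqP; rewrite -(@eqrXn2 _ 2) ?gdist_ge0 ?mulr_ge0 //; last exact: gdist_ge0.
apply/eqP; rewrite exprMn real_normK ?num_real //.
have i0 := @itv0 R.
rewrite (gdist_speed2 gs i0) (gdist_speed2 gc s1) speed2_affine mulr0 add0r //.
by case: gc => g _ _; exact: (g s s1).
Qed.

Lemma geodesic_rev c x y : geodesic_from_to c x y ->
  geodesic_from_to (fun r => c (1 - r)) y x.
Proof.
move=> gc; have [_ c0 c1] := gc.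
have := geodesic_sub gc itv1 itv0; rewrite c0 c1 => -[g' _ _]; split; rewrite ?subr0 ?subrr //.
by move: g'; rewrite (_ : (fun r => _) = fun r => c (1 - r)) //; apply/funext => r; congr c; ring.
Qed.

Lemma gdistC x y : gdist x y = gdist y x.
Proof.
have := gdist_sub (sgP x y) itv1 itv0; rewrite sg0 sg1 => ->.
by rewrite sub0r normrN normr1 mul1r.
Qed.

Lemma sg_sub x y (s t r : R) : 0 <= s <= 1 -> 0 <= t <= 1 -> 0 <= r <= 1 ->
  sg (sg x y s) (sg x y t) r = sg x y ((t - s) * r + s).
Proof. by move=> s1 t1 r1; rewrite (sg_unique (geodesic_sub (sgP x y) s1 t1)). Qed.

Lemma gdist_sg x y (s t : R) : 0 <= s <= 1 -> 0 <= t <= 1 ->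
  gdist (sg x y s) (sg x y t) = `|t - s| * gdist x y.
Proof. by move=> s1 t1; rewrite (gdist_sub (sgP x y)). Qed.

Lemma gdistxx x : gdist x x = 0.
Proof.
by have := gdist_sg x x itv0 itv0; rewrite sg0 subrr normr0 mul0r.
Qed.

(** A geodesic of zero speed is constant in each chart, hence locally constant, hence constant. *)
Lemma gdist_eq0 x y : gdist x y = 0 -> x = y.
Proof.
move=> D0; have gc := sgP x y; have [g c0 c1] := gc.
suff H : forall t : R, 0 <= t <= 1 -> sg x y t = x by rewrite -[RHS]c1 H ?ler01 ?lexx.
have loc (t : R) : 0 <= t <= 1 -> exists2 d, 0 < d & forall s, `|s - t| < d -> 0 <= s <= 1 ->
    sg x y s = sg x y t.
  move=> t1; have cc := geodesic_continuous g t1.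
  set p := sg x y t; have Np : \forall s \near t, dom p (sg x y s).
    by apply: (near_continuous cc); [exact: dom_open|exact: dom_self].
  have [d d0 Hd] := (near_eps _ _).1 Np; exists d => // s st s1.
  rewrite -(chartK (Hd s st)) -[RHS](chartK (dom_self p)); congr chart_inv.
  have : `|chart p (sg x y s) - chart p (sg x y t)| <= 0 * `|s - t|.
    apply: (@der_bound _ _ (chart p \o sg x y) (fun _ => 0)) => // r rst; last by rewrite normr0.
    have rt : `|r - t| < d by move: st; rewrite !ltr_norml; lra.
    have r1 : 0 <= r <= 1 by lra.
    have dr := geodesic_der (g r r1) (Hd r rt).
    have := gdist_speed2 gc r1; rewrite D0 expr0n /= => /esym.
    rewrite (speed2_chart (geodesic_continuous g r1) (Hd r rt) dr) => E.
    apply: (der_eq dr); apply/eqP; apply: contraT => n0.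
    by have := gf_gt0 (img_chart (Hd r rt)) n0; rewrite E ltxx.
  by rewrite mul0r normr_le0 subr_eq0 => /eqP.
apply: (@real_induction _ (fun t => sg x y t = x)) => //.
- move=> t t1 H; have [|d d0 Hd] := loc t; first lra.
  exists d => // s st s1; rewrite Hd ?H //; [lra|rewrite ltr_norml; lra|lra].
- move=> t t1 H; have [|d d0 Hd] := loc t; first lra.
  pose s := Num.max (t / 2) (t - d / 2).
  have s1 : t / 2 <= s by rewrite /s le_max lexx.
  have s2 : t - d / 2 <= s by rewrite /s le_max lexx orbT.
  have s3 : s < t by rewrite /s gt_max; lra.
  by rewrite -(Hd s) ?H //; [lra|rewrite ltr_norml; lra|lra].
Qed.

End geodesics.

(** * Neighborhoods in which short geodesics are controlled *)

Section nice_charts.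
Context {R : realType} {n : nat} (M : riemannian_manifold R n).
Implicit Types (p q x y z : M).
Hypothesis UG : uniquely_geodesic M.
Local Notation sg := (sg UG).

(** The smallness conditions on [D] under which both [gsol_ex] and [minimality] apply around [q]. *)
Record nice q (rho C lam D : R) : Prop := Nice {
  n_B : bounds q (chart q q) rho C lam ;
  n_D0 : 0 < D ; n_D1 : D <= 1 ;
  n_CD : 48 * C * D <= 1 ;
  n_lam : (C + n%:R) ^+ 2 * D <= lam ;
  n_rho : 4 * D <= rho }.

Lemma nice_ex q : exists rho C lam D, nice q rho C lam D.
Proof.
have [rho [C [lam B]]] := bounds_ex (img_chart (dom_self q)).
have rho0 := b_rho B; have C1 := b_C B; have lam0 := b_lam0 B.
pose N := (C + n%:R) ^+ 2.
have N1 : 0 < N by rewrite exprn_gt0 // ltr_pwDl //; lra.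
exists rho, C, lam, (Num.min 1 (Num.min (48 * C)^-1 (Num.min (lam / N) (rho / 4)))).
have CC : 0 < 48 * C by lra.
split=> //.
- by rewrite !lt_min ltr01 invr_gt0 CC !divr_gt0.
- by rewrite ge_min lexx.
- by rewrite -ler_pdivlMl // mulr1 !ge_min lexx orbT.
- by rewrite mulrC -ler_pdivlMr // !ge_min lexx !orbT.
- by rewrite mulrC -ler_pdivlMr // !ge_min lexx !orbT.
Qed.

(** With radius [D / 4] any two points have coordinates at distance at most [D / 2], as [gsol_ex]
    requires. *)
Definition Vs q (D : R) : set M := [set x | dom q x /\ `|chart q x - chart q q| < D / 4].

Lemma Vs_open q D : open (Vs q D).
Proof.
rewrite openE => x [qx xr]; rewrite /interior.
have cq := chart_continuous qx.
have N1 : \forall y \near x, dom q y by apply: open_nbhs_nbhs; split=> //; exact: dom_open.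
have [d d0 Hd] : exists2 d, 0 < d & forall u, `|u - chart q x| < d -> `|u - chart q q| < D / 4.
  exists (D / 4 - `|chart q x - chart q q|) => [|u]; first by rewrite subr_gt0.
  move=> h; rewrite -[u](subrK (chart q x)) -addrA (le_lt_trans (ler_normD _ _)) //.
  by move: h; lra.
have N2 : \forall y \near x, `|chart q y - chart q q| < D / 4.
  have N0 : \forall u \near chart q x, `|u - chart q q| < D / 4 by apply/near_eps; exists d.
  exact: (near_comp cq N0).
by apply: filterS2 N1 N2 => y.
Qed.

Section in_nice.
Variables (q : M) (rho C lam D : R).
Hypothesis Hn : nice q rho C lam D.

Let B := n_B Hn.
Let V := Vs q D.

Lemma Vs_self : V q.
Proof. by split; [exact: dom_self|rewrite subrr normr0 divr_gt0 // (n_D0 Hn)]. Qed.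

(** The solution of the boundary value problem is a geodesic between [x] and [y], hence the one
    chosen by [sg]. So the global geodesic between two close points stays in the chart and inherits
    all local estimates. *)
Lemma nice_sol x y : V x -> V y -> exists u v : R -> 'rV[R]_n,
  [/\ gsol q (chart q q) rho D u v, u 0 = chart q x, u 1 = chart q y,
     forall t, 0 <= t <= 1 -> dom q (sg x y t) /\ chart q (sg x y t) = u t &
     gdist x y ^+ 2 = gf q (u 0) (v 0) (v 0)].
Proof.
move=> [qx xr] [qy yr]; have D0 := n_D0 Hn; have rh := n_rho Hn.
have [||||||u [v [uv u0 u1]]] := @gsol_ex _ _ M q _ _ _ _ B D (chart q x) (chart q y).
- exact: ltW.
- exact: n_D1 Hn.
- exact: n_CD Hn.
- exact: n_rho Hn.
- by move: xr; lra.
- rewrite -[chart q y](subrK (chart q q)) -addrA (le_trans (ler_normD _ _)) //.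
  by rewrite (distrC (chart q q)); lra.
exists u, v; have pu t : -1 < t < 2 -> img q (u t) by move=> /uv[_ _ _]; exact: (b_img B).
have gg : geodesic_from_to (chart_inv q \o u) x y.
  split; rewrite /= ?u0 ?u1 ?chartK //.
  move=> t t1; have : \forall s \near t, -1 < s < 2.
    apply/near_eps; exists 1 => // s; rewrite ltr_norml; lra.
  move=> N; have N' := nbhs_interior N; apply: filterS2 N N' => s s2 Ns.
  have [_ dv _ _] := uv s s2; apply: geodesic_at_chart (pu s s2) _ dv.
  by apply: filterS Ns => r r2; have [] := uv r r2.
have sgE t : 0 <= t <= 1 -> sg x y t = chart_inv q (u t) by move=> t1; rewrite (sg_unique UG gg).
split=> // [t t1|].
  have t2 : -1 < t < 2 by lra.
  by rewrite sgE //; split; [exact: (img_dom (pu t t2))|exact: (chart_invK (pu t t2))].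
rewrite (gdist_speed2 UG gg itv0).
have [|du dv _ _] := uv 0; first lra.
have cu : {for (0 : R), continuous (chart_inv q \o u)} by apply: (geodesic_continuous _ itv0); case: gg.
have pq : dom q ((chart_inv q \o u) 0) by apply: img_dom; apply: pu; lra.
have dd : der (chart q \o (chart_inv q \o u)) 0 (v 0).
  apply: near_eq_der du; apply/near_eps; exists 1 => // s; rewrite ltr_norml subr0 => s1.
  by rewrite /= chart_invK //; apply: pu; lra.
by rewrite (speed2_chart cu pq dd) /= chart_invK //; apply: pu; lra.
Qed.

Lemma nice_min x y (c c' : R -> 'rV[R]_n) (P P' : R -> R) (th : R) : V x -> V y ->
  c 0 = chart q x -> c 1 = chart q y ->
  (forall t, 0 <= t <= 1 -> `|c t - chart q q| <= rho) ->
  (forall t, 0 <= t <= 1 -> {for t, continuous c} /\ {for t, continuous P}) ->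
  (forall t, 0 < t < 1 -> t != th -> [/\ der c t (c' t), der P t (P' t) &
     2^-1 * gf q (c t) (c' t) (c' t) <= P' t]) ->
  gdist x y ^+ 2 / 2 <= P 1 - P 0 /\
  (P 1 - P 0 <= gdist x y ^+ 2 / 2 -> forall t, 0 <= t <= 1 -> c t = chart q (sg x y t)).
Proof.
move=> Vx Vy c0 c1 cr cc Hd; have [u [v [uv u0 u1 su E]]] := nice_sol Vx Vy.
have [||H1 H2] := minimality B (ltW (n_D0 Hn)) (n_D1 Hn) (n_CD Hn) (n_lam Hn) uv _ _ cr cc Hd.
- by rewrite c0 u0.
- by rewrite c1 u1.
rewrite E mulrC; split=> // h t t1.
by rewrite (su t t1).2; exact: H2.
Qed.

Lemma nice_line x y K : V x -> V y ->
  (forall s, 0 <= s <= 1 -> gf q (chart q x + s *: (chart q y - chart q x))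
     (chart q y - chart q x) (chart q y - chart q x) <= K) ->
  gdist x y ^+ 2 <= K.
Proof.
move=> Vx Vy HK; have D0 := n_D0 Hn; have rh := n_rho Hn.
(* The competitor is the coordinate segment; the exceptional time 2 lies outside the interval. *)
have [|||||h _] := @nice_min x y (fun s => chart q x + s *: (chart q y - chart q x))
  (fun _ => chart q y - chart q x) (fun s => K / 2 * s) (fun _ => K / 2) 2 Vx Vy.
- by rewrite scale0r addr0.
- by rewrite scale1r addrC subrK.
- move=> t t1; apply: seg_ball => //; [case: Vx|case: Vy] => _; lra.
- move=> t t1; split; first exact: (der_continuous (der_line _ _ t)).
  by apply: contM; [exact: contC|].
- move=> t t1 _; split; first exact: der_line.
    by apply: der_eq; [ider|rewrite mul0r add0r mulr1].
  by have := HK t ltac:(lra); lra.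
- by move: h; lra.
Qed.

Lemma nice_ball x y t : V x -> V y -> 0 <= t <= 1 ->
  dom q (sg x y t) /\ `|chart q (sg x y t) - chart q q| <= rho.
Proof.
move=> Vx Vy t1; have [u [v [uv _ _ su _]]] := nice_sol Vx Vy.
have [qs ->] := su t t1; split=> //.
by have [|_ _ _] := uv t; first lra.
Qed.

(** [nice_min] applied to the concatenation of two geodesics that meet at time [th]; the majorant is
    piecewise affine, with slopes half the squared speeds. In the equality case the broken curve is
    the geodesic itself, so [y] is its point at [th]. *)
Lemma two_piece x y z th : V x -> V y -> V z -> 0 < th < 1 ->
  gdist x z ^+ 2 <= gdist x y ^+ 2 / th + gdist y z ^+ 2 / (1 - th) /\
  (gdist x y ^+ 2 / th + gdist y z ^+ 2 / (1 - th) <= gdist x z ^+ 2 -> y = sg x z th).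
Proof.
move=> Vx Vy Vz th1.
have [u [v [uv u0 u1 su E1]]] := nice_sol Vx Vy.
have [w [s [ws w0 w1 sw E2]]] := nice_sol Vy Vz.
have th0 : 0 < th by lra.
have th0' : 0 < 1 - th by lra.
pose L1 := gdist x y ^+ 2; pose L2 := gdist y z ^+ 2.
pose c1 t := u (th^-1 * t + 0); pose c2 t := w ((1 - th)^-1 * t + - (th / (1 - th))).
pose k1 := L1 / th ^+ 2 / 2; pose k2 := L2 / (1 - th) ^+ 2 / 2.
pose P2 t := k1 * th + k2 * (t - th).
pose c t := if t < th then c1 t else c2 t.
pose c' t := if t < th then th^-1 *: v (th^-1 * t + 0)
  else (1 - th)^-1 *: s ((1 - th)^-1 * t + - (th / (1 - th))).
pose P t := if t < th then k1 * t else P2 t.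
pose P' t := if t < th then k1 else k2.
have a1 t : 0 <= t <= th -> 0 <= th^-1 * t + 0 <= 1.
  by move=> tt; rewrite addr0 mulrC divr_ge0 ?ler_pdivrMr //=; lra_of th1 tt.
have a2 t : th <= t <= 1 -> 0 <= (1 - th)^-1 * t + - (th / (1 - th)) <= 1.
  move=> tt; rewrite mulrC -mulrBl divr_ge0 ?ler_pdivrMr //=; lra_of th1 tt.
have daff (k l t : R) : der (fun r => k * r + l) t k.
  by apply: der_eq; [ider|rewrite mul0r add0r mulr1 addr0].
have d1' t : 0 <= t <= th -> der c1 t (th^-1 *: v (th^-1 * t + 0)).
  move=> /a1 h; have [|du _ _ _] := uv (th^-1 * t + 0); first lra.
  exact: (@der_comp _ _ u (fun r => th^-1 * r + 0) _ th^-1 t du (daff _ _ _)).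
have d2' t : th <= t <= 1 -> der c2 t ((1 - th)^-1 *: s ((1 - th)^-1 * t + - (th / (1 - th)))).
  move=> /a2 h; have [|dw _ _ _] := ws ((1 - th)^-1 * t + - (th / (1 - th))); first lra.
  exact: (@der_comp _ _ w (fun r => (1 - th)^-1 * r + - (th / (1 - th))) _ (1 - th)^-1 t dw (daff _ _ _)).
have eqth : c1 th = c2 th.
  rewrite /c1 /c2 addr0 mulVf ?gt_eqF // (mulrC _ th) subrr w0.
  by rewrite u1.
have near_lt t : t < th -> \forall r \near t, r < th.
  by move=> h; apply/near_eps; exists (th - t); [lra_of h|move=> r; rewrite ltr_norml; lra_of isT].
have near_gt t : th < t -> \forall r \near t, th <= r.
  by move=> h; apply/near_eps; exists (t - th); [lra_of h|move=> r; rewrite ltr_norml; lra_of isT].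
have glue (W : normedModType R) (f g : R -> W) t : f th = g th ->
    {for t, continuous f} \/ th < t -> {for t, continuous g} \/ t < th ->
    {for t, continuous (fun r => if r < th then f r else g r)}.
  move=> fg cf cg; have [tl|tg|te] := ltgtP t th.
  - apply: (near_eq_continuous (f := f)); last by case: cf => // ?; exfalso; lra.
    by apply: filterS (near_lt t tl) => r ->.
  - apply: (near_eq_continuous (f := g)); last by case: cg => // ?; exfalso; lra.
    by apply: filterS (near_gt t tg) => r; rewrite leNgt => /negbTE ->.
  - have {}cf : {for t, continuous f} by case: cf => // ?; exfalso; lra.
    have {}cg : {for t, continuous g} by case: cg => // ?; exfalso; lra.
    apply: eps_continuous => e e0.
    have [d1 d10 H1] := continuous_eps cf e0; have [d2 d20 H2] := continuous_eps cg e0.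
    exists (Num.min d1 d2) => [|r]; first by rewrite lt_min d10.
    rewrite lt_min => /andP[/H1 h1 /H2 h2].
    by rewrite te ltxx; case: ifP => _; [rewrite -fg -te|rewrite -te].
have cE t : 0 <= t <= 1 -> {for t, continuous c}.
  move=> t1; apply: glue => //; have [h|h] := ltP t th.
  - by left; apply: (der_continuous (d1' t _)); lra.
  - have [->|h'] := eqVneq t th; first by left; apply: (der_continuous (d1' th _)); lra_of th1.
    by right; rewrite lt_neqAle eq_sym h'.
  - by right.
  - by left; apply: (der_continuous (d2' t _)); lra.
have dP2 t : der P2 t k2 by apply: der_eq; [rewrite /P2; ider|by rewrite /= !(mul0r, add0r, addr0, mulr1)].
have dP1 t : der (fun r => k1 * r) t k1 by apply: der_eq; [ider|by rewrite /= !(mul0r, add0r, addr0, mulr1)].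
have cPE t : {for t, continuous P}.
  apply: glue; first by rewrite /P2; ring.
    by left; exact: (der_continuous (dP1 t)).
  by left; exact: (der_continuous (dP2 t)).
have [|||||h1 h2] := @nice_min x z c c' P P' th Vx Vz.
- by rewrite /c th0 /c1 mulr0 addr0.
- rewrite /c ltNge (ltW (_ : th < 1)) /=; last lra.
  by rewrite /c2 (_ : _ + _ = 1) //; field; rewrite gt_eqF.
- move=> t t1; rewrite /c; case: ltrP => h.
    by have [|_ _ _] := uv (th^-1 * t + 0); first by have := a1 t ltac:(lra_of t1 h); lra_of isT.
  by have [|_ _ _] := ws ((1 - th)^-1 * t + - (th / (1 - th))); first by have := a2 t ltac:(lra_of t1 h); lra_of isT.
- by move=> t t1; split; [exact: cE|exact: cPE].
- move=> t t1 tth; rewrite /c' /P'; have [tl|tg|te] := ltgtP t th; last by rewrite te eqxx in tth.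
    have h1 : 0 <= t <= th by lra.
    split.
    + by apply: near_eq_der (d1' t h1); apply: filterS (near_lt t tl) => r; rewrite /c => ->.
    + by apply: near_eq_der (dP1 t); apply: filterS (near_lt t tl) => r; rewrite /P => ->.
    + rewrite /c tl /c1 /gf !bilE -/(gf _ _ _ _) (gsol_energy B uv (a1 t h1)) -E1 /k1 -/L1.
      by rewrite le_eqVlt; apply/orP; left; apply/eqP; field; rewrite gt_eqF.
  have h1 : th <= t <= 1 by lra.
  split.
  + apply: near_eq_der (d2' t h1); apply: filterS (near_gt t tg) => r; rewrite /c.
    by rewrite leNgt => /negbTE ->.
  + apply: near_eq_der (dP2 t); apply: filterS (near_gt t tg) => r; rewrite /P.
    by rewrite leNgt => /negbTE ->.
  + rewrite /c ltNge (ltW tg) /= /c2 /gf !bilE -/(gf _ _ _ _) (gsol_energy B ws (a2 t h1)) -E2 /k2 -/L2.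
    by rewrite le_eqVlt; apply/orP; left; apply/eqP; field; rewrite gt_eqF.
move: h1 h2; have PE : P 1 - P 0 = (L1 / th + L2 / (1 - th)) / 2.
  rewrite /P th0 ltNge (ltW (_ : th < 1)) /=; last lra.
  by rewrite /P2 /k1 /k2; field; rewrite !gt_eqF.
rewrite PE -/L1 -/L2 => h1 h2; split; first by move: h1; lra_of isT.
move=> h3; have := h2 ltac:(lra_of h3) th ltac:(lra_of th1).
rewrite /c ltxx -eqth /c1 addr0 mulVf ?gt_eqF // u1.
have [qs sr] := nice_ball Vx Vz (ltac:(lra_of th1) : 0 <= th <= 1).
have [qy _] := Vy.
by move=> E; rewrite -(chartK qy) E chartK.
Qed.

(** If [th] is the share of the first leg in the total length, the right side of [two_piece] is the
    square of the sum of the lengths. *)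
Lemma nice_triangle x y z : V x -> V y -> V z -> gdist x z <= gdist x y + gdist y z.
Proof.
move=> Vx Vy Vz; have a0 := gdist_ge0 x y; have b0 := gdist_ge0 y z.
have [/eqP|a1] := boolP (gdist x y == 0); first by move=> /[dup] /(gdist_eq0 UG) -> ->; rewrite add0r.
have [/eqP|b1] := boolP (gdist y z == 0); first by move=> /[dup] /(gdist_eq0 UG) -> ->; rewrite addr0.
have {}a1 : 0 < gdist x y by rewrite lt_neqAle eq_sym a1.
have {}b1 : 0 < gdist y z by rewrite lt_neqAle eq_sym b1.
have s0 : 0 < gdist x y + gdist y z by lra.
have [|h _] := @two_piece x y z (gdist x y / (gdist x y + gdist y z)) Vx Vy Vz.
  by rewrite divr_gt0 //= ltr_pdivrMr //; lra.
have h' : gdist x z ^+ 2 <= (gdist x y + gdist y z) ^+ 2.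
  apply: (le_trans h); rewrite le_eqVlt; apply/orP; left; apply/eqP.
  by field; rewrite addrAC subrr add0r !gt_eqF.
by rewrite ler_sqr ?nnegrE ?gdist_ge0 ?(ltW s0) in h'.
Qed.

Lemma nice_lip x y x' y' : V x -> V y -> V x' -> V y' -> forall t, 0 <= t <= 1 ->
  `|chart q (sg x' y' t) - chart q (sg x y t)| <=
    5 * (`|chart q x' - chart q x| + `|chart q y' - chart q y|) /\
  `|gdist x' y' ^+ 2 - gdist x y ^+ 2| <=
    9 * C * (`|chart q x' - chart q x| + `|chart q y' - chart q y|).
Proof.
move=> Vx Vy Vx' Vy' t t1.
have [u [v [uv u0 u1 su ->]]] := nice_sol Vx Vy.
have [w [z [wz w0 w1 sw ->]]] := nice_sol Vx' Vy'.
rewrite (su t t1).2 (sw t t1).2 -u0 -w0 -u1 -w1.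
have D0 := ltW (n_D0 Hn); have D1 := n_D1 Hn.
have C0 : 0 <= C by apply: le_trans (b_C B).
have [_ ht] := gsol_lip B D0 D1 (n_CD Hn) wz uv t1.
have [h0 _] := gsol_lip B D0 D1 (n_CD Hn) wz uv itv0.
split=> //; move: h0; set E := `|_| + `|_| => h0.
have [|_ _ vD ur] := uv 0; first lra.
have [|_ _ zD wr] := wz 0; first lra.
have -> : gf q (w 0) (z 0) (z 0) - gf q (u 0) (v 0) (v 0) =
    (gf q (w 0) (z 0) (z 0) - gf q (u 0) (z 0) (z 0))
    + (gf q (u 0) (z 0 - v 0) (z 0) + gf q (u 0) (v 0) (z 0 - v 0)).
  by rewrite /gf !bilE; ring.
rewrite (le_trans (ler_normD _ _)) //.
have g1 := b_gfL B (z 0) (z 0) ur wr.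
have g2 := ler_normD (gf q (u 0) (z 0 - v 0) (z 0)) (gf q (u 0) (v 0) (z 0 - v 0)).
have g3 := b_gf B (z 0 - v 0) (z 0) ur; have g4 := b_gf B (v 0) (z 0 - v 0) ur.
have wE : `|w 0 - u 0| <= E by rewrite /E lerDl.
have zz : `|z 0| <= 1 by lra_of D1 zD.
have vv : `|v 0| <= 1 by lra_of D1 vD.
have k1 : C * `|w 0 - u 0| * `|z 0| * `|z 0| <= C * E.
  rewrite -[leRHS]mulr1 -[leRHS]mulr1; do 2 (apply: ler_pM => //; first by rewrite !mulr_ge0).
  by rewrite ler_wpM2l.
have k2 : C * `|z 0 - v 0| * `|z 0| <= C * (4 * E).
  by rewrite -[leRHS]mulr1; apply: ler_pM => //; [rewrite mulr_ge0|rewrite ler_wpM2l].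
have k3 : C * `|v 0| * `|z 0 - v 0| <= C * (4 * E).
  by rewrite -[C in leRHS]mulr1; apply: ler_pM => //; [rewrite mulr_ge0|rewrite ler_wpM2l].
lra_of g1 g2 g3 g4 k1 k2 k3.
Qed.

End in_nice.
End nice_charts.

(** * Persistence of local minima and the triangle inequality *)

Section product_continuity.
Context {T U W : topologicalType}.

Lemma cont_pair (f : T -> U) (g : T -> W) t : {for t, continuous f} -> {for t, continuous g} ->
  {for t, continuous (fun s => (f s, g s))}.
Proof. by move=> cf cg; exact: cvg_pair. Qed.

Lemma cont_id (t : T) : {for t, continuous (fun s : T => s)}.
Proof. by move=> A. Qed.

Lemma cont_fst (y : U * W) : {for y, continuous (fun y : U * W => y.1)}.
Proof. exact: cvg_fst. Qed.

Lemma cont_snd (y : U * W) : {for y, continuous (fun y : U * W => y.2)}.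
Proof. exact: cvg_snd. Qed.

Lemma cont_comp (f : T -> U) (g : U -> W) t : {for t, continuous f} ->
  {for f t, continuous g} -> {for t, continuous (fun s => g (f s))}.
Proof. by move=> cf cg; exact: continuous_comp. Qed.

Lemma cont_cst (c : U) (t : T) : {for t, continuous (fun _ : T => c)}.
Proof. exact: cvg_cst. Qed.

End product_continuity.
Arguments cont_comp {T U W f g t} _ _.
Arguments cont_id {T} t.
Arguments cont_cst {T U} c t.

Lemma cont_norm {R : realType} {T : topologicalType} {V : normedModType R} (f : T -> V) t :
  {for t, continuous f} -> {for t, continuous (fun s => `|f s|)}.
Proof. by move=> cf; apply: (cont_comp cf); exact: norm_continuous. Qed.

Lemma cont_dist {R : realType} {V : normedModType R} (e z : V) :
  {for z, continuous (fun z => `|z - e|)}.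
Proof. exact: (cont_norm (contB (cont_id z) (contC e z))). Qed.

Section local_min.
Context {R : realType} {n : nat}.
Local Notation T := (R * 'rV[R]_n)%type.
Variables (E : T -> R) (G : T -> 'rV[R]_n) (e0 : 'rV[R]_n) (al be rho : R).
Hypothesis ab : al <= be.
Hypothesis rho0 : 0 < rho.
Hypothesis cE : forall t z, al <= t <= be -> `|z - e0| < rho -> {for (t, z), continuous E}.
Hypothesis cG : forall t z, al <= t <= be -> `|z - e0| < rho -> {for (t, z), continuous G}.
Hypothesis E0 : forall t, al <= t <= be -> E (t, e0) = 0.
Hypothesis decE : forall t z, al <= t <= be -> `|z - e0| < rho -> z <> e0 ->
  E (t, G (t, z)) < E (t, z).
Hypothesis G0 : forall t, al <= t <= be -> G (t, e0) = e0.

Lemma tube (K : set 'rV[R]_n) (c : R) (F : T -> R) (a b : R) : compact K ->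
  (forall t z, a <= t <= b -> K z -> {for (t, z), continuous F}) ->
  (forall z, K z -> F (a, z) < c) -> a <= b ->
  exists2 d, 0 < d & forall t z, a <= t < a + d -> t <= b -> K z -> F (t, z) < c.
Proof.
move=> cK cF Fa ab'.
have := (compact_near_coveringP K).1 cK R (nbhs a) (fun t z => F (t, z) < c) _.
case=> [x Kx|d /= d0 Hd].
  have N : \forall y \near (a, x), F y < c.
    have aab : a <= a <= b by lra.
    exact: (near_continuous (cF a x aab Kx) (@open_lt _ c) (Fa x Kx)).
  have cs : {for (x, a), continuous (fun y : 'rV[R]_n * R => (y.2, y.1))}.
    by apply: cont_pair; [exact: cont_snd|exact: cont_fst].
  exact: (near_comp cs N).
exists d => // t z ta tb Kz; apply: (Hd t) => //.
by rewrite /ball_ /= ltr_norml; lra.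
Qed.

Lemma tube0 (c : R) (F : T -> R) :
  (forall t, al <= t <= be -> {for (t, e0), continuous F}) ->
  (forall t, al <= t <= be -> F (t, e0) < c) ->
  exists2 d, 0 < d & forall t z, al <= t <= be -> `|z - e0| < d -> F (t, z) < c.
Proof.
move=> cF Fc.
have := (compact_near_coveringP `[al, be]%classic).1 (@segment_compact R al be) _ (nbhs e0)
  (fun z t => F (t, z) < c) _.
move=> H; have /near_eps[d d0 Hd] : \forall z \near e0, `[al, be]%classic `<=` (fun t => F (t, z) < c).
  apply: H => t /=; rewrite in_itv /= => t1.
  have N : \forall y \near (t, e0), F y < c.
    exact: (near_continuous (cF t t1) (@open_lt _ c) (Fc t t1)).
  by apply: filterS N => -[].
by exists d => // t z t1 zd; apply: (Hd z zd); rewrite /= in_itv.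
Qed.

Lemma annulus_compact (r s : R) : compact [set z : 'rV[R]_n | r <= `|z - e0| <= s].
Proof.
apply: (subclosed_compact _ (@cball_compact R n e0 s)) => [|z /= /andP[]//].
have -> : [set z : 'rV[R]_n | r <= `|z - e0| <= s] =
   (fun z => `|z - e0|) @^-1` [set x | r <= x] `&` (fun z => `|z - e0|) @^-1` [set x | x <= s].
  by apply/seteqP; split=> z /=; [move=> /andP[]|move=> [-> ->]].
by apply: closedI; apply: closed_comp; [move=> z _; exact: cont_dist|exact: closed_ge
  |move=> z _; exact: cont_dist|exact: closed_le].
Qed.

Lemma annulus_min (F : T -> R) (a b r s : R) :
  (forall t z, a <= t <= b -> r <= `|z - e0| <= s -> {for (t, z), continuous F}) ->
  (forall t z, a <= t <= b -> r <= `|z - e0| <= s -> 0 < F (t, z)) ->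
  exists2 m, 0 < m & forall t z, a <= t <= b -> r <= `|z - e0| <= s -> m <= F (t, z).
Proof.
move=> cF Fp; pose K := (`[a, b]%classic `*` [set z : 'rV[R]_n | r <= `|z - e0| <= s])%classic.
have cK : compact K by apply: compact_setX; [exact: segment_compact|exact: annulus_compact].
(* The product of the time interval with the annulus may be empty; any positive bound then works. *)
have [K0|nK] := pselect (K !=set0); last first.
  exists 1 => // t z t1 zr; exfalso; apply: nK; exists (t, z); split=> //=; by rewrite in_itv.
have KP t z : K (t, z) -> a <= t <= b /\ r <= `|z - e0| <= s.
  by move=> [/= t1 zr]; split=> //; move: t1; rewrite in_itv.
have [|[t z] /set_mem /KP[t1 zr] Hc] := compact_EVT_min K0 cK (f := F).
  by apply: continuous_in_subspaceT => -[t z] /set_mem /KP[t1 zr]; exact: cF.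
exists (F (t, z)); first exact: Fp.
move=> t' z' t1' zr'; apply: Hc; apply/mem_set; split=> //=; by rewrite in_itv.
Qed.

Lemma small_G (s : R) : 0 < s -> exists r, [/\ 0 < r, r < s &
  forall t z, al <= t <= be -> `|z - e0| <= r -> `|G (t, z) - e0| < s].
Proof.
move=> s0; have [||d d0 Hd] := @tube0 s (fun x => `|G x - e0|).
- move=> t t1; have cGt : {for (t, e0), continuous G} by apply: cG => //; rewrite subrr normr0.
  exact: (cont_norm (contB cGt (contC e0 (t, e0)))).
- by move=> t t1; rewrite G0 // subrr normr0.
exists (Num.min (d / 2) (s / 2)); split; first by rewrite lt_min !divr_gt0.
  by apply: (@le_lt_trans _ _ (s / 2)); [rewrite ge_min lexx orbT|lra].
move=> t z t1; rewrite le_min => /andP[zd _]; apply: Hd => //; lra.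
Qed.

Lemma cE2 t z : al <= t <= be -> `|z - e0| < rho -> {for z, continuous (fun z => E (t, z))}.
Proof.
move=> t1 zr; apply: (continuous_comp (f := fun z : 'rV[R]_n => (t, z)) (g := E)); last exact: cE.
by apply: cont_pair; [exact: cont_cst|exact: cont_id].
Qed.

Lemma cG2 t z : al <= t <= be -> `|z - e0| < rho -> {for z, continuous (fun z => G (t, z))}.
Proof.
move=> t1 zr; apply: (continuous_comp (f := fun z : 'rV[R]_n => (t, z)) (g := G)); last exact: cG.
by apply: cont_pair; [exact: cont_cst|exact: cont_id].
Qed.

Definition loc_min t := exists2 r, 0 < r & forall z, `|z - e0| < r -> 0 <= E (t, z).

(* Discrete mountain pass: the points of a small ball whose orbit under G falls
   into the basin of [e0], and those whose orbit reaches a negative value of E,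
   form two disjoint open sets covering the ball. *)
Lemma uniform_radius : exists r0, [/\ 0 < r0, r0 < rho & forall t, al <= t <= be -> loc_min t ->
  forall z, `|z - e0| < r0 -> 0 <= E (t, z)].
Proof.
have [r1 [r10 r1rho H1]] := small_G rho0.
have [r2 [r20 r21 H2]] := small_G r10.
(* An orbit that leaves the ball of radius [r2] first lands before [r1], and a step from this
   annulus costs at least [eta]. An orbit that starts below [eta] and leaves therefore reaches a
   negative value. *)
have [||eta eta0 Heta] := @annulus_min (fun x => E x - E (x.1, G x)) al be r2 r1.
- move=> t z t1 /andP[_ zr]; have zrho : `|z - e0| < rho by lra.
  apply: (contB (cE t1 zrho)).
  have h : `|G (t, z) - e0| < rho by apply: H1.
  apply: (continuous_comp (f := fun x : T => (x.1, G x)) (g := E)); last exact: cE.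
  by apply: cont_pair; [exact: cont_fst|exact: cG].
- move=> t z t1 /andP[zr zr']; rewrite subr_gt0 /=; apply: decE => //; first lra.
  by move=> ze; move: zr; rewrite ze subrr normr0; lra.
have [||r3 r30 H3] := @tube0 eta E.
- by move=> t t1; apply: cE => //; rewrite subrr normr0.
- by move=> t t1; rewrite E0.
pose r0 := Num.min r3 r2; have r0le3 : r0 <= r3 by rewrite /r0 ge_min lexx.
have r0le2 : r0 <= r2 by rewrite /r0 ge_min lexx orbT.
exists r0; split; [by rewrite /r0 lt_min r30|lra|].
move=> t t1 [r r0' Hr] z1 z1r; rewrite leNgt; apply/negP => Ez1.
pose g z := G (t, z); pose f z := E (t, z).
have cf z : `|z - e0| < rho -> {for z, continuous f} by exact: cE2.
have cg z : `|z - e0| < rho -> {for z, continuous g} by exact: cG2.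
have dec z : `|z - e0| < rho -> f (g z) <= f z.
  move=> zr; have [->|/eqP ze] := eqVneq z e0; first by rewrite /g G0.
  by rewrite ltW //; exact: decE.
pose rr := Num.min r rho.
have rrr : rr <= r by rewrite /rr ge_min lexx.
have rrrho : rr <= rho by rewrite /rr ge_min lexx orbT.
have [s1 [s10 s1r S1]] := @small_G rr (ltac:(by rewrite /rr lt_min r0')).
have [s2 [s20 s21 S2]] := small_G s10.
have fpos z : `|z - e0| <= s1 -> z <> e0 -> 0 < f z.
  move=> zs ze; apply: (@le_lt_trans _ _ (f (g z))); last by apply: decE => //; lra_of zs s1r rrrho.
  by apply: Hr; have := S1 t z t1 zs; lra_of rrr.
have [||m m0 Hm] := @annulus_min E t t s2 s1.
- by move=> t' z t1' zs; apply: cE; [lra_of t1 t1'|lra_of zs s1r rrrho].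
- move=> t' z t1' zs; have -> : t' = t by lra_of t1'.
  apply: fpos; first by lra_of zs.
  by move=> ze; move: zs; rewrite ze subrr normr0; lra_of s20.
(* A trapping region: a step from [V] stays within [s1] and cannot land in the annulus from [s2] to
   [s1], where [E >= m]. *)
pose V z := `|z - e0| < s2 /\ f z < m.
have Vstab z : V z -> V (g z).
  move=> [zs fz]; have zr : `|z - e0| < rho by lra_of zs s21 s1r rrrho.
  have h1 : `|g z - e0| < s1 by apply: S2 => //; exact: ltW.
  have h2 := dec z zr; split; last by lra_of fz h2.
  rewrite ltNge; apply/negP => h3.
  have := Hm t (g z) ltac:(by rewrite lexx) ltac:(lra_of h1 h3); rewrite -/(f (g z)); lra_of fz h2 h3.
have Vpos z : V z -> 0 <= f z by move=> [zs _]; apply: Hr; lra_of zs s21 s1r rrr.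
have e0rho : `|e0 - e0| < rho by rewrite subrr normr0.
have Ve0 : V e0 by split; rewrite ?subrr ?normr0 // /f E0.
pose it k z := iter k g z.
have itdec k z : (forall i, (i < k)%N -> `|it i z - e0| < rho) -> f (it k z) <= f z.
  elim: k => [_ //|k IH H]; apply: le_trans (dec _ (H k (ltnSn k))) _.
  by apply: IH => i ik; apply: H; exact: ltnW.
pose U1 z := exists2 k, forall i, (i < k)%N -> `|it i z - e0| < rho & V (it k z).
pose U2 z := exists2 k, forall i, (i <= k)%N -> `|it i z - e0| < rho & f (it k z) < 0.
have ito k z : (forall i, (i < k)%N -> `|it i z - e0| < rho) -> {for z, continuous (it k)}.
  elim: k => [_|k IH H]; first exact: cont_id.
  apply: (continuous_comp (f := it k) (g := g)); first by apply: IH => i ik; apply: H; exact: ltnW.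
  exact: cg (H k (ltnSn k)).
have cn (z : 'rV[R]_n) : {for z, continuous (fun z : 'rV[R]_n => `|z - e0|)} by exact: cont_dist.
have nearit k z : (forall i, (i < k)%N -> `|it i z - e0| < rho) ->
    \forall y \near z, forall i, (i < k)%N -> `|it i y - e0| < rho.
  elim: k => [_|k IH H]; first by near=> y => i.
  have N1 := IH (fun i ik => H i (ltnW ik)).
  have ck := ito k z (fun i ik => H i (ltnW ik)).
  have N2 : \forall y \near it k z, `|y - e0| < rho.
    exact: (near_continuous (cn _) (@open_lt _ rho) (H k (ltnSn k))).
  apply: filterS2 N1 (near_comp ck N2) => y Hy1 Hy2 i.
  by rewrite ltnS leq_eqVlt => /predU1P[->|] //; exact: Hy1.
have U1o z : U1 z -> \forall y \near z, U1 y.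
  move=> [k Hk [v1 v2]]; have N1 := nearit k z Hk; have ck := ito k z Hk.
  have N2 : \forall y \near it k z, `|y - e0| < s2.
    exact: (near_continuous (cn _) (@open_lt _ s2) v1).
  have N3 : \forall y \near it k z, f y < m.
    by apply: (near_continuous (cf _ _) (@open_lt _ m) v2); lra_of v1 s21 s1r rrrho.
  apply: filterS3 N1 (near_comp ck N2) (near_comp ck N3) => y h1 h2 h3.
  by exists k.
have U2o z : U2 z -> \forall y \near z, U2 y.
  move=> [k Hk v]; have N1 := nearit k.+1 z Hk.
  have ck := ito k z (fun i ik => Hk i (ltnW ik)).
  have N3 : \forall y \near it k z, f y < 0.
    by apply: (near_continuous (cf _ _) (@open_lt _ 0) v); exact: Hk.
  by apply: filterS2 N1 (near_comp ck N3) => y h1 h2; exists k.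
have U12 z : U1 z -> U2 z -> False.
  move=> [k Hk Vk] [j Hj fj].
  have : 0 <= f (it j z).
    have [kj|jk] := leqP k j.
      apply: Vpos; rewrite -(subnKC kj); elim: (j - k)%N => [|i IH]; first by rewrite addn0.
      by rewrite addnS; exact: Vstab.
    apply: le_trans (Vpos _ Vk) _; rewrite -(subnK (ltnW jk)) /it iterD; apply: itdec => i ij.
    by rewrite /it -iterD; apply: Hk; rewrite -(subnK (ltnW jk)) ltn_add2r.
  lra_of fj.
have cover z : `|z - e0| < r0 -> U1 z \/ U2 z.
  move=> zr; have fz : f z < eta by apply: H3 => //; lra_of zr r0le3.
  have [[j Hj]|stay] := pselect (exists j, r2 <= `|it j z - e0|).
    right; have exj : exists j, r2 <= `|it j z - e0| by exists j.
    have [k kr kmin] := find_ex_minn exj.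
    have kb i : (i < k)%N -> `|it i z - e0| < r2.
      by move=> ik; rewrite ltNge; apply/negP => /kmin; rewrite leqNgt ik.
    have k0 : (0 < k)%N by case: (k) kr => //=; lra_of zr r0le2.
    have kr1 : `|it k z - e0| < r1.
      by rewrite -(prednK k0) /it /=; apply: H2 => //; apply/ltW/kb; rewrite prednK.
    have kall i : (i < k.+1)%N -> `|it i z - e0| < rho.
      by rewrite ltnS leq_eqVlt => /predU1P[->|/kb]; lra_of kr1 r1rho r21.
    exists k.+1.
      move=> i; rewrite leq_eqVlt => /predU1P[->|]; last exact: kall.
      by rewrite /it /=; apply: H1 => //; exact: ltW.
    have := Heta t (it k z) t1 ltac:(lra_of kr kr1); rewrite /= -/(g _) -/(f _) -/(f _) -/(it k.+1 z).
    have := itdec k z (fun i ik => kall i (ltnW ik)); lra_of fz.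
  have {}stay j : `|it j z - e0| < r2 by rewrite ltNge; apply/negP => h; apply: stay; exists j.
  have srho j : `|it j z - e0| < rho by have := stay j; lra_of r21 r1rho.
  have [[k fk]|fnn] := pselect (exists k, f (it k z) < 0); first by right; exists k.
  have {}fnn k : 0 <= f (it k z) by rewrite leNgt; apply/negP => h; apply: fnn; exists k.
  (* An orbit that remains in the ball, keeps [E >= 0] and never enters [V] stays away from [e0];
     each step then lowers [E] by a fixed amount, which cannot go on forever. *)
  left; apply: contrapT => nU1.
  have nV k : ~ V (it k z) by move=> Vk; apply: nU1; exists k.
  have [s30 [s300 H30]] : exists s3, 0 < s3 /\ forall z, `|z - e0| < s3 -> V z.
    have N1 : \forall y \near e0, `|y - e0| < s2 by apply/near_eps; exists s2.
    have N2 : \forall y \near e0, f y < m.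
      by apply: (near_continuous (cf _ e0rho) (@open_lt _ m)); rewrite /= /f E0.
    have : \forall y \near e0, V y by apply: filterS2 N1 N2 => y.
    by move=> /near_eps[d d0 Hd]; exists d.
  have [||th th0 Hth] := @annulus_min (fun x => E x - E (x.1, G x)) t t s30 r2.
  - move=> t' z' t1' zr'; have zrho : `|z' - e0| < rho by lra_of zr' r21 r1rho.
    have t1'' : al <= t' <= be by lra_of t1 t1'.
    apply: (contB (cE t1'' zrho)).
    have h : `|G (t', z') - e0| < rho by apply: H1 => //; lra_of zr' r21.
    apply: (continuous_comp (f := fun x : T => (x.1, G x)) (g := E)); last exact: cE.
    by apply: cont_pair; [exact: cont_fst|exact: cG].
  - move=> t' z' t1' zr'; rewrite subr_gt0 /=; apply: decE; [lra_of t1 t1'|lra_of zr' r21 r1rho|].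
    by move=> ze; move: zr'; rewrite ze subrr normr0; lra_of s300.
  have drop k : f (it k z) <= f z - k%:R * th.
    elim: k => [|k IH]; first by rewrite mul0r subr0.
    have h : s30 <= `|it k z - e0| by rewrite leNgt; apply/negP => /H30; exact: nV.
    have := Hth t (it k z) ltac:(by rewrite lexx) ltac:(by have := stay k; lra_of h).
    rewrite /= -/(g _) -/(f _) -/(f _) -/(it k.+1 z) -natr1; lra_of IH.
  have := drop (Num.truncn (f z / th)).+1; have := fnn (Num.truncn (f z / th)).+1.
  have : f z / th < (Num.truncn (f z / th)).+1%:R by exact: truncnS_gt.
  by rewrite ltr_pdivrMr //; lra_of th0.
(* The segment from [e0] to [z1] starts in [U1] and cannot pass into the disjoint open set [U2]. So
   the orbit of [z1] ends in the trapping region, where [E >= 0], although [E] was already negative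
   at [z1]. *)
pose ze (s : R) := e0 + s *: (z1 - e0).
have zer s : 0 <= s <= 1 -> `|ze s - e0| < r0.
  move=> s1'; rewrite /ze addrAC subrr add0r normrZ.
  apply: le_lt_trans z1r; have /andP[s0 s1''] := s1'; rewrite ger0_norm // ler_piMl //.
have cze s : {for s, continuous ze} by exact: (der_continuous (der_line _ _ s)).
have HU1 : forall s, 0 <= s <= 1 -> U1 (ze s).
  apply: real_induction => //.
  - by exists 0%N => //; rewrite /ze scale0r addr0.
  - move=> s s1' HU.
    have /near_eps[d d0 Hd] := near_comp (cze s) (U1o _ (HU s ltac:(lra_of s1'))).
    by exists d => // s' ss' _; apply: Hd; rewrite ltr_norml; lra_of ss' d0.
  - move=> s s1' HU; have [//|HU2] := cover _ (zer s ltac:(lra_of s1')).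
    have /near_eps[d d0 Hd] := near_comp (cze s) (U2o _ HU2).
    pose s' := Num.max 0 (s - d / 2).
    have h1 : 0 <= s' by rewrite /s' le_max lexx.
    have h2 : s - d / 2 <= s' by rewrite /s' le_max lexx orbT.
    have h3 : s' < s by rewrite /s' gt_max; lra_of s1' d0.
    exfalso; apply: (U12 (ze s')); first by apply: HU; lra_of h1 h3.
    by apply: Hd; rewrite ltr_norml; lra_of h2 h3 d0.
have [k Hk Vk] := HU1 1 itv1; rewrite /ze scale1r addrC subrK in Hk Vk.
have := itdec k z1 Hk; have := Vpos _ Vk; rewrite -/(f z1) in Ez1; lra_of Ez1.
Unshelve. all: by end_near. Qed.

(** [uniform_radius] turns a local minimum into nonnegativity on one ball for all times, a condition
    that passes to limits in [t]. To go past [t], one more descent step makes the minimum at [t]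
    strict on an annulus, and strictness survives for a short time. *)
Lemma local_min_persists : loc_min al -> loc_min be.
Proof.
have ab' := ab; have rho0' := rho0.
move=> lal; have [r0 [r00 r0rho H0]] := uniform_radius.
have Ht : forall t, al <= t <= be -> forall z, `|z - e0| < r0 -> 0 <= E (t, z).
  apply: real_induction => //.
  - by apply: H0 => //; lra.
  - move=> t t1 H; have t1' : al <= t <= be by lra.
    have [s1 [s10 s1r S1]] := small_G r00.
    have [s2 [s20 s21 S2]] := small_G s10.
    have fpos z : `|z - e0| <= s1 -> z <> e0 -> 0 < E (t, z).
      move=> zs ze; apply: (@le_lt_trans _ _ (E (t, G (t, z)))); last by apply: decE => //; lra.
      by apply: H; [lra|exact: S1].
    have [|||d d0 Hd] := @tube _ 0 (fun x => - E x) t be (@annulus_compact s2 s1).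
    + by move=> t' z tt' /= zs; apply: contN; apply: cE; lra.
    + move=> z /= zs; rewrite oppr_lt0; apply: fpos; first lra.
      by move=> ze; move: zs; rewrite ze subrr normr0; lra_of s20.
    + lra.
    exists d => // t' tt' t'b; have t1'' : al <= t' <= be by lra.
    apply: H0 => //; exists s2 => // z zs.
    (* A minimizer with negative value would lie inside the annulus, and [G] would lower the value
       further within the ball. *)
    have [|c cs Hc] := @cball_min R n (fun z => E (t', z)) e0 s1 (ltW s10).
      by move=> u us; apply: cE2 => //; lra.
    apply: le_trans (Hc z ltac:(lra)); rewrite leNgt; apply/negP => Ec.
    have cs2 : `|c - e0| < s2.
      rewrite ltNge; apply/negP => h; have := Hd t' c ltac:(lra) t'b.
      by rewrite /= h cs oppr_lt0 => /(_ isT); lra.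
    have ce : c <> e0 by move=> ce; move: Ec; rewrite ce E0 // ltxx.
    have := decE t1'' (ltac:(lra) : `|c - e0| < rho) ce.
    by have := Hc (G (t', c)) (ltW (S2 t' c t1'' (ltW cs2))); lra.
  - move=> t t1 H z zr; have t1' : al <= t <= be by lra.
    rewrite leNgt; apply/negP => Ez.
    have ct : {for t, continuous (fun t => E (t, z))}.
      apply: (continuous_comp (f := fun t : R => (t, z)) (g := E)); last by apply: cE => //; lra.
      by apply: cont_pair; [exact: cont_id|exact: cont_cst].
    have /near_eps[d d0 Hd] := near_continuous ct (@open_lt _ 0) Ez.
    pose s' := Num.max al (t - d / 2).
    have h1 : al <= s' by rewrite /s' le_max lexx.
    have h2 : t - d / 2 <= s' by rewrite /s' le_max lexx orbT.
    have h3 : s' < t by rewrite /s' gt_max; lra.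
    have := H s' ltac:(lra) z zr; have := Hd s' ltac:(rewrite ltr_norml; lra).
    by rewrite /=; lra.
by exists r0 => //; apply: Ht; lra.
Qed.

End local_min.

Lemma near_cov {X Y Z : topologicalType} (K : set X) (y : Y) (F : X * Y -> Z) (A : set Z) :
  compact K -> (forall x, K x -> {for (x, y), continuous F}) -> open A ->
  (forall x, K x -> A (F (x, y))) -> \forall y' \near y, forall x, K x -> A (F (x, y')).
Proof.
move=> cK cF oA FA.
have H := (compact_near_coveringP K).1 cK _ (nbhs y) (fun y' x => A (F (x, y'))) _.
apply: H => x Kx; have N := near_continuous (cF x Kx) oA (FA x Kx).
by apply: filterS N => -[].
Qed.

Lemma near_eps_cont {R : realType} {T : topologicalType} {V : normedModType R} (f : T -> V) x :
  (forall e, 0 < e -> \forall y \near x, `|f y - f x| < e) -> {for x, continuous f}.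
Proof.
by move=> H; apply/cvgrPdist_lt => e /H; apply: filterS => y; rewrite distrC.
Qed.

Lemma cont_near_eps {R : realType} {T : topologicalType} {V : normedModType R} (f : T -> V) x e :
  {for x, continuous f} -> 0 < e -> \forall y \near x, `|f y - f x| < e.
Proof.
by move=> /cvgrPdist_lt cf /cf; apply: filterS => y; rewrite distrC.
Qed.

Lemma cont_fst_fst {A B C : topologicalType} (y : A * B * C) :
  {for y, continuous (fun z : A * B * C => z.1.1)}.
Proof. by apply: (cont_comp (f := fun z : A * B * C => z.1) (g := fun z : A * B => z.1)); exact: cont_fst. Qed.

Lemma cont_fst_snd {A B C : topologicalType} (y : A * B * C) :
  {for y, continuous (fun z : A * B * C => z.1.2)}.
Proof.
apply: (cont_comp (f := fun z : A * B * C => z.1) (g := fun z : A * B => z.2)).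
  exact: cont_fst.
exact: cont_snd.
Qed.

(** * Continuity of short geodesics and the descent step *)

Section distance.
Context {R : realType} {n : nat} (M : riemannian_manifold R n).
Implicit Types (p q x y z w : M).
Hypothesis UG : uniquely_geodesic M.
Local Notation sg := (sg UG).

Section in_nice.
Variables (q : M) (rho C lam D : R).
Hypothesis Hn : nice q rho C lam D.
Let V := Vs q D.

Lemma near_V (T : topologicalType) (f : T -> M) t : {for t, continuous f} -> V (f t) ->
  \forall s \near t, V (f s).
Proof. by move=> cf Vf; exact: (near_continuous cf (@Vs_open _ _ _ q D) Vf). Qed.

Lemma near_chart_eps (T : topologicalType) (f : T -> M) t e : {for t, continuous f} -> V (f t) ->
  0 < e -> \forall s \near t, `|chart q (f s) - chart q (f t)| < e.
Proof.
move=> cf [qf _] e0; apply: cont_near_eps => //.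
by apply: (cont_comp cf); exact: chart_continuous.
Qed.

Lemma nice_gdist_cont x y : V x -> V y ->
  {for (x, y), continuous (fun z : M * M => gdist z.1 z.2)}.
Proof.
move=> Vx Vy.
have c2 : {for (x, y), continuous (fun z : M * M => gdist z.1 z.2 ^+ 2)}.
  apply: near_eps_cont => e e0.
  have C0 : 0 < 9 * C by have := b_C (n_B Hn); lra.
  have d0 : 0 < e / (9 * C) / 2 by rewrite !divr_gt0.
  have N1 := near_V (@cont_fst M M (x, y)) Vx; have N2 := near_V (@cont_snd M M (x, y)) Vy.
  have N3 := near_chart_eps (@cont_fst M M (x, y)) Vx d0.
  have N4 := near_chart_eps (@cont_snd M M (x, y)) Vy d0.
  apply: filterS2 (filterI N1 N2) (filterI N3 N4) => -[x' y'] /= [Vx' Vy'] [dx dy].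
  have [_ h] := nice_lip UG Hn Vx Vy Vx' Vy' itv0.
  apply: (le_lt_trans h); rewrite mulrC -ltr_pdivlMr //.
  by move: dx dy; lra.
have -> : (fun z : M * M => gdist z.1 z.2) = (fun z : M * M => Num.sqrt (gdist z.1 z.2 ^+ 2)).
  by apply/funext => z; rewrite sqrtr_sqr ger0_norm // gdist_ge0.
apply: (cont_comp c2); exact: sqrt_continuous.
Qed.

Lemma nice_sg_cont x y t : V x -> V y -> 0 < t < 1 ->
  {for (x, y, t), continuous (fun z : M * M * R => sg z.1.1 z.1.2 z.2)}.
Proof.
move=> Vx Vy t1; have t1' : 0 <= t <= 1 by lra.
pose f1 (z : M * M * R) := z.1.1; pose f2 (z : M * M * R) := z.1.2.
pose f3 (z : M * M * R) := z.2.
have cf1 : {for (x, y, t), continuous f1} by exact: cont_fst_fst.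
have cf2 : {for (x, y, t), continuous f2} by exact: cont_fst_snd.
have cf3 : {for (x, y, t), continuous f3} by exact: cont_snd.
have Nt : \forall z \near (x, y, t), 0 < f3 z < 1.
  have N : \forall s \near t, 0 < s < 1.
    apply/near_eps; exists (Num.min t (1 - t)); first by rewrite lt_min; lra.
    by move=> s; rewrite lt_min !ltr_norml; lra.
  exact: (near_comp cf3 N).
have N12 : \forall z \near (x, y, t), V (f1 z) /\ V (f2 z).
  by apply: filterS2 (near_V cf1 Vx) (near_V cf2 Vy).
pose h (z : M * M * R) := chart q (sg (f1 z) (f2 z) (f3 z)).
have [qs _] := nice_ball UG Hn Vx Vy t1'.
have ch : {for (x, y, t), continuous h}.
  apply: near_eps_cont => e e0.
  have e3 : 0 < e / 30 by rewrite divr_gt0.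
  have N3 := near_chart_eps cf1 Vx e3; have N4 := near_chart_eps cf2 Vy e3.
  have cgt : {for (x, y, t), continuous (fun z : M * M * R => chart q (sg x y (f3 z)))}.
    have cs : {for t, continuous (sg x y)}.
      by apply: geodesic_continuous t1'; case: (sgP UG x y).
    have cs' : {for t, continuous (fun s => chart q (sg x y s))}.
      by apply: (cont_comp cs); exact: chart_continuous.
    exact: (@cont_comp _ _ _ f3 (fun s => chart q (sg x y s)) _ cf3 cs').
  have N5 := cont_near_eps cgt (divr_gt0 e0 (ltac:(by []) : 0 < 2 :> R)).
  apply: filterS3 (filterI Nt N12) (filterI N3 N4) N5 => z [zt [V1 V2]] [dx dy] dt.
  rewrite /h (_ : _ - _ = (chart q (sg (f1 z) (f2 z) (f3 z)) - chart q (sg x y (f3 z)))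
    + (chart q (sg x y (f3 z)) - chart q (sg x y t))); last by rewrite addrA subrK.
  apply: (le_lt_trans (ler_normD _ _)).
  have [h1 _] := nice_lip UG Hn Vx Vy V1 V2 (ltac:(lra) : 0 <= f3 z <= 1).
  by move: dx dy dt h1; rewrite /f3 /=; lra_of e0.
have ci : {for (x, y, t), continuous (fun z : M * M * R => chart_inv q (h z))}.
  by apply: (cont_comp ch); apply: chart_inv_cont; exact: img_chart.
have NE : \forall z \near (x, y, t), chart_inv q (h z) = sg z.1.1 z.1.2 z.2.
  apply: filterS2 Nt N12 => z zt [V1 V2]; rewrite /h chartK //.
  by have [] := nice_ball UG Hn V1 V2 (ltac:(lra) : 0 <= f3 z <= 1).
exact: (near_eq_continuous NE ci).
Qed.

End in_nice.

(** The geodesics from [p] to [z] and from [w] to [y] overlap between [w] and [z], where both are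
    the geodesic from [w] to [z], so they glue. The result passes [z] at time 1 and [y] at time
    [th + (1 - th) / f]. *)
Lemma sg_concat p z w y th f : 0 < th < 1 -> 0 < f < 1 -> w = sg p z th -> z = sg w y f ->
  z = sg p y (th + (1 - th) / f)^-1.
Proof.
move=> th1 f1 wE zE; pose r1 := th + (1 - th) / f.
have k0 : 0 < (1 - th) / f by rewrite divr_gt0; lra.
have r1g : 1 < r1.
  have : 1 - th < (1 - th) / f by rewrite ltr_pdivlMr ?gtr_pMr; lra.
  by rewrite /r1; lra.
have [g1 c0 c1] := sgP UG p z; have [g2 d0 d1] := sgP UG w y.
pose c2 (r : R) := sg w y ((f / (1 - th)) * r + - (th * (f / (1 - th)))).
have c2E r : c2 r = sg w y ((r - th) * (f / (1 - th))) by rewrite /c2; congr sg; ring.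
have kf : ((1 - th) / f) * (f / (1 - th)) = 1 by field; rewrite !gt_eqF; lra.
have kp : 0 < f / (1 - th) by rewrite divr_gt0; lra.
have gc2 : geod_on c2 th r1.
  apply: (@geod_on_affine _ _ M (sg w y) 0 1) => // r rr.
  have -> : f / (1 - th) * r + - (th * (f / (1 - th))) = (r - th) * (f / (1 - th)) by ring.
  have h1 : 0 <= (r - th) * (f / (1 - th)) by rewrite mulr_ge0; lra.
  have h2 : (r - th) * (f / (1 - th)) <= (r1 - th) * (f / (1 - th)) by rewrite ler_pM2r; lra.
  by move: h2; rewrite /r1 (addrC th) addrK kf; lra.
have E r : th <= r <= 1 -> sg p z r = c2 r.
  move=> rr; rewrite c2E; pose s := (r - th) / (1 - th).
  have s1 : 0 <= s <= 1 by rewrite /s divr_ge0 ?ler_pdivrMr /=; lra_of th1 rr.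
  have h1 := sg_sub UG p z (_ : 0 <= th <= 1) (@itv1 R) s1.
  rewrite sg1 -wE (_ : (1 - th) * s + th = r) in h1; last by rewrite /s; field; rewrite gt_eqF; lra.
  have h2 := sg_sub UG w y (@itv0 R) (_ : 0 <= f <= 1) s1.
  rewrite sg0 -zE (_ : (f - 0) * s + 0 = (r - th) * (f / (1 - th))) in h2; last by rewrite /s; ring.
  by rewrite -h1 ?h2 //; lra_of th1 f1.
have [||||||c [gc cE1 cE2]] := @geodesic_glue _ _ M (sg p z) c2 0 r1 th 1.
- lra.
- lra.
- lra.
- by move=> r rr; apply: g1.
- exact: gc2.
- exact: E.
have gg : geodesic_from_to (fun s => c (r1 * s + 0)) p y.
  split.
  - by apply: (@geod_on_affine _ _ M c 0 r1) => // r rr; nra.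
  - by rewrite mulr0 addr0 cE1 ?sg0 //; try lra; left; lra.
  - rewrite mulr1 addr0 cE2; last lra.
    by rewrite c2E /r1 (addrC th) addrK kf sg1.
have r1V : 0 <= r1^-1 <= 1 by rewrite invr_ge0 invf_le1; lra.
rewrite -/r1 (sg_unique UG gg r1V) addr0 mulfV ?gt_eqF //; last lra.
by rewrite cE1 ?sg1 //; try lra; right; lra.
Qed.

(** One step of the descent for the two-piece energy. On a clock that shows [th * a] at [w] and [t]
    at [y], the fraction [f] is where it shows [a]. Straightening the path from [w] through [z] to
    [y] lowers the energy by [two_piece]. If nothing is gained, [z] is already on the geodesic from
    [w] to [y], and [sg_concat] applies. *)
Lemma dec_step q rho C lam D (Hn : nice q rho C lam D) p z w y z' a t th f :
  0 < a < t -> 0 < th < 1 -> f = (1 - th) * a / (t - th * a) ->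
  w = sg p z th -> z' = sg w y f -> Vs q D w -> Vs q D z -> Vs q D y ->
  gdist p z' <= gdist p w + gdist w z' ->
  gdist p z' ^+ 2 / a + gdist z' y ^+ 2 / (t - a) <= gdist p z ^+ 2 / a + gdist z y ^+ 2 / (t - a)
  /\ (gdist p z ^+ 2 / a + gdist z y ^+ 2 / (t - a) <=
      gdist p z' ^+ 2 / a + gdist z' y ^+ 2 / (t - a) -> z = sg p y (a / t)).
Proof.
move=> a1 th1 fE wE z'E Vw Vz Vy tri.
have a0 : 0 < a by lra.
have t0 : 0 < t by lra.
have T0 : 0 < t - th * a by nra.
have ta0 : 0 < t - a by lra.
have tha : 0 < 1 - th by lra.
have th0 : 0 < th by lra.
have fp : 0 < f by rewrite fE divr_gt0 // mulr_gt0.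
have f1E : 1 - f = (t - a) / (t - th * a) by rewrite fE; field; rewrite gt_eqF.
have f1p : 0 < 1 - f by rewrite f1E divr_gt0.
have f1 : 0 < f < 1 by lra.
have f1' : 0 <= f <= 1 by lra.
have th1' : 0 <= th <= 1 by lra.
set d := gdist p z; set L := gdist w y; set d2 := gdist z y.
have d0 : 0 <= d by exact: gdist_ge0.
have L0 : 0 <= L by exact: gdist_ge0.
have e1 : gdist p w = th * d.
  by have := gdist_sg UG p z itv0 th1'; rewrite sg0 -wE subr0 ger0_norm //; lra_of th1.
have e2 : gdist w z = (1 - th) * d.
  by have := gdist_sg UG p z th1' itv1; rewrite sg1 -wE ger0_norm //; lra.
have e3 : gdist w z' = f * L.
  by have := gdist_sg UG w y itv0 f1'; rewrite sg0 -z'E subr0 ger0_norm //; lra_of fp.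
have e4 : gdist z' y = (1 - f) * L.
  by have := gdist_sg UG w y f1' itv1; rewrite sg1 -z'E ger0_norm //; lra_of f1p.
have [tp1 tp2] := two_piece UG Hn Vw Vz Vy f1.
rewrite -/L -/d2 e2 in tp1 tp2.
rewrite e1 e3 in tri; rewrite e4.
have X0 : 0 <= th * d + f * L by rewrite addr_ge0 // mulr_ge0 //; lra_of fp th1.
have s1 : gdist p z' ^+ 2 <= (th * d + f * L) ^+ 2 by rewrite ler_sqr ?nnegrE ?gdist_ge0.
(* Convexity of the square, with weights [th] and [1 - th], for the path from [p] through [w] to
   [z']. *)
have s2 : (th * d + f * L) ^+ 2 <= th * d ^+ 2 + (f * L) ^+ 2 / (1 - th).
  rewrite -subr_ge0 (_ : _ - _ = th / (1 - th) * ((1 - th) * d - f * L) ^+ 2).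
    by rewrite mulr_ge0 ?sqr_ge0 // divr_ge0 // ltW.
  by field; rewrite gt_eqF.
have s3 : gdist p z' ^+ 2 / a <= (th * d ^+ 2 + (f * L) ^+ 2 / (1 - th)) / a.
  by rewrite ler_pM2r ?invr_gt0 //; lra_of s1 s2.
have s4 : (f * L) ^+ 2 / (1 - th) / a + ((1 - f) * L) ^+ 2 / (t - a) = L ^+ 2 / (t - th * a).
  by rewrite f1E fE; field; rewrite !gt_eqF.
have s5 : (((1 - th) * d) ^+ 2 / f + d2 ^+ 2 / (1 - f)) / (t - th * a) =
    (1 - th) * d ^+ 2 / a + d2 ^+ 2 / (t - a).
  by rewrite f1E fE; field; rewrite !gt_eqF.
have s6 : L ^+ 2 / (t - th * a) <= (((1 - th) * d) ^+ 2 / f + d2 ^+ 2 / (1 - f)) / (t - th * a).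
  by rewrite ler_pM2r ?invr_gt0.
have s7 : (th * d ^+ 2 + (f * L) ^+ 2 / (1 - th)) / a =
   th * d ^+ 2 / a + (f * L) ^+ 2 / (1 - th) / a by rewrite mulrDl.
have s8 : th * d ^+ 2 / a + (1 - th) * d ^+ 2 / a = d ^+ 2 / a by field; rewrite gt_eqF.
split; first by lra_of s3 s6.
move=> h; have h' : (((1 - th) * d) ^+ 2 / f + d2 ^+ 2 / (1 - f)) / (t - th * a) <= L ^+ 2 / (t - th * a) by lra_of s3 h.
rewrite ler_pM2r ?invr_gt0 // in h'.
have zE := tp2 h'; have := sg_concat th1 f1 wE zE.
suff -> : (th + (1 - th) / f)^-1 = a / t by [].
have h1 : th + (1 - th) / f = t / a by rewrite fE; field; rewrite !gt_eqF.
by rewrite h1 invf_div.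
Qed.

End distance.

Lemma contV {R : realType} {T : topologicalType} (f : T -> R) t : {for t, continuous f} ->
  f t != 0 -> {for t, continuous (fun s => (f s)^-1)}.
Proof. by move=> cf f0; exact: cvgV. Qed.

Lemma cont_of_snd {T U W : topologicalType} (h : U -> W) (s : T) z : {for z, continuous h} ->
  {for (s, z), continuous (fun x : T * U => h x.2)}.
Proof. by move=> ch; apply: (cont_comp (f := fun x : T * U => x.2)) => //; exact: cont_snd. Qed.

Lemma cont_of_fst {T U W : topologicalType} (h : T -> W) (s : T) (z : U) : {for s, continuous h} ->
  {for (s, z), continuous (fun x : T * U => h x.1)}.
Proof. by move=> ch; apply: (cont_comp (f := fun x : T * U => x.1)) => //; exact: cont_fst. Qed.

(** With the intermediate point placed at the fraction [a / t] of the total length [D1 + de], the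
    two-piece energy of a path of that length is exactly [(D1 + de)^2 / t]. *)
Lemma two_leg_le {R : realFieldType} (a t D1 de D2 X r : R) : 0 < a < t -> 0 <= D1 + de ->
  0 <= D2 -> 0 <= X ->
  D2 ^+ 2 / t <= (a / t * (D1 + de)) ^+ 2 / a + X ^+ 2 / (t - a) ->
  X <= (1 - r) * D1 + de -> r * D1 = a / t * (D1 + de) -> D2 <= D1 + de.
Proof.
move=> a01 D0 D20 X0 h XE rE.
have t0 : 0 < t by lra.
have ta : 0 < t - a by lra.
have a0 : 0 < a by lra.
have at1 : a / t < 1 by rewrite ltr_pdivrMr //; lra.
have XE' : X <= (D1 + de) * (1 - a / t) by move: XE; rewrite mulrBl rE; lra.
have k2 : X ^+ 2 <= ((D1 + de) * (1 - a / t)) ^+ 2.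
  by rewrite ler_sqr ?nnegrE // mulr_ge0 //; lra.
have k3 : X ^+ 2 / (t - a) <= ((D1 + de) * (1 - a / t)) ^+ 2 / (t - a).
  by rewrite ler_pM2r ?invr_gt0.
have k4 : (a / t * (D1 + de)) ^+ 2 / a + ((D1 + de) * (1 - a / t)) ^+ 2 / (t - a) = (D1 + de) ^+ 2 / t.
  by field; rewrite !gt_eqF.
have k5 : D2 ^+ 2 / t <= (D1 + de) ^+ 2 / t by lra.
rewrite ler_pM2r ?invr_gt0 // in k5.
by rewrite -ler_sqr ?nnegrE.
Qed.

(** * The triangle inequality along a geodesic *)

Section triangle.
Context {R : realType} {n : nat} (M : riemannian_manifold R n).
Implicit Types (p q y w : M).
Hypothesis UG : uniquely_geodesic M.
Local Notation sg := (sg UG).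

Lemma gdist_cont2 q rho C lam D (T : topologicalType) (f1 f2 : T -> M) s : nice q rho C lam D ->
  {for s, continuous f1} -> {for s, continuous f2} -> Vs q D (f1 s) -> Vs q D (f2 s) ->
  {for s, continuous (fun s => gdist (f1 s) (f2 s))}.
Proof.
move=> Hn c1 c2 V1 V2.
apply: (@cont_comp _ _ _ (fun s => (f1 s, f2 s)) (fun z : M * M => gdist z.1 z.2)).
  exact: cont_pair.
exact: (nice_gdist_cont UG Hn V1 V2).
Qed.

Lemma sg_cont3 q rho C lam D (T : topologicalType) (f1 f2 : T -> M) (f3 : T -> R) s :
  nice q rho C lam D ->
  {for s, continuous f1} -> {for s, continuous f2} -> {for s, continuous f3} ->
  Vs q D (f1 s) -> Vs q D (f2 s) -> 0 < f3 s < 1 ->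
  {for s, continuous (fun s => sg (f1 s) (f2 s) (f3 s))}.
Proof.
move=> Hn c1 c2 c3 V1 V2 s1.
apply: (@cont_comp _ _ _ (fun s => (f1 s, f2 s, f3 s)) (fun z : M * M * R => sg z.1.1 z.1.2 z.2)).
  by apply: cont_pair => //; exact: cont_pair.
exact: (nice_sg_cont Hn V1 V2 s1).
Qed.

(** What is carried along a geodesic issued from [p]. Continuity of [sg p z th] is asked only for
    [th] close to 1: each step controls only the last part of the geodesics that end in the
    neighborhood. *)
Record good_on p (O : set M) (th0 : R) : Prop := GoodOn {
  go_open : open O ;
  go_th : th0 < 1 ;
  go_cont : forall z, O z -> {for z, continuous (gdist p)} ;
  go_tri : forall z z', O z -> O z' -> gdist p z' <= gdist p z + gdist z z' ;
  go_sg : forall z th, O z -> th0 < th < 1 ->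
    {for (z, th), continuous (fun x : M * R => sg p x.1 x.2)} }.

Definition good p y := exists O th0, good_on p O th0 /\ O y.

Lemma good_self p : good p p.
Proof.
have [rho [C [lam [D Hn]]]] := nice_ex p.
have Vp := Vs_self Hn.
exists (Vs p D), 0; split=> //; split=> //.
- exact: Vs_open.
- by move=> z Vz; apply: (gdist_cont2 Hn); [exact: cont_cst|exact: cont_id|exact: Vp|exact: Vz].
- by move=> z z' Vz Vz'; exact: (nice_triangle UG Hn).
- move=> z th Vz th1; apply: (sg_cont3 Hn); [exact: cont_cst|exact: cont_fst|exact: cont_snd|exact: Vp|exact: Vz|exact: th1].
Qed.

(** * Passing to the next point on the geodesic from p *)

Section closed_step.
Variables (p y0 : M) (a a1 t th th0 : R) (O : set M) (q : M) (rho C lam D : R).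
Let V := Vs q D.
Let s0 := sg p y0.
Let L := gdist p y0.
Hypothesis L0 : 0 < L.
Hypothesis Hn : nice q rho C lam D.
Hypothesis at1 : [/\ 0 < a, a < a1, a1 <= t & t <= 1].
Hypothesis th1 : 0 < th < 1.
Hypothesis th01 : th0 < th.
Hypothesis Vsig : forall s, a <= s <= t -> V (s0 s).
Hypothesis gO : good_on p O th0.
Hypothesis OV : O `<=` V.
Hypotheses (Oa : O (s0 a)) (Oth : O (s0 (th * a))) (Oa1 : O (s0 a1)).

Let phi := chart q.
Let hat := chart_inv q.
Let e0 := phi (s0 a).
Let W z := sg p z th.
Let fr s := (1 - th) * a / (s - th * a).
Let G (x : R * 'rV[R]_n) := sg (W (hat x.2)) (s0 x.1) (fr x.1).
(** The two-piece energy through [hat x.2], less the energy [L^2 s] of the geodesic up to [s = x.1],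
    so that it vanishes at [e0] at all times. Times start at [a1 > a] to keep [s - a] away from
    0. *)
Let E (x : R * 'rV[R]_n) := gdist p (hat x.2) ^+ 2 / a
  + gdist (hat x.2) (s0 x.1) ^+ 2 / (x.1 - a) - L ^+ 2 * x.1.

Let s0_in s : 0 <= s <= 1 -> gdist p (s0 s) = s * L.
Proof.
move=> s1; have := gdist_sg UG p y0 itv0 s1; rewrite sg0 subr0 ger0_norm //; lra.
Qed.

Let s0_sub s r : 0 <= s <= 1 -> 0 <= r <= 1 -> sg p (s0 s) r = s0 (s * r).
Proof. by move=> s1 r1; have := sg_sub UG p y0 itv0 s1 r1; rewrite sg0 subr0 addr0. Qed.

Let cs0 s : 0 <= s <= 1 -> {for s, continuous s0}.
Proof. by move=> s1; apply: geodesic_continuous s1; case: (sgP UG p y0). Qed.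

Let dq z : V z -> dom q z. Proof. by case. Qed.

Let hatK z : V z -> hat (phi z) = z. Proof. by move=> /dq; exact: chartK. Qed.

Let fr1 s : a < s -> 0 < fr s < 1.
Proof.
have [a0 _ _ _] := at1; have th1' := th1 => as_; have h : 0 < s - th * a by nra.
by rewrite /fr divr_gt0 ?ltr_pdivrMr //=; nra.
Qed.

Let cW z : O z -> {for z, continuous W}.
Proof.
move=> Oz; have h := go_sg gO Oz (ltac:(by rewrite th01; case/andP: th1) : th0 < th < 1).
apply: (@cont_comp _ _ _ (fun z : M => (z, th)) (fun x : M * R => sg p x.1 x.2)) h.
by apply: cont_pair; [exact: cont_id|exact: cont_cst].
Qed.

Let cfr s : a < s -> {for s, continuous fr}.
Proof.
have [a0 _ _ _] := at1; have th1' := th1 => as_; have h : 0 < s - th * a by nra.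
apply: contM; first exact: contC.
apply: contV; first by apply: contB; [exact: cont_id|exact: contC].
by rewrite gt_eqF.
Qed.

Let G_cont s (z : 'rV[R]_n) : a1 <= s <= t -> img q z -> O (hat z) -> V (W (hat z)) ->
  {for (s, z), continuous G}.
Proof.
have [a0 aa1 a1t t1] := at1 => s1 iz Oz Vw.
have ch : {for (s, z), continuous (fun x : R * 'rV[R]_n => hat x.2)}.
  by apply: cont_of_snd; exact: chart_inv_cont.
apply: (sg_cont3 Hn) => //.
- by apply: (cont_comp ch); exact: cW.
- by apply: cont_of_fst; apply: cs0; lra.
- by apply: cont_of_fst; apply: cfr; lra.
- by apply: Vsig => /=; lra.
- by apply: fr1 => /=; lra.
Qed.

Let He0 : [/\ img q e0, hat e0 = s0 a, W (s0 a) = s0 (th * a) &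
  forall s, a < s <= t -> sg (s0 (th * a)) (s0 s) (fr s) = s0 a].
Proof.
have [a0 aa1 a1t t1] := at1; have Va : V (s0 a) by exact: OV.
have th1' := th1.
split; [by apply: img_chart; exact: dq|exact: hatK| |].
  by rewrite /W s0_sub 1?mulrC //; lra.
move=> s s1; have fr1' := fr1 (ltac:(lra) : a < s).
have h1 : 0 <= th * a <= 1 by nra.
have h2 : 0 <= s <= 1 by lra.
have h3 : 0 <= fr s <= 1 by lra.
rewrite /s0 sg_sub //.
rewrite (_ : (s - th * a) * fr s + th * a = a) // /fr; field; rewrite gt_eqF //; nra.
Qed.

Let near_good : exists2 r, 0 < r & forall z : 'rV[R]_n, `|z - e0| < r ->
  [/\ img q z, O (hat z), O (W (hat z)) & forall s, a1 <= s <= t -> O (G (s, z))].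
Proof.
have [a0 aa1 a1t t1] := at1; have [ie he We Ge] := He0.
have oO := go_open gO.
have N1 : \forall z \near e0, img q z by apply: open_nbhs_nbhs; split=> //; exact: img_open.
have ch : {for e0, continuous hat} by exact: chart_inv_cont.
have N2 : \forall z \near e0, O (hat z) by apply: (near_continuous ch oO); rewrite he.
have cw : {for e0, continuous (fun z => W (hat z))}.
  by apply: (cont_comp ch); rewrite he; exact: cW.
have N3 : \forall z \near e0, O (W (hat z)) by apply: (near_continuous cw oO); rewrite he We.
have N4 : \forall z \near e0, forall s, `[a1, t]%classic s -> O (G (s, z)).
  apply: near_cov => //; first exact: segment_compact.
    move=> s; rewrite /= in_itv /= => s1; apply: G_cont => //; rewrite he //.
    by rewrite We; exact: OV.
  by move=> s; rewrite /= in_itv /= => s1; rewrite /G /= he We Ge //; lra.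
have : \forall z \near e0, (img q z /\ O (hat z)) /\ O (W (hat z)) /\
    forall s, `[a1, t]%classic s -> O (G (s, z)).
  exact: filterI (filterI N1 N2) (filterI N3 N4).
move=> /near_eps[r r0 Hr].
exists r => // z /Hr[[h1 h2] [h3 h4]]; split=> // s s1; apply: h4; by rewrite /= in_itv.
Qed.

Let E_cont s (z : 'rV[R]_n) : a1 <= s <= t -> img q z -> O (hat z) -> {for (s, z), continuous E}.
Proof.
have [a0 aa1 a1t t1] := at1 => s1 iz Oz.
have ch : {for (s, z), continuous (fun x : R * 'rV[R]_n => hat x.2)}.
  by apply: cont_of_snd; exact: chart_inv_cont.
have cc : {for (s, z), continuous (fun x : R * 'rV[R]_n => s0 x.1)}.
  by apply: cont_of_fst; apply: cs0; lra.
apply: contB; last by apply: contM; [exact: contC|exact: cont_fst].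
apply: contD; apply: contM.
- have c1 : {for (s, z), continuous (fun x : R * 'rV[R]_n => gdist p (hat x.2))}.
    by apply: (cont_comp ch); exact: (go_cont gO).
  exact: (contM c1 c1).
- exact: contC.
- have c1 : {for (s, z), continuous (fun x : R * 'rV[R]_n => gdist (hat x.2) (s0 x.1))}.
    by apply: (gdist_cont2 Hn ch cc); [exact: OV|apply: Vsig; rewrite /=; lra].
  exact: (contM c1 c1).
- apply: contV; first by apply: contB; [exact: cont_fst|exact: contC].
  by rewrite gt_eqF //=; lra.
Qed.


Let F y (z : 'rV[R]_n) := gdist p (hat z) ^+ 2 / a + gdist (hat z) y ^+ 2 / (t - a).
Let h y := sg p y (a / t).

Let E_dec y s (z : M) : a < s -> O z -> O (W z) -> V y -> O (sg (W z) y (fr s)) ->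
  gdist p (sg (W z) y (fr s)) ^+ 2 / a + gdist (sg (W z) y (fr s)) y ^+ 2 / (s - a)
    <= gdist p z ^+ 2 / a + gdist z y ^+ 2 / (s - a) /\
  (gdist p z ^+ 2 / a + gdist z y ^+ 2 / (s - a) <=
   gdist p (sg (W z) y (fr s)) ^+ 2 / a + gdist (sg (W z) y (fr s)) y ^+ 2 / (s - a) ->
   z = sg p y (a / s)).
Proof.
have [a0 _ _ _] := at1 => as_ Oz Ow Vy Oz'.
apply: (dec_step (UG := UG) Hn (th := th) (f := fr s) (w := W z)) => //.
- by rewrite a0.
- exact: OV.
- exact: OV.
- exact: (go_tri gO).
Qed.

Let E0 s : a1 <= s <= t -> E (s, e0) = 0.
Proof.
have [a0 aa1 a1t t1] := at1 => s1; have [_ he _ _] := He0.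
have d1 : gdist p (s0 a) = a * L by apply: s0_in; lra.
have d2 : gdist (s0 a) (s0 s) = (s - a) * L by rewrite gdist_sg ?ger0_norm //; lra.
rewrite /E /= he d1 d2; field; rewrite !gt_eqF //; lra.
Qed.

(** At time [a1] both the moving point and [s0 a1] lie in [O], where the triangle inequality is
    known; convexity of the square turns it into the inequality of energies. *)
Let loc_min_a1 : loc_min E e0 a1.
Proof.
have [a0 aa1 a1t t1] := at1; have [r r0 Hr] := near_good.
exists r => // z /Hr[_ Oz _ _].
have tri := go_tri gO Oz Oa1; have d1 : gdist p (s0 a1) = a1 * L by apply: s0_in; lra.
rewrite d1 in tri; rewrite /E /=.
set A := gdist p (hat z) in tri *; set B := gdist (hat z) (s0 a1) in tri *.
have L0' := L0.
have h1 : (a1 * L) ^+ 2 <= (A + B) ^+ 2.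
  by rewrite ler_sqr ?nnegrE ?addr_ge0 ?gdist_ge0 ?mulr_ge0 //; lra.
have h2 : (A + B) ^+ 2 / a1 <= A ^+ 2 / a + B ^+ 2 / (a1 - a).
  rewrite -subr_ge0 (_ : _ - _ = (A * (a1 - a) - B * a) ^+ 2 / (a1 * a * (a1 - a))).
    by rewrite divr_ge0 ?sqr_ge0 // !mulr_ge0 //; lra.
  by field; rewrite !gt_eqF //; lra.
have h3 : L ^+ 2 * a1 <= (A + B) ^+ 2 / a1 by rewrite ler_pdivlMr; nra.
lra.
Qed.

(** [local_min_persists] carries the minimum from [a1] to [t], and one descent step makes it strict.
    Closed balls with room for one more step are recorded for the compactness arguments that
    follow. *)
Let strict : exists r s, [/\ 0 < r, r < s,
  forall z : 'rV[R]_n, `|z - e0| <= s -> [/\ img q z, O (hat z), O (W (hat z)) & O (G (t, z))],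
  forall z : 'rV[R]_n, `|z - e0| <= s -> z <> e0 -> 0 < E (t, z) &
  forall z : 'rV[R]_n, `|z - e0| <= r -> `|phi (G (t, z)) - e0| < s].
Proof.
have [a0 aa1 a1t t1] := at1; have [ie he We Ge] := He0.
have [rho' r0 Hr] := near_good.
have cG s z : a1 <= s <= t -> `|z - e0| < rho' -> {for (s, z), continuous (fun x => phi (G x))}.
  move=> s1 /Hr[iz Oz Ow Og]; have c1 := G_cont s1 iz Oz (OV Ow).
  by apply: (cont_comp c1); apply: chart_continuous; apply: dq; apply: OV; exact: Og.
have G0 s : a1 <= s <= t -> phi (G (s, e0)) = e0.
  by move=> s1; rewrite /G /= he We Ge //; lra.
have dec s z : a1 <= s <= t -> `|z - e0| < rho' -> z <> e0 -> E (s, phi (G (s, z))) < E (s, z).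
  move=> s1 /Hr[iz Oz Ow Og] ze; have Vs0 : V (s0 s) by apply: Vsig; lra.
  have Og' := Og s s1.
  have [k1 k2] := @E_dec (s0 s) s (hat z) (ltac:(lra)) Oz Ow Vs0 Og'.
  rewrite ltNge; apply/negP; rewrite /E /= hatK; last exact: OV.
  rewrite lerD2r => /k2; rewrite s0_sub; [|lra|]; last first.
    by rewrite divr_ge0 ?ler_pdivrMr //=; lra_of a0 aa1 s1.
  have -> : s * (a / s) = a by field; rewrite gt_eqF; lra.
  by move=> E'; apply: ze; rewrite -(chart_invK iz) -/(hat z) E'.
have [||r r00 Hm] := @local_min_persists R n E (fun x => phi (G x)) e0 a1 t rho' a1t r0 _ cG E0 dec G0.
- by move=> s z s1 /Hr[iz Oz _ _]; exact: E_cont.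
- exact: loc_min_a1.
have t1' : a1 <= t <= t by lra.
have cGt : {for e0, continuous (fun z => phi (G (t, z)))}.
  apply: (@cont_comp _ _ _ (fun z : 'rV[R]_n => (t, z)) (fun x => phi (G x))).
    by apply: cont_pair; [exact: cont_cst|exact: cont_id].
  by apply: cG => //; rewrite subrr normr0.
pose m := Num.min r rho'; have m0 : 0 < m by rewrite lt_min r00.
have mr : m <= r by rewrite ge_min lexx.
have mr' : m <= rho' by rewrite ge_min lexx orbT.
have [d d0 Hd] := continuous_eps cGt m0; rewrite G0 // in Hd.
pose s := Num.min (d / 2) (m / 2).
have s00 : 0 < s by rewrite lt_min !divr_gt0.
have sd : s <= d / 2 by rewrite ge_min lexx.
have sm : s <= m / 2 by rewrite ge_min lexx orbT.
have [d' d'0 Hd'] := continuous_eps cGt s00; rewrite G0 // in Hd'.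
pose r' := Num.min (d' / 2) (s / 2).
have r's : r' <= s / 2 by rewrite ge_min lexx orbT.
have r'd : r' <= d' / 2 by rewrite ge_min lexx.
exists r', s; split.
- by rewrite lt_min !divr_gt0.
- lra_of s00 r's.
- by move=> z zs; have [|k1 k2 k3 k4] := Hr z; [lra_of r0 mr' sm zs|split=> //; exact: k4].
- move=> z zs ze; apply: (@le_lt_trans _ _ (E (t, phi (G (t, z))))).
    by apply: Hm; have := Hd z; lra_of mr d0 sd zs.
  by apply: dec => //; lra_of r0 mr' sm zs.
- by move=> z zs; apply: Hd'; lra_of d'0 r'd zs.
Qed.

Let F_cont y z : V y -> img q z -> O (hat z) ->
  {for (z, y), continuous (fun x => F x.2 x.1)}.
Proof.
have [a0 aa1 a1t t1] := at1 => Vy iz Oz.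
have ch : {for (z, y), continuous (fun x : 'rV[R]_n * M => hat x.1)}.
  by apply: cont_of_fst; exact: chart_inv_cont.
apply: contD; apply: contM; try exact: contC.
- have c1 : {for (z, y), continuous (fun x : 'rV[R]_n * M => gdist p (hat x.1))}.
    by apply: (cont_comp ch); exact: (go_cont gO).
  exact: (contM c1 c1).
- have c1 : {for (z, y), continuous (fun x : 'rV[R]_n * M => gdist (hat x.1) x.2)}.
    by apply: (gdist_cont2 Hn ch); [exact: cont_snd|exact: OV|exact: Vy].
  exact: (contM c1 c1).
Qed.

Let F_h y : dom q (h y) -> F y (phi (h y)) = gdist p y ^+ 2 / t.
Proof.
have [a0 aa1 a1t t1] := at1 => qh.
have at01 : 0 <= a / t <= 1 by rewrite divr_ge0 ?ler_pdivrMr //=; lra.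
have d1 : gdist p (h y) = a / t * gdist p y.
  by have := gdist_sg UG p y itv0 at01; rewrite sg0 subr0 ger0_norm //; lra.
have d2 : gdist (h y) y = (1 - a / t) * gdist p y.
  by have := gdist_sg UG p y at01 itv1; rewrite sg1 ger0_norm //; lra.
by rewrite /F /phi /hat chartK // d1 d2; field; rewrite !gt_eqF //; lra.
Qed.

(** Strictness at [s0 t] survives for nearby [y], so [F y] has a minimizer inside the small ball. A
    descent step from it stays in the ball and cannot lower [F y]; the equality case of [E_dec] then
    identifies the minimizer with [h y]. *)
Let core : exists U' s, [/\ open U' /\ U' (s0 t), U' `<=` V, 0 < s &
  forall y, U' y -> [/\ O (h y), `|phi (h y) - e0| < s,
    forall z : 'rV[R]_n, `|z - e0| <= s -> [/\ img q z, O (hat z) & gdist p y ^+ 2 / t <= F y z] &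
    forall z : 'rV[R]_n, `|z - e0| <= s -> F y z <= gdist p y ^+ 2 / t -> z = phi (h y)]].
Proof.
have [a0 aa1 a1t t1] := at1; have [r [s [r0 rs Hs Hp Hr]]] := strict.
have t1' : a <= t <= t by lra.
have Vt := Vsig t1'.
have e0s : `|e0 - e0| <= s by rewrite subrr normr0; lra.
have FE z : F (s0 t) z = E (t, z) + L ^+ 2 * t by rewrite /E subrK.
have cS z : `|z - e0| <= r ->
    {for (z, s0 t), continuous (fun x : 'rV[R]_n * M => sg (W (hat x.1)) x.2 (fr t))}.
  move=> zr; have [|iz Oz Ow _] := Hs z; first lra.
  apply: (sg_cont3 Hn).
  - apply: (@cont_of_fst _ _ _ (fun z => W (hat z))).
    by apply: (cont_comp (chart_inv_cont iz)); exact: cW.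
  - exact: cont_snd.
  - exact: cont_cst.
  - exact: OV.
  - exact: Vt.
  - by apply: fr1; lra.
have N1 : \forall y \near s0 t, forall z, [set z : 'rV[R]_n | r <= `|z - e0| <= s] z ->
    [set x | 0 < x] (F y z - F y e0).
  apply: (near_cov (F := fun x => F x.2 x.1 - F x.2 e0)).
  - exact: annulus_compact.
  - move=> z /andP[_ zs]; have [iz Oz _ _] := Hs z zs; have [ie Oe _ _] := Hs e0 e0s.
    apply: contB; first exact: F_cont.
    have c1 := @F_cont (s0 t) e0 Vt ie Oe.
    have c2 : {for s0 t, continuous (fun y => F y e0)}.
      apply: (@cont_comp _ _ _ (fun y : M => (e0, y)) (fun x => F x.2 x.1)) c1.
      by apply: cont_pair; [exact: cont_cst|exact: cont_id].
    exact: cont_of_snd c2.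
  - exact: open_gt.
  - move=> z /andP[zr zs]; rewrite /= !FE E0; last lra.
    rewrite opprD addrA addrAC addrK subr0; apply: Hp => // ze.
    by move: zr; rewrite ze subrr normr0; lra.
have N2 : \forall y \near s0 t, forall z, [set z : 'rV[R]_n | `|z - e0| <= r] z ->
    O (sg (W (hat z)) y (fr t)).
  apply: (near_cov (F := fun x => sg (W (hat x.1)) x.2 (fr t))) => //.
  - exact: cball_compact.
  - exact: (go_open gO).
  - by move=> z /= zr; have [|_ _ _] := Hs z; first lra.
have N3 : \forall y \near s0 t, forall z, [set z : 'rV[R]_n | `|z - e0| <= r] z ->
    [set x | x < s] `|phi (sg (W (hat z)) y (fr t)) - e0|.
  apply: (near_cov (F := fun x => `|phi (sg (W (hat x.1)) x.2 (fr t)) - e0|)) => //.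
  - exact: cball_compact.
  - move=> z /= zr; apply: cont_norm; apply: contB; last exact: contC.
    apply: (cont_comp (cS z zr)); apply: chart_continuous; apply: dq; apply: OV.
    by have [|_ _ _] := Hs z; first lra.
have N4 : \forall y \near s0 t, V y.
  by apply: open_nbhs_nbhs; split=> //; exact: Vs_open.
pose P y := [/\ V y, forall z : 'rV[R]_n, r <= `|z - e0| <= s -> 0 < F y z - F y e0,
  forall z : 'rV[R]_n, `|z - e0| <= r -> O (sg (W (hat z)) y (fr t)) &
  forall z : 'rV[R]_n, `|z - e0| <= r -> `|phi (sg (W (hat z)) y (fr t)) - e0| < s].
have N : \forall y \near s0 t, P y.
  by apply: filterS2 (filterI N1 N2) (filterI N3 N4) => y [k1 k2] [k3 k4]; split.
have PP y : P y -> [/\ O (h y), `|phi (h y) - e0| < s,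
    forall z : 'rV[R]_n, `|z - e0| <= s -> [/\ img q z, O (hat z) & gdist p y ^+ 2 / t <= F y z] &
    forall z : 'rV[R]_n, `|z - e0| <= s -> F y z <= gdist p y ^+ 2 / t -> z = phi (h y)].
  move=> [Vy P1 P2 P3].
  have key c : `|c - e0| <= s -> (forall u : 'rV[R]_n, `|u - e0| <= s -> F y c <= F y u) ->
      `|c - e0| < s /\ hat c = h y.
    move=> cs cmin; have cr : `|c - e0| < r.
      by rewrite ltNge; apply/negP => cr; have := P1 c; have := cmin e0 e0s; lra_of cs cr.
    split; first lra.
    have [ic Oc Ow _] := Hs c cs; have U' := P2 c (ltW cr).
    have [_ k] := @E_dec y t (hat c) (ltac:(lra_of aa1 a1t)) Oc Ow Vy U'; apply: k.
    have := cmin _ (ltW (P3 c (ltW cr))).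
    by rewrite {2}/F hatK //; exact: OV.
  have [|c cs cmin] := @cball_min R n (F y) e0 s (ltac:(lra)).
    move=> z /Hs[iz Oz _ _].
    apply: (@cont_comp _ _ _ (fun z : 'rV[R]_n => (z, y)) (fun x => F x.2 x.1)).
      by apply: cont_pair; [exact: cont_id|exact: cont_cst].
    exact: F_cont.
  have [cs' ch] := key c cs cmin; have [ic Oc _ _] := Hs c cs.
  have cE : c = phi (h y) by rewrite -ch [RHS]chart_invK.
  have Oh : O (h y) by rewrite -ch.
  have Fc : F y c = gdist p y ^+ 2 / t by rewrite cE F_h //; apply: dq; exact: OV.
  split=> //; first by rewrite -cE.
    by move=> z zs; have [iz Oz _ _] := Hs z zs; split=> //; rewrite -Fc; exact: cmin.
  move=> z zs Fz; have [|_ <-] := key z zs; last by rewrite [RHS]chart_invK //; case: (Hs z zs).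
  by move=> u us; apply: (le_trans Fz); rewrite -Fc; exact: cmin.
exists (interior P), s; split; [|by move=> y /interior_subset[]|lra|].
  by split; [exact: open_interior|exact: N].
by move=> y /interior_subset /PP.
Qed.


(** By [core], [h y] is the only minimizer of [F y] near [s0 a], hence continuous in [y] by
    compactness. Since [h y] lies in [O], what is known on [O] gives the distance from [p], the
    tails of geodesics and the triangle inequality near [s0 t]. *)
Lemma good_next : good p (s0 t).
Proof.
have [a0 aa1 a1t t1] := at1; have th1' := th1; have L0' := L0.
have [U' [s [[oO' Oy] OV' s00 H]]] := core.
have h_in y : U' y -> O (h y) by move=> /H[].
have h_cont y : U' y -> {for y, continuous h}.
  move=> Oy'; have [Oh hs Fmin Funiq] := H y Oy'; have Vh := OV Oh.
  have cph : {for y, continuous (fun y => phi (h y))}.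
    apply: near_eps_cont => e e00.
    pose K := [set z : 'rV[R]_n | `|z - e0| <= s] `&`
      (fun z : 'rV[R]_n => `|z - phi (h y)|) @^-1` [set x | e <= x].
    have cK : compact K.
      apply: (subclosed_compact _ (@cball_compact R n e0 s)); last by move=> z [].
      apply: closedI; last first.
        by apply: closed_comp; [move=> z _; exact: cont_dist|exact: closed_ge].
      by apply: compact_closed; [exact: norm_hausdorff|exact: cball_compact].
    have N : \forall y' \near y, forall z, K z -> [set x | 0 < x] (F y' z - F y' (phi (h y))).
      have [ih Ohh _] := Fmin _ (ltW hs).
      apply: (near_cov (F := fun x => F x.2 x.1 - F x.2 (phi (h y)))) => //.
      - move=> z [zs _]; have [iz Oz _] := Fmin z zs; have Vy := OV' _ Oy'.
        apply: contB; first exact: F_cont.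
        have c1 := @F_cont y (phi (h y)) Vy ih Ohh.
        have c2 : {for y, continuous (fun y' => F y' (phi (h y)))}.
          apply: (@cont_comp _ _ _ (fun y' : M => (phi (h y), y')) (fun x => F x.2 x.1)) c1.
          by apply: cont_pair; [exact: cont_cst|exact: cont_id].
        exact: cont_of_snd c2.
      - move=> z [zs /= ze]; rewrite subr_gt0 F_h; last exact: dq.
        rewrite ltNge; apply/negP => /(Funiq z zs) zE.
        by move: ze; rewrite zE subrr normr0; lra.
    have N' : \forall y' \near y, U' y' by apply: open_nbhs_nbhs.
    apply: filterS2 N N' => y' HK Oy''; have [Oh' hs' Fmin' _] := H y' Oy''.
    rewrite ltNge; apply/negP => ge.
    have := HK (phi (h y')) (conj (ltW hs') ge); rewrite /=.
    have [_ _] := Fmin' _ (ltW hs).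
    by rewrite F_h; [lra|apply: dq; exact: OV].
  have c2 : {for y, continuous (fun y => hat (phi (h y)))}.
    by apply: (cont_comp cph); apply: chart_inv_cont; apply: img_chart; exact: dq.
  apply: near_eq_continuous c2.
  have N' : \forall y' \near y, U' y' by apply: open_nbhs_nbhs.
  by apply: filterS N' => y' /h_in /OV /hatK.
have a01 : 0 < a < t by lra.
have at01 : 0 < a / t < 1 by rewrite divr_gt0 ?ltr_pdivrMr //=; lra.
have gh y : gdist p (h y) = a / t * gdist p y.
  by have := gdist_sg UG p y itv0 (ltac:(lra) : 0 <= a / t <= 1); rewrite sg0 subr0 ger0_norm //; lra.
have c1 y : U' y -> {for y, continuous (gdist p)}.
  move=> Oy'; have ch := h_cont y Oy'.
  have c : {for y, continuous (fun y => (a / t)^-1 * gdist p (h y))}.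
    apply: contM; first exact: contC.
    by apply: (cont_comp ch); apply: (go_cont gO); exact: h_in.
  by apply: (eq_cont _ c) => y'; rewrite gh mulKf // gt_eqF; lra.
pose b := th * (a / t); have b0 : 0 < b by rewrite mulr_gt0; lra_of at01 th1' a0.
have b1 : b < a / t by rewrite /b gtr_pMl; lra_of at01 th1'.
have WE y : W (h y) = sg p y b.
  have := sg_sub UG p y itv0 (ltac:(lra_of at01) : 0 <= a / t <= 1) (ltac:(lra_of th1') : 0 <= th <= 1).
  by rewrite sg0 subr0 addr0 (mulrC (a / t) th).
have near_w : \forall y \near s0 t, O (W (h y)).
  have c : {for s0 t, continuous (fun y => W (h y))}.
    by apply: (cont_comp (h_cont _ Oy)); apply: cW; exact: h_in.
  apply: (near_continuous c (go_open gO)).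
  rewrite WE s0_sub; [|lra_of a0 aa1 a1t t1|lra_of at01 b0 b1].
  by rewrite (_ : t * b = th * a) // /b; field; rewrite gt_eqF //; lra_of a0 aa1 a1t.
pose O1 := U' `&` interior (fun y => O (W (h y))).
have oO1 : open O1 by apply: openI => //; exact: open_interior.
have O1y : O1 (s0 t) by split.
have O1w y : O1 y -> O (W (h y)) by move=> [_ /interior_subset].
(* Beyond the fraction [b] the geodesic from [p] to [y] is the short geodesic from [W (h y)] to [y],
   which depends continuously on its ends. *)
have J y r : O1 y -> b < r < 1 -> {for (y, r), continuous (fun x : M * R => sg p x.1 x.2)}.
  move=> Oy' r1; have [Oy1 _] := Oy'.
  pose k (r : R) := (r - b) / (1 - b).
  have k1 (r' : R) : b < r' < 1 -> 0 < k r' < 1.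
    by move=> rr; rewrite /k divr_gt0 ?ltr_pdivrMr //=; lra_of at01 b1 rr.
  have c : {for (y, r), continuous (fun x : M * R => sg (W (h x.1)) x.1 (k x.2))}.
    apply: (sg_cont3 Hn).
    - apply: (@cont_of_fst _ _ _ (fun y => W (h y))).
      by apply: (cont_comp (h_cont _ Oy1)); apply: cW; exact: h_in.
    - exact: cont_fst.
    - apply: (@cont_of_snd _ _ _ k); apply: contM; last exact: contC.
      by apply: contB; [exact: cont_id|exact: contC].
    - by apply: OV; exact: O1w.
    - exact: OV'.
    - exact: k1.
  apply: near_eq_continuous c.
  have Nr : \forall r' \near r, b < r' < 1.
    apply/near_eps; exists (Num.min (r - b) (1 - r)); first by rewrite lt_min; lra.
    by move=> r'; rewrite lt_min !ltr_norml; lra_of isT.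
  have Ns : \forall x \near (y, r), b < x.2 < 1 := near_comp (@cont_snd M R (y, r)) Nr.
  apply: filterS Ns => -[y' r'] /= r'1.
  rewrite WE; have := sg_sub UG p y' (ltac:(lra_of at01 b0 b1) : 0 <= b <= 1) itv1 (ltac:(have := k1 _ r'1; lra_of isT) : 0 <= k r' <= 1).
  rewrite sg1 => ->; rewrite (_ : (1 - b) * k r' + b = r') // /k; field; rewrite gt_eqF; lra.
have dt : gdist p (s0 t) = t * L by apply: s0_in; lra.
have dt0 : 0 < gdist p (s0 t) by rewrite dt mulr_gt0 //; lra_of a0 aa1 a1t.
(* The time at which the geodesic from [p] to [x.1] has covered the fraction [a / t] of the length
   of the broken path to [x.2], as in [two_leg_le]. On the diagonal it is [a / t], and nearby it is
   still less than 1. *)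
pose sl (x : M * M) := a / t * (gdist p x.1 + gdist x.1 x.2) / gdist p x.1.
have csl : {for (s0 t, s0 t), continuous sl}.
  have cd : {for (s0 t, s0 t), continuous (fun x : M * M => gdist p x.1)}.
    by apply: cont_of_fst; exact: c1.
  apply: contM; last by apply: contV => //; rewrite gt_eqF.
  apply: contM; first exact: contC.
  by apply: contD => //; apply: (gdist_cont2 Hn); [exact: cont_fst|exact: cont_snd|exact: OV'|exact: OV'].
have slt : sl (s0 t, s0 t) = a / t by rewrite /sl /= gdistxx // addr0 mulfK // gt_eqF.
have cz : {for (s0 t, s0 t), continuous (fun x : M * M => sg p x.1 (sl x))}.
  apply: (@cont_comp _ _ _ (fun x : M * M => (x.1, sl x)) (fun x : M * R => sg p x.1 x.2)).
    by apply: cont_pair => //; exact: cont_fst.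
  by rewrite slt; apply: J => //; lra_of at01 b1.
have zt : sg p (s0 t) (sl (s0 t, s0 t)) = s0 a by rewrite slt -/(h (s0 t)) /h s0_sub; [rewrite (_ : t * (a / t) = a) //; field; rewrite gt_eqF; lra|lra_of a0 aa1 a1t t1|lra_of at01].
have Va : V (s0 a) by exact: OV.
have Nz1 : \forall x \near (s0 t, s0 t), V (sg p x.1 (sl x)).
  by apply: (near_continuous cz (@Vs_open _ _ _ q D)); rewrite zt.
have Nz2 : \forall x \near (s0 t, s0 t), `|phi (sg p x.1 (sl x)) - e0| < s.
  have c : {for (s0 t, s0 t), continuous (fun x : M * M => `|phi (sg p x.1 (sl x)) - e0|)}.
    apply: cont_norm; apply: contB; last exact: contC.
    by apply: (cont_comp cz); apply: chart_continuous; rewrite zt; exact: dq.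
  by apply: (near_continuous c (@open_lt _ s)); rewrite /= zt subrr normr0.
have Nz3 : \forall x \near (s0 t, s0 t), sl x < 1.
  by apply: (near_continuous csl (@open_lt _ 1)); rewrite /= slt; lra_of at01.
have Nz4 : \forall x \near (s0 t, s0 t), 0 < gdist p x.1.
  have cd : {for (s0 t, s0 t), continuous (fun x : M * M => gdist p x.1)}.
    by apply: cont_of_fst; exact: c1.
  exact: (near_continuous cd (@open_gt _ 0)).
have : \forall x \near (s0 t, s0 t), [/\ V (sg p x.1 (sl x)), `|phi (sg p x.1 (sl x)) - e0| < s,
    sl x < 1 & 0 < gdist p x.1].
  by apply: filterS2 (filterI Nz1 Nz2) (filterI Nz3 Nz4) => x [k1 k2] [k3 k4]; split.
move=> [[A B] /= [NA NB] HAB].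
pose O2 := O1 `&` interior (A `&` B).
have oO2 : open O2 by apply: openI => //; exact: open_interior.
exists O2, b; split; last by split=> //; exact: filterI.
split=> //.
- lra_of at01 b1.
- by move=> y [[Oy' _] _]; exact: c1.
- move=> y1 y2 [[Oy1 _] /interior_subset[A1 _]] [[Oy2 _] /interior_subset[_ B2]].
  have [] := HAB (y1, y2) (conj A1 B2); rewrite /= => Vz zs sl1 D10.
  set D1 := gdist p y1 in D10 *; set de := gdist y1 y2.
  have de0 : 0 <= de by exact: gdist_ge0.
  have slE : sl (y1, y2) * D1 = a / t * (D1 + de) by rewrite /sl /= -/D1 -/de divfK // gt_eqF.
  have sl0 : 0 <= sl (y1, y2).
    have k0 : 0 <= a / t * (D1 + de) by rewrite mulr_ge0 ?addr_ge0 ?(ltW D10) //; case/andP: at01 => /ltW.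
    by rewrite -slE pmulr_lge0 in k0.
  set r := sl (y1, y2) in slE sl0 sl1 Vz zs; set z := sg p y1 r in Vz zs.
  have r1 : 0 <= r <= 1 by lra_of sl0 sl1.
  have dz : gdist p z = r * D1.
    by have := gdist_sg UG p y1 itv0 r1; rewrite sg0 subr0 ger0_norm //; lra.
  have dz1 : gdist z y1 = (1 - r) * D1.
    by have := gdist_sg UG p y1 r1 itv1; rewrite sg1 ger0_norm //; lra_of sl1.
  have tri := nice_triangle UG Hn Vz (OV' _ Oy1) (OV' _ Oy2).
  have [_ _ Fm _] := H y2 Oy2; have [_ _] := Fm _ (ltW zs).
  rewrite /F hatK // dz slE => k.
  by apply: (two_leg_le a01 (addr_ge0 (ltW D10) de0) (gdist_ge0 _ _) (gdist_ge0 z y2) k _ slE); rewrite -dz1.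
- by move=> z r [Oz _]; exact: J.
Qed.

End closed_step.

End triangle.

Section triangle_global.
Context {R : realType} {n : nat} (M : riemannian_manifold R n).
Implicit Types (p q x y z w : M).
Hypothesis UG : uniquely_geodesic M.
Local Notation sg := (sg UG).
Local Notation good := (good UG).

Lemma good_onS p (O U : set M) (th0 : R) : good_on UG p O th0 -> open U ->
  good_on UG p (O `&` U) th0.
Proof.
move=> [oO th cO triO sO] oU; split=> //.
- exact: openI.
- by move=> z [/cO].
- by move=> z z' [Oz _] [Oz' _]; exact: triO.
- by move=> z t [Oz _]; exact: sO.
Qed.

(** The geodesic enters a controlled neighborhood of its point at [t] before time [t]. A good point
    at [a] in that neighborhood, then [a1] and [th], are chosen to meet the hypotheses of
    [good_next]. *)
Lemma good_closed p y0 (t : R) : 0 < t <= 1 ->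
  (forall s, 0 <= s < t -> good p (sg p y0 s)) -> good p (sg p y0 t).
Proof.
move=> t1 H; have [d0|/eqP d0] := eqVneq (gdist p y0) 0.
  have -> : sg p y0 t = p.
    apply/esym/(gdist_eq0 UG); have := gdist_sg UG p y0 itv0 (ltac:(lra) : 0 <= t <= 1).
    by rewrite sg0 d0 mulr0.
  exact: good_self.
have L0 : 0 < gdist p y0 by have := gdist_ge0 p y0; rewrite le_eqVlt => /predU1P[/esym|].
have cs s : 0 <= s <= 1 -> {for s, continuous (sg p y0)}.
  by move=> s1; apply: geodesic_continuous s1; case: (sgP UG p y0).
set y := sg p y0 t; have [rho [C [lam [D Hn]]]] := nice_ex y.
have NV : \forall s \near t, Vs y D (sg p y0 s).
  apply: (near_continuous _ (@Vs_open _ _ _ y D)); [apply: cs; lra|exact: Vs_self Hn].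
have [d d00 Hd] := (near_eps _ _).1 NV.
pose a := Num.max (t / 2) (t - d / 2).
have at2 : t / 2 <= a by rewrite le_max lexx.
have ad : t - d / 2 <= a by rewrite le_max lexx orbT.
have at_ : a < t by rewrite gt_max; lra.
have [ O0 [th0 [gO0 O0a]]] := H a ltac:(lra).
have gO := good_onS gO0 (@Vs_open _ _ _ y D).
set O := _ `&` _ in gO.
have Va s : a <= s <= t -> Vs y D (sg p y0 s).
  by move=> s1; apply: Hd; rewrite ltr_norml; lra.
have Oa : O (sg p y0 a) by split=> //; apply: Va; lra.
have NO : \forall s \near a, O (sg p y0 s).
  by apply: (near_continuous _ (go_open gO)) => //; apply: cs; lra.
have [d' d'0 Hd'] := (near_eps _ _).1 NO.
pose a1 := Num.min t (a + d' / 2).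
have a1t : a1 <= t by rewrite ge_min lexx.
have a1d : a1 <= a + d' / 2 by rewrite ge_min lexx orbT.
have aa1 : a < a1 by rewrite lt_min; lra.
(* Above [th0], and so close to 1 that [th * a] remains in the neighborhood of [a] given by [d']. *)
pose th := Num.max (1 / 2) (Num.max ((1 + th0) / 2) (1 - d' / 2)).
have th2 : 1 / 2 <= th by rewrite le_max lexx.
have th_0 : (1 + th0) / 2 <= th by rewrite !le_max lexx orbT.
have thd : 1 - d' / 2 <= th by rewrite !le_max lexx !orbT.
have tho := go_th gO.
have th_1 : th < 1 by rewrite !gt_max; lra.
apply: (@good_next _ _ M UG p y0 a a1 t th th0 O y rho C lam D) => //.
- by split; lra.
- lra.
- lra.
- by move=> z [].
- by apply: Hd'; rewrite ltr_norml; nra.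
- by apply: Hd'; rewrite ltr_norml; lra.
Qed.

Lemma good_all p y : good p y.
Proof.
rewrite -(sg1 UG p y); apply: (@real_induction _ (fun t => good p (sg p y t)) 0 1 _ _ _ _ 1 itv1) => //.
- by rewrite sg0; exact: good_self.
- move=> t t1 H; have [ O [th0 [gO Ot]]] := H t ltac:(lra).
  have c : {for t, continuous (sg p y)}.
    by apply: geodesic_continuous; [case: (sgP UG p y)|lra].
  have [d d0 Hd] := (near_eps _ _).1 (near_continuous c (go_open gO) Ot).
  exists d => // s st _; exists O, th0; split=> //; apply: Hd; rewrite ltr_norml; lra.
- move=> t t1 H; apply: good_closed; first lra.
  by move=> s s1; apply: H; lra.
Qed.

Lemma gdist_continuous p y : {for y, continuous (gdist p)}.
Proof. by have [ O [th0 [gO Oy]]] := good_all p y; exact: (go_cont gO). Qed.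

Lemma gdist_local p y : exists2 O : set M, open O /\ O y & forall z z', O z -> O z' ->
  gdist p z' <= gdist p z + gdist z z'.
Proof.
have [ O [th0 [gO Oy]]] := good_all p y; exists O; last exact: (go_tri gO).
by split=> //; exact: (go_open gO).
Qed.

(** The inequality near each point is summed along the geodesic from [y] to [z], on which lengths of
    subpieces add up. *)
Lemma gdist_triangle x y z : gdist x z <= gdist x y + gdist y z.
Proof.
suff H (t : R) : 0 <= t <= 1 -> gdist x (sg y z t) <= gdist x y + t * gdist y z.
  by have := H 1 itv1; rewrite sg1 mul1r.
move: t.
have cs s : 0 <= s <= 1 -> {for s, continuous (sg y z)}.
  by move=> s1; apply: geodesic_continuous s1; case: (sgP UG y z).
have step (t : R) : 0 <= t <= 1 -> exists2 d, 0 < d & forall r s, `|r - t| < d -> `|s - t| < d ->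
    0 <= r <= 1 -> 0 <= s <= 1 -> r <= s ->
    gdist x (sg y z s) <= gdist x (sg y z r) + (s - r) * gdist y z.
  move=> t1; have [ O [oO Ot] triO] := gdist_local x (sg y z t).
  have [d d0 Hd] := (near_eps _ _).1 (near_continuous (cs t t1) oO Ot).
  exists d => // r s rd sd r1 s1 rs.
  have := triO _ _ (Hd r rd) (Hd s sd); rewrite gdist_sg // ger0_norm //; lra.
apply: real_induction => //.
- by rewrite sg0 mul0r addr0.
- move=> t t1 H; have [|d d0 Hd] := step t; first lra.
  exists d => // s st s1; have h1 := H t ltac:(lra).
  have := Hd t s; rewrite subrr normr0 => /(_ d0).
  have sd : `|s - t| < d by rewrite ltr_norml; lra.
  by move=> /(_ sd ltac:(lra_of t1) ltac:(lra_of t1 st s1) ltac:(lra_of st)); rewrite mulrBl; lra_of h1.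
- move=> t t1 H; have [|d d0 Hd] := step t; first lra.
  pose r := Num.max (t / 2) (t - d / 2).
  have at2 : t / 2 <= r by rewrite le_max lexx.
  have ad : t - d / 2 <= r by rewrite le_max lexx orbT.
  have rt : r < t by rewrite gt_max; lra.
  have h1 := H r ltac:(lra).
  have := Hd r t; rewrite subrr normr0.
  have rd : `|r - t| < d by rewrite ltr_norml; lra.
  by move=> /(_ rd d0 ltac:(lra_of t1 at2 rt) ltac:(lra_of t1) ltac:(lra_of rt)); rewrite mulrBl; lra_of h1.
Qed.

End triangle_global.

(** * The Riemannian distance *)

Lemma inf_is {R : realType} (S : set R) (m : R) : S m -> (forall l, S l -> m <= l) -> inf S = m.
Proof.
move=> Sm H; apply/eqP; rewrite eq_le; apply/andP; split.
  by apply: ge_inf => //; exists m => l /H.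
by apply: lb_le_inf; [exists m|move=> l /H].
Qed.

Section length.
Context {R : realType} {n : nat} (M : riemannian_manifold R n).
Implicit Types (p q x y : M) (c : R -> M).

Lemma gf_cont (T : topologicalType) p (f a b : T -> 'rV[R]_n) t : img p (f t) ->
  {for t, continuous f} -> {for t, continuous a} -> {for t, continuous b} ->
  {for t, continuous (fun s => gf p (f s) (a s) (b s))}.
Proof.
move=> pf cf ca cb; apply: cont_sum => i; apply: cont_sum => j.
apply: contM; last exact: cont_coord.
apply: contM; last exact: cont_coord.
apply: (@cont_comp _ _ _ f (fun u => metric p u i j) t cf).
exact: (smooth_continuous (smooth_metric p i j)).
Qed.

Lemma speedE p c (t : R) v : {for t, continuous c} -> dom p (c t) -> der (chart p \o c) t v ->
  tnorm (c t) (velocity c t) = Num.sqrt (gf p (chart p (c t)) v v).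
Proof. by move=> cc pc dc; rewrite /tnorm -/(speed2 c t) (speed2_chart cc pc dc). Qed.

Lemma C1_der p c (t : R) : C1_curve c -> dom p (c t) ->
  (\forall s \near t, der (chart p \o c) s (d1 (chart p \o c) s)) /\
  {for t, continuous (d1 (chart p \o c))}.
Proof.
move=> [cc Hc] pc; have N : \forall s \near t, dom p (c s).
  by apply: (near_continuous (cc t)) => //; exact: dom_open.
split; first by apply: filterS N => s /Hc[h _]; apply/derP; split; [exact: h|].
by rewrite d1E; exact: (Hc p t pc).2.
Qed.

Lemma speed_continuous c (t : R) : C1_curve c ->
  {for t, continuous (fun s => tnorm (c s) (velocity c s))}.
Proof.
move=> Hc; have cc := Hc.1; pose p := c t; have pc : dom p (c t) by exact: dom_self.
have [N cd] := C1_der Hc pc.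
have Np : \forall s \near t, dom p (c s).
  by apply: (near_continuous (cc t)) => //; exact: dom_open.
have E : \forall s \near t, Num.sqrt (gf p (chart p (c s)) (d1 (chart p \o c) s) (d1 (chart p \o c) s))
    = tnorm (c s) (velocity c s).
  by apply: filterS2 N Np => s ds ps; rewrite (speedE (cc s) ps ds).
apply: (near_eq_continuous E).
apply: (@cont_comp _ _ _ (fun s => gf p (chart p (c s)) (d1 (chart p \o c) s) (d1 (chart p \o c) s)) Num.sqrt); last exact: sqrt_continuous.
apply: gf_cont => //; first exact: img_chart.
by apply: (cont_comp (cc t)); exact: chart_continuous.
Qed.

Lemma curve_length_prim c (P : R -> R) : C1_curve c ->
  (forall t, 0 <= t <= 1 -> der P t (tnorm (c t) (velocity c t))) -> curve_length c = P 1 - P 0.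
Proof.
move=> Hc dP; rewrite /curve_length /Rintegral (@continuous_FTC2 _ _ P) //.
- by apply: continuous_in_subspaceT => t _; exact: speed_continuous.
- have cP t : 0 <= t <= 1 -> {for t, continuous P} by move=> /dP; exact: der_continuous.
  split.
  + by move=> t; rewrite in_itv /= => t1; have /derP[] := dP t ltac:(lra).
  + exact: (cvg_at_right_filter (cP 0 itv0)).
  + exact: (cvg_at_left_filter (cP 1 itv1)).
- by move=> t; rewrite in_itv /= => t1; have /derP[_] := dP t ltac:(lra); rewrite d1E.
Qed.

Hypothesis UG : uniquely_geodesic M.
Local Notation sg := (sg UG).

(** For a short time the chord is estimated by [nice_line]: the metric length of the coordinate
    segment is close to the speed of [c] at [t] times the elapsed time. *)
Lemma gdist_infinitesimal c (t e : R) v : let q := c t in {for t, continuous c} ->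
  der (chart q \o c) t v -> 0 < e ->
  exists2 d, 0 < d & forall s, `|s| < d ->
    gdist (c t) (c (s + t)) <= (Num.sqrt (gf q (chart q q) v v) + e) * `|s|.
Proof.
move=> q cc dc e0; have [rho [C [lam [D Hn]]]] := nice_ex q.
set l := Num.sqrt _; have l0 : 0 <= l by exact: sqrtr_ge0.
have iq := img_chart (dom_self q).
have lE : l ^+ 2 = gf q (chart q q) v v by rewrite sqr_sqrtr // gf_ge0.
have cg : {for (chart q q, v), continuous (fun x : 'rV[R]_n * 'rV[R]_n => gf q x.1 x.2 x.2)}.
  by apply: (@gf_cont _ q fst snd snd); [exact: iq|exact: cont_fst|exact: cont_snd|exact: cont_snd].
have N : \forall x \near (chart q q, v), gf q x.1 x.2 x.2 < (l + e) ^+ 2.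
  apply: (near_continuous cg (@open_lt _ _)); rewrite /= -lE; nra.
have [[A B] /= [/near_eps[d1 d10 HA] /near_eps[d2 d20 HB]] HAB] := N.
have [d3 d30 Hd3] := der_eps dc (divr_gt0 d20 (ltr0Sn R 1)).
have cph : {for t, continuous (chart q \o c)} by exact: der_continuous dc.
have [d4 d40 Hd4] := continuous_eps cph d10.
have NV : \forall s \near t, Vs q D (c s).
  by apply: (near_continuous cc (@Vs_open _ _ _ q D)); exact: (Vs_self Hn).
have [d5 d50 Hd5] := (near_eps _ _).1 NV.
exists (Num.min d3 (Num.min d4 d5)); first by rewrite !lt_min d30 d40.
move=> s; rewrite !lt_min => /and3P[s3 s4 s5].
have [->|s0] := eqVneq s 0; first by rewrite add0r gdistxx // normr0 mulr0.
have Vq : Vs q D q by exact: (Vs_self Hn).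
have Vc : Vs q D (c (s + t)) by apply: Hd5; rewrite addrK.
pose w := s^-1 *: (chart q (c (s + t)) - chart q q).
have wE : chart q (c (s + t)) - chart q q = s *: w by rewrite /w scalerA mulfV // scale1r.
have wv : `|w - v| < d2.
  have := Hd3 s s3; rewrite /= wE -scalerBr normrZ mulrC ler_pM2r ?normr_gt0 // => h.
  by apply: (le_lt_trans h); rewrite ltr_pdivrMr // ltr_pMr // ltr1n.
have := nice_line UG Hn Vq Vc (K := ((l + e) * `|s|) ^+ 2) => /(_ _).
rewrite -/q => H; rewrite -ler_sqr ?nnegrE ?gdist_ge0 ?mulr_ge0 ?addr_ge0 //; last exact: ltW.
apply: H => r r1; rewrite wE.
have -> : gf q (chart q q + r *: (s *: w)) (s *: w) (s *: w) =
    s ^+ 2 * gf q (chart q q + r *: (s *: w)) w w by rewrite /gf !bilE; ring.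
rewrite exprMn mulrC real_normK ?num_real // ler_pM2r; last by rewrite exprn_even_gt0.
apply: ltW; apply: (HAB (chart q q + r *: (s *: w), w)); split; last exact: HB.
apply: HA; rewrite /= addrAC subrr add0r normrZ -wE.
have h4 : `|chart q (c (s + t)) - chart q q| < d1 by apply: Hd4; rewrite addrK.
by apply: le_lt_trans h4; rewrite ger0_norm ?ler_piMl //; lra_of r1.
Qed.

(** Induction along the curve with a slack [e * t]: one half of [e] absorbs the error of the chord,
    the other half that of the primitive of the speed. *)
Lemma gdist_le_length c : C1_curve c -> gdist (c 0) (c 1) <= curve_length c.
Proof.
move=> Hc; have cc := Hc.1; set l := fun t => tnorm (c t) (velocity c t).
have cl : continuous l by move=> t; exact: speed_continuous.
have [P [P0 dP']] := primitive_real cl.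
have dP t : 0 <= t <= 1 -> der P t (l t) by move=> t1; apply: dP'; lra.
rewrite (curve_length_prim Hc dP).
apply/ler_addgt0Pr => e e0.
have loc t : 0 <= t <= 1 -> exists2 d, 0 < d & forall s, `|s| < d ->
    gdist (c t) (c (s + t)) <= l t * `|s| + e / 2 * `|s| /\
    `|P (s + t) - P t - s * l t| <= e / 2 * `|s|.
  move=> t1; have e2 : 0 < e / 2 by lra.
  have [N _] := C1_der Hc (dom_self (c t)); have dc := nbhs_singleton N.
  have [d1 d10 H1] := gdist_infinitesimal (cc t) dc e2.
  have [d2 d20 H2] := der_eps (dP t t1) e2.
  exists (Num.min d1 d2) => [|s]; first by rewrite lt_min d10.
  rewrite lt_min => /andP[/H1 h1 /H2 h2]; split; last exact: h2.
  by rewrite /l (speedE (cc t) (dom_self (c t)) dc) -mulrDl.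
suff H : forall t, 0 <= t <= 1 -> gdist (c 0) (c t) <= P t - P 0 + e * t.
  by have := H 1 itv1; rewrite mulr1.
apply: real_induction => //.
- by rewrite gdistxx // subrr mulr0 addr0.
- move=> t t1 H; have [|d d0 Hd] := loc t; first lra.
  exists d => // s st s1; have h1 := H t ltac:(lra).
  have sd : `|s - t| < d by rewrite ltr_norml; lra.
  have [h2 h3] := Hd (s - t) sd; rewrite subrK in h2 h3.
  have h4 := gdist_triangle UG (c 0) (c t) (c s).
  rewrite (_ : `|s - t| = s - t) in h2 h3; last by rewrite ger0_norm; lra_of st.
  by move: h3; rewrite ler_norml => /andP[h3 _]; move: h1 h2 h3 h4; rewrite P0 -/(l t); move: (l t) => lt; nra.
- move=> t t1 H; have [|d d0 Hd] := loc t; first lra.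
  pose s := Num.max (t / 2) (t - d / 2).
  have s2 : t / 2 <= s by rewrite le_max lexx.
  have sd2 : t - d / 2 <= s by rewrite le_max lexx orbT.
  have st : s < t by rewrite gt_max; lra.
  have h1 := H s ltac:(lra).
  have sd : `|s - t| < d by rewrite ltr_norml; lra.
  have [h2 h3] := Hd (s - t) sd; rewrite subrK in h2 h3.
  have h4 := gdist_triangle UG (c 0) (c s) (c t); rewrite (gdistC UG (c s)) in h4.
  rewrite (_ : `|s - t| = t - s) in h2 h3; last by rewrite distrC ger0_norm; lra_of st.
  by move: h3; rewrite ler_norml => /andP[_ h3]; move: h1 h2 h3 h4; rewrite P0 -/(l t); move: (l t) => lt; nra.
Qed.


(** [C1_curve] concerns all real times, whereas a geodesic is controlled only near [0, 1]. The
    function [m] below is a C^1 nondecreasing map of the line into [0, 1], equal to 0 before 0 and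
    to 1 after 1; [sg] composed with it is a competitor of the same length. *)
Let h (s : R) := Num.max 0 s ^+ 2.
Let m (t : R) := 1 - h (1 - h t).
Let m' (t : R) := 2 * Num.max 0 (1 - h t) * (2 * Num.max 0 t).

Let max_neg (s : R) : s <= 0 -> Num.max 0 s = 0.
Proof. by move=> s0; apply/max_idPl. Qed.

Let max_pos (s : R) : 0 <= s -> Num.max 0 s = s.
Proof. by move=> s0; apply/max_idPr. Qed.

Let der_h t : der h t (2 * Num.max 0 t).
Proof.
have /orP[t0|t0] : (t < 0) || (0 <= t) by case: ltP.
  rewrite max_neg ?mulr0 ?(ltW t0) //; apply: (@near_eq_der _ _ (fun=> 0)); last exact: der_cst.
  apply/near_eps; exists (- t) => [|s]; first lra.
  by rewrite ltr_norml => st; rewrite /h max_neg ?expr0n //; lra.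
rewrite max_pos //; move: t0; rewrite le_eqVlt => /predU1P[t0|t0]; last first.
  apply: (@near_eq_der _ _ (fun s => s * s)).
    apply/near_eps; exists t => // s.
    by rewrite ltr_norml => st; rewrite /h max_pos //; lra.
  by apply: der_eq; [apply: derM; exact: der_id|rewrite mul1r mulr1; ring].
rewrite -t0 mulr0; apply/derP.
have lim : (fun x : R => x^-1 *: (h (x + 0) - h 0)) @ 0^' --> (0 : R).
  apply/cvgrPdist_le => e e0; near=> x.
  have x0 : x != 0 by near: x; exact: nbhs_dnbhs_neq.
  have xe : `|x| < e by near: x; exact: dnbhs0_lt.
  rewrite addr0 /h maxxx expr0n subr0 sub0r normrN normrZ normrV ?unitfE //.
  rewrite ler_pdivrMl ?normr_gt0 // normrX expr2.
  have k : `|Num.max 0 x| <= `|x| by case: (leP 0 x) => // _; rewrite normr0.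
  by apply: ler_pM => //; exact: (le_trans k (ltW xe)).
have lim' : (fun x : R => x^-1 *: ((h \o shift 0) (x *: 1) - h 0)) @ 0^' --> (0 : R).
  by apply: cvg_trans lim; apply: near_eq_cvg; near=> x; rewrite /= [x *: 1]mulr1.
split; first by apply/cvg_ex; exists 0; exact: lim'.
by rewrite d1E derive1E; apply: cvg_lim.
Unshelve. all: by end_near. Qed.

Let der_m t : der m t (m' t).
Proof.
have d2 : der (fun s => 1 - h s) t (0 - 2 * Num.max 0 t).
  by apply: derB; [exact: der_cst|exact: der_h].
have d3 : der (fun s => h (1 - h s)) t ((0 - 2 * Num.max 0 t) *: (2 * Num.max 0 (1 - h t))).
  exact: (@der_comp _ _ h (fun s => 1 - h s) _ _ t (der_h _) d2).
apply: der_eq; first by apply: derB; [exact: der_cst|exact: d3].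
by rewrite /m' /GRing.scale /=; ring.
Qed.

Let m_in t : 0 <= m t <= 1.
Proof.
have H s : 0 <= h s by rewrite /h sqr_ge0.
have h1 : h (1 - h t) <= 1.
  rewrite /h -[leRHS](expr1n _ 2) ler_sqr ?nnegrE // ?le_max ?lexx // ge_max ler01 /=.
  by have := H t; rewrite /h; lra.
by have := H (1 - h t); rewrite /m; lra.
Qed.

Let cont_m' t : {for t, continuous m'}.
Proof.
have cmax (f : R -> R) s : {for s, continuous f} -> {for s, continuous (fun s => Num.max 0 (f s))}.
  move=> cf; apply: (@cont_comp _ _ _ (fun s => (0, f s)) (fun x : R * R => Num.max x.1 x.2)).
    by apply: cont_pair => //; exact: cont_cst.
  exact: max_continuous.
apply: contM; apply: contM; try exact: contC.
  apply: cmax; apply: contB; first exact: contC.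
  exact: (der_continuous (der_h t)).
by apply: cmax; exact: cont_id.
Qed.

Lemma length_le_gdist x y : exists c, [/\ C1_curve c, c 0 = x, c 1 = y & curve_length c = gdist x y].
Proof.
have [gs s0 s1] := sgP UG x y; pose c t := sg x y (m t).
have cm t : {for t, continuous m} := der_continuous (der_m t).
have cc t : {for t, continuous c}.
  by apply: (cont_comp (cm t)); exact: (geodesic_continuous gs (m_in t)).
have m0 : m 0 = 0 by rewrite /m /h maxxx expr0n /= subr0 max_pos // expr1n subrr.
have m1 : m 1 = 1 by rewrite /m /h (max_pos ler01) expr1n subrr maxxx expr0n subr0.
have m'0 t : 0 <= m' t by rewrite !mulr_ge0 // le_max lexx.
have dc p t : dom p (c t) ->
    der (chart p \o c) t (m' t *: d1 (chart p \o sg x y) (m t)).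
  move=> pc; have [/nbhs_singleton dg _] := geodesic_chart (gs _ (m_in t)) pc.
  exact: (@der_comp _ _ (chart p \o sg x y) m _ _ t dg (der_m t)).
have C1 : C1_curve c.
  split=> // p t pc; have N : \forall s \near t, dom p (c s).
    by apply: (near_continuous (cc t)) => //; exact: dom_open.
  have /derP[h1 h2] := dc p t pc; split; first exact: h1.
  rewrite -d1E; have c1 : {for t, continuous (fun s => m' s *: d1 (chart p \o sg x y) (m s))}.
    apply: continuousZ; first exact: cont_m'.
    have [_ dv] := geodesic_chart (gs _ (m_in t)) pc.
    by apply: (cont_comp (cm t)); exact: der_continuous dv.
  by apply: near_eq_continuous c1; apply: filterS N => s /dc /derP[_].
exists c; split=> //; [by rewrite /c m0|by rewrite /c m1|].
rewrite (curve_length_prim C1 (P := fun t => gdist x y * m t)).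
  by rewrite m0 m1 mulr0 subr0 mulr1.
move=> t _; apply: der_eq; first by apply: derM; [exact: der_cst|exact: der_m].
have pc := dom_self (c t).
rewrite (speedE (cc t) pc (dc _ _ pc)) mul0r add0r.
have [/nbhs_singleton dg _] := geodesic_chart (gs _ (m_in t)) pc.
have := gdist_speed2 UG (sgP UG x y) (m_in t).
have cg : {for m t, continuous (sg x y)} := geodesic_continuous gs (m_in t).
rewrite (@speed2_chart _ _ _ (c t) (sg x y) (m t) _ cg pc dg).
rewrite /gf !bilE -/(gf _ _ _ _) mulrA => <-.
rewrite [X in Num.sqrt X](_ : _ = (gdist x y * m' t) ^+ 2); last by ring.
by rewrite sqrtr_sqr ger0_norm // mulr_ge0 // gdist_ge0.
Qed.

Lemma distE x y : dist x y = gdist x y.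
Proof.
apply: inf_is.
  by have [c [Hc c0 c1 cl]] := length_le_gdist x y; exists c.
by move=> l [c [Hc <- <- ->]]; exact: gdist_le_length.
Qed.

End length.

(** * Curvature and the second variation *)

Section curvature.
Context {R : realType} {n : nat} (M : riemannian_manifold R n).
Implicit Types (p q x : M) (u v e f a b w : 'rV[R]_n).

Lemma Gam0l p u b : Gam p u 0 b = 0.
Proof. by apply/rowP => k; rewrite !mxE bil0l. Qed.
Lemma Gam0r p u a : Gam p u a 0 = 0.
Proof. by apply/rowP => k; rewrite !mxE bil0r. Qed.

Lemma dGamZl p u l e a b : dGam p u (l *: e) a b = l *: dGam p u e a b.
Proof.
apply/rowP => k; rewrite !mxE /bil mulr_sumr; apply: eq_bigr => i _; rewrite mulr_sumr.
by apply: eq_bigr => j _ /=; rewrite dpartZ; ring.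
Qed.

Lemma dGamZm p u l e a b : dGam p u e (l *: a) b = l *: dGam p u e a b.
Proof. by apply/rowP => k; rewrite !mxE bilZl. Qed.

Lemma dGamC p u e a b : img p u -> dGam p u e a b = dGam p u e b a.
Proof.
move=> pu; apply/rowP => k; rewrite !mxE; apply: bilC => i j.
apply: eq_bigr => l _; congr (_ * _); rewrite pdE; apply: near_eq_derive; apply/near_eps.
have [d d0 Hd] := open_eps (@img_open _ _ _ p) pu.
by exists d => // y /Hd py; exact: christoffelC.
Qed.

(** R(a, b) w at any point of any chart, whereas [curvature_op] uses only the chart attached to the
    point. *)
Definition Rm p u a b w : 'rV[R]_n :=
  dGam p u a b w - dGam p u b a w + Gam p u a (Gam p u b w) - Gam p u b (Gam p u a w).

Lemma RmN p u a b w : Rm p u a b w = - Rm p u b a w.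
Proof. by rewrite /Rm; apply/rowP => k; rewrite !mxE; ring. Qed.

Lemma RmZl p u l a b w : Rm p u (l *: a) b w = l *: Rm p u a b w.
Proof.
rewrite /Rm dGamZl dGamZm !(GamZl, GamZr).
by apply/rowP => k; rewrite !mxE; ring.
Qed.

Lemma RmZm p u l a b w : Rm p u a (l *: b) w = l *: Rm p u a b w.
Proof. by rewrite RmN RmZl RmN scalerN opprK. Qed.

Lemma Rmxx p u a w : Rm p u a a w = 0.
Proof. by rewrite /Rm; apply/rowP => k; rewrite !mxE; ring. Qed.

Lemma curvature_opE x a b w : curvature_op x a b w = Rm x (chart x x) a b w.
Proof.
set u := chart x x; apply/rowP => l; rewrite !mxE.
pose S1 := \sum_k \sum_i \sum_j pd i (fun z => christoffel x z l j k) u * w 0 k * a 0 i * b 0 j.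
pose S2 := \sum_k \sum_i \sum_j pd j (fun z => christoffel x z l i k) u * w 0 k * a 0 i * b 0 j.
pose S3 := \sum_k \sum_i \sum_j \sum_m christoffel x u l i m * christoffel x u m j k * w 0 k * a 0 i * b 0 j.
pose S4 := \sum_k \sum_i \sum_j \sum_m christoffel x u l j m * christoffel x u m i k * w 0 k * a 0 i * b 0 j.
have -> : \sum_k \sum_i \sum_j curvature x u l k i j * w 0 k * a 0 i * b 0 j = S1 - S2 + S3 - S4.
  rewrite /S1 /S2 /S3 /S4 -sumrB -big_split -sumrB; apply: eq_bigr => k _ /=.
  rewrite -sumrB -big_split -sumrB; apply: eq_bigr => i _ /=.
  rewrite -sumrB -big_split -sumrB; apply: eq_bigr => j _ /=.
  rewrite /curvature -pdE; move: (pd i _ u) (pd j _ u) => A B.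
  rewrite -[RHS]addrA.
  have -> : \sum_m (christoffel x u l i m * christoffel x u m j k * w 0 k * a 0 i * b 0 j) -
      \sum_m (christoffel x u l j m * christoffel x u m i k * w 0 k * a 0 i * b 0 j) =
      (\sum_m (christoffel x u l i m * christoffel x u m j k
            - christoffel x u l j m * christoffel x u m i k)) * w 0 k * a 0 i * b 0 j.
    rewrite -sumrB !mulr_suml; apply: eq_bigr => m _.
    move: (christoffel x u l i m) (christoffel x u m j k) (christoffel x u l j m) (christoffel x u m i k).
    by move=> c1 c2 c3 c4; ring.
  by move: (\sum_m _) => S; ring.
congr (_ + _ + _ + _).
- rewrite /S1 /bil [RHS]exchange_big; apply: eq_bigr => k _; rewrite exchange_big.
  apply: eq_bigr => j _; rewrite /dpart !mulr_suml; apply: eq_bigr => i _; ring.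
- congr (- _); rewrite /S2 /bil [RHS]exchange_big; apply: eq_bigr => k _.
  apply: eq_bigr => j _; rewrite /dpart !mulr_suml; apply: eq_bigr => i _; ring.
- rewrite /S3 /bil exchange_big; apply: eq_bigr => i _ /=.
  transitivity (\sum_m \sum_k \sum_j christoffel x u l i m * christoffel x u m j k * w 0 k * a 0 i * b 0 j).
    by rewrite [RHS]exchange_big; apply: eq_bigr => k _; rewrite exchange_big.
  apply: eq_bigr => m _; rewrite mxE /bil exchange_big mulr_sumr; apply: eq_bigr => j _.
  by rewrite mulr_sumr; apply: eq_bigr => k _; ring.
- congr (- _); rewrite /S4 /bil; under eq_bigr => k _ do rewrite exchange_big.
  rewrite exchange_big; apply: eq_bigr => i _ /=.
  transitivity (\sum_m \sum_k \sum_j christoffel x u l i m * christoffel x u m j k * w 0 k * a 0 j * b 0 i).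
    by rewrite [RHS]exchange_big; apply: eq_bigr => k _; rewrite exchange_big.
  apply: eq_bigr => m _; rewrite mxE /bil exchange_big mulr_sumr; apply: eq_bigr => j _.
  by rewrite mulr_sumr; apply: eq_bigr => k _; ring.
Qed.

Definition D3T p q u f e a : 'rV[R]_n :=
  \row_k bil (fun i j => dpart (pd i (pd j (fun z => tr p q z 0 k))) u f) e a.

Lemma D3TC p q u f e a : imgI p q u -> D3T p q u f e a = D3T p q u e f a.
Proof.
move=> pqu; apply/rowP => k; rewrite !mxE /bil /dpart.
transitivity (\sum_i \sum_m \sum_j f 0 m * pd m (pd i (pd j (fun z => tr p q z 0 k))) u * e 0 i * a 0 j).
  apply: eq_bigr => i _; rewrite exchange_big; apply: eq_bigr => j _.
  by rewrite !mulr_suml.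
rewrite exchange_big; apply: eq_bigr => m _; rewrite exchange_big; apply: eq_bigr => j _.
rewrite !mulr_suml; apply: eq_bigr => i _.
rewrite (@pdC _ _ _ _ _ m i (@imgI_open _ _ _ p q) (smooth_pd j (smooth_tr p q k)) pqu).
ring.
Qed.

(** The law [Gam_tr] is differentiated once more. Antisymmetrization in the first two vectors
    removes the third derivatives [D3T] and the terms with the symmetric [D2T p q u f e]; a second
    use of [Gam_tr] absorbs the rest. *)
Lemma Rm_tr p q u f e a : imgI p q u ->
  DT p q u (Rm p u f e a) = Rm q (tr p q u) (DT p q u f) (DT p q u e) (DT p q u a).
Proof.
move=> pqu; have pu := imgI_img pqu; have qu := imgI_tr pqu.
have key f0 e0 : D2T p q u f0 (Gam p u e0 a) + DT p q u (dGam p u f0 e0 a) =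
    dGam q (tr p q u) (DT p q u f0) (DT p q u e0) (DT p q u a)
    + Gam q (tr p q u) (D2T p q u f0 e0) (DT p q u a)
    + Gam q (tr p q u) (DT p q u e0) (D2T p q u f0 a) + D3T p q u f0 e0 a.
  have u0 : u = u + (0 : R) *: f0 by rewrite scale0r addr0.
  have dl := @der_line R n u f0 0.
  have ii : imgI p q (u + (0 : R) *: f0) by rewrite -u0.
  have DTc a1 : der (fun s : R => DT p q (u + s *: f0) a1) 0 (D2T p q u f0 a1).
    apply: der_eq; first by apply: der_DT (der_cst _ _) => //; exact: dl.
    by rewrite /= -u0 -[X in DT _ _ _ X](scale0r a1) DTZ scale0r addr0.
  have dG : der (fun s : R => Gam p (u + s *: f0) e0 a) 0 (dGam p u f0 e0 a).
    apply: der_eq; first by apply: (der_Gam (c := fun s : R => u + s *: f0) (a := fun=> e0) (b := fun=> a) _ dl (der_cst _ _) (der_cst _ _)); rewrite -u0.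
    by rewrite /= -u0 Gam0l Gam0r !addr0.
  have dL : der (fun s : R => DT p q (u + s *: f0) (Gam p (u + s *: f0) e0 a)) 0
      (D2T p q u f0 (Gam p u e0 a) + DT p q u (dGam p u f0 e0 a)).
    apply: der_eq; first exact: (der_DT ii dl dG).
    by rewrite /= -u0.
  have dtr : der (fun s : R => tr p q (u + s *: f0)) 0 (DT p q u f0).
    by apply: der_eq; [exact: (der_tr ii dl)|rewrite /= -u0].
  have dD : der (fun s : R => D2T p q (u + s *: f0) e0 a) 0 (D3T p q u f0 e0 a).
    apply/der_rVP => k; rewrite mxE (_ : (fun s => _) = fun s : R =>
      bil (fun i j => pd i (pd j (fun z => tr p q z 0 k)) (u + s *: f0)) e0 a); last first.
      by apply/funext => s; rewrite mxE.
    have H i j : der (fun s : R => pd i (pd j (fun z => tr p q z 0 k)) (u + s *: f0)) 0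
        (dpart (pd i (pd j (fun z => tr p q z 0 k))) (u + (0 : R) *: f0) f0).
      apply: (der_along _ dl).
      exact: (smooth_differentiable (smooth_pd i (smooth_pd j (smooth_tr p q k)))).
    have := @der_bil _ _ (fun s i j => pd i (pd j (fun z => tr p q z 0 k)) (u + s *: f0))
       (fun s i j => dpart (pd i (pd j (fun z => tr p q z 0 k))) (u + s *: f0) f0)
       (fun=> e0) (fun=> a) 0 0 0 H (der_cst _ _) (der_cst _ _).
    by rewrite -u0 !bilE !addr0.
  have dR : der (fun s : R => Gam q (tr p q (u + s *: f0)) (DT p q (u + s *: f0) e0) (DT p q (u + s *: f0) a)
      + D2T p q (u + s *: f0) e0 a) 0
      (dGam q (tr p q u) (DT p q u f0) (DT p q u e0) (DT p q u a)
    + Gam q (tr p q u) (D2T p q u f0 e0) (DT p q u a)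
    + Gam q (tr p q u) (DT p q u e0) (D2T p q u f0 a) + D3T p q u f0 e0 a).
    apply: der_eq.
      by apply: derD; [apply: (der_Gam _ dtr (DTc e0) (DTc a)); rewrite -u0|exact: dD].
    by rewrite /= -u0.
  apply: (der_unique dL); apply: near_eq_der dR.
  have cl : {for 0, continuous (fun s : R => u + s *: f0)} by exact: der_continuous dl.
  have N : \forall s \near (0 : R), imgI p q (u + s *: f0).
    by apply: near_continuous cl (@imgI_open _ _ _ p q) _; rewrite -u0.
  by apply: filterS N => s Hs; rewrite Gam_tr.
have E1 : DT p q u (dGam p u f e a) = dGam q (tr p q u) (DT p q u f) (DT p q u e) (DT p q u a)
    + Gam q (tr p q u) (D2T p q u f e) (DT p q u a)
    + Gam q (tr p q u) (DT p q u e) (D2T p q u f a) + D3T p q u f e a - D2T p q u f (Gam p u e a).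
  by rewrite -key addrAC subrr add0r.
have E2 : DT p q u (dGam p u e f a) = dGam q (tr p q u) (DT p q u e) (DT p q u f) (DT p q u a)
    + Gam q (tr p q u) (D2T p q u f e) (DT p q u a)
    + Gam q (tr p q u) (DT p q u f) (D2T p q u e a) + D3T p q u f e a - D2T p q u e (Gam p u f a).
  by rewrite (D2TC f e) // (D3TC f e) // -key addrAC subrr add0r.
rewrite /Rm !(DTD, DTN) E1 E2 !Gam_tr // !GamDr.
by apply/rowP => k; rewrite !mxE; ring.
Qed.


Lemma gf_CauchySchwarz p u a b : img p u -> row_free (col_mx a b) ->
  gf p u a b ^+ 2 < gf p u a a * gf p u b b.
Proof.
move=> pu ab.
have indep l m : l *: a + m *: b = 0 -> l = 0 /\ m = 0.
  move=> E; have : row_mx l%:M m%:M *m col_mx a b = 0 :> 'rV_n.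
    by rewrite mul_row_col !mul_scalar_mx.
  move=> /eqP; rewrite mulmx_free_eq0 // => /eqP E'.
  have := congr1 (fun A : 'rV_(1 + 1) => A 0 (lshift 1 0)) E'.
  have := congr1 (fun A : 'rV_(1 + 1) => A 0 (rshift 1 0)) E'.
  by rewrite row_mxEl row_mxEr !mxE !eqxx !mulr1n.
have b0 : b != 0.
  apply/eqP => b0; have [_ /eqP] := indep 0 1 (ltac:(by rewrite scale0r add0r b0 scaler0)).
  by rewrite oner_eq0.
have gb := gf_gt0 pu b0.
have v0 : gf p u b b *: a - gf p u a b *: b != 0.
  apply/eqP; rewrite -scaleNr => /indep[E _].
  by move: gb; rewrite E ltxx.
have := gf_gt0 pu v0.
rewrite {1}/gf !bilE -!/(gf _ _ _ _) (gfC b a) //.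
move: (gf p u a a) (gf p u b b) (gf p u a b) gb => A B C B0.
rewrite (_ : _ + _ = B * (A * B - C ^+ 2)); last by ring.
by rewrite pmulr_rgt0 // subr_gt0.
Qed.

(** Sectional curvature divides by the Gram determinant, which is at most the product of the squared
    norms; a bound [kappa' <= 0] allows the product in its place. The inequality then includes
    dependent vectors, for which the curvature term vanishes. *)
Lemma sectional_lower (kappa kappa' : R) q u a b : sectional_ge M kappa ->
  kappa' <= kappa -> kappa' <= 0 -> img q u ->
  kappa' * (gf q u a a * gf q u b b) <= gf q u (Rm q u a b b) a.
Proof.
move=> Hs kk k0 qu; set x := chart_inv q u.
have qx : dom q x by exact: img_dom.
have qxu : imgI q x u by apply/imgI_P; split=> //; exact: dom_self.
rewrite !(gf_tr _ _ qxu) Rm_tr // /tr -/x.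
move: (DT q x u a) (DT q x u b) => {}a {}b.
have px : img x (chart x x) by exact: img_chart (dom_self x).
have gb := gf_ge0 b px; have ga := gf_ge0 a px.
have nonpos (X : R) : X = 0 -> kappa' * (gf x (chart x x) a a * gf x (chart x x) b b) <= X.
  by move=> ->; rewrite mulr_le0_ge0 // mulr_ge0.
case: (boolP (row_free (col_mx a b))) => [ab|].
  have CS := gf_CauchySchwarz px ab; have := Hs x a b ab.
  rewrite /sectional !innerE curvature_opE ler_pdivlMr ?subr_gt0 //.
  apply: le_trans; have C0 := sqr_ge0 (gf x (chart x x) a b).
  move: CS C0; move: (_ ^+ 2) (gf _ _ a a * _) => C A CA C0.
  by nra.
move=> nf; apply: nonpos.
have [c c0 E] : exists2 c : 'rV[R]_(1 + 1), c != 0 & c *m col_mx a b = 0.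
  have : kermx (col_mx a b) != 0 by rewrite kermx_eq0.
  move=> /rowV0Pn[c ck c0]; exists c => //; exact/sub_kermxP.
have {}E : c 0 (lshift 1 0) *: a + c 0 (rshift 1 0) *: b = 0.
  rewrite -[RHS]E -[c in RHS]hsubmxK mul_row_col.
  by congr (_ + _); apply/rowP => k; rewrite !mxE big_ord1 mxE.
have [l0|l0] := eqVneq (c 0 (lshift 1 0)) 0.
  have m0 : c 0 (rshift 1 0) != 0.
    apply: contra c0 => /eqP m0; apply/eqP/rowP => i; rewrite mxE.
    by case: (split_ordP i) => j ->; rewrite ord1.
  have -> : b = 0.
    by move: E => /eqP; rewrite l0 scale0r add0r scaler_eq0 (negbTE m0) => /eqP.
  by rewrite -(scale0r a) RmZm scale0r /gf bil0l.
have -> : a = (- ((c 0 (lshift 1 0))^-1 * c 0 (rshift 1 0))) *: b.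
  move: E => /eqP; rewrite addr_eq0 => /eqP E.
  by rewrite scaleNr -scalerA -scalerN -E scalerA mulVf // scale1r.
by rewrite RmZl Rmxx scaler0 /gf bil0l.
Qed.

End curvature.

Lemma cont_row {R : realType} {n : nat} (T : topologicalType) (f : T -> 'rV[R]_n) t :
  (forall i, {for t, continuous (fun s => f s 0 i)}) -> {for t, continuous f}.
Proof.
move=> H; apply: near_eps_cont => e e0.
have e2 : 0 < e / 2 by rewrite divr_gt0.
have N : \forall s \near t, forall i, `|f s 0 i - f t 0 i| < e / 2.
  by apply: filter_forall => i; exact: (cont_near_eps (H i) e2).
apply: filterS N => s Hs; apply: (@le_lt_trans _ _ (e / 2)); last by rewrite ltr_pdivrMr // ltr_pMr // ltr1n.
by apply: row_norm_le => [|i]; [exact: ltW|rewrite !mxE; exact: ltW].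
Qed.

Lemma taylor2_le {R : realType} (f f1 f2 : R -> R) (d m : R) :
  (forall s, `|s| < d -> der f s (f1 s)) -> (forall s, `|s| < d -> der f1 s (f2 s)) ->
  (forall s, `|s| < d -> f2 s <= m) ->
  forall s, `|s| < d -> f s <= f 0 + s * f1 0 + s ^+ 2 / 2 * m.
Proof.
have pos (g g1 g2 : R -> R) : (forall s, `|s| < d -> der g s (g1 s)) ->
    (forall s, `|s| < d -> der g1 s (g2 s)) -> (forall s, `|s| < d -> g2 s <= m) ->
    forall s, 0 <= s < d -> g s <= g 0 + s * g1 0 + s ^+ 2 / 2 * m.
  move=> dg dg1 gm s s0.
  have rd r : 0 <= r <= s -> `|r| < d by rewrite ltr_norml; lra.
  have h1 r : 0 <= r <= s -> g1 r <= g1 0 + r * m.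
    move=> rs; have := @der_mono R (fun x => g1 0 + x * m - g1 x) (fun x => m - g2 x) 0 r (ltac:(lra)).
    have D x : 0 <= x <= r -> der (fun x => g1 0 + x * m - g1 x) x (m - g2 x).
      move=> xr; apply: der_eq.
        apply: derB; last by apply: dg1; apply: rd; lra.
        by apply: derD; [exact: der_cst|apply: derM; [exact: der_id|exact: der_cst]].
      by rewrite add0r mul1r mulr0 addr0.
    move=> /(_ _ _) H; have : g1 0 + 0 * m - g1 0 <= g1 0 + r * m - g1 r.
      apply: H => x xr; first by apply: (der_continuous (D x _)); lra.
      split; first by apply: D; lra.
      by have := gm x (rd x ltac:(lra)); lra.
    lra.
  have D x : 0 <= x <= s -> der (fun x => g 0 + x * g1 0 + m / 2 * (x * x) - g x) x (g1 0 + x * m - g1 x).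
    move=> xs; apply: der_eq.
      apply: derB; last by apply: dg; exact: rd.
      apply: derD; first by apply: derD; [exact: der_cst|apply: derM; [exact: der_id|exact: der_cst]].
      by apply: derM; [exact: der_cst|apply: derM; exact: der_id].
    by rewrite !(mul0r, add0r, mulr1, mul1r, mulr0, addr0) (_ : m / 2 * (x + x) = x * m) //; field.
  have : g 0 + 0 * g1 0 + m / 2 * (0 * 0) - g 0 <= g 0 + s * g1 0 + m / 2 * (s * s) - g s.
    apply: (@der_mono R (fun x => g 0 + x * g1 0 + m / 2 * (x * x) - g x) (fun x => g1 0 + x * m - g1 x)).
    - lra.
    - by move=> x xs; exact: (der_continuous (D x xs)).
    - by move=> x xs; split; [apply: D; lra|have := h1 x ltac:(lra); lra].
  by rewrite expr2; lra.
move=> df df1 fm s sd; have [s0|s0] := leP 0 s.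
  by apply: (pos f f1 f2) => //; move: sd; rewrite ltr_norml; lra.
have dN x : der (fun x : R => - x) x (-1) by apply: der_eq; [apply: derN; exact: der_id|].
have Nd x : `|x| < d -> `|- x| < d by rewrite normrN.
have := pos (fun x => f (- x)) (fun x => - f1 (- x)) (fun x => f2 (- x)).
move=> /(_ _ _ _ (- s)); rewrite opprK oppr0 mulrNN sqrrN; apply.
- move=> x /Nd xd; apply: der_eq; first exact: (@der_comp _ _ f (fun x => - x) _ _ x (df _ xd) (dN x)).
  by rewrite /GRing.scale /= mulN1r.
- move=> x /Nd xd; apply: der_eq.
    by apply: derN; exact: (@der_comp _ _ f1 (fun x => - x) _ _ x (df1 _ xd) (dN x)).
  by rewrite /GRing.scale /= mulN1r opprK.
- by move=> x /Nd; exact: fm.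
- by move: sd; rewrite ltr_norml; lra.
Qed.

(** * Curves without acceleration at one time *)

Section acceleration.
Context {R : realType} {n : nat} (M : riemannian_manifold R n).
Implicit Types (p q x : M) (c : R -> M).

Lemma Gam_cont (T : topologicalType) p (f a b : T -> 'rV[R]_n) t : img p (f t) ->
  {for t, continuous f} -> {for t, continuous a} -> {for t, continuous b} ->
  {for t, continuous (fun s => Gam p (f s) (a s) (b s))}.
Proof.
move=> pf cf ca cb; apply: cont_row => k.
apply: (@eq_cont _ _ (fun s => bil (christoffel p (f s) k) (a s) (b s))); first by move=> s; rewrite mxE.
apply: cont_sum => i; apply: cont_sum => j.
apply: contM; last exact: cont_coord.
apply: contM; last exact: cont_coord.
apply: (@cont_comp _ _ _ f (fun u => christoffel p u k i j) t cf).
exact: (smooth_continuous (smooth_christoffel p k i j)).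
Qed.

Lemma dGam_cont (T : topologicalType) p (f e a b : T -> 'rV[R]_n) t : img p (f t) ->
  {for t, continuous f} -> {for t, continuous e} -> {for t, continuous a} ->
  {for t, continuous b} -> {for t, continuous (fun s => dGam p (f s) (e s) (a s) (b s))}.
Proof.
move=> pf cf ce ca cb; apply: cont_row => k.
apply: (@eq_cont _ _ (fun s => bil (fun i j => dpart (fun z => christoffel p z k i j) (f s) (e s)) (a s) (b s))).
  by move=> s; rewrite mxE.
apply: cont_sum => i; apply: cont_sum => j.
apply: contM; last exact: cont_coord.
apply: contM; last exact: cont_coord.
apply: cont_sum => m; apply: contM; first exact: cont_coord.
apply: (@cont_comp _ _ _ f (pd m (fun u => christoffel p u k i j)) t cf).
exact: (smooth_continuous (smooth_pd m (smooth_christoffel p k i j))).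
Qed.

(** The geodesic equation is imposed at the single time [t]. This is all that a second variation
    sees of a transverse curve, and the ends of the variations constructed below satisfy no more. *)
Definition acc_free c (t : R) : Prop := {for t, continuous c} /\
  forall q, dom q (c t) -> (\forall s \near t, der (chart q \o c) s (d1 (chart q \o c) s)) /\
    der (d1 (chart q \o c)) t
      (- Gam q (chart q (c t)) (d1 (chart q \o c) t) (d1 (chart q \o c) t)).

Lemma geodesic_acc_free c (t : R) : (\forall s \near t, geodesic_at c s) -> acc_free c t.
Proof.
move=> gc; have [cc _] := nbhs_singleton gc; split=> // q qc.
exact: geodesic_chart.
Qed.

Lemma acc_free_chart p (u v : R -> 'rV[R]_n) (t : R) : img p (u t) ->
  (\forall s \near t, der u s (v s)) -> der v t (- Gam p (u t) (v t) (v t)) ->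
  acc_free (chart_inv p \o u) t.
Proof.
move=> pu du dv; have cu := der_continuous (nbhs_singleton du).
split; first by apply: continuous_comp => //; exact: chart_inv_cont.
move=> q qc; have pqu : imgI p q (u t) by apply/imgI_P.
have N : \forall s \near t, imgI p q (u s).
  by apply: cu; apply: open_nbhs_nbhs; split=> //; exact: imgI_open.
have du1 : \forall s \near t, der (chart q \o (chart_inv p \o u)) s (DT p q (u s) (v s)).
  by apply: filterS2 N du => s Hs ds; exact: der_tr.
have du1' : \forall s \near t, DT p q (u s) (v s) = d1 (chart q \o (chart_inv p \o u)) s.
  by apply: filterS du1 => s /derP[_ ->].
split; first by apply: filterS2 du1 du1' => s ds <-.
have <- := nbhs_singleton du1'.
apply: der_eq; first exact: near_eq_der du1' (der_DT pqu (nbhs_singleton du) dv).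
by rewrite DTN Gam_tr //= -/(tr p q (u t)) opprD addrCA subrr addr0.
Qed.

Lemma acc_taylor c q e : acc_free c 0 -> dom q (c 0) -> 0 < e ->
  exists2 d, 0 < d & forall s, `|s| < d ->
    `|chart q (c s) - (chart q (c 0) + s *: d1 (chart q \o c) 0 - (s ^+ 2 / 2) *:
        Gam q (chart q (c 0)) (d1 (chart q \o c) 0) (d1 (chart q \o c) 0))| <= e * s ^+ 2.
Proof.
move=> [cc Hc] qc e0; have [du dv] := Hc q qc.
set u := chart q \o c in du dv *; set v := d1 u in du dv *.
set a := Gam _ _ _ _ in dv *.
have [d1 d10 H1] := (near_eps _ _).1 du; have [d2 d20 H2] := der_eps dv e0.
exists (Num.min d1 d2) => [|s]; first by rewrite lt_min d10.
rewrite lt_min => /andP[s1 s2].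
have := @der_bound R n (fun s => u s - (s *: v 0 - (s ^+ 2 / 2) *: a))
  (fun s => v s - (v 0 - s *: a)) 0 s (e * `|s|).
have -> : u s - (s *: v 0 - (s ^+ 2 / 2) *: a) - (u 0 - (0 *: v 0 - (0 ^+ 2 / 2) *: a)) =
    chart q (c s) - (u 0 + s *: v 0 - (s ^+ 2 / 2) *: a).
  by rewrite /u /= expr0n /= mul0r !scale0r; apply/rowP => i; rewrite !mxE; ring.
rewrite subr0 -[e * `|s| * `|s|]mulrA -expr2 real_normK ?num_real //; apply.
- by rewrite mulr_ge0 // ltW.
- move=> r rs; have rs' : `|r| <= `|s|.
    by case/orP: rs => rs; rewrite ler_norml; [rewrite (@ger0_norm _ s)|rewrite (@ler0_norm _ s)]; lra_of rs.
  apply: derB; first by apply: H1; rewrite subr0; lra.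
  apply: der_eq.
    apply: derB; first by apply: derZ; [exact: der_id|exact: der_cst].
    apply: derZ; last exact: der_cst.
    by apply: derM; [apply: derM; exact: der_id|exact: der_cst].
  by rewrite !(scaler0, addr0, scale1r); congr (_ - _ *: _); field.
- move=> r rs; have rs' : `|r| <= `|s|.
    by case/orP: rs => rs; rewrite ler_norml; [rewrite (@ger0_norm _ s)|rewrite (@ler0_norm _ s)]; lra_of rs.
  have := H2 r (le_lt_trans rs' s2); rewrite addr0 scalerN opprK => h.
  rewrite (_ : v r - _ = v r - v 0 + r *: a); last by apply/rowP => i; rewrite !mxE; ring.
  by apply: (le_trans h); rewrite ler_wpM2l // ltW.
Qed.

End acceleration.

(** * Parallel transport *)

Section parallel.
Context {R : realType} {n : nat} (M : riemannian_manifold R n).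
Variables (p : M) (u0 : 'rV[R]_n) (rho C lam D : R) (u v : R -> 'rV[R]_n).
Hypothesis B : bounds p u0 rho C lam.
Hypothesis CD : 48 * C * D <= 1.
Hypothesis uv : gsol p u0 rho D u v.

(** A linear equation solved by contraction, with the value prescribed at time 1, where the
    variation is given. By linearity the bound [2 |b|] is preserved however large [b] is. *)
Lemma parallel_ex (b : 'rV[R]_n) : exists P : R -> 'rV[R]_n, P 1 = b /\
  forall t, -1/2 < t < 3/2 -> der P t (- Gam p (u t) (v t) (P t)).
Proof.
(* An affine change turns [clamp] into truncation to [-1/2, 3/2], well inside the interval (-1, 2)
   on which [u] solves the equation. *)
pose cl (t : R) : R := clamp (t * (3/2) + (-1/4)) * (2/3) + 1/6.
have clb t : -1/2 <= cl t <= 3/2 by have := clamp_itv (t * (3/2) + (-1/4)); rewrite /cl; lra.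
have cli t : -1/2 <= t <= 3/2 -> cl t = t by move=> t1; rewrite /cl clamp_id; lra.
have clc t : {for t, continuous cl}.
  apply: contD; last exact: contC.
  apply: contM; last exact: contC.
  apply: (@cont_comp _ _ _ (fun t : R => t * (3/2) + (-1/4)) clamp); last exact: clamp_continuous.
  by apply: contD; [apply: contM; [exact: cont_id|exact: contC]|exact: contC].
have cl2 t : -1 < cl t < 2 by have := clb t; lra.
pose F (P : R -> 'rV[R]_n) t := - Gam p (u (cl t)) (v (cl t)) (P (cl t)).
pose Phi P t := b + (prim (F P) (cl t) - prim (F P) 1).
have C0 : 0 <= C by apply: le_trans (b_C B).
have FC P : continuous P -> continuous (F P).
  move=> cP t; have [du dv _ ur] := uv (cl2 t).
  apply: (contN (f := fun t => Gam p (u (cl t)) (v (cl t)) (P (cl t)))); apply: Gam_cont.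
  - exact: (b_img B).
  - by apply: (cont_comp (clc t)); exact: der_continuous du.
  - by apply: (cont_comp (clc t)); exact: der_continuous dv.
  - by apply: (cont_comp (clc t)); exact: cP.
have dprim P t : continuous P -> -1 < t < 2 -> der (prim (F P)) t (F P t).
  by move=> cP t2; apply: der_prim; [exact: FC|lra].
have Gb P t m : `|P (cl t)| <= m -> `|F P t| <= m / 48.
  move=> Pm; have [_ _ vD ur] := uv (cl2 t); rewrite /F normrN.
  apply: le_trans (b_Gam B _ _ ur) _.
  have h1 : C * `|v (cl t)| <= 1 / 48.
    by have : C * `|v (cl t)| <= C * D by [rewrite ler_wpM2l]; have := CD; lra.
  by apply: le_trans (ler_pM _ _ h1 Pm) _; rewrite ?mulr_ge0 //; lra.
have between (r t : R) : (1 <= r <= cl t) || (cl t <= r <= 1) -> -1 < r < 2.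
  by have := clb t; lra.
have cl1 t : `|cl t - 1| <= 3 / 2 by have := clb t; rewrite ler_norml; lra.
have [||P w m cP PD cw wD m0 Pw t|P [cP PD HP]] := @contraction_fixpoint R n Phi (2 * `|b|).
- by rewrite mulr_ge0.
- move=> P cP PD; split=> t.
    have h1 := der_continuous (dprim P (cl t) cP (cl2 t)).
    exact: (contD (contC b t) (contB (@cont_comp _ _ _ cl (prim (F P)) t (clc t) h1) (contC _ t))).
  have h : `|prim (F P) (cl t) - prim (F P) 1| <= 2 * `|b| / 48 * `|cl t - 1|.
    apply: (der_bound (F' := F P)); first by rewrite divr_ge0 // mulr_ge0.
      by move=> r /between; exact: dprim.
    by move=> r _; exact: Gb.
  apply: (le_trans (ler_normD _ _)).
  have : 2 * `|b| / 48 * `|cl t - 1| <= 2 * `|b| / 48 * (3 / 2).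
    by rewrite ler_wpM2l // divr_ge0 // mulr_ge0.
  by have := normr_ge0 b; lra.
- have dd r : -1 < r < 2 -> der (fun r => prim (F P) r - prim (F w) r) r (F P r - F w r).
    by move=> r2; apply: derB; exact: dprim.
  have Fd r : `|F P r - F w r| <= m / 48.
    have -> : F P r - F w r = F (fun r => P r - w r) r.
      by rewrite /F GamDr GamNr opprB opprK addrC.
    by apply: Gb; exact: Pw.
  have h : `|(prim (F P) (cl t) - prim (F w) (cl t)) - (prim (F P) 1 - prim (F w) 1)| <= m / 48 * `|cl t - 1|.
    apply: (@der_bound _ _ (fun r => prim (F P) r - prim (F w) r) (fun r => F P r - F w r)).
    - by rewrite divr_ge0.
    - by move=> r /between; exact: dd.
    - by move=> r _.
  have -> : Phi P t - Phi w t = (prim (F P) (cl t) - prim (F w) (cl t)) - (prim (F P) 1 - prim (F w) 1).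
    by rewrite /Phi; apply/rowP => i; rewrite !mxE; ring.
  apply: (le_trans h).
  have : m / 48 * `|cl t - 1| <= m / 48 * (3 / 2) by rewrite ler_wpM2l // divr_ge0.
  lra.
exists P; split; first by rewrite -HP /Phi cli ?subrr ?addr0 //; lra.
move=> t t1; apply: (@near_eq_der _ _ (fun s => b + (prim (F P) s - prim (F P) 1))).
  apply/near_eps; exists (Num.min (t + 1/2) (3/2 - t)); first by rewrite lt_min; lra.
  by move=> s; rewrite lt_min !ltr_norml => s2; rewrite -HP /Phi cli //; lra.
apply: der_eq.
  apply: derD; first exact: der_cst.
  by apply: derB; [apply: dprim => //; lra|exact: der_cst].
by rewrite add0r subr0 /F cli //; lra.
Qed.

Lemma parallel_norm (P : R -> 'rV[R]_n) :
  (forall t, -1/2 < t < 3/2 -> der P t (- Gam p (u t) (v t) (P t))) ->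
  forall t, -1/2 < t < 3/2 -> gf p (u t) (P t) (P t) = gf p (u 1) (P 1) (P 1).
Proof.
move=> dP.
have d0 t : -1/2 < t < 3/2 -> der (fun t => gf p (u t) (P t) (P t)) t 0.
  move=> t1; have [|du dv _ ur] := uv (t := t); first lra.
  have pu := b_img B ur.
  apply: der_eq; first exact: (der_gf pu du (dP t t1) (dP t t1)).
  by rewrite compat // /gf !bilE; ring.
have W (s t : R) : -1/2 < s -> s <= t -> t < 3/2 -> gf p (u t) (P t) (P t) = gf p (u s) (P s) (P s).
  move=> s1 st t1.
  have [r _ E] := @MVT_everywhere R (fun t => gf p (u t) (P t) (P t)) (fun=> 0) s t st (fun r _ => d0 r ltac:(lra)).
  by apply/eqP; rewrite -subr_eq0 E mul0r.
by move=> t t1; have [h|h] := leP t 1; [apply/esym/W|apply/W]; lra.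
Qed.

End parallel.

(** * Second variation of energy *)

Section variation.
Context {R : realType} {n : nat} (M : riemannian_manifold R n).
Implicit Types (r s : R) (a b : 'rV[R]_n).
Variables (q : M) (u0 : 'rV[R]_n) (rho C lam D : R) (u v P : R -> 'rV[R]_n).
Variables (phi phi1 : R -> R) (K : R).
Hypothesis B : bounds q u0 rho C lam.
Hypothesis uv : gsol q u0 rho D u v.
Hypothesis dP : forall r, -1/2 < r < 3/2 -> der P r (- Gam q (u r) (v r) (P r)).
Hypothesis dphi : forall r, der phi r (phi1 r).
Hypothesis dphi1 : forall r, der phi1 r (K * phi r).

(** The variation of [u] along [phi P]. Its quadratic term [vZ] gives each curve [vU r] zero
    acceleration at 0. [vA] and [vUs] are the partial derivatives of [vU] in [r] and in [s], [vB] is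
    the covariant derivative of [vA] in [s], and [vG2] is the second derivative in [s] of the
    squared speed. *)
Definition vW r : 'rV[R]_n := phi r *: P r.
Definition vZ r := - Gam q (u r) (vW r) (vW r).
Definition vWd r := phi1 r *: P r - phi r *: Gam q (u r) (v r) (P r).
Definition vZd r := - (dGam q (u r) (v r) (vW r) (vW r) + Gam q (u r) (vWd r) (vW r)
  + Gam q (u r) (vW r) (vWd r)).
Definition vU r s := u r + s *: vW r + (s ^+ 2 / 2) *: vZ r.
Definition vUs r s := vW r + s *: vZ r.
Definition vA r s := v r + s *: vWd r + (s ^+ 2 / 2) *: vZd r.
Definition vAs r s := vWd r + s *: vZd r.
Definition vB r s := vAs r s + Gam q (vU r s) (vUs r s) (vA r s).
Definition vBs r s := vZd r + (dGam q (vU r s) (vUs r s) (vUs r s) (vA r s)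
  + Gam q (vU r s) (vZ r) (vA r s) + Gam q (vU r s) (vUs r s) (vAs r s)).
Definition vG2 r s := 2 * gf q (vU r s) (vBs r s + Gam q (vU r s) (vUs r s) (vB r s)) (vA r s)
  + 2 * gf q (vU r s) (vB r s) (vB r s).

Lemma der_quad a b (c : 'rV[R]_n) s :
  der (fun s => a + s *: b + (s ^+ 2 / 2) *: c) s (b + s *: c).
Proof.
apply: der_eq.
  apply: derD; first by apply: derD; [exact: der_cst|apply: derZ; [exact: der_id|exact: der_cst]].
  apply: derZ; last exact: der_cst.
  by apply: derM; [apply: derM; exact: der_id|exact: der_cst].
by rewrite !(scaler0, addr0, add0r, scale1r); congr (_ + _ *: _); field.
Qed.

Let dv r : -1/2 < r < 3/2 -> [/\ der u r (v r), der v r (- Gam q (u r) (v r) (v r)) & img q (u r)].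
Proof.
move=> r1; have [|h1 h2 _ ur] := uv (t := r); first lra.
by split=> //; exact: (b_img B).
Qed.

Let dW r : -1/2 < r < 3/2 -> der vW r (vWd r).
Proof.
by move=> r1; apply: der_eq; [exact: (derZ (dphi r) (dP r1))|rewrite scalerN].
Qed.

Let dZ r : -1/2 < r < 3/2 -> der vZ r (vZd r).
Proof.
move=> r1; have [du _ qu] := dv r1.
by apply: derN; exact: (der_Gam qu du (dW r1) (dW r1)).
Qed.

Lemma der_vU_r r s : -1/2 < r < 3/2 -> der (vU^~ s) r (vA r s).
Proof.
move=> r1; have [du _ qu] := dv r1.
apply: der_eq.
  apply: derD; first by apply: derD; [exact: du|apply: derZ; [exact: der_cst|exact: dW]].
  by apply: derZ; [exact: der_cst|exact: dZ].
by rewrite !scale0r !add0r.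
Qed.

Let dAs r s : der (vAs r) s (vZd r).
Proof.
apply: der_eq; first by apply: derD; [exact: der_cst|apply: derZ; [exact: der_id|exact: der_cst]].
by rewrite scaler0 addr0 scale1r add0r.
Qed.

Let dUs r s : der (vUs r) s (vZ r).
Proof.
apply: der_eq; first by apply: derD; [exact: der_cst|apply: derZ; [exact: der_id|exact: der_cst]].
by rewrite scaler0 addr0 scale1r add0r.
Qed.

Lemma der_energy r s : img q (vU r s) ->
  der (fun s => gf q (vU r s) (vA r s) (vA r s)) s (2 * gf q (vU r s) (vB r s) (vA r s)).
Proof.
move=> qU; have dU : der (vU r) s (vUs r s) := der_quad (u r) (vW r) (vZ r) s.
have dA : der (vA r) s (vAs r s) := der_quad (v r) (vWd r) (vZd r) s.
apply: der_eq; first exact: (der_gf qU dU dA dA).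
rewrite compat // !(gfC (vA r s) _ qU).
rewrite /vB; move: (vU r s) (vAs r s) (vA r s) (Gam _ _ _ _) {dU dA qU} => w a c b.
by rewrite /gf !bilE; ring.
Qed.

Lemma der_energy2 r s : img q (vU r s) ->
  der (fun s => 2 * gf q (vU r s) (vB r s) (vA r s)) s (vG2 r s).
Proof.
move=> qU; have dU : der (vU r) s (vUs r s) := der_quad (u r) (vW r) (vZ r) s.
have dA : der (vA r) s (vAs r s) := der_quad (v r) (vWd r) (vZd r) s.
have dB : der (vB r) s (vBs r s).
  apply: der_eq; first by apply: derD; [exact: dAs|exact: (der_Gam qU dU (dUs r s) dA)].
  by [].
apply: der_eq; first by apply: derM; [exact: der_cst|exact: (der_gf qU dU dB dA)].
rewrite compat // mul0r add0r /vG2.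
have -> : vAs r s = vB r s - Gam q (vU r s) (vUs r s) (vA r s) by rewrite /vB addrK.
move: (Gam _ _ _ (vB r s)) => a; move: (Gam _ _ _ (vA r s)) => b.
move: (vBs r s) (vB r s) (vA r s) (vU r s) {dU dA dB qU} => c d e w.
by rewrite /gf !bilE; ring.
Qed.

Lemma vU0 r : vU r 0 = u r. Proof. by rewrite /vU expr0n /= mul0r !scale0r !addr0. Qed.
Lemma vUs0 r : vUs r 0 = vW r. Proof. by rewrite /vUs scale0r addr0. Qed.
Lemma vA0 r : vA r 0 = v r. Proof. by rewrite /vA expr0n /= mul0r !scale0r !addr0. Qed.
Lemma vAs0 r : vAs r 0 = vWd r. Proof. by rewrite /vAs scale0r addr0. Qed.

Lemma vB0 r : img q (u r) -> vB r 0 = phi1 r *: P r.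
Proof.
move=> qu; rewrite /vB vAs0 vU0 vUs0 vA0 /vWd /vW GamZl (GamC (P r)) //.
by rewrite subrK.
Qed.

(** At [s = 0] the curves [vU r] have zero acceleration for all [r], so exchanging the two covariant
    derivatives leaves the curvature term alone. *)
Lemma vBs0 r : img q (u r) ->
  vBs r 0 + Gam q (vU r 0) (vUs r 0) (vB r 0) = Rm q (u r) (vW r) (v r) (vW r).
Proof.
move=> qu; rewrite /vBs vU0 vUs0 vA0 vAs0 /vB vU0 vUs0 vA0 vAs0 /vZd /vZ /Rm.
rewrite (GamDr _ _ _ (vWd r)) GamNl (GamC (vWd r)) // (dGamC _ (vW r) (v r)) // (GamC (v r) (vW r)) //.
rewrite (GamC (v r) (Gam _ _ _ _)) //.
by apply/rowP => k; rewrite !mxE; ring.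
Qed.

Let cont r s : -1/2 < r < 3/2 -> img q (vU r s) -> {for (r, s), continuous (fun x : R * R => vG2 x.1 x.2)}.
Proof.
move=> r1 qU; have [du ddv qu] := dv r1.
have cu := der_continuous du; have cv := der_continuous ddv.
have cphi := der_continuous (dphi r); have cphi1 := der_continuous (dphi1 r).
have cP := der_continuous (dP r1).
have cW : {for r, continuous vW} := der_continuous (dW r1).
have cZ : {for r, continuous vZ} := der_continuous (dZ r1).
have cWd : {for r, continuous vWd}.
  apply: contB; first exact: (continuousZ cphi1 cP).
  exact: (continuousZ cphi (Gam_cont qu cu cv cP)).
have cZd : {for r, continuous vZd}.
  apply: (contN (f := fun r => dGam q (u r) (v r) (vW r) (vW r) + Gam q (u r) (vWd r) (vW r)
    + Gam q (u r) (vW r) (vWd r))).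
  exact: (contD (contD (dGam_cont qu cu cv cW cW) (Gam_cont qu cu cWd cW)) (Gam_cont qu cu cW cWd)).
pose T := (R * R)%type.
have lift (f : R -> 'rV[R]_n) : {for r, continuous f} -> {for (r, s), continuous (fun x : T => f x.1)}.
  exact: cont_of_fst.
have cs : {for (r, s), continuous (fun x : T => x.2)} by exact: cont_snd.
have cs2 : {for (r, s), continuous (fun x : T => x.2 ^+ 2 / 2)}.
  by apply: contM; [exact: (contM cs cs)|exact: contC].
have lu := lift _ cu; have lv := lift _ cv; have lW := lift _ cW; have lZ := lift _ cZ.
have lWd := lift _ cWd; have lZd := lift _ cZd.
have cU : {for (r, s), continuous (fun x : T => vU x.1 x.2)}.
  exact: (contD (contD lu (continuousZ cs lW)) (continuousZ cs2 lZ)).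
have cA : {for (r, s), continuous (fun x : T => vA x.1 x.2)}.
  exact: (contD (contD lv (continuousZ cs lWd)) (continuousZ cs2 lZd)).
have cUs : {for (r, s), continuous (fun x : T => vUs x.1 x.2)}.
  exact: (contD lW (continuousZ cs lZ)).
have cAs : {for (r, s), continuous (fun x : T => vAs x.1 x.2)}.
  exact: (contD lWd (continuousZ cs lZd)).
have cB : {for (r, s), continuous (fun x : T => vB x.1 x.2)}.
  exact: (contD cAs (@Gam_cont _ _ _ T q _ _ _ (r, s) qU cU cUs cA)).
have cBs : {for (r, s), continuous (fun x : T => vBs x.1 x.2)}.
  apply: (contD lZd); apply: contD; last exact: (@Gam_cont _ _ _ T q _ _ _ (r, s) qU cU cUs cAs).
  exact: (contD (@dGam_cont _ _ _ T q _ _ _ _ (r, s) qU cU cUs cUs cA) (@Gam_cont _ _ _ T q _ _ _ (r, s) qU cU lZ cA)).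
have cBB := contD cBs (@Gam_cont _ _ _ T q _ _ _ (r, s) qU cU cUs cB).
apply: contD; (apply: contM; first exact: contC).
  exact: (@gf_cont _ _ _ T q _ _ _ (r, s) qU cU cBB cA).
exact: (@gf_cont _ _ _ T q _ _ _ (r, s) qU cU cB cB).
Qed.


Variables (kp : R).
Hypothesis curv : forall w a b, img q w -> kp * (gf q w a a * gf q w b b) <= gf q w (Rm q w a b b) a.
Hypothesis KE : - kp * gf q (u 0) (v 0) (v 0) <= K.
Hypothesis u_in : forall r, 0 <= r <= 1 -> `|u r - u0| < rho.

(** As [P] is parallel, the covariant derivative of the variation field is [phi1 P]; the curvature
    bound and [- kp |v|^2 <= K] control the other term. *)
Lemma vG2_le r : 0 <= r <= 1 ->
  vG2 r 0 <= 2 * (phi1 r ^+ 2 + K * phi r ^+ 2) * gf q (u 1) (P 1) (P 1).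
Proof.
move=> r1; have r2 : -1/2 < r < 3/2 by lra.
have [_ _ qu] := dv r2.
rewrite /vG2 vBs0 // vU0 vA0 vB0 // RmN -(parallel_norm B uv dP r2).
have := curv (v r) (vW r) qu; rewrite (gsol_energy B uv r1).
rewrite [in gf q (u r) (- _)]/gf !bilNl -/(gf _ _ _ _).
move: (gf q (u r) (Rm _ _ _ _ _) _) => X.
have -> : gf q (u r) (vW r) (vW r) = phi r ^+ 2 * gf q (u r) (P r) (P r).
  by rewrite /gf /vW !bilE; ring.
have -> : gf q (u r) (phi1 r *: P r) (phi1 r *: P r) = phi1 r ^+ 2 * gf q (u r) (P r) (P r).
  by rewrite /gf !bilE; ring.
have N0 := gf_ge0 (P r) qu; have KE' := KE.
have h : - kp * gf q (u 0) (v 0) (v 0) * (phi r ^+ 2 * gf q (u r) (P r) (P r)) <=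
    K * (phi r ^+ 2 * gf q (u r) (P r) (P r)).
  by apply: ler_wpM2r => //; rewrite mulr_ge0 // sqr_ge0.
move: h {KE' N0}; move: (gf q (u r) (P r) (P r)) (gf q (u 0) _ _) => N L2; lra.
Qed.

(** Taylor's formula in [s] with one radius for all [r]: the second derivative is jointly continuous
    and [0, 1] is compact. *)
Lemma energy_le e : 0 < e -> exists2 d, 0 < d & forall s, `|s| < d -> forall r, 0 <= r <= 1 ->
  `|vU r s - u0| <= rho /\ gf q (vU r s) (vA r s) (vA r s) <= gf q (u 0) (v 0) (v 0)
    + s * (2 * gf q (u r) (phi1 r *: P r) (v r))
    + s ^+ 2 / 2 * (2 * (phi1 r ^+ 2 + K * phi r ^+ 2) * gf q (u 1) (P 1) (P 1) + e).
Proof.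
move=> e0.
have rr r : 0 <= r <= 1 -> -1/2 < r < 3/2 by lra.
have cU r s : 0 <= r <= 1 -> {for (r, s), continuous (fun x : R * R => vU x.1 x.2)}.
  move=> r1; have [du _ _] := dv (rr _ r1).
  have cW : {for r, continuous vW} := der_continuous (dW (rr _ r1)).
  have cZ : {for r, continuous vZ} := der_continuous (dZ (rr _ r1)).
  have cs : {for (r, s), continuous (fun x : R * R => x.2)} by exact: cont_snd.
  have cs2 : {for (r, s), continuous (fun x : R * R => x.2 ^+ 2 / 2)}.
    by apply: contM; [exact: (contM cs cs)|exact: contC].
  have lift (f : R -> 'rV[R]_n) : {for r, continuous f} -> {for (r, s), continuous (fun x : R * R => f x.1)}.
    exact: cont_of_fst.
  exact: (contD (contD (lift _ (der_continuous du)) (continuousZ cs (lift _ cW))) (continuousZ cs2 (lift _ cZ))).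
have N1 : \forall s \near (0 : R), forall r, `[0, 1]%classic r -> [set x | x < rho] `|vU r s - u0|.
  apply: (near_cov (F := fun x : R * R => `|vU x.1 x.2 - u0|)).
  - exact: segment_compact.
  - move=> r; rewrite /= in_itv /= => r1; apply: cont_norm; apply: contB; last exact: contC.
    exact: cU.
  - exact: open_lt.
  - by move=> r; rewrite /= in_itv /= => r1; rewrite vU0; exact: u_in.
have N2 : \forall s \near (0 : R), forall r, `[0, 1]%classic r -> [set x | x < e] (vG2 r s - vG2 r 0).
  apply: (near_cov (F := fun x : R * R => vG2 x.1 x.2 - vG2 x.1 0)).
  - exact: segment_compact.
  - move=> r; rewrite /= in_itv /= => r1.
    have qU : img q (vU r 0) by rewrite vU0; have [] := dv (rr _ r1).
    have c1 := cont (rr _ r1) qU.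
    apply: contB; first exact: c1.
    have c2 : {for r, continuous (fun r => vG2 r 0)}.
      apply: (@cont_comp _ _ _ (fun r : R => (r, 0 : R)) (fun x : R * R => vG2 x.1 x.2)) c1.
      by apply: cont_pair; [exact: cont_id|exact: cont_cst].
    exact: cont_of_fst c2.
  - exact: open_lt.
  - by move=> r _; rewrite /= subrr.
have [d1 d10 H1] := (near_eps _ _).1 N1; have [d2 d20 H2] := (near_eps _ _).1 N2.
pose d := Num.min d1 d2.
have d0 : 0 < d by rewrite lt_min d10.
have dd1 : d <= d1 by rewrite ge_min lexx.
have dd2 : d <= d2 by rewrite ge_min lexx orbT.
exists d => // s sd r r1.
have {}H1 s' : `|s'| < d -> `|vU r s' - u0| < rho.
  by move=> s'd; have := H1 s'; rewrite subr0 => /(_ (lt_le_trans s'd dd1) r); apply; rewrite /= in_itv.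
have {}H2 s' : `|s'| < d -> vG2 r s' < vG2 r 0 + e.
  move=> s'd; have := H2 s'; rewrite subr0 => /(_ (lt_le_trans s'd dd2) r).
  by rewrite /= in_itv /= r1 => /(_ isT); rewrite ltrBlDl.
split; first exact: ltW (H1 s sd).
have qU s' : `|s'| < d -> img q (vU r s') by move=> /H1 /ltW; exact: (b_img B).
have G2 := vG2_le r1.
have := @taylor2_le R (fun s => gf q (vU r s) (vA r s) (vA r s))
  (fun s => 2 * gf q (vU r s) (vB r s) (vA r s)) (vG2 r) d (2 * (phi1 r ^+ 2 + K * phi r ^+ 2) * gf q (u 1) (P 1) (P 1) + e).
move=> /(_ _ _ _ s sd); have [_ _ qu] := dv (rr _ r1).
rewrite vU0 vA0 vB0 // (gsol_energy B uv r1); apply.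
- by move=> s' s'd; apply: der_energy; exact: qU.
- by move=> s' s'd; apply: der_energy2; exact: qU.
- by move=> s' s'd; have := H2 s' s'd; lra.
Qed.

End variation.

(** * Variation of one short piece of a geodesic *)

Section pieces.
Context {R : realType} {n : nat} (M : riemannian_manifold R n).
Implicit Types (p q x y : M) (c : R -> M) (r s : R).
Hypothesis UG : uniquely_geodesic M.
Local Notation sg := (sg UG).

Lemma gsol_velocity q (u v : R -> 'rV[R]_n) c x y u0 rho D : gsol q u0 rho D u v ->
  geodesic_from_to c x y -> (forall r, 0 <= r <= 1 -> dom q (c r) /\ chart q (c r) = u r) ->
  v 0 = d1 (chart q \o c) 0 /\ v 1 = d1 (chart q \o c) 1.
Proof.
move=> uv [gc c0 c1] cu.
have dc r : 0 <= r <= 1 -> der (chart q \o c) r (d1 (chart q \o c) r).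
  by move=> r1; apply: (geodesic_der (gc r r1)); exact: (cu r r1).1.
have du r : 0 <= r <= 1 -> der u r (v r) by move=> r1; have [|h _ _ _] := uv r; first lra.
split.
  apply: (@der_right_unique _ _ u (chart q \o c) _ _ _ (du 0 itv0) (dc 0 itv0)) => r r1.
  by rewrite /= (cu r r1).2.
have dr (t : R) : der (fun r => 1 - r) t (-1).
  by apply: der_eq; [apply: derB; [exact: der_cst|exact: der_id]|rewrite sub0r].
have e1 : (1 : R) - 0 = 1 by rewrite subr0.
have h1 : der (fun r => u (1 - r)) 0 ((-1 : R) *: v 1).
  by have := @der_comp _ _ u (fun r => 1 - r) (v 1) (-1) 0; rewrite e1; apply; [exact: (du 1 itv1)|exact: dr].
have h2 : der (fun r => (chart q \o c) (1 - r)) 0 ((-1 : R) *: d1 (chart q \o c) 1).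
  by have := @der_comp _ _ (chart q \o c) (fun r => 1 - r) (d1 (chart q \o c) 1) (-1) 0; rewrite e1; apply; [exact: (dc 1 itv1)|exact: dr].
have := der_right_unique _ h1 h2; rewrite !scaleN1r => H.
apply: oppr_inj; apply: H => t t1 /=.
by rewrite (cu (1 - t) ltac:(lra)).2.
Qed.

(** Replacing the end of the varied curve by a point at distance [h], a small multiple of [s^2],
    costs at most [e / 2] in the coefficient of [s^2 / 2]. *)
Lemma half_sqr_le (C e A d g h s : R) : 1 <= C -> 0 < e -> `|s| <= 1 -> 0 <= d -> d <= C ->
  0 <= g -> d ^+ 2 / 2 <= A -> g <= d + C * h ->
  h <= Num.min e 1 / (16 * C ^+ 2) * s ^+ 2 -> 0 <= h -> g ^+ 2 / 2 <= A + s ^+ 2 / 2 * (e / 2).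
Proof.
move=> C1 e0 s1 d0 dC g0 dA gd hs h0.
have C0 : 0 < 16 * C ^+ 2 by rewrite mulr_gt0 // exprn_gt0 //; lra.
have m1 : Num.min e 1 <= 1 by rewrite ge_min lexx orbT.
have me : Num.min e 1 <= e by rewrite ge_min lexx.
have m0 : 0 < Num.min e 1 by rewrite lt_min e0 ltr01.
move: hs; rewrite mulrAC ler_pdivlMr // => hs.
set m := Num.min e 1 in hs m1 me m0.
have ss : s ^+ 2 <= 1 by rewrite -(expr1n _ 2) -(real_normK (num_real s)) ler_sqr ?nnegrE.
have ss0 : 0 <= s ^+ 2 by rewrite sqr_ge0.
set S := s ^+ 2 in hs ss ss0 *; set k := C * h in gd.
have k0 : 0 <= k by rewrite mulr_ge0 //; lra.
have hk : 16 * (C * k) <= m * S by rewrite /k; lra.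
have k1 : k <= 1.
  have : k <= C * k by rewrite ler_peMl.
  by have : m * S <= 1 * 1 by [apply: ler_pM => //; exact: ltW]; lra.
have g2 : g ^+ 2 <= (d + k) ^+ 2 by rewrite ler_sqr ?nnegrE ?addr_ge0.
have dk : d * k <= C * k by rewrite ler_wpM2r.
have kk : k * k <= C * k by rewrite ler_wpM2r //; lra.
have mS : m * S <= e * S by rewrite ler_wpM2r.
have Ck0 : 0 <= C * k by rewrite mulr_ge0 //; lra.
rewrite !expr2 in g2 dA *; clearbody k S m; lra.
Qed.

Lemma nice_gdist_le q rho C lam D x y : nice q rho C lam D -> Vs q D x -> Vs q D y ->
  gdist x y <= C.
Proof.
move=> Hn Vx Vy; have [u [v [uv _ _ _ E]]] := nice_sol UG Hn Vx Vy.
have C1 := b_C (n_B Hn); have D1 := n_D1 Hn; have D0 := n_D0 Hn.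
have [|_ _ vD ur] := uv 0; first lra.
rewrite -ler_sqr ?nnegrE ?gdist_ge0 //; last lra.
rewrite E; apply: (le_trans (ler_norm _)); apply: (le_trans (b_gf (n_B Hn) _ _ ur)).
rewrite -mulrA expr2; apply: ler_pM; rewrite ?mulr_ge0 //; first lra.
have h : `|v 0| <= 1 by lra.
by apply: le_trans C1; rewrite -[leRHS]mulr1; apply: ler_pM.
Qed.

Lemma nice_gdist_chart q rho C lam D x y : nice q rho C lam D -> Vs q D x -> Vs q D y ->
  gdist x y <= C * `|chart q y - chart q x|.
Proof.
move=> Hn Vx Vy; have C1 := b_C (n_B Hn); have D0 := n_D0 Hn; have rh := n_rho Hn.
rewrite -ler_sqr ?nnegrE ?gdist_ge0 ?mulr_ge0 //; last lra.
apply: (le_trans (nice_line UG Hn Vx Vy (K := C * `|chart q y - chart q x| * `|chart q y - chart q x|) _)).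
  move=> s s1; apply: (le_trans (ler_norm _)); apply: (b_gf (n_B Hn)).
  by apply: seg_ball => //; [case: Vx|case: Vy] => _; lra.
rewrite exprMn -mulrA -expr2; apply: ler_wpM2r; first exact: sqr_ge0.
by rewrite expr2 ler_peMl //; lra.
Qed.

(** The right end of the variation follows [beta] to second order and its left end is [beta0]. As
    [phi'' = K phi], the bound on the second variation is the derivative of [phi phi'], so only
    boundary terms remain. [beta0] is again without acceleration and can serve as right end of the
    preceding piece. *)
Lemma piece q rho C lam D x y c beta (phi phi1 : R -> R) K kp : nice q rho C lam D ->
  Vs q D x -> Vs q D y -> geodesic_from_to c x y -> acc_free beta 0 -> beta 0 = y ->
  (forall r, der phi r (phi1 r)) -> (forall r, der phi1 r (K * phi r)) -> phi 1 = 1 ->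
  (forall w a b, img q w -> kp * (gf q w a a * gf q w b b) <= gf q w (Rm q w a b b) a) ->
  - kp * gdist x y ^+ 2 <= K ->
  exists beta0, [/\ acc_free beta0 0, beta0 0 = x, phi 0 = 0 -> forall s, beta0 s = x,
    gf q (chart q x) (d1 (chart q \o beta0) 0) (d1 (chart q \o beta0) 0) =
      phi 0 ^+ 2 * gf q (chart q y) (d1 (chart q \o beta) 0) (d1 (chart q \o beta) 0) &
    forall e, 0 < e -> exists2 d, 0 < d & forall s, `|s| < d ->
      gdist (beta0 s) (beta s) ^+ 2 / 2 <= gdist x y ^+ 2 / 2
      + s * (gf q (chart q y) (d1 (chart q \o c) 1) (d1 (chart q \o beta) 0)
             - gf q (chart q x) (d1 (chart q \o c) 0) (d1 (chart q \o beta0) 0))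
      + s ^+ 2 / 2 * ((phi1 1 - phi 0 * phi1 0) *
         gf q (chart q y) (d1 (chart q \o beta) 0) (d1 (chart q \o beta) 0) + e)].
Proof.
move=> Hn Vx Vy gc ab b0 dphi dphi1 phi_1 curv KE.
have B := n_B Hn; have C1 := b_C B; have D0 := n_D0 Hn; have rh := n_rho Hn.
have [u [v [uv u0 u1 su E]]] := nice_sol UG Hn Vx Vy.
have cu r : 0 <= r <= 1 -> dom q (c r) /\ chart q (c r) = u r.
  by move=> r1; rewrite -(sg_unique UG gc r1); exact: su.
have [v0E v1E] := gsol_velocity uv gc cu.
set b := d1 (chart q \o beta) 0.
have [P [P1 dP]] := parallel_ex B (n_CD Hn) uv b.
have qy : dom q y by case: Vy.
have qx : dom q x by case: Vx.
have u_in r : 0 <= r <= 1 -> `|u r - chart q q| < rho.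
  move=> r1; have h : `|u r - u 0| <= D * `|r - 0|.
    apply: (der_bound (F' := v)); first exact: ltW.
      by move=> t t1; have [|h _ _ _] := uv t; first lra.
    by move=> t t1; have [|_ _ h _] := uv t; first lra.
  have h2 : D * `|r - 0| <= D * 1 by rewrite ler_wpM2l ?subr0 ?ger0_norm //; lra_of r1 D0.
  have h3 : `|u 0 - chart q q| < D / 4 by rewrite u0; case: Vx.
  rewrite -[u r](subrK (u 0)) -addrA; apply: (le_lt_trans (ler_normD _ _)); lra.
have KE' : - kp * gf q (u 0) (v 0) (v 0) <= K by rewrite -E.
pose U := vU q u P phi; pose A := vA q u v P phi phi1.
pose W := vW P phi; pose Z := vZ q u P phi.
have W1 : W 1 = b by rewrite /W /vW phi_1 scale1r.
have W0 : W 0 = phi 0 *: P 0 by [].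
have dU r s : der (U r) s (W r + s *: Z r) by exact: der_quad.
have iu r : 0 <= r <= 1 -> img q (u r) by move=> r1; apply: (b_img B); exact: ltW (u_in r r1).
have U0 r : U r 0 = u r by exact: vU0.
pose beta0 s := chart_inv q (U 0 s).
have bb0 : acc_free beta0 0.
  apply: (@acc_free_chart _ _ M q (U 0) (fun s => W 0 + s *: Z 0) 0); rewrite ?U0.
  - exact: iu itv0.
  - by near=> s; exact: dU.
  - apply: der_eq.
      by apply: derD; [exact: der_cst|apply: derZ; [exact: der_id|exact: der_cst]].
    by rewrite !scale0r !(addr0, add0r) scale1r.
have b0x : beta0 0 = x by rewrite /beta0 U0 u0 chartK.
have cU r : {for 0, continuous (U r)} by exact: der_continuous (dU r 0).
have NU r : 0 <= r <= 1 -> \forall s \near (0 : R), img q (U r s).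
  by move=> r1; apply: (near_continuous (cU r) (@img_open _ _ _ q)); rewrite U0; exact: iu.
have db0 : d1 (chart q \o beta0) 0 = W 0.
  have h : der (chart q \o beta0) 0 (W 0 + (0 : R) *: Z 0).
    by apply: near_eq_der (dU 0 0); apply: filterS (NU 0 itv0) => s Us; rewrite /= chart_invK.
  by have /derP[_ ->] := h; rewrite scale0r addr0.
set N := gf q (chart q y) b b.
have NE : gf q (u 1) (P 1) (P 1) = N by rewrite P1 u1.
have PN r : 0 <= r <= 1 -> gf q (u r) (P r) (P r) = N.
  by move=> r1; rewrite (parallel_norm B uv dP) ?NE //; lra.
exists beta0; split=> //.
- by move=> p0 s; rewrite /beta0 /U /vU /vZ /vW p0 scale0r Gam0l oppr0 !scaler0 !addr0 u0 chartK.
- rewrite db0 W0 -u0 /gf !bilE -/(gf _ _ _ _) PN; last exact: itv0.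
  by ring.
move=> e e0; rewrite db0.
have [d1 d10 H1] := energy_le B uv dP dphi dphi1 curv KE' u_in e0.
pose e2 := Num.min e 1 / (16 * C ^+ 2).
have e20 : 0 < e2 by rewrite divr_gt0 ?lt_min ?e0 ?ltr01 // mulr_gt0 // exprn_gt0 //; lra.
have qb : dom q (beta 0) by rewrite b0.
have [d2 d20 H2] := acc_taylor ab qb e20.
have NV r z : 0 <= r <= 1 -> Vs q D z -> u r = chart q z ->
    \forall s \near (0 : R), Vs q D (chart_inv q (U r s)).
  move=> r1 Vz uz; have c1 : {for 0, continuous (fun s => chart_inv q (U r s))}.
    by apply: (cont_comp (cU r)); apply: chart_inv_cont; rewrite U0; exact: iu.
  by apply: (near_continuous c1 (@Vs_open _ _ _ q D)); rewrite U0 uz chartK //; case: Vz.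
have N0 := NV 0 x itv0 Vx u0; have N1 := NV 1 y itv1 Vy u1.
have Nb : \forall s \near (0 : R), Vs q D (beta s).
  by apply: (near_continuous ab.1 (@Vs_open _ _ _ q D)); rewrite b0.
have : \forall s \near (0 : R), [/\ Vs q D (chart_inv q (U 0 s)), Vs q D (chart_inv q (U 1 s)),
    Vs q D (beta s), img q (U 0 s) & img q (U 1 s)].
  apply: filterS2 (filterI N0 N1) (filterI Nb (filterI (NU 0 itv0) (NU 1 itv1))).
  by move=> s [h1 h2] [h3 [h4 h5]]; split.
move=> /near_eps[d3 d30 H3].
exists (Num.min (Num.min d1 1) (Num.min d2 d3)); first by rewrite !lt_min d10 d20 d30 ltr01.
move=> s; rewrite !lt_min => /andP[/andP[s1 s_1] /andP[s2 s3]].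
have [V0 V1 Vb iU0 iU1] := H3 s ltac:(by rewrite subr0).
have {}H1 := H1 s s1; have {}H2 := H2 s s2.
pose slope := gf q (u 1) (v 1) b - gf q (u 0) (v 0) (W 0).
(* An explicit primitive of the bound in [energy_le]: the first variation is the derivative of
   [<v, W>], and [(phi phi1)' = phi1^2 + K phi^2] settles the second. *)
pose Pf r := gf q (u 0) (v 0) (v 0) / 2 * r + s * gf q (u r) (v r) (W r)
  + s ^+ 2 / 2 * (phi r * phi1 r * N + e / 2 * r).
pose Pf' r := gf q (u 0) (v 0) (v 0) / 2 + s * gf q (u r) (v r) (phi1 r *: P r)
  + s ^+ 2 / 2 * ((phi1 r ^+ 2 + K * phi r ^+ 2) * N + e / 2).
have dPf r : 0 <= r <= 1 -> der Pf r (Pf' r).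
  move=> r1; have r2 : -1/2 < r < 3/2 by lra_of r1.
  have [|du dv _ _] := uv r; first lra_of r1.
  have dW : der W r (phi1 r *: P r - phi r *: Gam q (u r) (v r) (P r)).
    by apply: der_eq; [exact: (derZ (dphi r) (dP r r2))|rewrite scalerN].
  have qu := iu r r1.
  apply: der_eq.
    apply: derD; first (apply: derD; first (apply: derM; [exact: der_cst|exact: der_id])).
      by apply: derM; [exact: der_cst|exact: (der_gf qu du dv dW)].
    apply: derM; first exact: der_cst.
    apply: derD; first (apply: derM; [apply: derM; [exact: dphi|exact: dphi1]|exact: der_cst]).
    by apply: derM; [exact: der_cst|exact: der_id].
  rewrite compat // /Pf' /W /vW GamZr.
  move: (Gam _ _ _ (v r)) (Gam _ _ _ (P r)) => G1 G2; rewrite /gf !bilE; ring.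
have [|||||h _] := nice_min UG Hn (c := U^~ s) (c' := A^~ s) (P := Pf) (P' := Pf') (th := 2) V0 V1.
- by rewrite chart_invK.
- by rewrite chart_invK.
- by move=> r r1; have [] := H1 r r1.
- move=> r r1; split; last exact: der_continuous (dPf r r1).
  by apply: der_continuous (der_vU_r B uv dP dphi _ _); lra_of r1.
- move=> r r1 _; split.
  + by apply: (der_vU_r B uv dP dphi _ _); lra_of r1.
  + by apply: dPf; lra_of r1.
  + have [|_ h] := H1 r; first lra_of r1.
    rewrite NE (gfC (phi1 r *: P r)) in h; last by apply: iu; lra_of r1.
    by rewrite /Pf'; move: h; rewrite -/(U r s) -/(A r s); lra_of isT.
have PfE : Pf 1 - Pf 0 = gdist x y ^+ 2 / 2 + s * slope
    + s ^+ 2 / 2 * ((phi1 1 - phi 0 * phi1 0) * N + e / 2).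
  by rewrite /Pf /slope E W1 phi_1; ring.
rewrite -v0E -v1E -u0 -u1 -/slope.
have tri := gdist_triangle UG (beta0 s) (chart_inv q (U 1 s)) (beta s).
have h4 := nice_gdist_chart Hn V1 Vb.
rewrite chart_invK // in h4.
have h5 : `|chart q (beta s) - U 1 s| <= e2 * s ^+ 2.
  by move: H2; rewrite b0 -/b -u1 /U /vU /vZ -/W W1 scalerN.
have := @half_sqr_le C e (Pf 1 - Pf 0) (gdist (beta0 s) (chart_inv q (U 1 s))) (gdist (beta0 s) (beta s))
  `|chart q (beta s) - U 1 s| s C1 e0 (ltW s_1) (gdist_ge0 _ _)
  (nice_gdist_le Hn V0 V1) (gdist_ge0 _ _) h (le_trans tri (lerD (lexx _) h4)) h5 (normr_ge0 _).
rewrite PfE; clearbody slope N; move: ((phi1 1 - phi 0 * phi1 0) * N) (gdist x y ^+ 2) (gdist (beta0 s) (beta s) ^+ 2).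
by clear; move=> a1 a2 a3; lra.
Unshelve. all: by end_near. Qed.

End pieces.

Lemma sqr_div_add {R : realFieldType} (a h A B g : R) : 0 < a -> 0 < h -> 0 <= A -> 0 <= B ->
  0 <= g -> g <= A + B -> g ^+ 2 / (2 * (a + h)) <= A ^+ 2 / (2 * a) + B ^+ 2 / (2 * h).
Proof.
move=> a0 h0 A0 B0 g0 gAB.
have s0 : 0 < a + h by rewrite addr_gt0.
have g2 : g ^+ 2 <= (A + B) ^+ 2 by rewrite ler_sqr ?nnegrE ?addr_ge0.
apply: (@le_trans _ _ ((A + B) ^+ 2 / (2 * (a + h)))).
  by rewrite ler_wpM2r // invr_ge0 mulr_ge0 // ltW.
rewrite -subr_ge0 (_ : _ - _ = (A * h - B * a) ^+ 2 / (2 * (a + h) * a * h)).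
  by rewrite divr_ge0 ?sqr_ge0 // !mulr_ge0 // ltW.
by field; rewrite !gt_eqF.
Qed.

(** * Upper barriers for the squared distance *)

Section barrier.
Context {R : realType} {n : nat} (M : riemannian_manifold R n).
Implicit Types (q y : M) (c : R -> M) (r s t : R).
Hypothesis UG : uniquely_geodesic M.
Local Notation sg := (sg UG).
Variables (p x : M) (ph ph1 : R -> R) (k2 kp : R).
Hypothesis dph : forall r, der ph r (ph1 r).
Hypothesis dph1 : forall r, der ph1 r (k2 * ph r).
Hypothesis ph0 : ph 0 = 0.
Hypothesis ph_gt0 : forall r, 0 < r -> 0 < ph r.
Hypothesis curv : forall q w a b, img q w ->
  kp * (gf q w a a * gf q w b b) <= gf q w (Rm q w a b b) a.
Hypothesis k2E : - kp * gdist p x ^+ 2 <= k2.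

Let sig := sg p x.
Let L2 := gdist p x ^+ 2.

(** D(p, .)^2 / (2 t) is the energy of going from [p] to a point in time [t]; with this
    normalization the bounds for consecutive pieces add up. *)
Definition barrier t := forall beta, acc_free beta 0 -> beta 0 = sig t ->
  forall e, 0 < e -> exists2 d, 0 < d & forall s, `|s| < d ->
    gdist p (beta s) ^+ 2 / (2 * t) <= L2 * t / 2
      + s * inner (sig t) (velocity sig t) (velocity beta 0)
      + s ^+ 2 / 2 * (ph1 t / ph t * inner (sig t) (velocity beta 0) (velocity beta 0) + e).

Lemma inner_velocity q c c' t t' : {for t, continuous c} -> {for t', continuous c'} ->
  c t = c' t' -> dom q (c t) -> derivable (chart q \o c) t 1 -> derivable (chart q \o c') t' 1 ->
  inner (c t) (velocity c t) (velocity c' t') =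
    gf q (chart q (c t)) (d1 (chart q \o c) t) (d1 (chart q \o c') t').
Proof.
move=> cc cc' E qc d d'.
have dc : der (chart q \o c) t (d1 (chart q \o c) t) by apply/derP; split; [exact: d|].
have dc' : der (chart q \o c') t' (d1 (chart q \o c') t') by apply/derP; split; [exact: d'|].
have qc' : dom q (c' t') by rewrite -E.
by rewrite (velocity_chart cc qc dc) (velocity_chart cc' qc' dc') -E inner_chart.
Qed.

(** The barrier at [a] is applied to the left end of a variation of the piece from [a] to [t]. With
    [phi] proportional to [ph], its coefficient [ph1 a / ph a] cancels the left boundary term of the
    piece, and the first-order terms at [a] cancel as well. *)
Lemma barrier_step q rho C lam D a t : nice q rho C lam D -> 0 <= a -> a < t -> t <= 1 ->
  Vs q D (sig a) -> Vs q D (sig t) -> (0 < a -> barrier a) -> barrier t.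
Proof.
move=> Hn a0 at_ t1 Va Vt IH beta ab b0 e e0.
have gs := sgP UG p x; have [ggs _ _] := gs.
pose h := t - a; have h0 : 0 < h by rewrite subr_gt0.
have t0 : 0 < t by exact: le_lt_trans at_.
have t01 : 0 <= t <= 1 by rewrite (ltW t0).
have a01 : 0 <= a <= 1 by rewrite a0 /= (le_trans (ltW at_)).
have pt := ph_gt0 t0.
pose c r := sig (h * r + a).
have gc : geodesic_from_to c (sig a) (sig t) := geodesic_sub gs a01 t01.
pose f r := h * r + a.
have df r : der f r h.
  by apply: der_eq; [apply: derD; [apply: derM; [exact: der_cst|exact: der_id]|exact: der_cst]|rewrite mul0r add0r mulr1 addr0].
pose phi r := ph (f r) / ph t; pose phi1 r := h * ph1 (f r) / ph t.
have dphi r : der phi r (phi1 r).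
  apply: der_eq; first by apply: derM; [exact: (@der_comp _ _ ph f _ _ r (dph _) (df r))|exact: der_cst].
  by rewrite mulr0 addr0.
have dphi1 r : der phi1 r (h ^+ 2 * k2 * phi r).
  apply: der_eq.
    apply: derM; last exact: der_cst.
    by apply: derM; [exact: der_cst|exact: (@der_comp _ _ ph1 f _ _ r (dph1 _) (df r))].
  by rewrite /phi /GRing.scale /=; ring.
have f1 : f 1 = t by rewrite /f mulr1 /h subrK.
have f0 : f 0 = a by rewrite /f mulr0 add0r.
have phi_1 : phi 1 = 1 by rewrite /phi f1 mulfV // gt_eqF.
have dist2 : gdist (sig a) (sig t) ^+ 2 = h ^+ 2 * L2.
  by rewrite (gdist_sub UG gs a01 t01) exprMn real_normK ?num_real.
have kE : - kp * gdist (sig a) (sig t) ^+ 2 <= h ^+ 2 * k2.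
  rewrite dist2 mulrCA; apply: ler_wpM2l; [exact: sqr_ge0|exact: k2E].
have [be0 [ab0 be00 be0p Nbe0 H]] := piece UG Hn Va Vt gc ab b0 dphi dphi1 phi_1 (curv (q := q)) kE.
have qt : dom q (sig t) by case: Vt.
have qa : dom q (sig a) by case: Va.
have qb : dom q (beta 0) by rewrite b0.
have qb0 : dom q (be0 0) by rewrite be00.
have ds r : 0 <= r <= 1 -> dom q (sig r) -> der (chart q \o sig) r (d1 (chart q \o sig) r).
  by move=> r1 qr; exact: (geodesic_der (ggs r r1)).
have dc r : dom q (sig (f r)) -> 0 <= f r <= 1 -> d1 (chart q \o c) r = h *: d1 (chart q \o sig) (f r).
  move=> qr fr; have /derP[_ //] : der (chart q \o c) r (h *: d1 (chart q \o sig) (f r)).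
  exact: (@der_comp _ _ (chart q \o sig) f _ _ r (ds _ fr qr) (df r)).
have dc1 : d1 (chart q \o c) 1 = h *: d1 (chart q \o sig) t by rewrite dc f1.
have dc0 : d1 (chart q \o c) 0 = h *: d1 (chart q \o sig) a by rewrite dc f0.
have csig r : 0 <= r <= 1 -> {for r, continuous sig} := geodesic_continuous ggs.
have db : derivable (chart q \o beta) 0 1 by have [/nbhs_singleton /derP[]] := ab.2 q qb.
have db0 : derivable (chart q \o be0) 0 1 by have [/nbhs_singleton /derP[]] := ab0.2 q qb0.
have dst : derivable (chart q \o sig) t 1 by have /derP[] := ds t t01 qt.
have dsa : derivable (chart q \o sig) a 1 by have /derP[] := ds a a01 qa.
have IX : inner (sig t) (velocity sig t) (velocity beta 0) =
    gf q (chart q (sig t)) (d1 (chart q \o sig) t) (d1 (chart q \o beta) 0).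
  exact: (inner_velocity (csig t t01) ab.1 (esym b0) qt dst db).
have IN : inner (sig t) (velocity beta 0) (velocity beta 0) =
    gf q (chart q (sig t)) (d1 (chart q \o beta) 0) (d1 (chart q \o beta) 0).
  by rewrite -b0; exact: (inner_velocity ab.1 ab.1 erefl qb db db).
have IXa : inner (sig a) (velocity sig a) (velocity be0 0) =
    gf q (chart q (sig a)) (d1 (chart q \o sig) a) (d1 (chart q \o be0) 0).
  exact: (inner_velocity (csig a a01) ab0.1 (esym be00) qa dsa db0).
have INa : inner (sig a) (velocity be0 0) (velocity be0 0) =
    gf q (chart q (sig a)) (d1 (chart q \o be0) 0) (d1 (chart q \o be0) 0).
  by rewrite -be00; exact: (inner_velocity ab0.1 ab0.1 erefl qb0 db0 db0).
rewrite dc1 dc0 in H; rewrite -INa -IN in Nbe0; rewrite IX.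
have e1 : 0 < e * h / 2 by rewrite divr_gt0 // mulr_gt0.
have [d1' d10 H1] := H _ e1.
rewrite -IN in H1 *; set N := inner (sig t) _ _ in Nbe0 H1 *.
set X := gf q (chart q (sig t)) _ _.
set Xa := gf q (chart q (sig a)) (d1 (chart q \o sig) a) _ in IXa.
have {}H1 s : `|s| < d1' -> gdist (be0 s) (beta s) ^+ 2 / (2 * h) <= h * L2 / 2 + s * (X - Xa)
    + s ^+ 2 / 2 * ((ph1 t / ph t - ph a * ph1 a / ph t ^+ 2) * N + e / 2).
  move=> /H1; rewrite dist2 /gf !bilZl -!/(gf _ _ _ _) -/X -/Xa /phi /phi1 f1 f0 => h1.
  rewrite invfM mulrA ler_pdivrMr //; apply: (le_trans h1); rewrite le_eqVlt; apply/orP; left; apply/eqP.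
  by field; rewrite gt_eqF.
(* For [a = 0] the condition [ph 0 = 0] fixes the left end of the variation at [p], and one piece is
   enough. *)
move: a0; rewrite le_eqVlt => /predU1P[a0|a0].
  exists d1' => // s /H1.
  have -> : be0 s = p by rewrite be0p ?/phi ?f0 -?a0 ?ph0 ?mul0r // /sig sg0.
  have Xa0 : Xa = 0.
    have w0 : d1 (chart q \o be0) 0 = 0.
      apply/eqP; apply: contraT => w0; have := gf_gt0 (img_chart qa) w0.
      by rewrite -INa Nbe0 /phi f0 -a0 ph0 mul0r expr0n mul0r ltxx.
    by rewrite /Xa w0 /gf bil0r.
  have -> : h = t by rewrite /h -a0 subr0.
  rewrite Xa0 -a0 ph0 !mul0r !subr0 => h1; apply: (le_trans h1).
  rewrite (mulrC t L2); apply: lerD => //; apply: ler_wpM2l.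
    by rewrite divr_ge0 ?sqr_ge0.
  by rewrite lerD2l ler_pdivrMr // ler_peMr ?ler1n // ltW.
have e2 : 0 < e / 2 by rewrite divr_gt0.
have [d2 d20 H2] := IH a0 be0 ab0 be00 _ e2.
rewrite IXa Nbe0 in H2.
exists (Num.min d1' d2) => [|s]; first by rewrite lt_min d10.
rewrite lt_min => /andP[/H1 h1 /H2 h2].
have tri := gdist_triangle UG p (be0 s) (beta s).
have h3 := sqr_div_add a0 h0 (gdist_ge0 _ _) (gdist_ge0 _ _) (gdist_ge0 _ _) tri.
have ath : a + h = t by rewrite /h addrC subrK.
rewrite ath in h3; apply: (le_trans h3); apply: (le_trans (lerD h2 h1)).
rewrite le_eqVlt; apply/orP; left; apply/eqP; rewrite -ath /phi f0 ath.
have pa := ph_gt0 a0.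
move: (ph t) (ph a) (ph1 t) (ph1 a) pt pa => T A T1 A1 T0 A0.
by rewrite -ath; field; rewrite !gt_eqF.
Qed.

(** The property is guarded by [0 < t], as the coefficient is singular at 0; the first piece starts
    from [a = 0], where [barrier_step] needs no earlier barrier. *)
Lemma barrier_all : barrier 1.
Proof.
have gs := sgP UG p x; have [ggs _ _] := gs.
have csig r : 0 <= r <= 1 -> {for r, continuous sig} := geodesic_continuous ggs.
suff H : forall t : R, 0 <= t <= 1 -> 0 < t -> barrier t by apply: H => //; exact: itv1.
have near t : 0 <= t <= 1 -> exists q rho C lam D d, [/\ nice q rho C lam D, 0 < d &
    forall s, `|s - t| < d -> Vs q D (sig s)].
  move=> t1; have [rho [C [lam [D Hn]]]] := nice_ex (sig t).
  have NV : \forall s \near t, Vs (sig t) D (sig s).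
    by apply: (near_continuous (csig t t1) (@Vs_open _ _ _ _ D)); exact: (Vs_self Hn).
  have [d d0 Hd] := (near_eps _ _).1 NV.
  by exists (sig t), rho, C, lam, D, d.
apply: real_induction => //.
- by rewrite ltxx.
- move=> t t1 H; have t01 : 0 <= t <= 1 by lra.
  have [q [rho [C [lam [D [d [Hn d0 Hd]]]]]]] := near t t01.
  exists d => // s st s1 _; apply: (barrier_step Hn (a := t)) => //; try lra.
  + by apply: Hd; rewrite subrr normr0.
  + by apply: Hd; rewrite ltr_norml; lra.
  + by apply: H; lra.
- move=> t t1 H _; have t01 : 0 <= t <= 1 by lra.
  have [q [rho [C [lam [D [d [Hn d0 Hd]]]]]]] := near t t01.
  pose a := Num.max (t / 2) (t - d / 2).
  have a2 : t / 2 <= a by rewrite le_max lexx.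
  have ad : t - d / 2 <= a by rewrite le_max lexx orbT.
  have at_ : a < t by rewrite gt_max; lra.
  apply: (barrier_step Hn (a := a)) => //; try lra.
  + by apply: Hd; rewrite ltr_norml; lra.
  + by apply: Hd; rewrite subrr normr0.
  + by apply: H; lra.
Qed.

End barrier.

(** Upper barriers with arbitrarily small quadratic term replace [F'' <= 0]. If the conclusion
    failed, subtracting the tangent at 0 and [c s^2] would leave a function that vanishes at both
    ends and is negative just after 0; at its interior minimum the second difference would be
    negative. *)
Lemma concave_le {R : realType} (F : R -> R) (a0 : R) :
  (forall s, 0 <= s <= 1 -> {for s, continuous F}) ->
  (forall s, 0 <= s <= 1 -> exists2 a, (s = 0 -> a = a0) & forall e, 0 < e ->
     exists2 d, 0 < d & forall h, `|h| < d -> F (s + h) <= F s + a * h + e * h ^+ 2) ->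
  F 1 <= F 0 + a0.
Proof.
move=> cF H; rewrite leNgt; apply/negP => lt.
pose c := F 1 - F 0 - a0; have c0 : 0 < c by rewrite /c; lra.
pose G s := F s - (F 0 + a0 * s + c * (s * s)).
have G0 : G 0 = 0 by rewrite /G; ring.
have G1 : G 1 = 0 by rewrite /G /c; ring.
have cG s : 0 <= s <= 1 -> {for s, continuous G}.
  move=> s1; apply: (contB (cF s s1)); apply: contD; first apply: contD; first exact: contC.
    by apply: contM; [exact: contC|exact: cont_id].
  by apply: contM; [exact: contC|exact: (contM (cont_id _) (cont_id _))].
have c2 : 0 < c / 2 by rewrite divr_gt0.
have [a aE /(_ _ c2)[d d0 Hd]] := H 0 itv0.
rewrite aE // in Hd.
pose h := Num.min (1 / 2) (d / 2).
have h0 : 0 < h by rewrite lt_min; lra.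
have h1 : h <= 1 / 2 by rewrite ge_min lexx.
have hd : h <= d / 2 by rewrite ge_min lexx orbT.
have Gh : G h < 0.
  have := Hd h; rewrite add0r gtr0_norm // => /(_ ltac:(lra)); rewrite /G expr2.
  have : 0 < h * h by rewrite mulr_gt0.
  by nra.
have [|s1 s11 Hs1] := @EVT_min R G 0 1 ler01.
  by apply: continuous_in_subspaceT => s; rewrite inE /= in_itv /=; exact: cG.
rewrite in_itv /= in s11.
have Gs1 : G s1 < 0 by apply: le_lt_trans (Hs1 h _) Gh; rewrite in_itv /=; lra.
have s10 : s1 != 0 by apply: contraTneq Gs1 => ->; rewrite G0 ltxx.
have s1n : s1 != 1 by apply: contraTneq Gs1 => ->; rewrite G1 ltxx.
have s12 : 0 < s1 < 1 by rewrite !lt_neqAle eq_sym s10 s1n.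
have [b _ /(_ _ c2)[d' d'0 Hd']] := H s1 s11.
pose h' := Num.min (d' / 2) (Num.min (s1 / 2) ((1 - s1) / 2)).
have h'0 : 0 < h' by rewrite !lt_min; lra.
have h'd : h' <= d' / 2 by rewrite ge_min lexx.
have h's : h' <= s1 / 2 by rewrite !ge_min lexx orbT.
have h's2 : h' <= (1 - s1) / 2 by rewrite !ge_min lexx !orbT.
have k1 := Hd' h'; rewrite gtr0_norm // in k1; have {}k1 := k1 ltac:(lra).
have k2 := Hd' (- h'); rewrite normrN gtr0_norm // in k2; have {}k2 := k2 ltac:(lra).
have m1 := Hs1 (s1 + h') ltac:(rewrite in_itv /=; lra).
have m2 := Hs1 (s1 - h') ltac:(rewrite in_itv /=; lra).
have hh : 0 < h' * h' * c by rewrite !mulr_gt0.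
rewrite sqrrN in k2; move: m1 m2 k1 k2; rewrite /G expr2.
move: (F (s1 + h')) (F (s1 - h')) (F s1) => F1 F2 F3; nra.
Qed.

(** * The cosine law *)

Section comparison.
Context {R : realType} {n : nat} (M : riemannian_manifold R n).
Implicit Types (p q y z : M) (c : R -> M) (r s t : R).
Hypothesis UG : uniquely_geodesic M.
Local Notation sg := (sg UG).

Lemma Log_velocity p y : Log y p = - velocity (sg p y) 1.
Proof.
have gs := sgP UG p y; have [g _ c1] := gs.
have e1 : (1 : R) - 0 = 1 by rewrite subr0.
rewrite (LogE UG (geodesic_rev gs)) !velocityE e1 c1.
have dc : der (chart y \o sg p y) 1 (d1 (chart y \o sg p y) 1).
  by apply: (geodesic_der (g 1 itv1)); rewrite c1; exact: dom_self.
have dr : der (fun r : R => 1 - r) 0 (-1).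
  by apply: der_eq; [apply: derB; [exact: der_cst|exact: der_id]|rewrite sub0r].
have := @der_comp _ _ (chart y \o sg p y) (fun r => 1 - r) (d1 (chart y \o sg p y) 1) (-1) 0.
by rewrite e1 => /(_ dc dr) /derP[_ ->]; rewrite scaleN1r.
Qed.

(** Subtracting from D(p, c s)^2 / 2 the parabola with the coefficient of the barrier leaves a
    function with upper barriers of arbitrarily small quadratic term, to which [concave_le] applies.
    The slope at 0 is the first variation. *)
Lemma comparison_gen p y z c (ph ph1 : R -> R) (k2 kp Z : R) :
  (forall r, der ph r (ph1 r)) -> (forall r, der ph1 r (k2 * ph r)) -> ph 0 = 0 ->
  (forall r, 0 < r -> 0 < ph r) ->
  (forall q w a b, img q w -> kp * (gf q w a a * gf q w b b) <= gf (M := M) q w (Rm q w a b b) a) ->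
  Z = ph1 1 / ph 1 ->
  geodesic_from_to c y z -> (forall s, 0 <= s <= 1 -> - kp * gdist p (c s) ^+ 2 <= k2) ->
  gdist p z ^+ 2 / 2 <= gdist p y ^+ 2 / 2 - inner y (Log y p) (velocity c 0)
    + Z / 2 * inner y (velocity c 0) (velocity c 0).
Proof.
move=> dph dph1 ph0 phg curv ZE gc kE; have [g c0 c1] := gc.
have cc s : 0 <= s <= 1 -> {for s, continuous c} := geodesic_continuous g.
pose V := inner y (velocity c 0) (velocity c 0).
have VE s : 0 <= s <= 1 -> speed2 c s = V.
  by move=> s1; rewrite (@speed2_const _ _ _ c 0 1 g s 0 s1 itv0) /speed2 c0.
pose F s := gdist p (c s) ^+ 2 / 2 - Z * V / 2 * (s * s).
suff : F 1 <= F 0 + - inner y (Log y p) (velocity c 0).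
  by rewrite /F c0 c1 -/V; lra.
apply: concave_le.
  move=> s s1; apply: contB.
    have c2 : {for s, continuous (fun s => gdist p (c s))}.
      by apply: (cont_comp (cc s s1)); exact: gdist_continuous.
    by apply: contM; [exact: (contM c2 c2)|exact: contC].
  by apply: contM; [exact: contC|exact: (contM (cont_id _) (cont_id _))].
move=> s s1; pose beta h := c (1 * h + s).
have gs : \forall h \near 1 * 0 + s, geodesic_at c h by rewrite mulr0 add0r; exact: g.
have gb : \forall h \near (0 : R), geodesic_at beta h.
  have cf : {for (0 : R), continuous (fun h : R => 1 * h + s)}.
    by apply: contD; [apply: contM; [exact: contC|exact: cont_id]|exact: contC].
  have := near_comp cf (nbhs_interior gs).
  by apply: filterS => h; exact: geodesic_affine.
have ab := geodesic_acc_free gb.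
have b0 : beta 0 = c s by rewrite /beta mulr0 add0r.
have bV : inner (c s) (velocity beta 0) (velocity beta 0) = V.
  rewrite -(VE s s1) -b0 -/(speed2 beta 0) /beta speed2_affine //.
  by rewrite expr1n mul1r mulr0 add0r.
have := @barrier_all _ _ _ UG p (c s) ph ph1 k2 kp dph dph1 ph0 phg curv (kE s s1) beta ab.
rewrite sg1 b0 => /(_ erefl) H.
exists (inner (c s) (velocity (sg p (c s)) 1) (velocity beta 0) - Z * V * s).
  move=> s0; rewrite /beta s0 mulr0 subr0 c0 Log_velocity !innerE.
  have -> : (fun h : R => c (1 * h + 0)) = c by apply/funext => h; rewrite mul1r addr0.
  by rewrite /gf !bilE opprK.
move=> e e0; have [|d d0 Hd] := H (2 * e); first by rewrite mulr_gt0.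
exists d; first exact: d0.
move=> h /Hd; rewrite bV -ZE /F /beta mul1r (addrC h).
move: (gdist p (c (s + h)) ^+ 2) (gdist p (c s) ^+ 2) (inner _ _ _) => A B I.
rewrite !mulr1 !expr2; clearbody V; clear; lra.
Qed.

Lemma comparison kappa p y z c r : sectional_ge M kappa -> 0 < r -> geodesic_from_to c y z ->
  (forall s, 0 <= s <= 1 -> gdist p (c s) <= r) ->
  gdist p z ^+ 2 / 2 <= gdist p y ^+ 2 / 2 - inner y (Log y p) (velocity c 0)
    + zeta kappa r / 2 * inner y (velocity c 0) (velocity c 0).
Proof.
move=> Hs r0 gc Hr; rewrite /zeta; case: ifPn => [k0|k0]; last first.
  (* For [kappa >= 0] the comparison is with curvature 0, where [ph t = t] gives the constant 1. *)
  apply: (@comparison_gen p y z c (fun t => t) (fun=> 1) 0 0 1 _ _ _ _ _ _ gc) => //.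
  - by move=> t; exact: der_id.
  - by move=> t; rewrite mul0r; exact: der_cst.
  - by move=> q w a b; apply: (sectional_lower a b Hs) => //; rewrite leNgt.
  - by rewrite divr1.
  - by move=> s _; rewrite oppr0 mul0r.
set k := r * _; have k1 : 0 < k.
  by rewrite mulr_gt0 // sqrtr_gt0 normr_gt0 lt_eqF.
have kk : k ^+ 2 = r ^+ 2 * - kappa by rewrite /k exprMn sqr_sqrtr // ltr0_norm.
have de (l t : R) : der (fun t => expR (l * t)) t (l * expR (l * t)).
  have dl : der (fun t => l * t) t l.
    by apply: der_eq; [apply: derM; [exact: der_cst|exact: der_id]|rewrite mul0r add0r mulr1].
  have dE : der expR (l * t) (expR (l * t)) by exact: is_derive_expR.
  exact: (@der_comp _ _ expR (fun t => l * t) _ _ t dE dl).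
(* This is [2 sinh (k t)]: its logarithmic derivative at 1 is [k coth k], the value of [zeta]. *)
apply: (@comparison_gen p y z c (fun t => expR (k * t) - expR (- k * t))
  (fun t => k * expR (k * t) - - k * expR (- k * t)) (k ^+ 2) kappa _ _ _ _ _ _ _ gc) => //.
- by move=> t; apply: derB; exact: de.
- move=> t; apply: der_eq.
    by apply: derB; apply: derM; (try exact: der_cst); exact: de.
  by rewrite /=; ring.
- by rewrite !mulr0 subrr.
- by move=> t t0; rewrite subr_gt0 ltr_expR mulNr gtrN // mulr_gt0.
- by move=> q w a b; apply: (sectional_lower a b Hs) => //; exact: ltW.
- by rewrite /coth !mulr1 mulrA; congr (_ / _); ring.
- move=> s /Hr h; rewrite kk mulrC; apply: ler_wpM2r; first by rewrite oppr_ge0 ltW.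
  by rewrite ler_sqr ?nnegrE ?gdist_ge0 // ltW.
Qed.

End comparison.

(** * Gradient descent *)

Section zeta_bounds.
Context {R : realType}.
Implicit Types (s t r : R).

Lemma expR_gap s : 0 < s -> 0 < expR s - expR (- s).
Proof. by move=> s0; rewrite subr_gt0 ltr_expR gtrN. Qed.

Lemma coth_le s t : 0 < s -> s <= t -> coth t <= coth s.
Proof.
move=> s0 st; have t0 : 0 < t by apply: lt_le_trans st.
have gs := expR_gap s0; have gt := expR_gap t0.
rewrite /coth ler_pdivrMr // mulrAC ler_pdivlMr //.
have h1 : expR s <= expR t by rewrite ler_expR.
have h2 : expR (- t) <= expR (- s) by rewrite ler_expR lerN2.
have : expR s * expR (- t) <= expR t * expR (- s) by apply: ler_pM => //; exact: expR_ge0.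
by move: (expR s) (expR t) (expR (- s)) (expR (- t)) => a b c d; lra.
Qed.

Lemma xcoth_ge1 s : 0 < s -> 1 <= s * coth s.
Proof.
move=> s0; rewrite /coth mulrA ler_pdivlMr ?expR_gap // mul1r -subr_ge0.
have dE t : der expR t (expR t) by exact: is_derive_expR.
have dN t : der (fun t => expR (- t)) t (- expR (- t)).
  have dl : der (fun t : R => - t) t (-1) by apply: der_eq; [apply: derN; exact: der_id|].
  apply: der_eq; first exact: (@der_comp _ _ expR (fun t => - t) _ _ t (dE _) dl).
  by rewrite /GRing.scale /= mulN1r.
pose g t := t * (expR t + expR (- t)) - (expR t - expR (- t)).
have dg t : der g t (t * (expR t - expR (- t))).
  apply: der_eq.
    apply: derB; last by apply: derB; [exact: dE|exact: dN].
    by apply: derM; [exact: der_id|apply: derD; [exact: dE|exact: dN]].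
  by rewrite /=; ring.
have : g 0 <= g s.
  apply: (@der_mono _ g (fun t => t * (expR t - expR (- t)))); first exact: ltW.
    by move=> t _; exact: der_continuous (dg t).
  by move=> t /andP[t0 _]; split; [exact: dg|rewrite ltW // mulr_gt0 // expR_gap].
by rewrite {1}/g mul0r oppr0 subrr subr0.
Qed.

Lemma zeta_ge1 kappa r : 0 < r -> 1 <= zeta kappa r.
Proof.
move=> r0; rewrite /zeta; case: ifP => // k0; apply: xcoth_ge1.
by rewrite mulr_gt0 // sqrtr_gt0 normr_gt0 lt_eqF.
Qed.

(** [coth] decreases, so [zeta] grows at most linearly with the radius; this trades the radius of
    the ball for the initial distance. *)
Lemma zeta_scale kappa r l : 0 < r -> 1 <= l -> zeta kappa (l * r) <= l * zeta kappa r.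
Proof.
move=> r0 l1; rewrite /zeta; case: ifP => [k0|_]; last by rewrite mulr1.
have q0 : 0 < Num.sqrt `|kappa| by rewrite sqrtr_gt0 normr_gt0 lt_eqF.
have rq : 0 < r * Num.sqrt `|kappa| by rewrite mulr_gt0.
rewrite -[l * r * _]mulrA; set z := r * _ in rq *; rewrite [leRHS]mulrA.
apply: ler_wpM2l; first by rewrite mulr_ge0 ?(ltW rq) // (le_trans ler01).
by apply: coth_le => //; rewrite ler_peMl // ltW.
Qed.

End zeta_bounds.

(** The decrease of [f] pays for the gradient term of the cosine law; [u s <= u] makes the price
    uniform in the fraction [s] of the step. *)
Lemma step_bound {R : realFieldType} (d2 dd de de' L u G s : R) : 0 < L -> 0 < u -> u <= 1 ->
  0 <= s -> s <= 1 -> de' <= de - s * (u / L) * (1 - u * s / 2) * G ->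
  dd <= d2 - 2 * s * (u / L) * de + s ^+ 2 * (u / L) * G / L -> 0 <= de' -> 0 <= de ->
  de' <= de -> dd <= d2 + (- (2 * s * u * de) + s * ((de - de') / (1 - u / 2))) / L.
Proof.
move=> L0 u0 u1 s0 s1 h1 h2 de'0 de0 dede.
have us : u * s <= u by rewrite ler_piMr // ltW.
have a0 : 0 < 1 - u / 2 by lra.
have b0 : 0 < 1 - u * s / 2 by lra.
apply: (le_trans h2).
have h3 : s * (u / L) * G <= (de - de') / (1 - u * s / 2) by rewrite ler_pdivlMr //; lra.
have h4 : (de - de') / (1 - u * s / 2) <= (de - de') / (1 - u / 2).
  by apply: ler_wpM2l; [lra|rewrite lef_pV2 ?posrE //; lra].
have h5 : s * (s * (u / L) * G) / L <= s * ((de - de') / (1 - u / 2)) / L.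
  by rewrite ler_pM2r ?invr_gt0 //; apply: ler_wpM2l => //; exact: le_trans h4.
have -> : s ^+ 2 * (u / L) * G / L = s * (s * (u / L) * G) / L by ring.
have -> : 2 * s * (u / L) * de = 2 * s * u * de / L by ring.
by rewrite (mulrDl _ _ L^-1) (mulNr _ L^-1); lra.
Qed.

(** [start] separates the first step, when the sum [S] is still empty, from the later ones, when it
    contains [de0]. In the first step the gain of the step itself takes the place of the missing
    term of the sum, and everything is multiplied by [s]. *)
Lemma invariant_bound {R : realFieldType} (R2 d2 dd de0 de de' S L u s : R) (start : bool) :
  0 < L -> 0 < u -> u <= 1 -> 0 <= s -> s <= 1 -> 0 < R2 ->
  d2 <= R2 + ((de0 - de) / (1 - u / 2) - 2 * u * S) / L ->
  (if start then de = de0 /\ S = 0 else de0 <= S) -> 0 <= de' -> de' <= de -> de <= de0 ->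
  de0 <= L * R2 / 2 ->
  dd <= d2 + (- (2 * s * u * de) + s * ((de - de') / (1 - u / 2))) / L -> dd < 3 / 2 * R2.
Proof.
move=> L0 u0 u1 s0 s1 R0 h1 hS d0 dd1 dd2 dL h2.
have a0 : 0 < 1 - u / 2 by lra.
have ia : 0 < (1 - u / 2)^-1 by rewrite invr_gt0.
have thlt : (1 - u / 2)^-1 - 2 * u < 1.
  rewrite -subr_gt0 (_ : _ - _ = u * (3 / 2 - u) / (1 - u / 2)).
    by rewrite divr_gt0 // mulr_gt0 //; lra.
  by field; rewrite gt_eqF //; lra.
set a := (1 - u / 2)^-1 in h1 h2 ia thlt.
have d00 : 0 <= de0 by lra.
suff : L * (dd - R2) <= de0 * a - 2 * u * de0 \/ L * (dd - R2) <= s * (de0 * a - 2 * u * de0).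
  have h3 : de0 * a - 2 * u * de0 <= de0 by rewrite (_ : _ - _ = de0 * (a - 2 * u)); [rewrite ler_piMr // ltW|ring].
  have h3' : 0 < de0 -> de0 * a - 2 * u * de0 < de0.
    by move=> dp; rewrite (_ : _ - _ = de0 * (a - 2 * u)); [rewrite gtr_pMr|ring].
  have LR : 0 < L * R2 by rewrite mulr_gt0.
  have fin : L * (dd - R2) < L * R2 / 2 -> dd < 3 / 2 * R2.
    by rewrite -mulrA ltr_pM2l //; lra.
  (* Strictness comes from [de0 > 0]; if [de0 = 0] there is no excess at all, and [R2 > 0]
     suffices. *)
  case=> h4; apply: fin; have [dp|dp] := ltP 0 de0.
  - by have := h3' dp; lra.
  - by have -> : L * (dd - R2) < L * R2 / 2 by have : de0 = 0 by [lra_of d0 dd1 dd2 dp]; move=> E; rewrite E !(mul0r, mulr0) in h4; lra_of LR h4.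
  - have [X0|X0] := leP 0 (de0 * a - 2 * u * de0).
      have : s * (de0 * a - 2 * u * de0) <= de0 * a - 2 * u * de0 by rewrite ler_piMl.
      by have := h3' dp; lra.
    have : s * (de0 * a - 2 * u * de0) <= 0 by rewrite mulr_ge0_le0 // ltW.
    lra.
  - by have E : de0 = 0 by [lra_of d0 dd1 dd2 dp]; rewrite E !(mul0r, mulr0, subr0) in h4; lra_of LR h4.
have LI (z : R) : L * (z / L) = z by field; rewrite gt_eqF.
have k1 : L * (d2 - R2) <= (de0 - de) * a - 2 * u * S.
  by rewrite -[leRHS]LI; apply: ler_wpM2l; [exact: ltW|lra].
have k2 : L * (dd - d2) <= - (2 * s * u * de) + s * ((de - de') * a).
  by rewrite -[leRHS]LI; apply: ler_wpM2l; [exact: ltW|lra].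
have dea : 0 <= de' * a by rewrite mulr_ge0 // ltW.
have sd : 0 <= s * (de' * a) by rewrite mulr_ge0.
case: start hS => [[E S0]|hS]; [right|left].
  by rewrite S0 E in k1 k2; lra.
have k3 : s * ((de - de') * a) <= (de - de') * a by rewrite ler_piMl // mulr_ge0 ?subr_ge0 // ltW.
have k4 : 0 <= 2 * s * u * de by rewrite !mulr_ge0 //; lra_of d0 dd1 u0.
have k5 : 2 * u * de0 <= 2 * u * S by rewrite ler_wpM2l // mulr_ge0 // ltW.
lra.
Qed.

Lemma local_min_der {R : realType} (F : R -> R) a : der F 0 a ->
  (\forall s \near (0 : R), F 0 <= F s) -> a = 0.
Proof.
move=> dF /near_eps[d d0 Hd]; apply/eqP; rewrite -normr_le0; apply/ler_addgt0Pr => e e0.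
rewrite add0r; have [d' d'0 Hd'] := der_eps dF e0.
pose s := Num.min (d / 2) (d' / 2).
have s0 : 0 < s by rewrite lt_min !divr_gt0.
have s1 : s <= d / 2 by rewrite ge_min lexx.
have s2 : s <= d' / 2 by rewrite ge_min lexx orbT.
have k1 := Hd s; rewrite subr0 gtr0_norm // in k1; have {}k1 := k1 ltac:(lra).
have k2 := Hd (- s); rewrite subr0 normrN gtr0_norm // in k2; have {}k2 := k2 ltac:(lra).
have k3 := Hd' s; rewrite gtr0_norm // addr0 in k3; have {}k3 := k3 ltac:(lra).
have k4 := Hd' (- s); rewrite normrN gtr0_norm // addr0 in k4; have {}k4 := k4 ltac:(lra).
move: k3 k4; rewrite /GRing.scale /= !ler_norml => /andP[_ k3] /andP[_ k4].
have k5 : - a * s <= e * s by rewrite mulNr; move: k3; rewrite (mulrC s); lra.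
have k6 : a * s <= e * s by move: k4; rewrite mulNr (mulrC s); lra.
by rewrite ler_pM2r // in k5; rewrite ler_pM2r // in k6; lra.
Qed.

Section descent.
Context {R : realType} {n : nat} (M : riemannian_manifold R n).
Implicit Types (y z : M) (c : R -> M) (s t : R).
Hypothesis UG : uniquely_geodesic M.
Variables (kappa L : R) (f : M -> \bar R) (xs : M) (r : R).
Hypothesis Hs : sectional_ge M kappa.
Hypothesis L0 : 0 < L.
Hypothesis fmin : minimizer f xs.
Hypothesis r_ge0 : 0 <= r.
Let X := closed_rball xs (r * Num.sqrt (3 / 2)).
Hypothesis HF : class_F L X f.

Let h y : R := fine (f y).

Lemma innerZl y k a b : inner y (k *: a) b = k * inner y a b.
Proof. by rewrite !innerE /gf !bilE. Qed.
Lemma innerZr y k a b : inner y a (k *: b) = k * inner y a b.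
Proof. by rewrite !innerE /gf !bilE. Qed.

Lemma innerC y a b : inner y a b = inner y b a.
Proof. by rewrite !innerE gfC //; exact: img_chart (dom_self y). Qed.

Lemma ball_in y : X y <-> gdist xs y <= r * Num.sqrt (3 / 2).
Proof. by rewrite /X /closed_rball /= distE. Qed.

Lemma center_in : X xs.
Proof. by apply/ball_in; rewrite gdistxx // mulr_ge0 // sqrtr_ge0. Qed.

Lemma fin_in y : X y -> f y \is a fin_num.
Proof. by move=> Xy; have [_ _ _ [U [_ XU dU]] _] := HF; have [] := dU y (XU y Xy). Qed.

Lemma value_ge y : f y \is a fin_num -> h xs <= h y.
Proof. by move=> fy; apply: fine_le => //; exact: fin_in center_in. Qed.

(** [f] is finite on an open set around [xs], so its real-valued coordinate expression has a local
    minimum along every coordinate line. *)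
Lemma grad_min : grad f xs = 0.
Proof.
have [_ _ _ [U [oU XU dU]] _] := HF.
have Uxs := XU xs center_in; have [_ df] := dU xs Uxs.
rewrite /grad (_ : \row_i _ = 0) ?mul0mx //; apply/rowP => i; rewrite !mxE -pdE.
set u := chart xs xs in df *; rewrite -dpart_delta; set e := delta_mx 0 i.
have u0 : u = u + (0 : R) *: e by rewrite scale0r addr0.
have dl := @der_line R n u e 0.
apply: (@local_min_der _ (fun s => in_chart f xs (u + s *: e))).
  have := @der_along _ _ (in_chart f xs) (fun s : R => u + s *: e) 0 e.
  by rewrite -u0; apply.
have cl : {for 0, continuous (fun s : R => chart_inv xs (u + s *: e))}.
  apply: (@cont_comp _ _ _ (fun s : R => u + s *: e) (chart_inv xs)); first exact: der_continuous dl.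
  by rewrite -u0; apply: chart_inv_cont; exact: img_chart (dom_self xs).
have N : \forall s \near (0 : R), U (chart_inv xs (u + s *: e)).
  by apply: (near_continuous cl oU); rewrite /= -u0 chartK //; exact: dom_self.
apply: filterS N => s Us; rewrite /in_chart -u0 chartK; last exact: dom_self.
by apply: value_ge; case: (dU _ Us).
Qed.

Lemma convex_le y z : X y -> X z -> h y + inner y (grad f y) (Log y z) <= h z.
Proof.
move=> Xy Xz; have [_ _ _ _ H] := HF; have /andP[h1 _] := H y z Xy Xz.
by move: h1; rewrite /bregman /h; lra.
Qed.

Lemma smooth_le y z : X y -> X z ->
  h z <= h y + inner y (grad f y) (Log y z) + L / 2 * inner y (Log y z) (Log y z).
Proof.
move=> Xy Xz; have [_ _ _ _ H] := HF; have /andP[_] := H y z Xy Xz.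
rewrite /bregman (distE UG) /gdist /tnorm sqr_sqrtr ?inner_ge0 // /h; lra.
Qed.

Lemma gap_le y : X y -> h y - h xs <= L / 2 * gdist xs y ^+ 2.
Proof.
move=> Xy; have := smooth_le center_in Xy.
rewrite grad_min {1}innerE /gf bil0l addr0 -[inner _ _ _]sqr_sqrtr ?inner_ge0 //.
by rewrite -/(tnorm _ _) -/(gdist xs y); lra.
Qed.

Lemma sub_geodesic c y z s : geodesic_from_to c y z -> 0 <= s <= 1 ->
  exists c', [/\ geodesic_from_to c' y (c s), velocity c' 0 = s *: velocity c 0 &
    forall t, c' t = c (s * t)].
Proof.
move=> gc s1; have [g c0 _] := gc; have := geodesic_sub gc itv0 s1; rewrite c0 => gs.
exists (fun t => c ((s - 0) * t + 0)); split=> //; last by move=> t; rewrite subr0 addr0.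
rewrite !velocityE mulr0 addr0 c0.
have dc : der (chart y \o c) 0 (d1 (chart y \o c) 0).
  by apply: (geodesic_der (g 0 itv0)); rewrite c0; exact: dom_self.
have df : der (fun t => (s - 0) * t + 0) 0 s.
  by apply: der_eq; [apply: derD; [apply: derM; [exact: der_cst|exact: der_id]|exact: der_cst]|rewrite mul0r add0r mulr1 addr0 subr0].
have := @der_comp _ _ (chart y \o c) (fun t => (s - 0) * t + 0) (d1 (chart y \o c) 0) s 0.
by rewrite mulr0 addr0 => /(_ dc df) /derP[_ ->].
Qed.

Section positive_radius.
Hypothesis r0 : 0 < r.
Let zt := zeta kappa (Num.sqrt (3 / 2) * r).
Let u := zt^-1.
Let eta := (zt * L)^-1.

Let rr0 : 0 < Num.sqrt (3 / 2) * r.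
Proof. by rewrite mulr_gt0 // sqrtr_gt0 divr_gt0. Qed.

Let zt1 : 1 <= zt. Proof. exact: zeta_ge1. Qed.
Let u0 : 0 < u. Proof. by rewrite invr_gt0 (lt_le_trans ltr01). Qed.
Let u1 : u <= 1. Proof. by rewrite invf_le1 // (lt_le_trans ltr01). Qed.
Let etaE : eta = u / L. Proof. by rewrite /eta invfM. Qed.
Let eta0 : 0 < eta. Proof. by rewrite etaE divr_gt0. Qed.

(** The smoothness inequality and the cosine law at the fraction [s] of a gradient step; only the
    part of the geodesic up to [s] has to be inside the ball. *)
Lemma partial_step c y z s : X y -> geodesic_from_to c y z ->
  velocity c 0 = - eta *: grad f y -> 0 <= s <= 1 ->
  (forall t, 0 <= t <= s -> X (c t)) ->
  h (c s) - h xs <= h y - h xs - s * (u / L) * (1 - u * s / 2) * inner y (grad f y) (grad f y) /\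
  gdist xs (c s) ^+ 2 <= gdist xs y ^+ 2 - 2 * s * (u / L) * (h y - h xs)
    + s ^+ 2 * (u / L) * inner y (grad f y) (grad f y) / L.
Proof.
move=> Xy gc vc s1 Xc; have Xs : X (c s) by apply: Xc; lra.
have [c' [gc' vc' c'E]] := sub_geodesic gc s1.
have LogE' : Log y (c s) = (- (s * eta)) *: grad f y.
  by rewrite (LogE UG gc') vc' vc scalerA mulrN.
have G0 : 0 <= inner y (grad f y) (grad f y) by exact: inner_ge0.
have ul : u * L^-1 * L = u by rewrite divfK // gt_eqF.
split.
  have := smooth_le Xy Xs; rewrite LogE' !(innerZl, innerZr) etaE.
  move: (inner y _ _) G0 => G _ H.
  rewrite (_ : _ - _ * G = h y + - (s * (u / L)) * G + L / 2 * (- (s * (u / L)) * (- (s * (u / L)) * G)) - h xs).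
    by rewrite lerD2r.
  by field; rewrite gt_eqF.
have ball t : 0 <= t <= 1 -> gdist xs (c' t) <= Num.sqrt (3 / 2) * r.
  by move=> t1; rewrite c'E (mulrC (Num.sqrt _)); apply/ball_in; apply: Xc; nra.
have H := comparison UG Hs rr0 gc' ball; rewrite -/zt vc' vc in H.
have cv := convex_le Xy center_in; rewrite innerC in cv.
move: H; rewrite !(innerZl, innerZr) => H.
have ze : zt * eta = L^-1 by rewrite etaE mulrA /u mulfV ?mul1r // gt_eqF // (lt_le_trans ltr01).
set I := inner y (Log y xs) _ in H cv; set G := inner y (grad f y) _ in H G0 *.
have sI : s * eta * I <= - (s * eta * (h y - h xs)).
  by rewrite -mulrN; apply: ler_wpM2l; [rewrite mulr_ge0 ?(ltW eta0) //; case/andP: s1|lra].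
have e2 : zt / 2 * (s * (s * (- eta * (- eta * G)))) = s ^+ 2 * eta * G / L / 2.
  by rewrite -ze; ring.
rewrite e2 in H; rewrite -etaE.
move: H sI; rewrite (_ : s * (- eta * I) = - (s * eta * I)); last by ring.
by rewrite (_ : 2 * s * eta * (h y - h xs) = 2 * (s * eta * (h y - h xs))); [lra|ring].
Qed.

(** As long as the geodesic is in the ball the estimates apply and give a strict bound on the
    distance to [xs], so it can be continued inside; closedness of the ball handles limits. *)
Lemma stay c y z (S : R) (start : bool) (de0 : R) : X y -> geodesic_from_to c y z ->
  velocity c 0 = - eta *: grad f y ->
  gdist xs y ^+ 2 <= r ^+ 2 + ((de0 - (h y - h xs)) / (1 - u / 2) - 2 * u * S) / L ->
  (if start then h y - h xs = de0 /\ S = 0 else de0 <= S) -> h y - h xs <= de0 ->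
  de0 <= L * r ^+ 2 / 2 -> forall s, 0 <= s <= 1 -> X (c s).
Proof.
move=> Xy gc vc h1 h2 h3 h4; have [g c0 _] := gc.
have cc s : 0 <= s <= 1 -> {for s, continuous (fun s => gdist xs (c s))}.
  move=> s1; apply: (@cont_comp _ _ _ c (gdist xs)); last exact: gdist_continuous.
  exact: geodesic_continuous.
have q0 : 0 <= Num.sqrt (3 / 2 : R) by exact: sqrtr_ge0.
have q2 : Num.sqrt (3 / 2 : R) ^+ 2 = 3 / 2 by rewrite sqr_sqrtr // divr_ge0.
have rq : 0 <= r * Num.sqrt (3 / 2) by rewrite mulr_ge0.
apply: real_induction => //.
- by rewrite c0.
- move=> t t1 Xc; have t01 : 0 <= t <= 1 by lra.
  have [k1 k2] := partial_step Xy gc vc t01 Xc.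
  have Xt : X (c t) by apply: Xc; lra.
  have de'0 : 0 <= h (c t) - h xs by rewrite subr_ge0; apply: value_ge; exact: fin_in.
  have G0 : 0 <= inner y (grad f y) (grad f y) by exact: inner_ge0.
  have u1' := u1; have u0' := u0.
  have dd : h (c t) - h xs <= h y - h xs.
    apply: (le_trans k1); rewrite gerBl; apply: mulr_ge0 => //; apply: mulr_ge0; last by nra.
    by rewrite mulr_ge0 ?divr_ge0 ?(ltW u0) ?(ltW L0) //; lra.
  have t0 : 0 <= t by lra.
  have t1' : t <= 1 by lra.
  have k3 := step_bound L0 u0 u1 t0 t1' k1 k2 de'0 (le_trans de'0 dd) dd.
  have r2 : 0 < r ^+ 2 by rewrite exprn_gt0.
  have k4 := invariant_bound L0 u0 u1 t0 t1' r2 h1 h2 de'0 dd h3 h4 k3.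
  have k5 : gdist xs (c t) < r * Num.sqrt (3 / 2).
    rewrite -ltr_sqr ?nnegrE ?gdist_ge0 //.
    by rewrite exprMn q2 mulrC.
  have /near_eps[d d0 Hd] := near_continuous (cc t t01) (@open_lt _ (r * Num.sqrt (3 / 2))) k5.
  exists d => // s st _; apply/ball_in; apply: ltW; apply: Hd; rewrite ltr_norml; lra.
- move=> t t1 Xc; apply/ball_in; rewrite leNgt; apply/negP => k5; have t01 : 0 <= t <= 1 by lra.
  have /near_eps[d d0 Hd] := near_continuous (cc t t01) (@open_gt _ (r * Num.sqrt (3 / 2))) k5.
  pose s := Num.max 0 (t - d / 2).
  have s0 : 0 <= s by rewrite le_max lexx.
  have sd : t - d / 2 <= s by rewrite le_max lexx orbT.
  have st : s < t by rewrite gt_max; lra.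
  have st' : `|s - t| < d by rewrite ltr_norml; lra.
  have k6 := Hd s st'; have s1 : 0 <= s < t by lra.
  by have /ball_in := Xc s s1; rewrite leNgt k6.
Qed.

Section iterates.
Variable x : nat -> M.
Hypothesis gd : gradient_descent f eta x.
Hypothesis x0 : gdist xs (x 0%N) = r.

Let de (t : nat) : R := h (x t) - h xs.
Let S (t : nat) : R := \sum_(i < t) de i.
Let G (t : nat) := inner (x t) (grad f (x t)) (grad f (x t)).

Let X0 : X (x 0%N).
Proof.
have q1 : 1 <= Num.sqrt (3 / 2 : R) by rewrite -[leLHS](sqrtr1 R); apply: ler_wsqrtr; lra.
by apply/ball_in; rewrite x0 ler_peMr.
Qed.

Let de0_le : de 0%N <= L * r ^+ 2 / 2.
Proof. by have := gap_le X0; rewrite x0 /de; lra. Qed.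

Let deS (t : nat) : X (x t) -> X (x t.+1) -> (exists2 c, geodesic_from_to c (x t) (x t.+1) &
    velocity c 0 = - eta *: grad f (x t) /\ forall s, 0 <= s <= 1 -> X (c s)) ->
  [/\ 0 <= de t.+1, de t.+1 <= de t - u / L / 2 * G t, de t.+1 <= de t &
    gdist xs (x t.+1) ^+ 2 <= gdist xs (x t) ^+ 2 +
      (- (2 * u * de t) + (de t - de t.+1) / (1 - u / 2)) / L].
Proof.
move=> Xt Xt1 [c gc [vc Xc]]; have [g _ c1] := gc.
have [k1 k2] := partial_step Xt gc vc itv1 Xc.
rewrite c1 in k1 k2.
have d1 : 0 <= de t.+1 by rewrite subr_ge0; apply: value_ge; exact: fin_in.
have G0 : 0 <= G t by exact: inner_ge0.
have u1' := u1; have u0' := u0.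
have uL : 0 <= u / L by rewrite divr_ge0 // ltW.
have k3 : de t.+1 <= de t - u / L / 2 * G t.
  apply: (le_trans k1); rewrite lerD2l lerN2; apply: ler_wpM2r => //.
  by rewrite mul1r mulr1; apply: ler_wpM2l => //; lra.
have k4 : de t.+1 <= de t by apply: (le_trans k3); rewrite gerBl mulr_ge0 // divr_ge0.
split=> //.
have := step_bound L0 u0 u1 ler01 (lexx 1) k1 k2 d1 (le_trans d1 k4) k4.
by rewrite mul1r mulr1.
Qed.

(** Two facts that feed each other: the invariant at [t] keeps the next step inside the ball, and
    that step yields the invariant at [t + 1]. *)
Lemma iterates_inv (t : nat) : [/\ X (x t), de t <= de 0,
  gdist xs (x t) ^+ 2 <= r ^+ 2 + ((de 0%N - de t) / (1 - u / 2) - 2 * u * S t) / L &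
  if (t == 0)%N then de t = de 0%N /\ S t = 0 else de 0%N <= S t] /\
  (exists2 c, geodesic_from_to c (x t) (x t.+1) &
    velocity c 0 = - eta *: grad f (x t) /\ forall s, 0 <= s <= 1 -> X (c s)).
Proof.
have next k : [/\ X (x k), de k <= de 0,
    gdist xs (x k) ^+ 2 <= r ^+ 2 + ((de 0%N - de k) / (1 - u / 2) - 2 * u * S k) / L &
    if (k == 0)%N then de k = de 0%N /\ S k = 0 else de 0%N <= S k] ->
  (exists2 c, geodesic_from_to c (x k) (x k.+1) &
    velocity c 0 = - eta *: grad f (x k) /\ forall s, 0 <= s <= 1 -> X (c s)).
  move=> [Xk k1 k2 k3]; have [c gc vc] := gd k; exists c => //; split=> //.
  exact: (stay Xk gc vc k2 k3 k1 de0_le).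
suff H : [/\ X (x t), de t <= de 0,
    gdist xs (x t) ^+ 2 <= r ^+ 2 + ((de 0%N - de t) / (1 - u / 2) - 2 * u * S t) / L &
    if (t == 0)%N then de t = de 0%N /\ S t = 0 else de 0%N <= S t] by split; last exact: next.
elim: t => [|t IH].
  by rewrite /S big_ord0 x0 subrr mul0r mulr0 subrr mul0r addr0; split.
have [Xt t1 t2 t3] := IH; have H := next t IH.
have Xt1 : X (x t.+1) by have [c [_ _ <-] [_ Xc]] := H; apply: Xc; exact: itv1.
have [d1 _ d2 d3] := deS Xt Xt1 H.
have SE : S t.+1 = S t + de t by rewrite /S big_ord_recr.
split=> //.
- exact: le_trans d2 t1.
- apply: (le_trans d3); apply: (le_trans (lerD t2 (lexx _))).
  rewrite SE le_eqVlt; apply/orP; left; apply/eqP; field; rewrite !gt_eqF //.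
  by have u1' := u1; lra.
- rewrite /= SE; move: t3; case: eqP => [_ [-> ->]|_ t3]; first by rewrite add0r.
  by apply: (le_trans t3); rewrite lerDl (le_trans d1).
Qed.

Lemma iterates_in (t : nat) : X (x t). Proof. by have [[]] := iterates_inv t. Qed.

Lemma iterates_dec (t : nat) : [/\ 0 <= de t.+1, de t.+1 <= de t - u / L / 2 * G t & de t.+1 <= de t].
Proof.
have [_ H] := iterates_inv t; by have [] := deS (iterates_in t) (iterates_in t.+1) H.
Qed.

Lemma gap_ge0 (t : nat) : 0 <= de t.
Proof. by rewrite subr_ge0; apply: value_ge; apply: fin_in; exact: iterates_in. Qed.

(** The gaps decrease, so [t] times the last one is at most [S]; since the squared distance in the
    invariant is nonnegative, [u S] is at most [L r^2]. *)
Lemma rate (t : nat) : t%:R * de t <= zt * L * r ^+ 2.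
Proof.
have tS : t%:R * de t <= S t.
  elim: t => [|t IH]; first by rewrite mul0r /S big_ord0.
  have [_ _ d] := iterates_dec t; rewrite /S big_ord_recr /= -/(S t) -natr1 mulrDl mul1r.
  apply: lerD => //; apply: le_trans IH; exact: ler_wpM2l.
have [[_ d2 d3 _] _] := iterates_inv t.
have u1' := u1; have u0' := u0; have g0 := gap_ge0 t.
have k0 : 0 <= r ^+ 2 + ((de 0%N - de t) / (1 - u / 2) - 2 * u * S t) / L.
  by apply: le_trans d3; exact: sqr_ge0.
have k1 : (de 0%N - de t) / (1 - u / 2) <= 2 * de 0.
  rewrite ler_pdivrMr; last lra.
  by have := gap_ge0 0%N; nra.
have k2 : 0 <= L * r ^+ 2 + ((de 0%N - de t) / (1 - u / 2) - 2 * u * S t).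
  rewrite (_ : _ + _ = L * (r ^+ 2 + ((de 0%N - de t) / (1 - u / 2) - 2 * u * S t) / L)).
    by rewrite mulr_ge0 // ltW.
  by rewrite mulrDr [L * (_ / L)]mulrC divfK // gt_eqF.
have k3 : u * S t <= L * r ^+ 2 by have := de0_le; lra.
have k4 : u * (t%:R * de t) <= L * r ^+ 2 by apply: le_trans k3; rewrite ler_pM2l.
have zu : zt * u = 1 by rewrite mulfV // gt_eqF // (lt_le_trans ltr01).
have zt0 : 0 < zt by exact: lt_le_trans ltr01 zt1.
have k5 : zt * (u * (t%:R * de t)) <= zt * (L * r ^+ 2) by rewrite ler_pM2l.
by rewrite (mulrA zt u) zu mul1r mulrA in k5.
Qed.

Lemma gap_bound (t : nat) : de t <= L * r ^+ 2 / 2.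
Proof. by have [[_ d _ _] _] := iterates_inv t; exact: le_trans d de0_le. Qed.

Lemma strong_rate mu (t : nat) : 0 < mu -> strongly_g_convex mu X f ->
  de t <= expR (- (u * mu / L) * t%:R) * (L * r ^+ 2 / 2).
Proof.
move=> mu0 sc.
(* The Polyak-Lojasiewicz inequality: strong convexity towards [xs], where the inner product is
   eliminated by [|grad f + mu Log|^2 >= 0]. *)
have PL k : 2 * mu * de k <= G k.
  have := sc _ _ (iterates_in k) center_in.
  rewrite /bregman (distE UG) /gdist /tnorm sqr_sqrtr ?inner_ge0 // -/(h (x k)) -/(h xs).
  have := inner_ge0 (x k) (grad f (x k) + mu *: Log (x k) xs).
  rewrite !innerE {1}/gf !bilE -!/(gf _ _ _ _) (gfC (Log _ _) (grad _ _)); last exact: img_chart (dom_self _).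
  rewrite /G innerE /de; move: (gf _ _ (grad _ _) (grad _ _)) (gf _ _ _ (Log _ _)) => A.
  move: (gf _ _ _ (Log _ _)) => B' B; nra.
elim: t => [|t IH]; first by rewrite mulr0 expR0 mul1r; exact: gap_bound.
have [_ d _] := iterates_dec t.
have a0 : 0 <= u / L / 2 by rewrite !divr_ge0 // ltW.
have k1 : u / L / 2 * (2 * mu * de t) <= u / L / 2 * G t by exact: ler_wpM2l (PL t).
have k2 : de t.+1 <= (1 + - (u * mu / L)) * de t.
  by apply: (le_trans d); move: k1; rewrite (_ : u / L / 2 * _ = u * mu / L * de t); [lra|field; rewrite gt_eqF].
apply: (le_trans k2); have -> : t.+1%:R = 1 + t%:R :> R by rewrite nat1r.
rewrite (mulrDr (- _) 1) mulr1 expRD -[leRHS]mulrA.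
apply: (@le_trans _ _ (expR (- (u * mu / L)) * de t)); last by apply: ler_wpM2l; [exact: expR_ge0|exact: IH].
by apply: ler_wpM2r; [exact: gap_ge0|exact: expR_ge1Dx].
Qed.

End iterates.
End positive_radius.

(** The case [R = 0], in which the step size involves the value of [zeta] at radius 0: the gradient
    vanishes at [xs], so any [eta] leaves the point fixed. *)
Lemma iterates_cst (x : nat -> M) eta : x 0%N = xs -> gradient_descent f eta x ->
  forall t : nat, x t = xs.
Proof.
move=> x0 gd; elim=> // t IH; have [c gc vc] := gd t.
rewrite IH in gc vc; rewrite grad_min scaler0 in vc.
apply/esym/(gdist_eq0 UG); rewrite /gdist (LogE UG gc) vc /tnorm innerE /gf bil0l.
exact: sqrtr0.
Qed.

Lemma eps_minimizerP y eps : X y -> h y - h xs <= eps -> eps_minimizer f xs eps y.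
Proof.
move=> Xy he; rewrite /eps_minimizer -(fineK (fin_in Xy)) -(fineK (fin_in center_in)).
by rewrite -EFinB lee_fin.
Qed.

End descent.

Lemma linear_le_gap {R : realFieldType} (t z w L r2 eps de : R) : 0 < eps -> 0 <= de -> 0 < w ->
  0 < L -> 0 < r2 -> z <= 2 * w -> t * de <= z * L * r2 -> 2 * (w * L * r2 / eps) <= t ->
  de <= eps.
Proof.
move=> e0 d0 w0 L0 r0 zw h1 h2.
have W0 : 0 < w * L * r2 by rewrite !mulr_gt0.
have t0 : 0 < t by apply: lt_le_trans h2; rewrite mulr_gt0 // divr_gt0.
have h3 : 2 * (w * L * r2) <= t * eps by rewrite -ler_pdivrMr // -(mulrA 2).
have h4 : z * L * r2 <= 2 * (w * L * r2) by rewrite !mulrA !ler_pM2r.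
by rewrite -(ler_pM2l t0); lra.
Qed.

Lemma exponential_le_gap {R : realType} (t z w L mu r2 eps de : R) : 0 < eps -> 0 < mu ->
  0 < w -> 0 < z -> 0 < L -> 0 < r2 -> z <= 2 * w -> de <= L * r2 / 2 ->
  de <= expR (- (z^-1 * mu / L) * t) * (L * r2 / 2) ->
  2 * (w * L / mu * ln (L * r2 / eps)) <= t -> de <= eps.
Proof.
move=> e0 mu0 w0 z0 L0 r0 zw h0 h1 h2; have Lr : 0 < L * r2 by rewrite mulr_gt0.
(* If [L r2 <= eps] the logarithm is not positive and [t] may be 0, but the initial gap is already
   small enough. *)
have [small|big] := leP (L * r2) eps; first lra.
set l := ln _ in h2; have El : expR l = L * r2 / eps by rewrite lnK // posrE divr_gt0.
have l0 : 0 <= l by rewrite ln_ge0 // ler_pdivlMr // mul1r ltW.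
have a0 : 0 < z^-1 * mu / L by rewrite divr_gt0 // mulr_gt0 // invr_gt0.
have h3 : l <= z^-1 * mu / L * t.
  apply: (@le_trans _ _ (z^-1 * mu / L * (2 * (w * L / mu * l)))); last by rewrite ler_pM2l.
  rewrite (_ : _ * (2 * _) = 2 * w / z * l); last by field; rewrite !gt_eqF.
  by rewrite ler_peMl // ler_pdivlMr // mul1r.
apply: (le_trans h1).
have h4 : expR (- (z^-1 * mu / L) * t) <= expR (- l) by rewrite ler_expR mulNr lerN2.
apply: (@le_trans _ _ (expR (- l) * (L * r2 / 2))); first by rewrite ler_pM2r // divr_gt0.
rewrite expRN El invf_div (_ : eps / _ * _ = eps / 2); first lra.
by field; rewrite !gt_eqF.
Qed.

Theorem theorem3 (R : realType) :
  exists2 C : R, 0 < C &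
  forall (n : nat) (M : riemannian_manifold R n) (kappa_min L : R)
    (f : M -> \bar R) (xs : M) (x : nat -> M),
  let r := dist (x 0%N) xs in
  let X := closed_rball xs (r * Num.sqrt (3 / 2)) in
  let eta := (zeta kappa_min (Num.sqrt (3 / 2) * r) * L)^-1 in
  uniquely_geodesic M ->
  sectional_ge M kappa_min ->
  0 < L ->
  minimizer f xs ->
  class_F L X f ->
  gradient_descent f eta x ->
  [/\ forall t : nat, X (x t),
      forall eps : R, 0 < eps ->
        forall t : nat, C * (zeta kappa_min r * L * r ^+ 2 / eps) <= t%:R ->
          eps_minimizer f xs eps (x t) &
      forall mu : R, 0 < mu -> strongly_g_convex mu X f ->
        forall eps : R, 0 < eps ->
        forall t : nat,
          C * (zeta kappa_min r * L / mu * ln (L * r ^+ 2 / eps)) <= t%:R ->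
          eps_minimizer f xs eps (x t)].
Proof.
(* An upper bound for [sqrt (3 / 2)], by which [zeta] may grow from radius [r] to the radius of the
   ball; both rates are linear in [zeta]. *)
exists 2; first by [].
move=> n M kappa L f xs x r X eta UG Hs L0 fmin HF gd.
have rE : gdist xs (x 0%N) = r by rewrite /r (distE UG) (gdistC UG).
have r_ge0 : 0 <= r by rewrite -rE; exact: gdist_ge0.
have epsP := @eps_minimizerP _ _ _ UG L f xs r r_ge0 HF.
have q0 : 0 <= Num.sqrt (3 / 2 : R) by exact: sqrtr_ge0.
have q1 : 1 <= Num.sqrt (3 / 2 : R) by rewrite -[leLHS](sqrtr1 R); apply: ler_wsqrtr; lra.
have q2 : Num.sqrt (3 / 2 : R) <= 2.
  rewrite -ler_sqr ?nnegrE // sqr_sqrtr; last by rewrite divr_ge0.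
  by rewrite expr2; lra.
move: (r_ge0); rewrite le_eqVlt => /predU1P[r0|r0].
  have x0 : x 0%N = xs by apply/esym/(gdist_eq0 UG); rewrite rE -r0.
  have xE := iterates_cst UG fmin r_ge0 HF x0 gd.
  have Xs : X xs by exact: center_in.
  have me eps t : 0 < eps -> eps_minimizer f xs eps (x t).
    by move=> e0; rewrite xE; apply: epsP => //; rewrite subrr ltW.
  by split=> [t|eps e0 t _|mu _ _ eps e0 t _]; [rewrite xE|exact: me|exact: me].
have Xx := iterates_in UG Hs L0 fmin r_ge0 HF r0 gd rE.
have z1 : 1 <= zeta kappa (Num.sqrt (3 / 2) * r).
  by apply: zeta_ge1; rewrite mulr_gt0 // (lt_le_trans _ q1).
have w1 : 1 <= zeta kappa r by exact: zeta_ge1.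
have w0 : 0 < zeta kappa r by exact: lt_le_trans w1.
have z0 : 0 < zeta kappa (Num.sqrt (3 / 2) * r) by exact: lt_le_trans z1.
have zw : zeta kappa (Num.sqrt (3 / 2) * r) <= 2 * zeta kappa r.
  by apply: le_trans (zeta_scale kappa r0 q1) _; rewrite ler_pM2r.
have r2 : 0 < r ^+ 2 by rewrite exprn_gt0.
have g0 t := gap_ge0 UG Hs L0 fmin r_ge0 HF r0 gd rE t.
split=> // [eps e0 t ht|mu mu0 sc eps e0 t ht]; apply: epsP => //.
  exact: linear_le_gap e0 (g0 t) w0 L0 r2 zw (rate UG Hs L0 fmin r_ge0 HF r0 gd rE t) ht.
exact: exponential_le_gap e0 mu0 w0 z0 L0 r2 zw (gap_bound UG Hs L0 fmin r_ge0 HF r0 gd rE t)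
  (strong_rate UG Hs L0 fmin r_ge0 HF r0 gd rE t mu0 sc) ht.
Qed.
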